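(* Let $\sigma\ge1$ be an integer, $\lambda\in\mathbb{R}\setminus\{0\}$, and $\mathcal M=\mathbb{T}^d$ or $\mathcal M=\mathbb{R}^d$. Let $(\kappa_j)_{j\in J_0}$ be initial wave vectors, $(\kappa_j)_{j\in J}$ the associated full family of wave vectors, and $(\alpha_j)_{j\in J_0}$ initial amplitudes. Assume: (A1) $(\alpha_j)_{j\in J_0}\in E(\mathcal M)$ and, if $\mathcal M=\mathbb{R}^d$, in addition $(\partial_x^\beta\alpha_j)_{j\in J_0}\in E(\mathbb{R}^d)$ for all $|\beta|\le2$ and $(\langle\kappa_j\rangle\partial_x^\beta\alpha_j)_{j\in J_0}\in E(\mathbb{R}^d)$ for all $|\beta|\le1$; (A2) there exists $c>0$ such that for all $(\ell_1,\dots,\ell_{2\sigma+1})\in N$, $$\Big|\,\Big|\sum_{p=1}^{2\sigma+1}(-1)^{p+1}\kappa_{\ell_p}\Big|^2-\sum_{p=1}^{2\sigma+1}(-1)^{p+1}|\kappa_{\ell_p}|^2\Big|\ge c .$$ Let $T>0$ and let $(a_j)_{j\in J}\in C([0,T];E(\mathcal M))$ be the solution of the profile system with initial data $(\alpha_j)_{j\in J}$, and define the approximate solution $u^\varepsilon_{\rm app}\in C([0,T];W(\mathcal M))$ by $$u^\varepsilon_{\rm app}(t,x)=\sum_{j\in J}a_j(t,x)e^{i\phi_j(t,x)/\varepsilon},\qquad \phi_j(t,x)=\kappa_j\cdot x-\frac t2|\kappa_j|^2 .$$ Consider a family of initial data $(u_0^\varepsilon)_{\varepsilon>0}$ in $W(\mathcal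 M)$ such that $$\big\|u_0^\varepsilon-u^\varepsilon_{\rm app}|_{t=0}\big\|_{W(\mathcal M)}\le C_0\varepsilon$$ for some $C_0\ge0$ independent of $\varepsilon$. Then there exists $\varepsilon_0(T)>0$ such that for any $0<\varepsilon\le\varepsilon_0(T)$ the exact solution of the Cauchy problem $$i\varepsilon\partial_tu^\varepsilon+\frac{\varepsilon^2}{2}\Delta u^\varepsilon=\lambda\varepsilon|u^\varepsilon|^{2\sigma}u^\varepsilon,\qquad u^\varepsilon(0,x)=u_0^\varepsilon(x),\quad x\in\mathcal M,$$ satisfies $u^\varepsilon\in L^\infty([0,T];W(\mathcal M))$. In addition, $$\|u^\varepsilon-u^\varepsilon_{\rm app}\|_{L^\infty([0,T]\times\mathcal M)}\le\|u^\varepsilon-u^\varepsilon_{\rm app}\|_{L^\infty([0,T];W(\mathcal M))}\le C\varepsilon,$$ where $C$ is independent of $\varepsilon$.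
   Context: $\mathbb{T}=\mathbb{R}/2\pi\mathbb{Z}$; if $\mathcal M=\mathbb{T}^d$, only $\varepsilon>0$ with $1/\varepsilon\in\mathbb{N}^*=\{1,2,\dots\}$ are considered. $\langle\kappa\rangle=(1+|\kappa|^2)^{1/2}$. Wiener algebras: $W(\mathbb{T}^d)$ is the space of $f(y)=\sum_{k\in\mathbb Z^d}b_ke^{ik\cdot y}$ with $\|f\|_W=\sum_k|b_k|<\infty$; $W(\mathbb{R}^d)$ is the space of tempered distributions $f$ with $\|f\|_W=\|\widehat f\|_{L^1(\mathbb{R}^d)}<\infty$, where $\widehat f(\xi)=(2\pi)^{-d/2}\int_{\mathbb R^d} f(x)e^{-ix\cdot\xi}dx$. Wave vectors: the initial wave vectors $(\kappa_j)_{j\in J_0}$ form a finite or countable family of pairwise distinct vectors, in $\mathbb{R}^d$ if $\mathcal M=\mathbb{R}^d$ and in $\mathbb{Z}^d$ if $\mathcal M=\mathbb{T}^d$. Put $S_0=\{\kappa_j\}_{j\in J_0}$ and inductively let $S_{n+1}$ be the union of $S_n$ and of all vectors $\kappa=\sum_{k=1}^{2\sigma+1}(-1)^{k+1}\xi_k$ with $\xi_1,\dots,\xi_{2\sigma+1}\in S_n$ and $\sum_{k=1}^{2\sigma+1}(-1)^{k+1}|\xi_k|^2=|\kappa|^2$. The full set is $S=\bigcup_nS_n=\{\kappa_j\}_{j\in J}$, with $J_0\subset J\subset\mathbb{Z}$ and $\kappa_j\neq\kappa_k$ for $j\ne k$. Amplitude space: $E(\mathbb{R}^d)$ is the space of families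 $a=(a_j)_{j\in J}$ of functions on $\mathbb R^d$ with $\|a\|_E=\sum_{j}\|\widehat a_j\|_{L^1(\mathbb{R}^d)}<\infty$; $E(\mathbb{T}^d)=\ell^1(J)$ (complex numbers, i.e. amplitudes independent of $x$), with $\|a\|_E=\sum_j|a_j|$. A family indexed by $J_0$ is extended by $0$ to $J$ (so $\alpha_j=0$ for $j\in J\setminus J_0$). Resonant and non-resonant sets: for $j\in J$, $$I_j^\sigma=\Big\{(\ell_1,\dots,\ell_{2\sigma+1})\in J^{2\sigma+1}:\ \sum_{k=1}^{2\sigma+1}(-1)^{k+1}\kappa_{\ell_k}=\kappa_j,\ \sum_{k=1}^{2\sigma+1}(-1)^{k+1}|\kappa_{\ell_k}|^2=|\kappa_j|^2\Big\},$$ and $N=J^{2\sigma+1}\setminus\bigcup_{j\in J}I_j^\sigma$. Profile system: for all $j\in J$, $$\partial_ta_j+\kappa_j\cdot\nabla a_j=-i\lambda\sum_{(\ell_1,\dots,\ell_{2\sigma+1})\in I_j^\sigma}a_{\ell_1}\overline{a}_{\ell_2}\cdots\overline a_{\ell_{2\sigma}}a_{\ell_{2\sigma+1}},\qquad a_j(0,x)=\alpha_j(x),$$ understood in integrated form along the characteristics $x+t\kappa_j$ (with $\nabla a_j=0$ when $\mathcal M=\mathbb{T}^d$). The exact solution is understood in the Duhamel (mild) sense in $W(\mathcal M)$. *)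

(* Defs.v *)
From HB Require Import structures.
From mathcomp Require Import all_boot all_order all_algebra.
From mathcomp Require Import all_classical all_reals all_analysis.
From mathcomp Require Import ess_sup_inf complex.

Set Implicit Arguments.
Unset Strict Implicit.
Unset Printing Implicit Defensive.

Import Order.TTheory GRing.Theory Num.Theory.
Import numFieldNormedType.Exports.

Local Open Scope classical_set_scope.
Local Open Scope ring_scope.

Section lebesgue_tuple.
Context (R : realType).
Local Notation mR := (measurableTypeR R).

Definition cons_tuple n (p : mR * n.-tuple mR) : n.+1.-tuple mR :=
  [tuple of p.1 :: p.2].

Definition uncons_tuple n (t : n.+1.-tuple mR) : mR * n.-tuple mR :=
  (thead t, [tuple of behead t]).

Lemma cons_tupleK n : cancel (@cons_tuple n) (@uncons_tuple n).
Proof. by case=> x t; congr pair; apply/val_inj. Qed.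

Lemma measurable_cons_tuple n :
  measurable_fun [set: mR * n.-tuple mR] (@cons_tuple n).
Proof. exact: measurable_cons. Qed.

Lemma measurable_uncons_tuple n :
  measurable_fun [set: n.+1.-tuple mR] (@uncons_tuple n).
Proof.
apply: measurable_fun_pair; last exact: measurable_behead.
exact: measurable_tnth.
Qed.

Section step.
Context (n : nat) (mu : {sigma_finite_measure set (n.-tuple mR) -> \bar R}).
Local Notation prod_mu := (@lebesgue_measure R \x mu)%E.

Definition lebesgue_tuple_step : set (n.+1.-tuple mR) -> \bar R :=
  pushforward prod_mu (@cons_tuple n).

Let step0 : lebesgue_tuple_step set0 = 0%E.
Proof. by rewrite /lebesgue_tuple_step /pushforward preimage_set0 measure0. Qed.

Let step_ge0 A : (0 <= lebesgue_tuple_step A)%E.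
Proof. by rewrite /lebesgue_tuple_step /pushforward; exact: measure_ge0. Qed.

Let step_sigma_additive : semi_sigma_additive lebesgue_tuple_step.
Proof.
move=> F mF tF mUF.
have mc B : measurable B -> measurable (@cons_tuple n @^-1` B).
  by move=> mB; rewrite -[X in measurable X]setTI; exact: measurable_cons_tuple.
rewrite /lebesgue_tuple_step /pushforward preimage_bigcup.
apply: measure_semi_sigma_additive.
- by move=> k; exact: mc.
- apply/trivIsetP => /= i j _ _ ij; rewrite -preimage_setI.
  by move/trivIsetP : tF => /(_ _ _ _ _ ij) ->//; rewrite preimage_set0.
- by rewrite -preimage_bigcup; exact: mc.
Qed.

HB.instance Definition _ := isMeasure.Build _ _ _ lebesgue_tuple_step
  step0 step_ge0 step_sigma_additive.

Let step_sigma_finite : sigma_finite setT lebesgue_tuple_step.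
Proof.
have /sigma_finiteP[F [TF ndF Foo]] :=
  sigma_finiteT (@lebesgue_measure R : {sigma_finite_measure set _ -> \bar R}).
have /sigma_finiteP[G [TG ndG Goo]] := sigma_finiteT mu.
exists (fun k => @uncons_tuple n @^-1` (F k `*` G k)).
  rewrite -preimage_bigcup (_ : \bigcup_k (F k `*` G k) = setT)//.
  rewrite -subTset => -[x y] _.
  have [k _ Fkx] : (\bigcup_k F k) x by rewrite -TF.
  have [l _ Gly] : (\bigcup_k G k) y by rewrite -TG.
  exists (maxn k l) => //; split => /=.
    by move: x Fkx; exact/subsetPset/ndF/leq_maxl.
  by move: y Gly; exact/subsetPset/ndG/leq_maxr.
move=> k; have [mF Fk] := Foo k; have [mG Gk] := Goo k; split.
  rewrite -[X in measurable X]setTI; apply: measurable_uncons_tuple => //.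
  exact: measurableX.
rewrite /lebesgue_tuple_step /pushforward -comp_preimage.
rewrite (_ : _ \o _ = idfun) ?preimage_id//; last exact/funext/cons_tupleK.
by rewrite product_measure1E// lte_mul_pinfty// ge0_fin_numE.
Qed.

HB.instance Definition _ := Measure_isSigmaFinite.Build _ _ _
  lebesgue_tuple_step step_sigma_finite.

End step.

Fixpoint lebesgue_tuple n : {sigma_finite_measure set (n.-tuple mR) -> \bar R} :=
  match n with
  | 0 => \d_([tuple] : 0.-tuple mR)
  | n'.+1 => lebesgue_tuple_step (lebesgue_tuple n')
  end.

End lebesgue_tuple.

Section complex_analysis.
Context {R : realType}.

Definition cabs (z : R[i]) : R := ComplexField.Normc.normc z.

Definition expi (theta : R) : R[i] := (cos theta +i* sin theta)%C.

Definition csummable (I : choiceType) (A : set I) (f : I -> R[i]) : Prop :=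
  (\esum_(i in A) (cabs (f i))%:E < +oo)%E.

(* Positive part minus negative part: the value of the unordered sum as soon as
   the family is absolutely summable, which holds in all uses below. *)
Definition rsum (I : choiceType) (A : set I) (f : I -> R) : R :=
  fine (\esum_(i in A) (Num.max (f i) 0)%:E)%E
  - fine (\esum_(i in A) (Num.max (- f i) 0)%:E)%E.

Definition csum (I : choiceType) (A : set I) (f : I -> R[i]) : R[i] :=
  (rsum A (fun i => complex.Re (f i)) +i* rsum A (fun i => complex.Im (f i)))%C.

Section integral.
Context disp (T : measurableType disp) (mu : {measure set T -> \bar R}).

Definition cintegrable (D : set T) (f : T -> R[i]) : Prop :=
  mu.-integrable D (fun t => (complex.Re (f t))%:E) /\
  mu.-integrable D (fun t => (complex.Im (f t))%:E).

Definition cintegral (D : set T) (f : T -> R[i]) : R[i] :=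
  (Rintegral mu D (fun t => complex.Re (f t))
   +i* Rintegral mu D (fun t => complex.Im (f t)))%C.
End integral.

Definition time_integral (t : R) (f : R -> R[i]) : R[i] :=
  cintegral (@lebesgue_measure R) `[0, t] f.

End complex_analysis.

(* [Torus] is T^d = R^d / 2 pi Z^d and [Space] is R^d. Functions on T^d are
   represented by (2 pi Z^d)-periodic functions on R^d. *)
Variant domain := Torus | Space.

Section wiener.
Context {R : realType} {d : nat}.
Implicit Types (M : domain) (x y : 'rV[R]_d).

(* The norm of ['rV[R]_d] provided by the library is the sup norm, hence
   these explicit Euclidean notions. *)
Definition dot x y : R := \sum_i x 0 i * y 0 i.
Definition sqnorm x : R := dot x x.
Definition japanese x : R := Num.sqrt (1 + sqnorm x).

Definition freq M : Type :=
  match M with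
  | Torus => 'rV[int]_d
  | Space => d.-tuple (measurableTypeR R)
  end.

Definition freq_vec M : freq M -> 'rV[R]_d :=
  match M with
  | Torus => fun k => \row_i (k 0 i)%:~R
  | Space => fun xi => \row_i tnth xi i
  end.

(* l^1(Z^d), resp. L^1(R^d). *)
Definition L1 M : (freq M -> R[i]) -> Prop :=
  match M with
  | Torus => fun b => csummable setT b
  | Space => fun g => cintegrable (lebesgue_tuple R d) setT g
  end.

Definition L1_norm M : (freq M -> R[i]) -> \bar R :=
  match M with
  | Torus => fun b => (\esum_(k in setT) (cabs (b k))%:E)%E
  | Space => fun g => (\int[lebesgue_tuple R d]_xi (cabs (g xi))%:E)%E
  end.

(* Fourier series, resp. inverse Fourier transform for the convention
   hat f (xi) = (2 pi)^(-d/2) \int f(x) e^{-i x.xi} dx. *)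
Definition fourier_inv M : (freq M -> R[i]) -> 'rV[R]_d -> R[i] :=
  match M with
  | Torus => fun b x =>
      csum setT (fun k => b k * expi (dot x (freq_vec (M := Torus) k)))
  | Space => fun g x =>
      (((Num.sqrt (2 * pi)) ^- d)%:C)%C *
      cintegral (lebesgue_tuple R d) setT
        (fun xi => g xi * expi (dot x (freq_vec (M := Space) xi)))
  end.

(* A tempered distribution whose Fourier transform is an L^1 function is the
   continuous function given by Fourier inversion. *)
Definition is_fourier M (f : 'rV[R]_d -> R[i]) : set (freq M -> R[i]) :=
  [set g | L1 g /\ forall x, f x = fourier_inv g x].

Definition in_W M (f : 'rV[R]_d -> R[i]) : Prop :=
  exists g : freq M -> R[i], is_fourier f g.

(* The Fourier coefficients (resp. transform) of f in W, which are unique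
   (resp. unique almost everywhere). *)
Definition fourier M (f : 'rV[R]_d -> R[i]) : freq M -> R[i] :=
  xget (fun=> 0) (@is_fourier M f).

Definition W_norm M (f : 'rV[R]_d -> R[i]) : \bar R :=
  if `[< in_W M f >] then L1_norm (@fourier M f) else +oo%E.

Definition cont_W M (T : R) (u : R -> 'rV[R]_d -> R[i]) : Prop :=
  forall t, 0 <= t <= T -> in_W M (u t) /\
    W_norm M (fun x => u s x - u t x) @[s --> within `[0, T] (nbhs t)] --> 0%E.

Definition time_measure (T : R) : {measure set (measurableTypeR R) -> \bar R} :=
  mrestr (@lebesgue_measure R) (measurable_itv `[0, T]).

Definition Linf_W_norm M (T : R) (u : R -> 'rV[R]_d -> R[i]) : \bar R :=
  ess_sup (time_measure T) (fun t => W_norm M (u t)).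

(* For periodic functions the essential supremum over R^d is the essential
   supremum over T^d. *)
Definition Linf_norm (T : R) (u : R -> 'rV[R]_d -> R[i]) : \bar R :=
  ess_sup (time_measure T \x lebesgue_tuple R d)%E
    (fun p => (cabs (u p.1 (freq_vec (M := Space) p.2)))%:E).

(* The propagator e^{i eps t Delta / 2}. *)
Definition propagator M (eps t : R) (f : 'rV[R]_d -> R[i]) :
    'rV[R]_d -> R[i] :=
  fourier_inv (fun xi : freq M =>
    expi (- (eps * t / 2 * sqnorm (freq_vec xi))) * fourier f xi).

Definition nonlinearity (sigma : nat) (f : 'rV[R]_d -> R[i]) :
    'rV[R]_d -> R[i] :=
  fun x => ((cabs (f x) ^+ sigma.*2)%:C)%C * f x.

(* Duhamel formula for i eps u_t + eps^2/2 Delta u = lambda eps |u|^{2 sigma} u.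
   Evaluation at x is continuous on W, so the W-valued time integral is
   computed pointwise in x. *)
Definition mild_solution M (sigma : nat) (lambda eps T : R)
    (u0 : 'rV[R]_d -> R[i]) (u : R -> 'rV[R]_d -> R[i]) : Prop :=
  cont_W M T u /\
  forall t x, 0 <= t <= T ->
    u t x = propagator M eps t u0 x
      + (0 -i* lambda)%C * time_integral t (fun s =>
          propagator M eps (t - s) (nonlinearity sigma (u s)) x).

(* If M = T^d, the semiclassical parameter is the inverse of an integer. *)
Definition admissible M (eps : R) : Prop :=
  0 < eps /\ (M = Torus -> exists n : nat, (0 < n)%N /\ eps^-1 = n%:R).

Definition alt_vec n (v : 'I_n -> 'rV[R]_d) : 'rV[R]_d :=
  \sum_(k < n) (-1) ^+ k *: v k.

Definition alt_sqnorm n (v : 'I_n -> 'rV[R]_d) : R :=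
  \sum_(k < n) (-1) ^+ k * sqnorm (v k).

Fixpoint generated (sigma : nat) (S0 : set 'rV[R]_d) (n : nat) :
    set 'rV[R]_d :=
  match n with
  | 0 => S0
  | n'.+1 => generated sigma S0 n' `|`
      [set k | exists xi : 'I_sigma.*2.+1 -> 'rV[R]_d,
        [/\ forall p, generated sigma S0 n' (xi p),
            k = alt_vec xi & alt_sqnorm xi = sqnorm k]]
  end.

(* (kappa_j)_{j in J0} are the initial wave vectors and (kappa_j)_{j in J} is
   the full family. *)
Definition wave_vectors M (sigma : nat) (J0 J : set int)
    (kappa : int -> 'rV[R]_d) : Prop :=
  [/\ J0 `<=` J,
      forall j k, J j -> J k -> kappa j = kappa k -> j = k,
      M = Torus -> forall j, J0 j -> forall i, kappa j 0 i \is a Num.int &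
      kappa @` J = \bigcup_n generated sigma (kappa @` J0) n].

Definition resonant (sigma : nat) (J : set int) (kappa : int -> 'rV[R]_d)
    (j : int) : set (sigma.*2.+1.-tuple int) :=
  [set l | [/\ forall p, J (tnth l p),
     alt_vec (fun p => kappa (tnth l p)) = kappa j &
     alt_sqnorm (fun p => kappa (tnth l p)) = sqnorm (kappa j)]].

Definition nonresonant (sigma : nat) (J : set int) (kappa : int -> 'rV[R]_d) :
    set (sigma.*2.+1.-tuple int) :=
  [set l | forall p, J (tnth l p)] `\` \bigcup_(j in J) resonant J kappa j.

(* The spaces E(M), for families indexed by D; when M = T^d the amplitudes
   are the families of functions that do not depend on x. *)
Definition E_norm M (D : set int) (a : int -> 'rV[R]_d -> R[i]) : \bar R :=
  match M with
  | Torus => (\esum_(j in D) (cabs (a j 0))%:E)%E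
  | Space => (\esum_(j in D) W_norm Space (a j))%E
  end.

Definition in_E M (D : set int) (a : int -> 'rV[R]_d -> R[i]) : Prop :=
  (M = Torus -> forall j, D j -> forall x, a j x = a j 0) /\
  (E_norm M D a < +oo)%E.

Definition cont_E M (D : set int) (T : R)
    (a : R -> int -> 'rV[R]_d -> R[i]) : Prop :=
  forall t, 0 <= t <= T -> in_E M D (a t) /\
    E_norm M D (fun j x => a s j x - a t j x)
      @[s --> within `[0, T] (nbhs t)] --> 0%E.

Definition extend0 (D : set int) (a : int -> 'rV[R]_d -> R[i]) :
    int -> 'rV[R]_d -> R[i] :=
  fun j x => if `[< D j >] then a j x else 0.

Definition cderivable (i : 'I_d) (f : 'rV[R]_d -> R[i]) : Prop :=
  forall x, derivable (fun y => complex.Re (f y) : R^o) x (delta_mx 0 i) /\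
            derivable (fun y => complex.Im (f y) : R^o) x (delta_mx 0 i).

Definition partial (i : 'I_d) (f : 'rV[R]_d -> R[i]) : 'rV[R]_d -> R[i] :=
  fun x => ('D_(delta_mx 0 i) (fun y => complex.Re (f y) : R^o) x
            +i* 'D_(delta_mx 0 i) (fun y => complex.Im (f y) : R^o) x)%C.

Definition mpartial (beta : 'I_d -> nat) (f : 'rV[R]_d -> R[i]) :
    'rV[R]_d -> R[i] :=
  foldr (fun i => iter (beta i) (partial i)) f (enum 'I_d).

Definition morder (beta : 'I_d -> nat) : nat := (\sum_i beta i)%N.

(* All the partial derivatives of order at most m exist. *)
Definition has_partials (m : nat) (f : 'rV[R]_d -> R[i]) : Prop :=
  forall beta i, (morder beta < m)%N -> cderivable i (mpartial beta f).

Definition assumption_A1 M (J0 : set int) (kappa : int -> 'rV[R]_d)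
    (alpha : int -> 'rV[R]_d -> R[i]) : Prop :=
  in_E M J0 alpha /\
  (M = Space ->
    [/\ forall j, J0 j -> has_partials 2 (alpha j),
        forall beta, (morder beta <= 2)%N ->
          in_E M J0 (fun j => mpartial beta (alpha j)) &
        forall beta, (morder beta <= 1)%N ->
          in_E M J0 (fun j x =>
            ((japanese (kappa j))%:C)%C * mpartial beta (alpha j) x)]).

Definition assumption_A2 (sigma : nat) (J : set int)
    (kappa : int -> 'rV[R]_d) : Prop :=
  exists2 c : R, 0 < c & forall l, nonresonant J kappa l ->
    c <= `|sqnorm (alt_vec (fun p : 'I_sigma.*2.+1 => kappa (tnth l p)))
           - alt_sqnorm (fun p => kappa (tnth l p))|.

Definition alt_prod n (z : 'I_n -> R[i]) : R[i] :=
  \prod_(k < n) (if odd k then conjc (z k) else z k).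

(* The profile system, integrated along the characteristics x + t kappa_j;
   amplitudes that do not depend on x make the transport term trivial. *)
Definition profile_solution M (sigma : nat) (lambda T : R) (J : set int)
    (kappa : int -> 'rV[R]_d) (alpha : int -> 'rV[R]_d -> R[i])
    (a : R -> int -> 'rV[R]_d -> R[i]) : Prop :=
  cont_E M J T a /\
  forall t j x, 0 <= t <= T -> J j ->
    a t j (x + t *: kappa j) = alpha j x
      + (0 -i* lambda)%C * time_integral t (fun s =>
          csum (resonant (sigma := sigma) J kappa j) (fun l =>
            alt_prod (fun p => a s (tnth l p) (x + s *: kappa j)))).

Definition phase (kappa : 'rV[R]_d) (t : R) x : R :=
  dot kappa x - t / 2 * sqnorm kappa.

Definition u_app (J : set int) (kappa : int -> 'rV[R]_d)
    (a : R -> int -> 'rV[R]_d -> R[i]) (eps t : R) x : R[i] :=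
  csum J (fun j => a t j x * expi (phase (kappa j) t x / eps)).

End wiener.

(* Main.v *)
Require Import Defs.
From HB Require Import structures.
From mathcomp Require Import all_boot all_order all_algebra.
From mathcomp Require Import all_classical all_reals all_analysis.
From mathcomp Require Import measurable_realfun ess_sup_inf complex.
From mathcomp Require Import ring lra zify.

Set Implicit Arguments.
Unset Strict Implicit.
Unset Printing Implicit Defensive.

Import Order.TTheory GRing.Theory Num.Theory.
Import numFieldNormedType.Exports.

Local Open Scope classical_set_scope.
Local Open Scope ring_scope.

(** The nonlinear term of the equation carries the same factor eps as the time
    derivative. In the interaction picture, where w is obtained from u by undoing
    the free Schrodinger flow, the equation therefore becomes a fixed point
    problem [w = duhamel_map w] in which the nonlinearity is locally Lipschitz
    with constants that do not depend on eps: the Wiener space is a Banach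
    algebra ([N_mul]) on which the flow acts isometrically ([Nw_flow]). In a norm
    with an exponential weight in time the map is a contraction on bounded sets.
    Picard iteration started at an approximate solution, instead of a constant,
    then yields an exact solution on the whole interval [0, T] that is as close
    to the approximate one as the residual of the latter is small
    ([duhamel_exists]); the same contraction gives uniqueness
    ([duhamel_unique]). It remains to see that the residual of [u_app] is O(eps)
    ([residual_bound]).

    The power of [u_app] expands into one wave for each tuple of
    [2 sigma + 1] indices ([flow_nonlinearity]). By Galilean invariance
    ([flow_modulate]) the wave of a tuple becomes, in the interaction picture, a
    fixed plane wave times a phase that rotates at the speed given by the defect
    of resonance of the tuple over 2 eps, times the free flow over the small time
    eps s / 2 of the product of the amplitudes, seen along the characteristic of
    the combined wave vector. There are two cases.
    - The defect is 0. Up to the small flow, whose effect is O(eps) in terms of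
      two derivatives of the amplitudes ([flow_sub_le]), these tuples produce the
      right hand side of the profile system, which therefore compensates them
      ([N_resonant]).
    - The defect is nonzero, hence bounded away from 0 by a constant c. The phase
      changes sign after a time of at most 2 pi eps / c, during which the
      amplitude moves by O(eps): the time integral cancels over pairs of half
      periods ([N_nonresonant], [N_time_half_period]).

    Both cases are summed over all tuples, which needs summable bounds, uniform
    in time, for two derivatives of the amplitudes and for one derivative or none
    times the size of the wave vectors ([profile_majorant]). They hold at time 0
    and are propagated by the profile system. A Gronwall argument applies because
    the sizes of the wave vectors satisfy [P j <= \sum_k P (l k)] when [l]
    resonates with [j], and because frequency weights obey a Leibniz rule
    ([Nw_alt_prod]). The finiteness of the sums, which Gronwall's argument
    presupposes, is obtained by truncating the weights, and the truncation is
    removed by Fatou's lemma ([truncated_bound], [propagated]). The derivatives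
    of the initial amplitudes enter through their frequency weights only
    ([Nw_partial]).

    The torus and the space differ by their groups of frequencies, Z^d with the
    counting measure and R^d with the Lebesgue measure. The argument is carried
    out once for an abstract group of this kind ([fsetting]). Two facts make the
    Fourier side usable: the transform of a function of the algebra is unique
    almost everywhere ([isF_uniq]), and a continuous curve in the algebra has a
    jointly measurable family of transforms ([contW_joint]), so that time
    integrals commute with the flow and obey the triangle inequality by Fubini's
    theorem. On the torus the amplitudes are constant in space, so that all their
    derivatives vanish, and eps is the inverse of an integer, so that the rescaled
    wave vectors are frequencies ([frequency]). *)

(** * Complex numbers *)

Notation Re := complex.Re.
Notation Im := complex.Im.

Section complex_facts.
Context {R : realType}.
Implicit Types (z w : R[i]) (t : R).

Lemma complexP z w : Re z = Re w -> Im z = Im w -> z = w.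
Proof. by case: z w => [a b] [c d] /= -> ->. Qed.

Lemma cabsE z : cabs z = Num.sqrt (Re z ^+ 2 + Im z ^+ 2).
Proof. by case: z. Qed.
Lemma cabs_ge0 z : 0 <= cabs z.
Proof. by rewrite cabsE sqrtr_ge0. Qed.
Lemma cabs0 : cabs (0 : R[i]) = 0.
Proof. exact: ComplexField.Normc.normc0. Qed.
Lemma cabs1 : cabs (1 : R[i]) = 1.
Proof. exact: ComplexField.Normc.normc1. Qed.
Lemma cabsM z w : cabs (z * w) = cabs z * cabs w.
Proof. exact: ComplexField.Normc.normcM. Qed.
Lemma cabsN z : cabs (- z) = cabs z.
Proof. exact: normcN. Qed.
Lemma cabsD z w : cabs (z + w) <= cabs z + cabs w.
Proof. exact: le_normcD. Qed.
Lemma cabsB z w : cabs (z - w) <= cabs z + cabs w.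
Proof. by rewrite -(cabsN w) cabsD. Qed.
Lemma cabs_subC z w : cabs (z - w) = cabs (w - z).
Proof. by rewrite -cabsN opprB. Qed.
Lemma cabs_eq0 z : cabs z = 0 -> z = 0.
Proof. exact: ComplexField.Normc.eq0_normc. Qed.
Lemma cabs_conj z : cabs (conjc z) = cabs z.
Proof. by case: z => a b; rewrite !cabsE/= sqrrN. Qed.
Lemma cabs_real t : cabs (t%:C)%C = `|t|.
Proof. by rewrite cabsE/= expr0n/= addr0 sqrtr_sqr. Qed.
Lemma cabs_prod n (z : 'I_n -> R[i]) :
  cabs (\prod_(k < n) z k) = \prod_(k < n) cabs (z k).
Proof. exact: (big_morph cabs cabsM cabs1). Qed.

Lemma ReD z w : Re (z + w) = Re z + Re w. Proof. by case: z; case: w. Qed.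
Lemma ImD z w : Im (z + w) = Im z + Im w. Proof. by case: z; case: w. Qed.
Lemma ReN z : Re (- z) = - Re z. Proof. by case: z. Qed.
Lemma ImN z : Im (- z) = - Im z. Proof. by case: z. Qed.
Lemma ReM z w : Re (z * w) = Re z * Re w - Im z * Im w.
Proof. by case: z; case: w. Qed.
Lemma ImM z w : Im (z * w) = Re z * Im w + Im z * Re w.
Proof. by case: z; case: w. Qed.

Lemma le_Re_cabs z : `|Re z| <= cabs z.
Proof. by rewrite cabsE -sqrtr_sqr ler_wsqrtr// lerDl sqr_ge0. Qed.
Lemma le_Im_cabs z : `|Im z| <= cabs z.
Proof. by rewrite cabsE -sqrtr_sqr ler_wsqrtr// lerDr sqr_ge0. Qed.
Lemma cabs_leD z : cabs z <= `|Re z| + `|Im z|.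
Proof.
have -> : z = ((Re z)%:C)%C + (0 +i* 1)%C * ((Im z)%:C)%C.
  by apply: complexP; rewrite ?(ReD, ImD, ReM, ImM)/=; ring.
rewrite (le_trans (cabsD _ _))// cabsM !cabs_real cabsE/=.
rewrite expr0n expr1n add0r sqrtr1.
by rewrite !(mul0r, mul1r, mulr0, subr0, addr0, add0r).
Qed.

Lemma conjcM z w : conjc (z * w) = conjc z * conjc w.
Proof. exact: (rmorphM (@conjc R)). Qed.
Lemma conjcB z w : conjc (z - w) = conjc z - conjc w.
Proof. exact: (rmorphB (@conjc R)). Qed.

Lemma expi0 : expi (0 : R) = 1.
Proof. by apply: complexP; rewrite /= ?cos0 ?sin0. Qed.
Lemma expiD s t : expi (s + t) = expi s * expi t.
Proof.
by apply: complexP; rewrite /expi ?(ReM, ImM)/= ?cosD ?sinD; ring.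
Qed.
Lemma expiN t : expi (- t) = conjc (expi t).
Proof. by apply: complexP; rewrite /= ?cosN ?sinN. Qed.
Lemma cabs_expi t : cabs (expi t) = 1.
Proof. by rewrite cabsE/= cos2Dsin2 sqrtr1. Qed.
Lemma expi_pi : expi (pi : R) = -1.
Proof. by apply: complexP; rewrite /= ?cospi ?sinpi ?oppr0. Qed.
Lemma expiK t : expi (- t) * expi t = 1.
Proof. by rewrite -expiD addNr expi0. Qed.
Lemma expi_sum n (t : 'I_n -> R) :
  expi (\sum_(k < n) t k) = \prod_(k < n) expi (t k).
Proof. exact: (big_morph expi expiD expi0). Qed.

Lemma abs_sin_le t : `|sin t| <= `|t|.
Proof.
wlog t0 : t / 0 < t => [hw|].
  have [->|tn0] := eqVneq t 0; first by rewrite sin0.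
  have [/hw//|t0] := ltP 0 t.
  rewrite -normrN -sinN -(normrN t) hw// oppr_gt0 lt_neqAle tn0//.
have [|c _] := @MVT R sin cos 0 t t0 (fun x _ => is_derive_sin x).
  by apply: continuous_subspaceT => x; exact: continuous_sin.
rewrite sin0 !subr0 => ->; rewrite normrM ler_piMl// cos_max//.
Qed.

Lemma expiB_sqr t : cabs (expi t - 1) ^+ 2 = (2 * sin (t / 2)) ^+ 2.
Proof.
rewrite cabsE sqr_sqrtr ?addr_ge0 ?sqr_ge0// !(ReD, ImD, ReN, ImN)/=.
have tE : t = t / 2 + t / 2 by lra.
have c2 := cos2Dsin2 (t / 2).
rewrite {1 2}tE cosD sinD.
move: c2; set c := cos _; set s := sin _ => c2.
have -> : c * c - s * s = 1 - 2 * s ^+ 2.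
  have -> : c * c = 1 - s ^+ 2 by rewrite -c2; ring.
  ring.
have -> : (1 - 2 * s ^+ 2 - 1) ^+ 2 + (s * c + c * s - 0) ^+ 2 =
  4 * s ^+ 2 * (c ^+ 2 + s ^+ 2) by ring.
by rewrite c2; ring.
Qed.

Lemma cabs_expiB1E t : cabs (expi t - 1) = `|2 * sin (t / 2)|.
Proof.
by apply/eqP; rewrite -(eqrXn2 (n := 2)) ?cabs_ge0 ?normr_ge0// expiB_sqr real_normK ?num_real.
Qed.

Lemma cabs_expiB1 t : cabs (expi t - 1) <= `|t|.
Proof.
rewrite cabs_expiB1E normrM gtr0_norm//.
have := abs_sin_le (t / 2); rewrite normrM [ `|2^-1|]gtr0_norm//.
lra.
Qed.

Lemma cabs_expiB s t : cabs (expi s - expi t) <= `|s - t|.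
Proof.
have -> : expi s - expi t = expi t * (expi (s - t) - 1).
  by rewrite mulrBr -expiD mulr1 [t + _]addrC subrK.
by rewrite cabsM cabs_expi mul1r cabs_expiB1.
Qed.

End complex_facts.

(** * Integrals of complex functions *)

Section cmeas.
Context {R : realType} d (T : measurableType d).
Implicit Types (f g : T -> R[i]) (h : T -> R) (D : set T).

Definition cmeas f := measurable_fun setT (fun t => Re (f t)) /\
                      measurable_fun setT (fun t => Im (f t)).

Lemma cmeas_cst z : cmeas (fun=> z).
Proof. by split; exact: measurable_cst. Qed.
Lemma cmeasD f g : cmeas f -> cmeas g -> cmeas (fun t => f t + g t).
Proof.
move=> [f1 f2] [g1 g2]; split.
- by under eq_fun do rewrite ReD; exact: measurable_funD.
- by under eq_fun do rewrite ImD; exact: measurable_funD.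
Qed.
Lemma cmeasM f g : cmeas f -> cmeas g -> cmeas (fun t => f t * g t).
Proof.
move=> [f1 f2] [g1 g2]; split.
- under eq_fun do rewrite ReM.
  by apply: measurable_funB; exact: measurable_funM.
- under eq_fun do rewrite ImM.
  by apply: measurable_funD; exact: measurable_funM.
Qed.
Lemma cmeasN f : cmeas f -> cmeas (fun t => - f t).
Proof.
move=> mf; under eq_fun do rewrite -mulN1r.
by apply: cmeasM => //; exact: cmeas_cst.
Qed.
Lemma cmeasB f g : cmeas f -> cmeas g -> cmeas (fun t => f t - g t).
Proof. by move=> mf mg; apply: cmeasD => //; exact: cmeasN. Qed.
Lemma cmeas_conj f : cmeas f -> cmeas (fun t => conjc (f t)).
Proof.
move=> [f1 f2]; split.
- by apply: eq_measurable_fun f1 => t _; case: (f t).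
- apply: eq_measurable_fun (measurable_funN f2) => t _ /=; by case: (f t).
Qed.
Lemma cmeas_real h : measurable_fun setT h -> cmeas (fun t => ((h t)%:C)%C).
Proof. by move=> mh; split => //; exact: measurable_cst. Qed.
Lemma cmeas_expi h : measurable_fun setT h -> cmeas (fun t => expi (h t)).
Proof.
move=> mh; split; apply: (measurableT_comp _ mh);
  apply: continuous_measurable_fun.
- exact: continuous_cos.
- exact: continuous_sin.
Qed.

Lemma measurable_cabs f : cmeas f -> measurable_fun setT (fun t => cabs (f t)).
Proof.
move=> [f1 f2]; under eq_fun do rewrite cabsE.
apply: (@measurableT_comp _ _ _ _ _ _ (@Num.sqrt R)).
  by apply: continuous_measurable_fun; exact: sqrt_continuous.
by apply: measurable_funD; exact: measurable_funX.
Qed.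
Lemma measurable_ecabs f : cmeas f ->
  measurable_fun setT (fun t => (cabs (f t))%:E).
Proof. by move=> mf; apply/measurable_EFinP; exact: measurable_cabs. Qed.

End cmeas.

Lemma cmeas_comp {R : realType} d d' (T : measurableType d)
    (T' : measurableType d') (f : T' -> R[i]) (p : T -> T') :
  cmeas f -> measurable_fun setT p -> cmeas (f \o p).
Proof.
move=> [f1 f2] mp; split.
  exact: (measurableT_comp f1 mp).
exact: (measurableT_comp f2 mp).
Qed.

Section cint.
Context {R : realType} d (T : measurableType d) (mu : {measure set T -> \bar R}).
Implicit Types (f g : T -> R[i]).

Local Notation cint f := (cintegral mu setT f).
Local Notation Cint f := (cintegrable mu setT f).
Local Notation aI f := (\int[mu]_x (cabs (f x))%:E)%E.

Lemma CintP f : Cint f <-> cmeas f /\ (aI f < +oo)%E.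
Proof.
split=> [[/integrableP[f1 i1] /integrableP[f2 i2]]|[mf fi]].
  have mf : cmeas f by split; exact/measurable_EFinP.
  split => //; have := lte_add_pinfty i1 i2.
  rewrite -ge0_integralD//; last 2 first.
    by apply: measurableT_comp.
    by apply: measurableT_comp.
  apply: le_lt_trans; apply: ge0_le_integral => //.
  - by move=> x _; rewrite lee_fin cabs_ge0.
  - exact: measurable_ecabs.
  - by apply: emeasurable_funD; exact: measurableT_comp.
  - by move=> x _; rewrite -EFinD lee_fin cabs_leD.
case: (mf) => f1 f2; split; apply/integrableP; split;
    do ?exact/measurable_EFinP; apply: le_lt_trans fi;
    apply: ge0_le_integral => //=;
    do ?[by move=> x _; rewrite lee_fin cabs_ge0];
    do ?[exact: measurable_ecabs];
    do ?[by apply/measurable_EFinP; apply: measurableT_comp].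
- by move=> x _; rewrite lee_fin le_Re_cabs.
- by move=> x _; rewrite lee_fin le_Im_cabs.
Qed.

Lemma Cint_meas f : Cint f -> cmeas f. Proof. by move/CintP => []. Qed.
Lemma Cint_lty f : Cint f -> (aI f < +oo)%E. Proof. by move/CintP => []. Qed.
Lemma aI_ge0 f : (0 <= aI f)%E.
Proof. by apply: integral_ge0 => x _; rewrite lee_fin cabs_ge0. Qed.
Lemma aI_fin f : Cint f -> aI f \is a fin_num.
Proof. by move=> /Cint_lty fi; rewrite ge0_fin_numE ?aI_ge0. Qed.

Lemma le_aI f g : cmeas f -> cmeas g -> (forall x, cabs (f x) <= cabs (g x)) ->
  (aI f <= aI g)%E.
Proof.
move=> mf mg fg; apply: ge0_le_integral => //.
- by move=> x _; rewrite lee_fin cabs_ge0.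
- exact: measurable_ecabs.
- exact: measurable_ecabs.
- by move=> x _; rewrite lee_fin.
Qed.

Lemma le_Cint f g : cmeas f -> Cint g -> (forall x, cabs (f x) <= cabs (g x)) ->
  Cint f.
Proof.
move=> mf /CintP[mg gi] fg; apply/CintP; split => //.
exact: le_lt_trans (le_aI _ _ fg) gi.
Qed.

Lemma Cint0 : Cint (fun=> 0).
Proof. by split; exact: integrable0. Qed.

Lemma CintD f g : Cint f -> Cint g -> Cint (fun x => f x + g x).
Proof.
move=> [f1 f2] [g1 g2]; split.
- by under eq_fun do rewrite ReD EFinD; exact: integrableD.
- by under eq_fun do rewrite ImD EFinD; exact: integrableD.
Qed.

Lemma CintM f g : Cint f -> cmeas g -> (forall x, cabs (g x) <= 1) ->
  Cint (fun x => f x * g x).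
Proof.
move=> fi mg g1; apply: le_Cint (fi) _.
  by apply: cmeasM => //; exact: Cint_meas.
by move=> x; rewrite cabsM ler_piMr// cabs_ge0.
Qed.

Lemma CintZ z f : Cint f -> Cint (fun x => z * f x).
Proof.
move=> /CintP[mf fi]; apply/CintP; split.
  by apply: cmeasM => //; exact: cmeas_cst.
under eq_integral do rewrite cabsM EFinM.
rewrite ge0_integralZl//; last 3 first.
- exact: measurable_ecabs.
- by move=> x _; rewrite lee_fin cabs_ge0.
- by rewrite lee_fin cabs_ge0.
by rewrite lte_mul_pinfty// lee_fin cabs_ge0.
Qed.

Lemma CintN f : Cint f -> Cint (fun x => - f x).
Proof. by move=> fi; under eq_fun do rewrite -mulN1r; exact: CintZ. Qed.
Lemma CintB f g : Cint f -> Cint g -> Cint (fun x => f x - g x).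
Proof. by move=> fi gi; apply: CintD => //; exact: CintN. Qed.

Lemma eq_cint f g : f =1 g -> cint f = cint g.
Proof. by move=> /funext ->. Qed.

Lemma cintD f g : Cint f -> Cint g -> cint (fun x => f x + g x) = cint f + cint g.
Proof.
move=> [f1 f2] [g1 g2]; apply: complexP; rewrite ?(ReD, ImD)/=.
- by under eq_Rintegral do rewrite ReD; rewrite RintegralD.
- by under eq_Rintegral do rewrite ImD; rewrite RintegralD.
Qed.

Lemma cintZ z f : Cint f -> cint (fun x => z * f x) = z * cint f.
Proof.
move=> [f1 f2].
have iZ c (h : T -> R) : mu.-integrable setT (EFin \o h) ->
    mu.-integrable setT (EFin \o (fun x => c * h x)).
  by move=> ih; rewrite /comp; under eq_fun do rewrite EFinM; exact: integrableZl.
apply: complexP; rewrite ?(ReM, ImM)/=.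
- under eq_Rintegral do rewrite ReM.
  by rewrite RintegralB// ?RintegralZl//; exact: iZ.
- under eq_Rintegral do rewrite ImM.
  by rewrite RintegralD// ?RintegralZl//; exact: iZ.
Qed.

Lemma cintN f : Cint f -> cint (fun x => - f x) = - cint f.
Proof.
move=> fi; under [in LHS]eq_fun do rewrite -mulN1r.
by rewrite cintZ// mulN1r.
Qed.
Lemma cintB f g : Cint f -> Cint g -> cint (fun x => f x - g x) = cint f - cint g.
Proof. by move=> fi gi; rewrite cintD ?cintN//; exact: CintN. Qed.
Lemma cint0 : cint (fun=> 0) = 0.
Proof.
by apply: complexP => /=; rewrite /Rintegral integral0.
Qed.

Lemma cint_conj f : Cint f -> cint (fun x => conjc (f x)) = conjc (cint f).
Proof.
move=> [f1 f2]; apply: complexP => /=.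
- by apply: eq_Rintegral => x _; case: (f x).
- rewrite -mulN1r -RintegralZl//.
  by apply: eq_Rintegral => x _; case: (f x) => a b /=; rewrite mulN1r.
Qed.

(** Rotating the value of the integral to the positive real axis reduces the
    bound to the real triangle inequality for the real part. *)
Lemma cint_abs f : Cint f -> ((cabs (cint f))%:E <= aI f)%E.
Proof.
move=> fi; have [->|z0] := eqVneq (cint f) 0; first by rewrite cabs0 aI_ge0.
have az0 : cabs (cint f) != 0 by apply: contra z0 => /eqP/cabs_eq0 ->.
pose w := conjc (cint f) * (((cabs (cint f))^-1)%:C)%C.
have wfi : Cint (fun x => w * f x) by exact: CintZ.
have aw : cabs w = 1.
  by rewrite cabsM cabs_conj cabs_real normrV ?unitfE// ger0_norm ?cabs_ge0// divff.
have -> : cabs (cint f) = Re (cint (fun x => w * f x)).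
  rewrite cintZ// /w; move: (az0); case: (cint f) => a b; rewrite cabsE /= => r0.
  have r2 : Num.sqrt (a ^+ 2 + b ^+ 2) ^+ 2 = a ^+ 2 + b ^+ 2.
    by rewrite sqr_sqrtr// addr_ge0 ?sqr_ge0.
  set r := Num.sqrt _ in r0 r2 *.
  apply: (mulIf r0); rewrite -expr2 r2; field.
  exact: r0.
case: (wfi) => wf1 _; rewrite /=.
rewrite (le_trans (y := (`|(\int[mu]_x (Re (w * f x)))%R|)%:E))//.
  by rewrite lee_fin ler_norm.
rewrite EFin_normr_Rintegral//.
apply: le_trans (le_abse_integral mu _ _) _ => //.
  exact: (measurable_int mu).
apply: ge0_le_integral => //.
- by apply: measurableT_comp => //; exact: (measurable_int mu).
- by apply: measurable_ecabs; exact: Cint_meas.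
- by move=> x _; rewrite /= lee_fin (le_trans (le_Re_cabs _))// cabsM aw mul1r.
Qed.

Lemma aI_eq0 f : cmeas f -> aI f = 0%E -> forall g, cmeas g ->
  Cint (fun x => f x * g x) /\ cint (fun x => f x * g x) = 0.
Proof.
move=> mf f0 g mg.
have mfg : cmeas (fun x => f x * g x) by exact: cmeasM.
have aE (h : T -> R[i]) : aI h = (\int[mu]_x `|(cabs (h x))%:E|)%E.
  by apply: eq_integral => x _; rewrite gee0_abs// lee_fin cabs_ge0.
have i0 : aI (fun x => f x * g x) = 0%E.
  have : ae_eq mu setT (fun x => (cabs (f x))%:E) (cst 0%E).
    by apply/(ae_eq_integral_abs mu measurableT (measurable_ecabs mf)); rewrite -aE.
  move=> h; rewrite aE.
  apply/(ae_eq_integral_abs mu measurableT (measurable_ecabs mfg)).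
  by apply: filterS h => x /(_ I) [fx0] _; rewrite cabsM fx0 mul0r.
have fgi : Cint (fun x => f x * g x) by apply/CintP; split => //; rewrite i0.
split => //; apply: cabs_eq0; apply/eqP; rewrite eq_le cabs_ge0 andbT.
by rewrite -lee_fin (le_trans (cint_abs fgi))// i0.
Qed.

End cint.

Section ae_fine.
Context {R : realType} d (T : measurableType d) (mu : {measure set T -> \bar R}).

Lemma integrable_fine (h : T -> \bar R) : mu.-integrable setT h ->
  mu.-integrable setT (fun x => (fine (h x))%:E) /\
  (\int[mu]_x (fine (h x))%:E = \int[mu]_x h x)%E.
Proof.
move=> ih; have mh := measurable_int mu ih.
have mfh : measurable_fun setT (fun x => (fine (h x))%:E).
  apply/measurable_EFinP; apply: (measurableT_comp _ mh).
  exact: fine_measurable.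
split.
  apply: le_integrable ih => // x _.
  by case: (h x) => //= [|]; rewrite normr0 ?leey.
apply: ae_eq_integral => //.
by apply: filterS (integrable_ae measurableT ih) => x /(_ I) hx _; rewrite fineK.
Qed.

End ae_fine.

Section real_fubini.
Context {R : realType} d1 d2 (T1 : measurableType d1) (T2 : measurableType d2).
Variables (m1 : {sigma_finite_measure set T1 -> \bar R})
          (m2 : {sigma_finite_measure set T2 -> \bar R}).

Lemma measurable_int2 (f : T1 * T2 -> \bar R) :
  measurable_fun setT f -> (forall z, 0 <= f z)%E ->
  measurable_fun setT (fun x => \int[m2]_y f (x, y))%E.
Proof. by move=> mf f0; exact: measurable_fun_fubini_tonelli_F. Qed.

Lemma fubini_fine (f : T1 * T2 -> R) (g : T1 * T2 -> R) :
  measurable_fun setT f -> measurable_fun setT g -> (forall z, `|f z| <= g z) ->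
  (\int[m1]_x \int[m2]_y (g (x, y))%:E < +oo)%E ->
  (m1 \x m2)%E.-integrable setT (EFin \o f) /\
  m1.-integrable setT (fun x => (Rintegral m2 setT (fun y => f (x, y)))%:E) /\
  (\int[m1]_x (Rintegral m2 setT (fun y => f (x, y)))%:E =
   \int[m1]_x \int[m2]_y (f (x, y))%:E)%E.
Proof.
move=> mf mg fg gi.
have i12 : (m1 \x m2)%E.-integrable setT (EFin \o f).
  apply/integrable12ltyP; first exact/measurable_EFinP.
  apply: le_lt_trans gi; apply: ge0_le_integral => //.
  - by move=> x _; exact: integral_ge0.
  - apply: (measurable_int2 (f := fun z => `|(f z)%:E|%E)) => //.
    by apply: measurableT_comp => //; exact/measurable_EFinP.
  - apply: (measurable_int2 (f := fun z => (g z)%:E)).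
      exact/measurable_EFinP.
    by move=> z; rewrite lee_fin (le_trans _ (fg z)).
  - move=> x _; apply: ge0_le_integral => //=.
    + apply/measurable_EFinP/measurableT_comp => //.
      exact: measurableT_comp mf (measurable_pair1 _).
    + apply/measurable_EFinP.
      exact: measurableT_comp mg (measurable_pair1 _).
    + by move=> y _; rewrite lee_fin.
split => //; exact: integrable_fine (integrable_fubini_F i12).
Qed.

End real_fubini.

Section cfubini.
Context {R : realType} d1 d2 (T1 : measurableType d1) (T2 : measurableType d2).
Variables (m1 : {sigma_finite_measure set T1 -> \bar R})
          (m2 : {sigma_finite_measure set T2 -> \bar R}).
Variable F : T1 * T2 -> R[i].
Hypothesis mF : cmeas F.

Lemma ctonelli : (\int[m1]_x \int[m2]_y (cabs (F (x, y)))%:E =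
                  \int[m2]_y \int[m1]_x (cabs (F (x, y)))%:E)%E.
Proof.
have h1 := measurable_ecabs mF.
have h2 z : (0 <= (cabs (F z))%:E)%E by rewrite lee_fin cabs_ge0.
exact: (@fubini_tonelli _ _ _ _ _ m1 m2 _ h1 h2).
Qed.

Hypothesis iF : (\int[m1]_x \int[m2]_y (cabs (F (x, y)))%:E < +oo)%E.

Lemma cfubini :
  [/\ cintegrable m1 setT (fun x => cintegral m2 setT (fun y => F (x, y))),
      cintegrable m2 setT (fun y => cintegral m1 setT (fun x => F (x, y))) &
      cintegral m1 setT (fun x => cintegral m2 setT (fun y => F (x, y))) =
      cintegral m2 setT (fun y => cintegral m1 setT (fun x => F (x, y)))].
Proof.
have [mFr mFi] := mF.
have mFa := measurable_cabs mF.
have [i1 [r1 r1E]] := fubini_fine mFr mFa (fun z => le_Re_cabs (F z)) iF.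
have [i2 [r2 r2E]] := fubini_fine mFi mFa (fun z => le_Im_cabs (F z)) iF.
have iF' := iF; rewrite ctonelli in iF'.
have msw := @measurable_swap _ _ T2 T1.
have [_ [s1 s1E]] := fubini_fine (g := fun z => cabs (F (unstable.swap z))) (measurableT_comp mFr msw) (measurableT_comp mFa msw)
   (fun z => le_Re_cabs (F (unstable.swap z))) iF'.
have [_ [s2 s2E]] := fubini_fine (g := fun z => cabs (F (unstable.swap z))) (measurableT_comp mFi msw) (measurableT_comp mFa msw)
   (fun z => le_Im_cabs (F (unstable.swap z))) iF'.
split; [by split|by split|].
apply: complexP; rewrite /= {1 3}/Rintegral; congr fine.
- by rewrite r1E [RHS]s1E; exact: Fubini i1.
- by rewrite r2E [RHS]s2E; exact: Fubini i2.
Qed.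

End cfubini.

Section cdom.
Context {R : realType} d (T : measurableType d) (mu : {measure set T -> \bar R}).

Lemma dominated_real (f : nat -> T -> R) (l g : T -> R) :
  (forall n, measurable_fun setT (f n)) ->
  (forall x, f n x @[n --> \oo] --> l x) ->
  mu.-integrable setT (EFin \o g) ->
  (forall n x, `|f n x| <= g x) ->
  (\int[mu]_x (f n x)%:E @[n --> \oo] --> \int[mu]_x (l x)%:E)%E.
Proof.
move=> mf fl ig fg.
apply: (@dominated_cvg _ _ _ mu setT measurableT (fun n x => (f n x)%:E)
  (fun x => (l x)%:E) (EFin \o g)) => //.
- by move=> n; exact/measurable_EFinP.
- by move=> x _; apply: cvg_EFin; [exact: nearW|exact: fl].
- by move=> n x _ /=; rewrite lee_fin.
Qed.

Lemma dominated_abs0 (f : nat -> T -> R[i]) (g : T -> R[i]) :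
  (forall n, cmeas (f n)) ->
  (forall x, cabs (f n x) @[n --> \oo] --> (0 : R)) ->
  cintegrable mu setT g ->
  (forall n x, cabs (f n x) <= cabs (g x)) ->
  (\int[mu]_x (cabs (f n x))%:E @[n --> \oo] --> 0)%E.
Proof.
move=> mf f0 ig fg.
have -> : 0%E = (\int[mu]_x (0 : R)%:E)%E by rewrite integral0.
apply: (@dominated_real _ _ (fun x => cabs (g x))) => //.
- by move=> n; exact: measurable_cabs.
- case/CintP : ig => mg ig; apply/integrableP; split.
    exact: measurable_ecabs.
  rewrite (eq_integral (fun x => (cabs (g x))%:E))// => x _ /=.
  by rewrite ger0_norm ?cabs_ge0.
- by move=> n x; rewrite ger0_norm ?cabs_ge0.
Qed.

End cdom.

Section cpush.
Context {R : realType} d1 d2 (T1 : measurableType d1) (T2 : measurableType d2).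
Variables (m1 : {measure set T1 -> \bar R}) (m2 : {measure set T2 -> \bar R}).
Variable p : T1 -> T2.
Hypothesis mp : measurable_fun setT p.
Hypothesis pm : forall A, measurable A -> m1 (p @^-1` A) = m2 A.

Lemma ge0_int_push (f : T2 -> \bar R) : measurable_fun setT f ->
  (forall y, 0 <= f y)%E -> (\int[m1]_x f (p x) = \int[m2]_y f y)%E.
Proof.
move=> mf f0.
rewrite -[LHS](ge0_integral_pushforward mp m1 measurableT mf); last by move=> y _.
by apply: eq_measure_integral => A mA _; rewrite -pm.
Qed.

Lemma cint_push (f : T2 -> R[i]) : cintegrable m2 setT f ->
  cintegrable m1 setT (f \o p) /\ cintegral m1 setT (f \o p) = cintegral m2 setT f.
Proof.
move=> /[dup] fi /CintP[mf li].
have fpi : cintegrable m1 setT (f \o p).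
  apply/CintP; split; first exact: cmeas_comp.
  rewrite (ge0_int_push (f := fun y => (cabs (f y))%:E))//.
    exact: measurable_ecabs.
  by move=> y; rewrite lee_fin cabs_ge0.
split => //; case: (fpi) => r1 r2; case: fi => s1 s2.
have pE (h : T2 -> R) : measurable_fun setT h ->
    m1.-integrable setT (EFin \o (h \o p)) ->
    Rintegral m1 setT (h \o p) = Rintegral m2 setT h.
  move=> mh ih; rewrite /Rintegral; congr fine.
  have mh' : measurable_fun setT (EFin \o h) by exact/measurable_EFinP.
  rewrite -(integral_pushforward mp mh' ih measurableT).
  by apply: eq_measure_integral => A mA _; rewrite -pm.
case: mf => mf1 mf2.
by apply: complexP => /=; rewrite -pE//.
Qed.

End cpush.

(** * Sums as integrals for the counting measure *)

(** A countable type on which every subset is measurable, so that sums become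
    integrals. The parameter [i0] provides the default point that measurable
    types carry. *)
Definition disc (I : countType) (i0 : I) : Type := I.
HB.instance Definition _ (I : countType) (i0 : I) := Countable.on (disc i0).
HB.instance Definition _ (I : countType) (i0 : I) := isPointed.Build (disc i0) i0.
HB.instance Definition _ (I : countType) (i0 : I) :=
  @isMeasurable.Build default_measure_display (disc i0)
  discrete_measurable discrete_measurable0
  discrete_measurableC discrete_measurableU.

Section count.
Context {R : realType} (I : countType) (i0 : I).
Local Notation D := (disc i0).

Definition countm : set D -> \bar R := @counting D R.
HB.instance Definition _ := Measure.copy countm (@counting D R).

Lemma measurable_fun_disc d' (T' : measurableType d') (f : D -> T') :
  measurable_fun setT f.
Proof. by []. Qed.
Lemma cmeas_disc (f : D -> R[i]) : cmeas f.
Proof. by split. Qed.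

Definition initial n : set D := [set i : I | (pickle i < n)%N].

Lemma finite_initial n : finite_set (initial n).
Proof.
have -> : initial n = (pickle : I -> nat) @^-1` `I_n by [].
apply: finite_preimage => // x y _ _; exact: (pcan_inj pickleK).
Qed.

Lemma bigcup_initial : \bigcup_n initial n = setT.
Proof. by apply/seteqP; split => // i _; exists (pickle (i : I)).+1 => //=; rewrite /initial/=. Qed.

Lemma countm_sigma_finite : sigma_finite [set: D] countm.
Proof.
exists initial; first by rewrite bigcup_initial.
by move=> n; split => //; rewrite /countm/= /counting asboolT ?ltry//; exact: finite_initial.
Qed.

HB.instance Definition _ := @Measure_isSigmaFinite.Build _ _ _ countm countm_sigma_finite.

End count.
Arguments countm {R} {I} i0 _.

Lemma finite_set_ind (T : choiceType) (P : set T -> Prop) :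
  P set0 ->
  (forall i A, finite_set A -> ~ A i -> P A -> P ([set i] `|` A)) ->
  forall A, finite_set A -> P A.
Proof.
move=> P0 PS A /finite_seqP[s ->]; elim: s => [|x s IH].
  by rewrite (_ : [set` _] = set0)//; apply/seteqP; split.
have E : [set` x :: s] = [set x] `|` [set` s].
  apply/seteqP; split => y /=; rewrite in_cons.
    by case/orP => [/eqP ->|ys]; [left|right].
  by case=> [->|->]; rewrite ?eqxx ?orbT.
have [xs|xs] := boolP (x \in s).
  rewrite E (_ : _ `|` _ = [set` s])//.
  by apply/seteqP; split => [y [->|]//|y ys]; right.
by rewrite E; apply: PS => //; exact/negP.
Qed.

Section esum_count.
Context {R : realType} (I : countType) (i0 : I).
Local Notation D := (disc i0).
Local Notation cm := (@countm R I i0).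
Implicit Types (A : set I) (f : I -> \bar R).

Lemma countm1 (i : I) : cm [set i] = 1%E.
Proof.
by rewrite /countm/= /counting asboolT ?finite_set1// fset_set1 mathcomp.finmap.finmap.cardfs1.
Qed.

Lemma int_count_set1 f i : (0 <= f i)%E -> (\int[cm]_(x in [set i]) f x = f i)%E.
Proof.
move=> f0; rewrite (eq_integral (cst (f i))); last first.
  by move=> x; rewrite inE => ->.
by rewrite integral_cst//= (_ : cm [set i] = 1%E) ?mule1//; exact: countm1.
Qed.

Lemma int_count_fset A f : finite_set A -> (forall i, 0 <= f i)%E ->
  (\int[cm]_(x in (A : set D)) f x = \esum_(i in A) f i)%E.
Proof.
move=> fA f0; rewrite esum_fset//.
elim/finite_set_ind : A / fA => [|i A fA iA IH].
  by rewrite integral_set0 fsbig_set0.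
rewrite fsbigU//; last first.
  by move=> x [xi xA]; exfalso; move: xi xA => ->; exact: iA.
rewrite fsbig_set1 ge0_integral_setU//; last first.
  by apply/disj_setPS => x [] -> /iA.
by rewrite int_count_set1// IH.
Qed.

(** Monotone convergence along the finite initial segments of the enumeration.
    *)
Lemma int_countE f : (forall i, 0 <= f i)%E ->
  (\int[cm]_x f x = \esum_(i in [set: I]) f i)%E.
Proof.
move=> f0; apply/eqP; rewrite eq_le; apply/andP; split; last first.
  apply: ge_ereal_sup => _ [A [fA _] <-].
  rewrite -esum_fset// -int_count_fset//.
  exact: ge0_subset_integral.
have := @ge0_nondecreasing_set_cvg_integral _ _ R (@initial I i0) f cm.
rewrite bigcup_initial => h.
have h1 : nondecreasing_seq (@initial I i0).
  move=> m n mn; apply/subsetPset => i /= /leq_trans; exact.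
have {h1}h2 : (\int[cm]_(x in @initial I i0 n) f x)%E @[n --> \oo] --> (\int[cm]_x f x)%E.
  exact: h.
move/cvg_lim : (h2) => <-//.
apply: lime_le; first by apply/cvg_ex; eexists; exact: h2.
apply: nearW => n; rewrite int_count_fset//; last exact: finite_initial.
rewrite esum_fset//; last exact: finite_initial.
by apply: ereal_sup_ubound; exists (@initial I i0 n) => //; split => //; exact: finite_initial.
Qed.

Lemma esum_int_count A f : (forall i, 0 <= f i)%E ->
  (\esum_(i in A) f i = \int[cm]_x (f \_ (A : set D)) x)%E.
Proof.
move=> f0; rewrite int_countE; last by move=> i; rewrite /patch; case: ifP.
by rewrite esum_mkcond; apply: eq_esum => i _; rewrite /patch.
Qed.

Definition crestrict (A : set I) (f : I -> R[i]) : D -> R[i] :=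
  fun i => if i \in A then f i else 0.

Lemma csummableP A (f : I -> R[i]) :
  csummable A f <-> cintegrable cm setT (crestrict A f).
Proof.
have E : (\esum_(i in A) (cabs (f i))%:E =
    \int[cm]_x (cabs (crestrict A f x))%:E)%E.
  rewrite esum_int_count; last by move=> i; rewrite lee_fin cabs_ge0.
  apply: eq_integral => i _; rewrite /crestrict /patch.
  by case: ifP => _; rewrite ?cabs0.
split; rewrite /csummable E => h; last by case/CintP : h.
by apply/CintP; split => //; exact: cmeas_disc.
Qed.

Lemma rsumE A (f : I -> R) :
  cm.-integrable setT (fun i : D => ((if i \in A then f i else 0))%:E) ->
  rsum A f = Rintegral cm setT (fun i : D => if i \in A then f i else 0).
Proof.
move=> fi; rewrite /rsum /Rintegral integralE fineB; last 2 first.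
- exact: integrable_pos_fin_num.
- exact: integrable_neg_fin_num.
congr (fine _ - fine _); rewrite esum_int_count;
    do ?[by move=> i; rewrite lee_fin le_max lexx orbT];
  apply: eq_integral => i _; rewrite /patch.
- by rewrite funeposE -EFin_max; case: ifP => _ //; rewrite maxxx.
- by rewrite funenegE -EFinN -EFin_max; case: ifP => _ //; rewrite oppr0 maxxx.
Qed.

(** The positive and negative parts in [rsum] are those of the Lebesgue
    integral. Linearity, dominated convergence and Fubini for [csum] are read
    off from the integral. *)
Lemma csumE A (f : I -> R[i]) : csummable A f ->
  csum A f = cintegral cm setT (crestrict A f).
Proof.
move=> /csummableP[s1 s2].
have e1 : (fun i : D => if i \in A then Re (f i) else 0) = (fun i => Re (crestrict A f i)).
  by apply/funext => i; rewrite /crestrict; case: ifP.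
have e2 : (fun i : D => if i \in A then Im (f i) else 0) = (fun i => Im (crestrict A f i)).
  by apply/funext => i; rewrite /crestrict; case: ifP.
apply: complexP => /=; rewrite rsumE ?e1 ?e2//.
- by rewrite (_ : (fun i : D => (if i \in A then Re (f i) else 0)%:E) = EFin \o (fun i : D => if i \in A then Re (f i) else 0))// e1.
- by rewrite (_ : (fun i : D => (if i \in A then Im (f i) else 0)%:E) = EFin \o (fun i : D => if i \in A then Im (f i) else 0))// e2.
Qed.

End esum_count.

Section csum_theory.
Context {R : realType} (I : countType) (i0 : I).
Implicit Types (A B : set I) (f g : I -> R[i]).

Lemma csum_eq A f g : (forall i, A i -> f i = g i) -> csum A f = csum A g.
Proof.
by move=> fg; congr (_ +i* _)%C; congr (fine _ - fine _);
  apply: eq_esum => i /fg ->.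
Qed.

Lemma csummable_le A f (g : I -> \bar R) :
  (forall i, A i -> (cabs (f i))%:E <= g i)%E -> (\esum_(i in A) g i < +oo)%E ->
  csummable A f.
Proof.
by move=> fg gi; apply: le_lt_trans gi; apply: le_esum => i /fg.
Qed.

Lemma csummableD A f g : csummable A f -> csummable A g ->
  csummable A (fun i => f i + g i).
Proof.
move=> /(csummableP i0) sf /(csummableP i0) sg; apply/(csummableP i0).
rewrite (_ : crestrict _ _ = fun i => crestrict A f i + crestrict A g i).
  exact: CintD.
by apply/funext => i; rewrite /crestrict; case: ifP; rewrite ?addr0.
Qed.
Lemma csumD A f g : csummable A f -> csummable A g ->
  csum A (fun i => f i + g i) = csum A f + csum A g.
Proof.
move=> sf sg; rewrite !(csumE i0)//; last exact: csummableD.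
rewrite -cintD; do ?exact/csummableP.
by apply: eq_cint => i; rewrite /crestrict; case: ifP; rewrite ?addr0.
Qed.
Lemma csummableZ A z f : csummable A f -> csummable A (fun i => z * f i).
Proof.
move=> /(csummableP i0) sf; apply/(csummableP i0).
rewrite (_ : crestrict _ _ = fun i => z * crestrict A f i).
  exact: CintZ.
by apply/funext => i; rewrite /crestrict; case: ifP; rewrite ?mulr0.
Qed.
Lemma csumZ A z f : csummable A f -> csum A (fun i => z * f i) = z * csum A f.
Proof.
move=> sf; rewrite !(csumE i0)//; last exact: csummableZ.
rewrite -cintZ; do ?exact/csummableP.
by apply: eq_cint => i; rewrite /crestrict; case: ifP; rewrite ?mulr0.
Qed.
Lemma csumB A f g : csummable A f -> csummable A g ->
  csum A (fun i => f i - g i) = csum A f - csum A g.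
Proof.
move=> sf sg; rewrite -mulN1r -csumZ// -csumD//; last exact: csummableZ.
by apply: csum_eq => i _; rewrite mulN1r.
Qed.

Lemma csummableS A B f : A `<=` B -> csummable B f -> csummable A f.
Proof.
move=> AB; apply: le_lt_trans.
rewrite (esum_mkcond A) (esum_mkcond B); apply: le_esum => i _.
case: ifPn => [|_]; first by rewrite inE => /AB/mem_set ->.
by case: ifP => _; rewrite lee_fin ?cabs_ge0.
Qed.

Lemma csum_mkcond A f : csum A f = csum setT (fun i => if i \in A then f i else 0).
Proof.
congr (_ +i* _)%C; congr (fine _ - fine _); rewrite esum_mkcond;
  apply: eq_esum => i _; case: ifP => //= _; rewrite ?oppr0 maxxx//.
Qed.
Lemma csummable_mkcond A f :
  csummable A f = csummable setT (fun i => if i \in A then f i else 0).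
Proof.
rewrite /csummable esum_mkcond; congr (is_true (_ < _)%E).
by apply: eq_esum => i _; case: ifP; rewrite ?cabs0.
Qed.

Lemma csumU A B f : A `&` B = set0 -> csummable (A `|` B) f ->
  csum (A `|` B) f = csum A f + csum B f.
Proof.
move=> AB s; have sA : csummable A f by apply: csummableS s; exact: subsetUl.
have sB : csummable B f by apply: csummableS s; exact: subsetUr.
rewrite (csum_mkcond A) (csum_mkcond B) -csumD; last 2 first.
- by rewrite -csummable_mkcond.
- by rewrite -csummable_mkcond.
rewrite csum_mkcond; apply: csum_eq => i _; rewrite in_setU.
have [iA|iA] := boolP (i \in A); have [iB|iB] := boolP (i \in B); rewrite ?(addr0, add0r)//=.
by move: iA iB; rewrite !inE => iA iB; have : (A `&` B) i by []; rewrite AB.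
Qed.

Lemma csum_fin A f : finite_set A -> csum A f = \sum_(i \in A) f i.
Proof.
move=> fA.
have sA B : finite_set B -> csummable B f.
  move=> fB; rewrite /csummable esum_fset//.
    by rewrite fsumEFin// ltry.
  by move=> i _; rewrite lee_fin cabs_ge0.
have c0 (B : set I) : B = set0 -> csum B f = 0.
  move=> ->; apply: complexP; rewrite /= /rsum !esum_set0/= subr0//.
have c1 i : csum [set i] f = f i.
  have h (x : R) : Num.max x 0 - Num.max (- x) 0 = x.
    by case: (leP 0 x) => x0; [rewrite max_r ?subr0// oppr_le0|rewrite max_l; lra].
  by apply: complexP; rewrite /= /rsum !esum_set1/= ?lee_fin ?le_max ?lexx ?orbT// h.
elim/finite_set_ind : A / fA => [|i A fA iA IH].
  by rewrite fsbig_set0 c0.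
have Ai : [set i] `&` A = set0 by apply/seteqP; split => // x [/= ->].
rewrite csumU//; last by apply: sA; rewrite finite_setU; split.
by rewrite fsbigU// ?fsbig_set1 ?c1 ?IH// => x [xi xA]; exfalso; move: xi xA => ->; exact: iA.
Qed.

End csum_theory.

Section limit_bounds.
Context {R : realType}.

Lemma cvgn_ub (u : nat -> R) (l K : R) :
  u @ \oo --> l -> (forall n, u n <= K) -> l <= K.
Proof.
move=> ul uK; rewrite -(cvg_lim (@Rhausdorff R) ul); apply: limr_le.
  by apply/cvg_ex; exists l.
by apply: nearW => n.
Qed.

Lemma cvge_lb (u : nat -> \bar R) (l K : \bar R) :
  u @ \oo --> l -> (forall n, K <= u n)%E -> (K <= l)%E.
Proof.
move=> ul uK; rewrite -(cvg_lim (@ereal_hausdorff R) ul); apply: lime_ge.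
  by apply/cvg_ex; exists l.
by apply: nearW => n.
Qed.

End limit_bounds.

(** * Fourier analysis on Z^d and R^d at once *)

(** What the Wiener algebra uses of the frequencies of the torus and of the
    space: a group [fs_G] with an invariant measure, an additive map [fs_vec] to
    R^d, and the fact that the half-spaces generate the measurable sets. The
    constant [fs_cst] normalizes the inverse transform; being at most 1, it lets
    the norm of the algebra dominate the supremum. *)
Record fsetting (R : realType) (d : nat) := FSetting {
  fs_disp : measure_display ;
  fs_G : measurableType fs_disp ;
  fs_mu : {sigma_finite_measure set fs_G -> \bar R} ;
  fs_vec : fs_G -> 'rV[R]_d ;
  fs_cst : R ;
  fs_add : fs_G -> fs_G -> fs_G ;
  fs_opp : fs_G -> fs_G ;
  fs_vecD : forall a b, fs_vec (fs_add a b) = fs_vec a + fs_vec b ;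
  fs_vecN : forall a, fs_vec (fs_opp a) = - fs_vec a ;
  fs_mD : measurable_fun setT (fun p : fs_G * fs_G => fs_add p.1 p.2) ;
  fs_mN : measurable_fun setT fs_opp ;
  fs_mvec : forall i, measurable_fun setT (fun a => fs_vec a 0 i) ;
  fs_muD : forall c A, measurable A -> fs_mu (fs_add c @^-1` A) = fs_mu A ;
  fs_muN : forall A, measurable A -> fs_mu (fs_opp @^-1` A) = fs_mu A ;
  fs_cst01 : 0 < fs_cst <= 1 ;
  fs_gen : forall C : set (set fs_G),
    (forall A, C A -> C (~` A)) ->
    (forall A : nat -> set fs_G, (forall n, C (A n)) -> C (\bigcup_n A n)) ->
    (forall i c, C [set a | c < fs_vec a 0 i]) ->
    forall A, measurable A -> C A }.

Section fourier.
Context {R : realType} {d : nat} (S : fsetting R d).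
Local Notation G := (fs_G S).
Local Notation mu := (fs_mu S).
Local Notation vec := (@fs_vec _ _ S).
Local Notation V := 'rV[R]_d.
Local Notation cint f := (cintegral mu setT f).
Local Notation Cint f := (cintegrable mu setT f).
Local Notation aI f := (\int[mu]_x (cabs (f x))%:E)%E.
Implicit Types (x y : V) (f : V -> R[i]) (g : G -> R[i]) (w : V -> R).

Lemma dotDl x x' y : dot (x + x') y = dot x y + dot x' y.
Proof. by rewrite /dot -big_split; apply: eq_bigr => i _; rewrite mxE mulrDl. Qed.
Lemma dotC x y : dot x y = dot y x.
Proof. by apply: eq_bigr => i _; rewrite mulrC. Qed.
Lemma dotDr x y y' : dot x (y + y') = dot x y + dot x y'.
Proof. by rewrite dotC dotDl !(dotC x). Qed.
Lemma dotZl a x y : dot (a *: x) y = a * dot x y.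
Proof. by rewrite /dot mulr_sumr; apply: eq_bigr => i _; rewrite mxE mulrA. Qed.
Lemma dotZr a x y : dot x (a *: y) = a * dot x y.
Proof. by rewrite dotC dotZl dotC. Qed.
Lemma dotNl x y : dot (- x) y = - dot x y.
Proof. by rewrite -scaleN1r dotZl mulN1r. Qed.
Lemma dotNr x y : dot x (- y) = - dot x y.
Proof. by rewrite dotC dotNl dotC. Qed.
Lemma dot0l x : dot 0 x = 0.
Proof. by rewrite /dot big1// => i _; rewrite mxE mul0r. Qed.
Lemma dot_delta i x : dot (delta_mx 0 i) x = x 0 i.
Proof.
rewrite /dot (bigD1 i)//= big1 ?addr0 => [|j ji]; rewrite mxE eqxx ?eqxx ?mul1r//.
by rewrite (negbTE ji) mul0r.
Qed.

Definition fchar x (a : G) : R[i] := expi (dot x (vec a)).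

Lemma measurable_dot x : measurable_fun setT (fun a : G => dot x (vec a)).
Proof.
apply: measurable_sum => i.
by apply: measurable_funM => //; exact: fs_mvec.
Qed.
Lemma measurable_sqnorm : measurable_fun setT (fun a : G => sqnorm (vec a)).
Proof.
by apply: measurable_sum => i; apply: measurable_funM => //; exact: fs_mvec.
Qed.
Lemma cmeas_fchar x : cmeas (fchar x).
Proof. by apply: cmeas_expi; exact: measurable_dot. Qed.
Lemma fcharD x y a : fchar (x + y) a = fchar x a * fchar y a.
Proof. by rewrite /fchar dotDl expiD. Qed.
Lemma fchar0 a : fchar 0 a = 1.
Proof. by rewrite /fchar dot0l expi0. Qed.
Lemma fchar_add x a b : fchar x (fs_add a b) = fchar x a * fchar x b.
Proof. by rewrite /fchar fs_vecD dotDr expiD. Qed.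
Lemma cabs_fchar x a : cabs (fchar x a) = 1. Proof. exact: cabs_expi. Qed.

Lemma Cint_fchar g x : Cint g -> Cint (fun a => g a * fchar x a).
Proof.
move=> gi; apply: CintM => //; first exact: cmeas_fchar.
by move=> a; rewrite cabs_fchar.
Qed.

(** ** Injectivity of the Fourier transform *)

Definition vanishing g := Cint g /\ forall x, cint (fun a => g a * fchar x a) = 0.

(** The multipliers that preserve the functions with vanishing transform form an
    algebra that contains the trigonometric polynomials, because a modulation of
    [g] translates its transform, and that is closed under bounded pointwise
    limits. Hence it contains all indicator functions, which forces [g] to
    vanish. *)
Definition multiplier (phi : G -> R) :=
  [/\ measurable_fun setT phi, exists K, forall a, `|phi a| <= K &
      forall g, vanishing g -> vanishing (fun a => ((phi a)%:C)%C * g a)].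

Lemma vanishingZ z g : vanishing g -> vanishing (fun a => z * g a).
Proof.
move=> [gi g0]; split; first exact: CintZ.
move=> x; under eq_fun do rewrite -mulrA.
by rewrite cintZ ?g0 ?mulr0//; exact: Cint_fchar.
Qed.
Lemma vanishingD g h : vanishing g -> vanishing h -> vanishing (fun a => g a + h a).
Proof.
move=> [gi g0] [hi h0]; split; first exact: CintD.
move=> x; under eq_fun do rewrite mulrDl.
by rewrite cintD ?g0 ?h0 ?addr0//; exact: Cint_fchar.
Qed.
Lemma vanishing_fchar y g : vanishing g -> vanishing (fun a => fchar y a * g a).
Proof.
move=> [gi g0]; split.
  by under eq_fun do rewrite mulrC; exact: Cint_fchar.
move=> x; rewrite -[RHS](g0 (y + x)); apply: eq_cint => a.
by rewrite fcharD; ring.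
Qed.

Lemma multiplier_cst r : multiplier (fun=> r).
Proof.
split; [exact: measurable_cst|by exists (Num.norm r)|].
by move=> g; exact: vanishingZ.
Qed.
Lemma multiplierD p q : multiplier p -> multiplier q ->
  multiplier (fun a => p a + q a).
Proof.
move=> [mp [K pK] hp] [mq [L qL] hq]; split.
- exact: measurable_funD.
- by exists (K + L) => a; rewrite (le_trans (ler_normD _ _))// lerD.
- move=> g vg; under eq_fun do rewrite rmorphD mulrDl.
  by apply: vanishingD; [exact: hp|exact: hq].
Qed.
Lemma multiplierM p q : multiplier p -> multiplier q ->
  multiplier (fun a => p a * q a).
Proof.
move=> [mp [K pK] hp] [mq [L qL] hq]; split.
- exact: measurable_funM.
- by exists (K * L) => a; rewrite normrM ler_pM.
- move=> g vg; under eq_fun do rewrite rmorphM -mulrA.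
  by apply: hp; exact: hq.
Qed.
Lemma multiplier_sin y c : multiplier (fun a => sin (dot y (vec a) + c)).
Proof.
split.
- apply: (@measurableT_comp _ _ _ _ _ _ (@sin R)).
    by apply: continuous_measurable_fun; exact: continuous_sin.
  by apply: measurable_funD => //; exact: measurable_dot.
- by exists 1 => a; exact: sin_max.
- move=> g vg.
  rewrite (_ : (fun a => _) = fun a => ((0 -i* 2^-1)%C * expi c) * (fchar y a * g a) +
     ((0 +i* 2^-1)%C * expi (- c)) * (fchar (- y) a * g a)).
    by apply: vanishingD; apply: vanishingZ; exact: vanishing_fchar.
  apply/funext => a; rewrite !mulrA -mulrDl; congr (_ * _).
  rewrite /fchar -!mulrA -!expiD dotNl -opprD addrC.
  set t := c + _; rewrite expiN; apply: complexP; rewrite !(ReD, ImD, ReM, ImM)/=.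
    lra.
  lra.
Qed.

(** Dominated convergence, under each of the integrals that define the
    transform. *)
Lemma multiplier_lim (p : nat -> G -> R) (l : G -> R) K :
  (forall n, multiplier (p n)) -> (forall n a, `|p n a| <= K) ->
  (forall a, p n a @[n --> \oo] --> l a) -> multiplier l.
Proof.
move=> mp pK pl.
have ml : measurable_fun setT l.
  apply: (measurable_fun_cvg (h := p)) => [n|a _]; last exact: pl.
  by case: (mp n).
have lK a : `|l a| <= K.
  have h : `|p n a| @[n --> \oo] --> `|l a| by apply: cvg_norm.
  by apply: cvgn_ub h _ => n.
split => //; first by exists K.
move=> g vg; have [gi g0] := vg.
have K0 : 0 <= K by rewrite (le_trans _ (lK (point : G))).
have b (q : G -> R) : (forall a, `|q a| <= K) -> measurable_fun setT q ->
    Cint (fun a => ((q a)%:C)%C * g a).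
  move=> qK mq; apply: le_Cint (CintZ (K%:C)%C gi) _.
    by apply: cmeasM; [exact: cmeas_real|exact: Cint_meas gi].
  by move=> a; rewrite !cabsM ler_wpM2r ?cabs_ge0// !cabs_real (ger0_norm K0).
split; first exact: b.
move=> x; apply: cabs_eq0; apply/eqP; rewrite eq_le cabs_ge0 andbT.
have H : (\int[mu]_a (cabs (((p n a - l a)%:C)%C * g a))%:E @[n --> \oo] --> 0)%E.
  apply: (dominated_abs0 (g := fun a => ((2 * K)%:C)%C * g a)).
  - move=> n; apply: cmeasM; last exact: Cint_meas gi.
    by apply: cmeas_real; apply: measurable_funB => //; case: (mp n).
  - move=> a; under eq_fun do rewrite cabsM cabs_real.
    rewrite -(mul0r (cabs (g a))); apply: cvgMl.
    have : p n a - l a @[n --> \oo] --> l a - l a by apply: cvgB => //; exact: cvg_cst.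
    by rewrite subrr => /cvg_norm; rewrite normr0.
  - exact: CintZ.
  - move=> n a; rewrite !cabsM ler_wpM2r ?cabs_ge0// !cabs_real.
    rewrite [leRHS]ger0_norm; last by rewrite mulr_ge0.
    by rewrite (le_trans (ler_normB _ _))// mulr_natl mulr2n lerD.
suff h n : ((cabs (cint (fun a => ((l a)%:C)%C * g a * fchar x a)))%:E <=
    \int[mu]_a (cabs (((p n a - l a)%:C)%C * g a))%:E)%E.
  by rewrite -lee_fin; apply: cvge_lb H _ => n.
have [mpn _ hp] := mp n; have [pi0 p0] := hp g vg.
rewrite -[X in cabs X]subr0 -(p0 x) -cintB; last 2 first.
- by apply: Cint_fchar; exact: b.
- exact: Cint_fchar.
apply: le_trans (cint_abs _) _.
  by apply: CintB; apply: Cint_fchar => //; exact: b.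
rewrite le_eqVlt; apply/orP; left; apply/eqP; apply: eq_integral => a _.
have -> : ((l a)%:C)%C * g a * fchar x a - ((p n a)%:C)%C * g a * fchar x a =
  ((l a - p n a)%:C)%C * g a * fchar x a by rewrite rmorphB; ring.
by rewrite !cabsM cabs_fchar mulr1 !cabs_real distrC.
Qed.

(** The cubic [(3 t - t^3) / 2] maps [-1, 1] to itself and its iterates converge
    to the sign: it is the polynomial substitute for a jump. *)
Definition cubic (t : R) : R := (3 * t - t ^+ 3) / 2.

Lemma cubicN t : cubic (- t) = - cubic t.
Proof. by rewrite /cubic; field. Qed.
Lemma cubic_itv t : 0 < t <= 1 ->
  t <= cubic t <= 1 /\ 1 - cubic t <= (1 - t) * (1 - t / 2).
Proof.
move=> /andP[t0 t1]; rewrite /cubic.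
have h : 0 <= (1 - t) by lra.
have h2 : 0 <= t * ((1 - t) * (1 + t)).
  by rewrite !mulr_ge0//; lra.
have h3 : 0 <= (1 - t) ^+ 2 * (2 + t) by rewrite mulr_ge0 ?sqr_ge0//; lra.
have h4 : 0 <= (1 - t) * t ^+ 2 by rewrite mulr_ge0 ?sqr_ge0.
by split; [apply/andP; split|]; nra.
Qed.

Lemma cubic_iter t n : 0 < t <= 1 ->
  t <= iter n cubic t <= 1 /\ 1 - iter n cubic t <= (1 - t / 2) ^+ n.
Proof.
move=> /andP[t0 t1]; elim: n => [|n [/andP[IH1 IH2] IH3]] /=.
  by rewrite expr0 lexx t1; split => //; lra.
set s := iter n cubic t in IH1 IH2 IH3 *.
have s0 : 0 < s by exact: lt_le_trans IH1.
have [/andP[h1 h2] h3] := cubic_itv (t := s) ltac:(by rewrite s0 IH2).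
split; first by rewrite (le_trans IH1 h1) h2.
rewrite (le_trans h3)// exprSr ler_pM//; lra.
Qed.

Lemma cubic_iterN t n : iter n cubic (- t) = - iter n cubic t.
Proof. by elim: n => //= n ->; rewrite cubicN. Qed.
Lemma cubic_iter0 n : iter n cubic 0 = 0.
Proof. by elim: n => //= n ->; rewrite /cubic expr0n/=; lra. Qed.

Lemma cubic_cvg t : `|t| <= 1 -> iter n cubic t @[n --> \oo] --> Num.sg t.
Proof.
have pos s : 0 < s <= 1 -> iter n cubic s @[n --> \oo] --> (1 : R).
  move=> /andP[s0 s1].
  have e0 : (1 - s / 2) ^+ n @[n --> \oo] --> (0 : R).
    by apply: cvg_expr; rewrite ger0_norm; lra.
  apply: (@squeeze_cvgr _ _ _ _ (fun n => 1 - (1 - s / 2) ^+ n) (fun=> 1)).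
  - apply: nearW => n.
    have [/andP[_ h1] h2] := cubic_iter n (t := s) ltac:(by rewrite s0 s1).
    by rewrite h1 andbT; lra.
  - by rewrite -[X in _ --> X]subr0; apply: cvgB => //; exact: cvg_cst.
  - exact: cvg_cst.
move=> t1; have [t0|t0|->] := ltgtP t 0.
- rewrite ltr0_sg// -(opprK t); under eq_fun do rewrite cubic_iterN.
  by apply: cvgN; apply: pos; rewrite oppr_gt0 t0 -(ltr0_norm t0).
- by rewrite gtr0_sg//; apply: pos; rewrite t0 -(gtr0_norm t0).
- by rewrite sgr0; under eq_fun do rewrite cubic_iter0; exact: cvg_cst.
Qed.

Lemma cubic_iter_le1 t n : `|t| <= 1 -> `|iter n cubic t| <= 1.
Proof.
move=> t1; have pos s : 0 < s <= 1 -> `|iter n cubic s| <= 1.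
  move=> s01; have [/andP[h1 h2] _] := cubic_iter n s01.
  by rewrite ger0_norm// (le_trans _ h1)//; case/andP: s01 => /ltW.
have [t0|t0|->] := ltgtP t 0.
- rewrite -(opprK t) cubic_iterN normrN; apply: pos.
  by rewrite oppr_gt0 t0 -(ltr0_norm t0).
- by apply: pos; rewrite t0 -(gtr0_norm t0).
- by rewrite cubic_iter0 normr0.
Qed.

Lemma multiplier_sg p : multiplier p -> (forall a, `|p a| <= 1) ->
  multiplier (fun a => Num.sg (p a)).
Proof.
move=> mp p1; apply: (@multiplier_lim (fun n a => iter n cubic (p a)) _ 1).
- elim => [//|n IH] /=.
  rewrite (_ : (fun a => _) = fun a => (3 / 2) * iter n cubic (p a) + 
     (- (1/2)) * (iter n cubic (p a) * (iter n cubic (p a) * iter n cubic (p a)))).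
    apply: multiplierD; apply: multiplierM => //; try exact: multiplier_cst.
    by apply: multiplierM => //; exact: multiplierM.
  by apply/funext => a; rewrite /cubic; field.
- by move=> n a; exact: cubic_iter_le1.
- by move=> a; exact: cubic_cvg.
Qed.

Lemma sg_sin (t : R) : `|t| < pi -> Num.sg (sin t) = Num.sg t.
Proof.
move=> tpi; have [t0|t0|->] := ltgtP t 0; last by rewrite sin0.
- rewrite (ltr0_sg t0) ltr0_sg// -oppr_gt0 -sinN sin_gt0_pi// oppr_gt0 t0.
  by rewrite -(ltr0_norm t0).
- by rewrite (gtr0_sg t0) gtr0_sg// sin_gt0_pi// t0 -(gtr0_norm t0).
Qed.

(** [sin ((xi_i - c) / n)] has the sign of [xi_i - c] once [n] is large. *)
Lemma multiplier_half i c : multiplier (fun a => Num.sg (vec a 0 i - c)).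
Proof.
pose t n : R := n.+1%:R^-1.
apply: (@multiplier_lim (fun n a => Num.sg (sin (dot (t n *: delta_mx 0 i) (vec a) - t n * c))) _ 1).
- move=> n; apply: multiplier_sg; first exact: multiplier_sin.
  by move=> a; exact: sin_max.
- by move=> n a; rewrite normr_sg lern1; case: (_ != _).
- move=> a; apply: cvg_near_cst.
  have h : t n * (vec a 0 i - c) @[n --> \oo] --> (0 : R).
    rewrite -[X in _ --> X](mul0r (vec a 0 i - c)); apply: cvgMl.
    exact: cvg_harmonic.
  move/cvgrPdist_lt : h => /(_ pi (pi_gt0 R)).
  apply: filterS => n; rewrite sub0r normrN => hn.
  by rewrite dotZl dot_delta -mulrBr sg_sin// sgrM gtr0_sg ?mul1r// invr_gt0.
Qed.

(** The sets whose indicator is a multiplier form a sigma-algebra, and the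
    indicator of a half-space is a quadratic polynomial in the sign function. *)
Lemma multiplier_indic A : measurable A -> multiplier (\1_A : G -> R).
Proof.
have half i c : multiplier (\1_[set a | c < vec a 0 i] : G -> R).
  have m := multiplier_half i c.
  rewrite (_ : \1_ _ = fun a => 2^-1 * (Num.sg (vec a 0 i - c) *
     Num.sg (vec a 0 i - c) + Num.sg (vec a 0 i - c))).
    apply: multiplierM; first exact: multiplier_cst.
    by apply: multiplierD => //; exact: multiplierM.
  apply/funext => a; rewrite indicE; have [h|h|h] := ltgtP (vec a 0 i - c) 0.
  - rewrite ltr0_sg// memNset//=; [lra|apply/negP; rewrite -leNgt; lra].
  - rewrite gtr0_sg// mem_set//=; [lra|lra].
  - rewrite h sgr0 memNset//=; [lra|apply/negP; rewrite -leNgt; lra].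
have cC A0 : multiplier (\1_A0 : G -> R) -> multiplier (\1_(~` A0) : G -> R).
  move=> h; rewrite (_ : \1_ _ = fun a => 1 + (-1) * \1_A0 a).
    by apply: multiplierD; [|apply: multiplierM => //]; exact: multiplier_cst.
  by apply/funext => a; rewrite !indicE in_setC; case: (a \in A0) => /=; lra.
have cI A0 B0 : multiplier (\1_A0 : G -> R) -> multiplier (\1_B0 : G -> R) ->
    multiplier (\1_(A0 `&` B0) : G -> R).
  move=> h1 h2; rewrite (_ : \1_ _ = fun a => \1_A0 a * \1_B0 a).
    exact: multiplierM.
  by apply/funext => a; rewrite !indicE in_setI -natrM mulnb.
apply: (@fs_gen _ _ S (fun A => multiplier (\1_A : G -> R))) => //.
move=> B mB.
pose U n := \bigcup_(k in `I_n) B k.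
have mU n : multiplier (\1_(U n) : G -> R).
  elim: n => [|n IH].
    rewrite (_ : U 0%N = set0) ?indic0; first exact: multiplier_cst.
    by rewrite /U II0 bigcup_set0.
  rewrite (_ : U n.+1 = ~` (~` U n `&` ~` B n)).
    by apply: (cC); apply: cI; exact: cC.
  rewrite setCI !setCK /U; apply/seteqP; split => a.
    move=> [k /=]; rewrite ltnS leq_eqVlt => /orP[/eqP ->|kn] Bk; [by right|].
    by left; exists k.
  by move=> [[k /= kn Bk]|Bn]; [exists k => //=; exact: ltnW|exists n => /=].
apply: (@multiplier_lim (fun n => \1_(U n)) _ 1) => //.
  by move=> n a; rewrite indicE normr_nat lern1; case: (_ \in _).
move=> a; apply: cvg_near_cst; have [h|h] := boolP (a \in \bigcup_n B n).
  move: (h); rewrite inE => -[k _ Bk].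
  exists k.+1 => // n /= kn; rewrite !indicE h mem_set//; exists k => //=.
apply: nearW => n; rewrite !indicE (negbTE h) memNset// => -[k _ Bk].
by move/negP : h; apply; rewrite inE; exists k.
Qed.

(** Multiply [h] by the indicator of the set where its real part is positive and
    evaluate the transform at 0: the positive part of [h] has integral 0. The
    four functions [g], [- g], [i g] and [- i g] are treated in this way. *)
Lemma vanishing0 g : vanishing g -> aI g = 0%E.
Proof.
move=> vg.
have pos h : vanishing h -> (\int[mu]_a (Num.max (Re (h a)) 0)%:E = 0)%E.
  move=> vh; have [hi _] := vh; have mh := Cint_meas hi; have [mr _] := mh.
  pose A := [set a | 0 < Re (h a)].
  have mA : measurable A.
    rewrite (_ : A = setT `&` (fun a => Re (h a)) @^-1` `]0, +oo[).
      exact: mr.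
    by rewrite setTI; apply/seteqP; split => a /=; rewrite in_itv/= andbT.
  have [_ _ hA] := multiplier_indic mA.
  have [iA /(_ 0) /(congr1 (@complex.Re R)) /= hA0] := hA h vh.
  have E : (\int[mu]_a (Num.max (Re (h a)) 0)%:E =
     \int[mu]_a (Re (((\1_A a)%:C)%C * h a * fchar 0 a))%:E)%E.
    apply: eq_integral => a _; congr (_%:E).
    rewrite fchar0 mulr1 ReM /= mul0r subr0 indicE.
    have [ha|ha] := ltP 0 (Re (h a)).
      by rewrite mem_set// mul1r.
    by rewrite memNset ?mul0r//= /A/=; apply/negP; rewrite -leNgt.
  have fin : (\int[mu]_a (Re (((\1_A a)%:C)%C * h a * fchar 0 a))%:E)%E \is a fin_num.
    by apply: integrable_fin_num => //; have [] := Cint_fchar 0 iA.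
  by rewrite E -[LHS]fineK//; move: hA0; rewrite /Rintegral => ->.
have mg := Cint_meas vg.1.
have p1 := pos _ vg.
have p2 := pos _ (vanishingZ (-1) vg).
have p3 := pos _ (vanishingZ (0 -i* 1)%C vg).
have p4 := pos _ (vanishingZ (0 +i* 1)%C vg).
have mM z : measurable_fun setT (fun a => (Num.max (Re (z * g a)) 0)%:E).
  apply/measurable_EFinP; apply: measurable_maxr => //.
  by have [] := cmeasM (cmeas_cst _ z) mg.
have m0 (z : R[i]) a : (0 <= (Num.max (Re (z * g a)) 0)%:E)%E.
  by rewrite lee_fin le_max lexx orbT.
have p1' : (\int[mu]_a (Num.max (Re (1 * g a)) 0)%:E = 0)%E.
  by rewrite -[RHS]p1; apply: eq_integral => a _; rewrite mul1r.
apply/eqP; rewrite eq_le aI_ge0 andbT.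
have -> : 0%E = (\int[mu]_a ((Num.max (Re (1 * g a)) 0)%:E +
   (Num.max (Re (-1 * g a)) 0)%:E + ((Num.max (Re ((0 -i* 1)%C * g a)) 0)%:E +
   (Num.max (Re ((0 +i* 1)%C * g a)) 0)%:E)))%E.
  rewrite ge0_integralD//; last 4 first.
  - by move=> a _; exact: adde_ge0.
  - exact: emeasurable_funD.
  - by move=> a _; exact: adde_ge0.
  - exact: emeasurable_funD.
  by rewrite !ge0_integralD// p1' p2 p3 p4 !adde0.
apply: ge0_le_integral => //.
- by move=> a _; rewrite lee_fin cabs_ge0.
- exact: measurable_ecabs.
- by apply: emeasurable_funD; exact: emeasurable_funD.
- move=> a _; rewrite -!EFinD lee_fin (le_trans (cabs_leD _))//.
  have nm (t : R) : `|t| = Num.max t 0 + Num.max (- t) 0.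
    by have [t0|t0] := leP 0 t; [rewrite ger0_norm// max_r ?addr0// oppr_le0|rewrite ltr0_norm// max_l ?add0r// oppr_ge0 ltW].
  rewrite (nm (Re (g a))) (nm (Im (g a))) mul1r mulN1r ReN !ReM/=.
  by rewrite !mul0r mulN1r mul1r sub0r opprK sub0r.
Qed.

End fourier.

(** ** The Wiener algebra *)

Section wiener_def.
Context {R : realType} {d : nat} (S : fsetting R d).
Local Notation G := (fs_G S).
Local Notation mu := (fs_mu S).
Local Notation vec := (@fs_vec _ _ S).
Local Notation V := 'rV[R]_d.
Local Notation cint f := (cintegral mu setT f).
Local Notation Cint f := (cintegrable mu setT f).
Local Notation aI f := (\int[mu]_x (cabs (f x))%:E)%E.
Implicit Types (x y : V) (f : V -> R[i]) (g : G -> R[i]) (w : V -> R).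

Definition finv g : V -> R[i] :=
  fun x => ((fs_cst S)%:C)%C * cint (fun a => g a * fchar x a).
Definition isF f : set (G -> R[i]) :=
  [set g | Cint g /\ forall x, f x = finv g x].
Definition inW f : Prop := exists g, isF f g.
Definition fhat f : G -> R[i] := xget (fun=> 0) (isF f).

Definition weight w := (forall v, 0 <= w v) /\
  measurable_fun setT (fun a : G => w (vec a)).
Definition wint w g : \bar R := (\int[mu]_a (w (vec a) * cabs (g a))%:E)%E.
(** A weighted L^1 norm of the transform: [w = 1] gives the Wiener norm,
    [w = l1norm] and [w = sqnorm] play the role of first and second derivatives.
    *)
Definition Nw w f : \bar R := if `[< inW f >] then wint w (fhat f) else +oo%E.
Local Notation N := (Nw (fun=> 1)).

Lemma weight1 : weight (fun=> 1).
Proof. by split => //; exact: measurable_cst. Qed.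

Lemma wint1 g : wint (fun=> 1) g = aI g.
Proof. by apply: eq_integral => a _; rewrite mul1r. Qed.

Lemma wint_ge0 w g : weight w -> (0 <= wint w g)%E.
Proof.
by move=> [w0 _]; apply: integral_ge0 => a _; rewrite lee_fin mulr_ge0 ?cabs_ge0.
Qed.

Lemma measurable_wint w g : weight w -> cmeas g ->
  measurable_fun setT (fun a => (w (vec a) * cabs (g a))%:E).
Proof.
move=> [_ mw] mg; apply/measurable_EFinP; apply: measurable_funM => //.
exact: measurable_cabs.
Qed.

Lemma le_wint w w' g h : weight w -> weight w' -> cmeas g -> cmeas h ->
  (forall a, w (vec a) * cabs (g a) <= w' (vec a) * cabs (h a)) ->
  (wint w g <= wint w' h)%E.
Proof.
move=> ww ww' mg mh gh; apply: ge0_le_integral => //.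
- by move=> a _; rewrite lee_fin mulr_ge0 ?cabs_ge0//; case: ww.
- exact: measurable_wint.
- exact: measurable_wint.
- by move=> a _; rewrite lee_fin.
Qed.

Lemma wintD w g h : weight w -> cmeas g -> cmeas h ->
  (wint w (fun a => g a + h a)%R <= wint w g + wint w h)%E.
Proof.
move=> ww mg mh; rewrite -ge0_integralD//; last 4 first.
- by move=> a _; rewrite lee_fin mulr_ge0 ?cabs_ge0//; case: ww.
- exact: measurable_wint.
- by move=> a _; rewrite lee_fin mulr_ge0 ?cabs_ge0//; case: ww.
- exact: measurable_wint.
apply: ge0_le_integral => //.
- by move=> a _; rewrite lee_fin mulr_ge0 ?cabs_ge0//; case: ww.
- by apply: measurable_wint => //; exact: cmeasD.
- by apply: emeasurable_funD; exact: measurable_wint.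
- by move=> a _; rewrite -EFinD lee_fin -mulrDr ler_wpM2l ?cabsD//; case: ww.
Qed.

Lemma wintZ w z g : weight w -> cmeas g ->
  (wint w (fun a => z * g a)%R = (cabs z)%:E * wint w g)%E.
Proof.
move=> ww mg; rewrite -ge0_integralZl//; last 3 first.
- exact: measurable_wint.
- by move=> a _; rewrite lee_fin mulr_ge0 ?cabs_ge0//; case: ww.
- by rewrite lee_fin cabs_ge0.
by apply: eq_integral => a _; rewrite -EFinM cabsM; congr (_%:E); ring.
Qed.

Lemma wint_aI0 w g : weight w -> cmeas g -> aI g = 0%E -> wint w g = 0%E.
Proof.
move=> ww mg g0.
have [/Cint_lty h1 _] := aI_eq0 mg g0 (cmeas_real ww.2).
have aE (h : G -> R[i]) : aI h = (\int[mu]_x `|(cabs (h x))%:E|)%E.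
  by apply: eq_integral => x _; rewrite gee0_abs// lee_fin cabs_ge0.
have : ae_eq mu setT (fun a => (cabs (g a))%:E) (cst 0%E).
  by apply/(ae_eq_integral_abs mu measurableT (measurable_ecabs mg)); rewrite -aE.
move=> h.
have -> : wint w g = (\int[mu]_a `|(w (vec a) * cabs (g a))%:E|)%E.
  by apply: eq_integral => x _; rewrite gee0_abs// lee_fin mulr_ge0 ?cabs_ge0//; case: ww.
apply/(ae_eq_integral_abs mu measurableT (measurable_wint ww mg)).
by apply: filterS h => x /(_ I) [fx0] _; rewrite fx0 mulr0.
Qed.

Lemma isF_uniq f g h : isF f g -> isF f h -> aI (fun a => g a - h a) = 0%E.
Proof.
move=> [gi fg] [hi fh]; apply: vanishing0; split; first exact: CintB.
move=> x; under eq_fun do rewrite mulrBl.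
rewrite cintB; do ?exact: Cint_fchar.
have c0 : ((fs_cst S)%:C)%C != 0 :> R[i].
  by rewrite eq_complex/= eqxx andbT gt_eqF//; have /andP[] := fs_cst01 S.
by apply/eqP; rewrite subr_eq0; apply/eqP/(mulfI c0); rewrite -[LHS]fg fh.
Qed.

Lemma isF_fhat f : inW f -> isF f (fhat f).
Proof. by move=> [g fg]; rewrite /fhat; apply: xgetPex; exists g. Qed.

(** Two transforms of the same function agree almost everywhere, so that the
    norm does not depend on the one that [fhat] picks. *)
Lemma wint_uniq w f g h : weight w -> isF f g -> isF f h -> wint w g = wint w h.
Proof.
move=> ww; have le g' h' : isF f g' -> isF f h' -> (wint w g' <= wint w h')%E.
  move=> fg fh; have [[gi _] [hi _]] := (fg, fh).
  have mg := Cint_meas gi; have mh := Cint_meas hi.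
  rewrite (_ : g' = fun a => (g' a - h' a) + h' a); last first.
    by apply/funext => a; rewrite subrK.
  apply: le_trans (wintD ww _ mh) _; first exact: cmeasB.
  by rewrite wint_aI0 ?add0e//; [exact: cmeasB|exact: isF_uniq fg fh].
by move=> fg fh; apply/eqP; rewrite eq_le !le.
Qed.

Lemma NwE w f g : weight w -> isF f g -> Nw w f = wint w g.
Proof.
move=> ww fg; have fW : inW f by exists g.
by rewrite /Nw asboolT//; apply: wint_uniq fg => //; exact: isF_fhat.
Qed.
Lemma Nw_notin w f : ~ inW f -> Nw w f = +oo%E.
Proof. by move=> h; rewrite /Nw asboolF. Qed.

Lemma NE f g : isF f g -> N f = aI g.
Proof. by move=> fg; rewrite (NwE _ fg) ?wint1//; exact: weight1. Qed.

Lemma Nw_ge0 w f : weight w -> (0 <= Nw w f)%E.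
Proof.
by move=> ww; rewrite /Nw; case: ifP => // _; exact: wint_ge0.
Qed.
Lemma N_ge0 f : (0 <= N f)%E. Proof. exact: Nw_ge0 weight1. Qed.
Lemma inW_lty f : inW f -> (N f < +oo)%E.
Proof. by move=> [g fg]; rewrite (NE fg); apply: Cint_lty; case: fg. Qed.
Lemma lty_inW w f : (Nw w f < +oo)%E -> inW f.
Proof. by apply: contraPP => /(Nw_notin w) ->. Qed.
Lemma N_fin f : inW f -> N f \is a fin_num.
Proof. by move=> fW; rewrite ge0_fin_numE ?N_ge0// inW_lty. Qed.

Lemma le_Nw w w' f : weight w -> weight w' -> (forall v, w v <= w' v) ->
  (Nw w f <= Nw w' f)%E.
Proof.
move=> ww ww' h; have [[g fg]|fW] := pselect (inW f); last by rewrite !Nw_notin.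
rewrite !(NwE _ fg)//; have mg := Cint_meas fg.1.
by apply: le_wint => // a; rewrite ler_wpM2r ?cabs_ge0.
Qed.

Lemma le_Nw_N w K f : weight w -> 0 <= K -> (forall v, w v <= K) ->
  (Nw w f <= K%:E * N f)%E \/ ~ inW f.
Proof.
move=> ww K0 h; have [[g fg]|fW] := pselect (inW f); last by right.
left; rewrite (NwE ww fg) (NwE weight1 fg).
have mg := Cint_meas fg.1.
have -> : K%:E = (cabs ((K%:C)%C : R[i]))%:E by rewrite cabs_real ger0_norm.
rewrite -(wintZ _ weight1 mg).
apply: (le_wint ww weight1 mg); first by apply: cmeasM => //; exact: cmeas_cst.
by move=> a; rewrite mul1r cabsM cabs_real ger0_norm// ler_wpM2r ?cabs_ge0.
Qed.

Lemma isFD f f' g g' : isF f g -> isF f' g' ->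
  isF (fun x => f x + f' x) (fun a => g a + g' a).
Proof.
move=> [gi fg] [gi' fg']; split; first exact: CintD.
move=> x; rewrite fg fg' /finv -mulrDr -cintD; do ?exact: Cint_fchar.
by congr (_ * _); apply: eq_cint => a; rewrite mulrDl.
Qed.
Lemma isFZ z f g : isF f g -> isF (fun x => z * f x) (fun a => z * g a).
Proof.
move=> [gi fg]; split; first exact: CintZ.
move=> x; rewrite fg /finv mulrCA; congr (_ * _).
rewrite -cintZ; last exact: Cint_fchar.
by apply: eq_cint => a; rewrite mulrA.
Qed.
Lemma isF0 : isF (fun=> 0) (fun=> 0).
Proof.
split; first exact: Cint0.
by move=> x; rewrite /finv; under eq_cint do rewrite mul0r; rewrite cint0 mulr0.
Qed.
Lemma Nw0 w : weight w -> Nw w (fun=> 0) = 0%E.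
Proof.
move=> ww; rewrite (NwE ww isF0).
by rewrite /wint integral0_eq// => a _; rewrite cabs0 mulr0.
Qed.
Lemma inWD f f' : inW f -> inW f' -> inW (fun x => f x + f' x).
Proof. by move=> [g fg] [g' fg']; exists (fun a => g a + g' a); exact: isFD. Qed.
Lemma inWZ z f : inW f -> inW (fun x => z * f x).
Proof. by move=> [g fg]; exists (fun a => z * g a); exact: isFZ. Qed.
Lemma inWN f : inW f -> inW (fun x => - f x).
Proof. by move=> fW; under eq_fun do rewrite -mulN1r; exact: inWZ. Qed.
Lemma inWB f f' : inW f -> inW f' -> inW (fun x => f x - f' x).
Proof. by move=> fW fW'; apply: inWD => //; exact: inWN. Qed.

Lemma NwD w f f' : weight w -> (Nw w (fun x => f x + f' x)%R <= Nw w f + Nw w f')%E.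
Proof.
move=> ww; have [[g fg]|fW] := pselect (inW f); last first.
  by rewrite (Nw_notin _ fW) addye ?leey// gt_eqF// (lt_le_trans _ (Nw_ge0 _ ww)) ?ltNyr.
have [[g' fg']|fW] := pselect (inW f'); last first.
  by rewrite (Nw_notin _ fW) addey ?leey// gt_eqF// (lt_le_trans _ (Nw_ge0 _ ww)) ?ltNyr.
rewrite (NwE ww fg) (NwE ww fg') (NwE ww (isFD fg fg')).
by apply: wintD => //; [exact: Cint_meas fg.1|exact: Cint_meas fg'.1].
Qed.
Lemma NwZ w z f : weight w -> inW f ->
  (Nw w (fun x => z * f x)%R = (cabs z)%:E * Nw w f)%E.
Proof.
move=> ww [g fg]; rewrite (NwE ww fg) (NwE ww (isFZ z fg)) wintZ//.
exact: Cint_meas fg.1.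
Qed.
Lemma NwN w f : weight w -> Nw w (fun x => - f x) = Nw w f.
Proof.
move=> ww; have h f' : inW f' -> Nw w (fun x => - f' x) = Nw w f'.
  move=> fW; under [in LHS]eq_fun do rewrite -mulN1r.
  by rewrite NwZ// cabsN cabs1 mul1e.
have [fW|fW] := pselect (inW f); first exact: h.
rewrite !Nw_notin// => fW'; apply: fW.
by rewrite (_ : f = fun x => - - f x); [exact: inWN|apply/funext => x; rewrite opprK].
Qed.
Lemma NwB w f f' : weight w -> (Nw w (fun x => f x - f' x)%R <= Nw w f + Nw w f')%E.
Proof. by move=> ww; apply: le_trans (NwD _ _ ww) _; rewrite NwN. Qed.
Lemma Nw_subC w f f' : weight w ->
  Nw w (fun x => f x - f' x) = Nw w (fun x => f' x - f x).
Proof.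
by move=> ww; rewrite -NwN//; congr (Nw _ _); apply/funext => x; rewrite opprB.
Qed.
Lemma Nw_tri w f1 f2 f3 : weight w ->
  (Nw w (fun x => f1 x - f3 x)%R <=
   Nw w (fun x => f1 x - f2 x)%R + Nw w (fun x => f2 x - f3 x)%R)%E.
Proof.
move=> ww; apply: le_trans (NwD _ _ ww).
rewrite le_eqVlt; apply/orP; left; apply/eqP; congr (Nw _ _).
by apply/funext => x; rewrite addrA subrK.
Qed.

Lemma sup_le_N f x : ((cabs (f x))%:E <= N f)%E.
Proof.
have [[g fg]|fW] := pselect (inW f); last by rewrite Nw_notin ?leey.
rewrite (NE fg); case: fg => gi ->; rewrite /finv cabsM EFinM cabs_real.
have /andP[c0 c1] := fs_cst01 S.
rewrite gtr0_norm// (le_trans (y := (1%:E * (cabs (cint (fun a => (g a * fchar x a)%R)))%:E)%E))//.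
  by rewrite lee_wpmul2r// lee_fin cabs_ge0.
rewrite mul1e (le_trans (cint_abs (Cint_fchar _ gi)))//.
rewrite le_eqVlt; apply/orP; left; apply/eqP; apply: eq_integral => a _.
by rewrite cabsM cabs_fchar mulr1.
Qed.

(** ** Fourier multipliers of modulus one and modulations *)

Definition phase_at (r : R) (y : V) (v : V) : R := r * sqnorm v + dot y v.

Lemma phase_atD r s y z v : phase_at (r + s) (y + z) v = phase_at r y v + phase_at s z v.
Proof. by rewrite /phase_at dotDl; ring. Qed.
Lemma phase_at0 v : phase_at 0 0 v = 0.
Proof. by rewrite /phase_at mul0r dot0l addr0. Qed.

Lemma measurable_phase_at r y : measurable_fun setT (fun a : G => phase_at r y (vec a)).
Proof.
apply: measurable_funD; last exact: measurable_dot.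
by apply: measurable_funM => //; exact: measurable_sqnorm.
Qed.

(** The multiplier of symbol [expi (r |xi|^2 + y . xi)]: the free Schrodinger
    flow for [y = 0], the translation by [y] for [r = 0]. Having both in one
    family makes the transport that the flow induces on a modulated function a
    flow again. *)
Definition flow r y f : V -> R[i] :=
  finv (fun a => expi (phase_at r y (vec a)) * fhat f a).

Lemma Cint_flow r y g : Cint g -> Cint (fun a => expi (phase_at r y (vec a)) * g a).
Proof.
move=> gi; under eq_fun do rewrite mulrC.
apply: CintM => //; first by apply: cmeas_expi; exact: measurable_phase_at.
by move=> a; rewrite cabs_expi.
Qed.

Lemma finv_uniq g h x : Cint g -> Cint h -> aI (fun a => g a - h a) = 0%E ->
  finv g x = finv h x.
Proof.
move=> gi hi gh; rewrite /finv; congr (_ * _).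
apply/eqP; rewrite -subr_eq0 -cintB; do ?exact: Cint_fchar.
under eq_cint do rewrite -mulrBl.
have mgh : cmeas (fun a => g a - h a) by apply: cmeasB; [exact: Cint_meas gi|exact: Cint_meas hi].
by have [_ ->] := aI_eq0 mgh gh (@cmeas_fchar R d S x).
Qed.

Lemma isF_flow r y f g : isF f g ->
  isF (flow r y f) (fun a => expi (phase_at r y (vec a)) * g a).
Proof.
move=> fg; have [gi _] := fg; split; first exact: Cint_flow.
have fW : inW f by exists g.
have fh := isF_fhat fW; have [hi _] := fh.
move=> x; apply: finv_uniq; do ?exact: Cint_flow.
have := isF_uniq fh fg; set I1 := (X in X = _ -> _) => I10; rewrite -[RHS]I10.
by apply: eq_integral => a _; rewrite -mulrBr cabsM cabs_expi mul1r.
Qed.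

Lemma inW_flow r y f : inW f -> inW (flow r y f).
Proof.
by move=> [g fg]; exists (fun a => expi (phase_at r y (vec a)) * g a); exact: isF_flow.
Qed.

Lemma Nw_flow w r y f : weight w -> inW f -> Nw w (flow r y f) = Nw w f.
Proof.
move=> ww [g fg]; rewrite (NwE ww fg) (NwE ww (isF_flow r y fg)).
by apply: eq_integral => a _; rewrite cabsM cabs_expi mul1r.
Qed.

Lemma isF_funE f f' g : isF f g -> isF f' g -> f = f'.
Proof. by move=> [_ fg] [_ fg']; apply/funext => x; rewrite fg fg'. Qed.

Lemma flow_flow r s y z f : inW f -> flow r y (flow s z f) = flow (r + s) (y + z) f.
Proof.
move=> [g fg]; apply: (isF_funE (isF_flow r y (isF_flow s z fg))).
rewrite (_ : (fun a => _) = fun a => expi (phase_at (r + s) (y + z) (vec a)) * g a).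
  exact: isF_flow.
by apply/funext => a; rewrite mulrA -expiD phase_atD.
Qed.

Lemma flow0 f : inW f -> flow 0 0 f = f.
Proof.
move=> [g fg]; apply: (isF_funE (isF_flow 0 0 fg)).
rewrite (_ : (fun a => _) = g)//.
by apply/funext => a; rewrite phase_at0 expi0 mul1r.
Qed.

Lemma flowD r y f f' : inW f -> inW f' ->
  flow r y (fun x => f x + f' x) = fun x => flow r y f x + flow r y f' x.
Proof.
move=> [g fg] [g' fg'].
apply: (isF_funE (isF_flow r y (isFD fg fg'))).
rewrite (_ : (fun a => _) = fun a => expi (phase_at r y (vec a)) * g a +
  expi (phase_at r y (vec a)) * g' a).
  by apply: isFD; exact: isF_flow.
by apply/funext => a; rewrite mulrDr.
Qed.
Lemma flowZ r y z f : inW f ->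
  flow r y (fun x => z * f x) = fun x => z * flow r y f x.
Proof.
move=> [g fg]; apply: (isF_funE (isF_flow r y (isFZ z fg))).
rewrite (_ : (fun a => _) = fun a => z * (expi (phase_at r y (vec a)) * g a)).
  by apply: isFZ; exact: isF_flow.
by apply/funext => a; rewrite mulrCA.
Qed.
Lemma flowB r y f f' : inW f -> inW f' ->
  flow r y (fun x => f x - f' x) = fun x => flow r y f x - flow r y f' x.
Proof.
move=> fW fW'; have e : (fun x => f x - f' x) = (fun x => f x + (-1) * f' x).
  by apply/funext => x; rewrite mulN1r.
rewrite e flowD//; last exact: inWZ.
by rewrite flowZ//; apply/funext => x; rewrite mulN1r.
Qed.

Lemma flow_translate y f : inW f -> flow 0 y f = fun x => f (x + y).
Proof.
move=> [g fg]; have [gi fE] := fg; apply/funext => x.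
have [_ ->] := isF_flow 0 y fg.
rewrite fE /finv; congr (_ * _); apply: eq_cint => a.
by rewrite fcharD /phase_at mul0r add0r /fchar; ring.
Qed.

Lemma inW_translate y f : inW f -> inW (fun x => f (x + y)).
Proof. by move=> fW; rewrite -flow_translate//; exact: inW_flow. Qed.
Lemma Nw_translate w y f : weight w -> Nw w (fun x => f (x + y)) = Nw w f.
Proof.
move=> ww; have h (f' : V -> R[i]) y' : inW f' -> Nw w (fun x => f' (x + y')) = Nw w f'.
  by move=> fW; rewrite -flow_translate// Nw_flow.
have [fW|fW] := pselect (inW f); first exact: h.
rewrite !Nw_notin// => fW'; apply: fW.
have := inW_translate (- y) fW'; rewrite (_ : (fun x => _) = f)//.
by apply/funext => x /=; rewrite subrK.
Qed.

Lemma isF_conj f g : isF f g ->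
  isF (fun x => conjc (f x)) (fun a => conjc (g (fs_opp a))).
Proof.
move=> [gi fg].
have [gi' gE] := cint_push (@fs_mN _ _ S) (@fs_muN _ _ S) gi.
have gc : Cint (fun a => conjc (g (fs_opp a))).
  apply: le_Cint (gi') _.
    by apply: cmeas_conj; exact: Cint_meas gi'.
  by move=> a; rewrite cabs_conj.
split => // x; rewrite fg /finv conjcM conjc_real; congr (_ * _).
have [_ <-] := cint_push (@fs_mN _ _ S) (@fs_muN _ _ S) (Cint_fchar x gi).
rewrite -cint_conj; last first.
  by have [] := cint_push (@fs_mN _ _ S) (@fs_muN _ _ S) (Cint_fchar x gi).
apply: eq_cint => a /=; rewrite conjcM; congr (_ * _).
by rewrite /fchar fs_vecN dotNr expiN conjcK.
Qed.

Lemma inW_conj f : inW f -> inW (fun x => conjc (f x)).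
Proof.
by move=> [g fg]; exists (fun a => conjc (g (fs_opp a))); exact: isF_conj.
Qed.

Lemma Nw_conj w f : weight w -> (forall v, w (- v) = w v) ->
  Nw w (fun x => conjc (f x)) = Nw w f.
Proof.
move=> ww wN; have h f' : inW f' -> Nw w (fun x => conjc (f' x)) = Nw w f'.
  move=> [g fg]; rewrite (NwE ww fg) (NwE ww (isF_conj fg)) /wint.
  rewrite -[RHS](ge0_int_push (@fs_mN _ _ S) (@fs_muN _ _ S)); last 2 first.
  - by apply: measurable_wint => //; exact: Cint_meas fg.1.
  - by move=> a; rewrite lee_fin mulr_ge0 ?cabs_ge0//; case: ww.
  by apply: eq_integral => a _; rewrite cabs_conj fs_vecN wN.
have [fW|fW] := pselect (inW f); first exact: h.
rewrite !Nw_notin// => fW'; apply: fW.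
rewrite (_ : f = fun x => conjc (conjc (f x))); first exact: inW_conj.
by apply/funext => x; rewrite conjcK.
Qed.

(** Modulation is translation on the frequency side. Only frequencies of the
    group are allowed, since on the torus the modulated function must remain
    periodic. *)
Lemma isF_modulate (b : G) f g : isF f g ->
  isF (fun x => expi (dot (vec b) x) * f x) (fun a => g (fs_add (fs_opp b) a)).
Proof.
move=> [gi fg].
have m1 : measurable_fun setT (@fs_add _ _ S (fs_opp b)).
  exact: measurableT_comp (@fs_mD _ _ S) (measurable_pair1 _).
have pu := cint_push m1 (@fs_muD _ _ S (fs_opp b)).
have [gi' _] := pu _ gi.
split => // x; rewrite fg /finv mulrCA; congr (_ * _).
have [hi' <-] := pu _ (Cint_fchar x gi).
rewrite -cintZ//; apply: eq_cint => a /=.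
by rewrite fchar_add /fchar fs_vecN dotNr (dotC (vec b)) mulrCA; congr (_ * _);
  rewrite mulrA (mulrC (expi _)) expiK mul1r.
Qed.

Lemma inW_modulate (b : G) f : inW f -> inW (fun x => expi (dot (vec b) x) * f x).
Proof.
move=> [g fg]; exists (fun a => g (fs_add (fs_opp b) a)); exact: isF_modulate.
Qed.

Lemma N_modulate (b : G) f : inW f -> N (fun x => expi (dot (vec b) x) * f x) = N f.
Proof.
move=> [g fg]; rewrite (NE fg) (NE (isF_modulate b fg)).
have m1 : measurable_fun setT (@fs_add _ _ S (fs_opp b)).
  exact: measurableT_comp (@fs_mD _ _ S) (measurable_pair1 _).
rewrite -[RHS](ge0_int_push m1 (@fs_muD _ _ S (fs_opp b)))//.
- by apply: measurable_ecabs; exact: Cint_meas fg.1.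
- by move=> a; rewrite lee_fin cabs_ge0.
Qed.

(** Galilean invariance: after the shift of frequency by [vec b], the cross term
    of [|xi + vec b|^2] is the symbol of a translation by [2 r vec b]. *)
Lemma flow_modulate (b : G) r y f : inW f ->
  flow r y (fun x => expi (dot (vec b) x) * f x) =
  fun x => expi (phase_at r y (vec b)) *
    (expi (dot (vec b) x) * flow r (y + (2 * r) *: vec b) f x).
Proof.
move=> [g fg].
apply: (isF_funE (isF_flow r y (isF_modulate b fg))).
rewrite (_ : (fun a => _) = fun a => expi (phase_at r y (vec b)) *
   (fun a => expi (phase_at r (y + (2 * r) *: vec b) (vec a)) * g a) (fs_add (fs_opp b) a)).
  exact: (isFZ _ (isF_modulate b (isF_flow r _ fg))).
apply/funext => a /=; rewrite mulrA -expiD; congr (expi _ * _).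
rewrite fs_vecD fs_vecN /phase_at /sqnorm !(dotDl, dotDr, dotNl, dotNr, dotZl, dotZr).
by rewrite (dotC (vec a) (vec b)); ring.
Qed.

End wiener_def.

(** ** Integrals of families of functions of the Wiener algebra *)

Section meas_cint.
Context {R : realType} d1 d2 (T1 : measurableType d1) (T2 : measurableType d2).
Variable (m2 : {sigma_finite_measure set T2 -> \bar R}).

Lemma measurable_Rint2 (f : T1 * T2 -> R) : measurable_fun setT f ->
  measurable_fun setT (fun x => Rintegral m2 setT (fun y => f (x, y))).
Proof.
move=> mf; rewrite /Rintegral; apply: (@measurableT_comp _ _ _ _ _ _ (@fine R)).
  exact: fine_measurable.
under eq_fun do rewrite integralE.
have mf' : measurable_fun setT (EFin \o f) by exact/measurable_EFinP.
apply: emeasurable_funB.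
- rewrite (_ : (fun x => _) = (fun x => \int[m2]_y ((EFin \o f)^\+ (x, y)))%E).
    by apply: measurable_int2 => //; exact: measurable_funepos.
  by apply/funext => x; apply: eq_integral => y _; rewrite !funeposE.
- rewrite (_ : (fun x => _) = (fun x => \int[m2]_y ((EFin \o f)^\- (x, y)))%E).
    by apply: measurable_int2 => //; exact: measurable_funeneg.
  by apply/funext => x; apply: eq_integral => y _; rewrite !funenegE.
Qed.

Lemma cmeas_cint2 (F : T1 * T2 -> R[i]) : cmeas F ->
  cmeas (fun x => cintegral m2 setT (fun y => F (x, y))).
Proof.
move=> [h1 h2]; split.
- exact: (measurable_Rint2 (f := fun z => Re (F z))).
- exact: (measurable_Rint2 (f := fun z => Im (F z))).
Qed.

End meas_cint.

Section ae_cint.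
Context {R : realType}.

Lemma ae_cint_eq d (T : measurableType d) (mu : {measure set T -> \bar R})
    (f g : T -> R[i]) : cintegrable mu setT f -> cmeas g ->
  {ae mu, forall x, f x = g x} ->
  cintegrable mu setT g /\ cintegral mu setT f = cintegral mu setT g.
Proof.
move=> fi mg fg; have [mf1 mf2] := Cint_meas fi; have [mg1 mg2] := mg.
have gi : cintegrable mu setT g.
  apply/CintP; split => //.
  have -> : (\int[mu]_x (cabs (g x))%:E = \int[mu]_x (cabs (f x))%:E)%E.
    apply: ae_eq_integral => //.
    - exact: measurable_ecabs.
    - exact: measurable_ecabs (Cint_meas fi).
    - by apply: filterS fg => x ->.
  exact: Cint_lty.
split => //; apply: complexP; rewrite /= /Rintegral; congr fine;
  (apply: ae_eq_integral; [by []|exact/measurable_EFinP|exact/measurable_EFinP|]);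
  by apply: filterS fg => x ->.
Qed.

Context d1 d2 (T1 : measurableType d1) (T2 : measurableType d2).
Variables (m1 : {sigma_finite_measure set T1 -> \bar R})
          (m2 : {sigma_finite_measure set T2 -> \bar R}).
Variable F : T1 * T2 -> R[i].
Hypothesis mF : cmeas F.

Hypothesis iF : (\int[m1]_x \int[m2]_y (cabs (F (x, y)))%:E < +oo)%E.

Lemma ae_Cint_slice : {ae m1, forall x, cintegrable m2 setT (fun y => F (x, y))}.
Proof.
have [mFr mFi] := mF.
have mFa := measurable_cabs mF.
have [i1 _] := fubini_fine mFr mFa (fun z => le_Re_cabs (F z)) iF.
have [i2 _] := fubini_fine mFi mFa (fun z => le_Im_cabs (F z)) iF.
by apply: filterS2 (ae_integrable1 i1) (ae_integrable1 i2) => x h1 h2; split.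
Qed.

(** The inner integral is known to converge for almost every [x] only; elsewhere
    its value is immaterial to the outer integral. *)
Lemma cint_slice_mul (u : T1 -> R[i]) : cmeas u ->
  (forall x, cabs (u x) <= 1) ->
  cintegral m1 setT (fun x => cintegral m2 setT (fun y => F (x, y)) * u x) =
  cintegral m1 setT (fun x => cintegral m2 setT (fun y => F (x, y) * u x)).
Proof.
move=> mu u1; have [i1 _ _] := cfubini mF iF.
have [] // := @ae_cint_eq _ _ m1 
  (fun x => cintegral m2 setT (fun y => F (x, y)) * u x)
  (fun x => cintegral m2 setT (fun y => F (x, y) * u x)).
- exact: CintM.
- have mFu : cmeas (fun z => F z * u z.1).
    by apply: cmeasM => //; exact: cmeas_comp mu measurable_fst.
  exact: (cmeas_cint2 m2 mFu).
- apply: filterS ae_Cint_slice => x hx; rewrite mulrC -cintZ//.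
  by apply: eq_cint => y; rewrite mulrC.
Qed.

End ae_cint.

Section wiener_integral.
Context {R : realType} {d : nat} (S : fsetting R d).
Local Notation G := (fs_G S).
Local Notation mu := (fs_mu S).
Local Notation vec := (@fs_vec _ _ S).
Local Notation V := 'rV[R]_d.
Local Notation Nw := (Nw S).
Local Notation N := (Nw (fun=> 1)).
Local Notation inW := (inW S).

Context dT (T : measurableType dT) (m : {sigma_finite_measure set T -> \bar R}).

(** A family of functions with a jointly measurable choice of transforms, to
    which Fubini's theorem applies. *)
Definition joint (D : set T) (f : T -> V -> R[i]) (g : T * G -> R[i]) :=
  cmeas g /\ forall s, D s -> isF (S := S) (f s) (fun a => g (s, a)).

Lemma joint_Nw_meas D f g w : measurable D -> joint D f g -> weight S w ->
  measurable_fun D (fun s => Nw w (f s)).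
Proof.
move=> mD [mg fg] ww.
apply: (eq_measurable_fun (fun s => \int[mu]_a (w (vec a) * cabs (g (s, a)))%:E)%E).
  by move=> s; rewrite inE => Ds; rewrite (NwE ww (fg _ Ds)).
apply: measurable_funTS.
apply: (measurable_int2 mu (f := fun z : T * G => (w (vec z.2) * cabs (g z))%:E)).
  apply/measurable_EFinP; apply: measurable_funM; last exact: measurable_cabs.
  exact: (measurableT_comp ww.2 measurable_snd).
by move=> z; rewrite lee_fin mulr_ge0 ?cabs_ge0//; case: ww.
Qed.

Section whole.
Variables (f : T -> V -> R[i]) (g : T * G -> R[i]).
Hypothesis fg : joint setT f g.
Hypothesis ifin : (\int[m]_s N (f s) < +oo)%E.

Let mg : cmeas g. Proof. by case: fg. Qed.
Let gfin : (\int[m]_s \int[mu]_a (cabs (g (s, a)))%:E < +oo)%E.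
Proof.
apply: le_lt_trans ifin; rewrite le_eqVlt; apply/orP; left; apply/eqP.
by apply: eq_integral => s _; rewrite (NE (fg.2 s I)).
Qed.

Let Gh (a : G) := cintegral m setT (fun s => g (s, a)).

Let mswap : cmeas (fun z : G * T => g (z.2, z.1)).
Proof. exact: (cmeas_comp mg (@measurable_swap _ _ G T)). Qed.

(** By Fubini the transform of the integral is the integral [Gh] of the
    transforms. The norm bound is then the triangle inequality under the
    integral over [s]. *)
Lemma joint_integral_whole :
  isF (S := S) (fun x => cintegral m setT (fun s => f s x)) Gh /\
  forall w, weight S w ->
    (Nw w (fun x => cintegral m setT (fun s => f s x)) <= \int[m]_s Nw w (f s))%E.
Proof.
have [h1 h2 h3] := cfubini mg gfin.
have FG : isF (S := S) (fun x => cintegral m setT (fun s => f s x)) Gh.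
  split => // x; rewrite /finv.
  have gfin' : (\int[mu]_a \int[m]_s (cabs (g (s, a)))%:E < +oo)%E by rewrite -ctonelli.
  rewrite /Gh (cint_slice_mul mswap gfin' (@cmeas_fchar _ _ S x)); last first.
    by move=> a; rewrite cabs_fchar.
  have mgx : cmeas (fun z : T * G => g z * fchar x z.2).
    by apply: cmeasM => //; exact: (cmeas_comp (@cmeas_fchar _ _ S x) measurable_snd).
  have gx : (\int[m]_s \int[mu]_a (cabs (g (s, a) * fchar x a))%:E < +oo)%E.
    apply: le_lt_trans gfin; rewrite le_eqVlt; apply/orP; left; apply/eqP.
    by apply: eq_integral => s _; apply: eq_integral => a _; rewrite cabsM cabs_fchar mulr1.
  have [k1 k2 k3] := cfubini mgx gx.
  rewrite -[X in _ * X]k3 -cintZ//.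
  by apply: eq_cint => s; have [_ ->] := fg.2 s I.
split => // w ww; rewrite (NwE ww FG).
apply: (@le_trans _ _ (\int[mu]_a \int[m]_s (w (vec a) * cabs (g (s, a)))%:E)%E).
  have mwg : measurable_fun setT (fun z : G * T => (w (vec z.1) * cabs (g (z.2, z.1)))%:E).
    apply/measurable_EFinP; apply: measurable_funM.
      exact: (measurableT_comp ww.2 measurable_fst).
    exact: (measurable_cabs mswap).
  have mwg1 : measurable_fun setT (fun a : G => \int[m]_s (w (vec a) * cabs (g (s, a)))%:E)%E.
    apply: (measurable_int2 m mwg).
    by move=> z; rewrite lee_fin mulr_ge0 ?cabs_ge0//; case: ww.
  apply: ae_ge0_le_integral => //.
  - by move=> a _; rewrite lee_fin mulr_ge0 ?cabs_ge0//; case: ww.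
  - by apply: measurable_wint => //; exact: Cint_meas h2.
  - by move=> a _; apply: integral_ge0 => s _; rewrite lee_fin mulr_ge0 ?cabs_ge0//; case: ww.
  have gfin' : (\int[mu]_a \int[m]_s (cabs (g (s, a)))%:E < +oo)%E by rewrite -ctonelli.
  apply: filterS (ae_Cint_slice mswap gfin') => a ha _.
  under [leRHS]eq_integral do rewrite EFinM.
  rewrite ge0_integralZl//; last 3 first.
  - exact: measurable_ecabs (Cint_meas ha).
  - by move=> s _; rewrite lee_fin cabs_ge0.
  - by rewrite lee_fin; case: ww.
  rewrite EFinM lee_wpmul2l//; first by rewrite lee_fin; case: ww.
  exact: cint_abs.
rewrite le_eqVlt; apply/orP; left; apply/eqP.
pose wg (z : T * G) := (w (vec z.2) * cabs (g z))%:E.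
have mwg : measurable_fun setT wg.
  apply/measurable_EFinP; apply: measurable_funM; last exact: measurable_cabs.
  exact: (measurableT_comp ww.2 measurable_snd).
have wg0 z : (0 <= wg z)%E by rewrite lee_fin mulr_ge0 ?cabs_ge0//; case: ww.
rewrite -[LHS](@fubini_tonelli _ _ _ _ _ m mu _ mwg wg0).
by apply: eq_integral => s _; rewrite (NwE ww (fg.2 s I)).
Qed.

Lemma joint_flow_whole r y :
  flow S r y (fun x => cintegral m setT (fun s => f s x)) =
  fun x => cintegral m setT (fun s => flow S r y (f s) x).
Proof.
have [FG _] := joint_integral_whole.
have [_ H] := isF_flow r y FG; apply/funext => x; rewrite H /finv /Gh.
have gfin' : (\int[mu]_a \int[m]_s (cabs (g (s, a)))%:E < +oo)%E by rewrite -ctonelli.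
pose u a := expi (phase_at r y (vec a)) * fchar x a.
have mu_ : cmeas u.
  apply: cmeasM; last exact: cmeas_fchar.
  by apply: cmeas_expi; exact: measurable_phase_at.
have u1 a : cabs (u a) <= 1 by rewrite cabsM cabs_fchar cabs_expi mulr1.
rewrite (_ : (fun a => _) = fun a => cintegral m setT (fun s => g (s, a)) * u a); last first.
  by apply/funext => a; rewrite /u; ring.
rewrite (cint_slice_mul mswap gfin' mu_ u1).
have mgx : cmeas (fun z : T * G => g z * u z.2).
  by apply: cmeasM => //; exact: (cmeas_comp mu_ measurable_snd).
have gx : (\int[m]_s \int[mu]_a (cabs (g (s, a) * u a))%:E < +oo)%E.
  apply: le_lt_trans gfin; rewrite le_eqVlt; apply/orP; left; apply/eqP.
  apply: eq_integral => s _; apply: eq_integral => a _.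
  by rewrite !cabsM cabs_fchar cabs_expi mulr1 mulr1.
have [k1 k2 k3] := cfubini mgx gx.
rewrite -[X in _ * X]k3 -(cintZ _ k1); congr (cintegral _ _ _).
apply/funext => s.
have [_ ->] := isF_flow r y (fg.2 s I); congr (_ * _).
by apply: eq_cint => a; rewrite /u; ring.
Qed.

End whole.

Lemma cint_mkcond (D : set T) (f : T -> R[i]) :
  cintegral m D f = cintegral m setT (fun s => if s \in D then f s else 0).
Proof.
apply: complexP => /=; rewrite Rintegral_mkcond;
  by apply: eq_Rintegral => s _; rewrite /patch; case: ifP.
Qed.

Section onset.
Variables (D : set T) (f : T -> V -> R[i]) (g : T * G -> R[i]).
Hypothesis mD : measurable D.
Hypothesis fg : joint D f g.
Hypothesis ifin : (\int[m]_(s in D) N (f s) < +oo)%E.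

Let f' s : V -> R[i] := if s \in D then f s else (fun=> 0).
Let g' (z : T * G) : R[i] := if z.1 \in D then g z else 0.

Let fg' : joint setT f' g'.
Proof.
have [mg h] := fg; split; last first.
  move=> s _; rewrite /f' /g' /=; case: ifPn => [|_]; last exact: isF0.
  by rewrite inE => /h.
rewrite (_ : g' = fun z => ((\1_D z.1)%:C)%C * g z).
  apply: cmeasM => //; apply: cmeas_real.
  exact: (measurableT_comp (measurable_indic mD) measurable_fst).
by apply/funext => z; rewrite /g' indicE; case: ifP => _; rewrite ?mul1r ?mul0r.
Qed.

Let Nf' w : weight S w -> (\int[m]_s Nw w (f' s) = \int[m]_(s in D) Nw w (f s))%E.
Proof.
move=> ww; rewrite [RHS]integral_mkcond; apply: eq_integral => s _.
by rewrite /f' /patch; case: ifP => // _; rewrite Nw0.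
Qed.

Let ifin' : (\int[m]_s N (f' s) < +oo)%E.
Proof. by rewrite Nf'//; exact: weight1. Qed.

Let fE : (fun x => cintegral m setT (fun s => f' s x)) = (fun x => cintegral m D (fun s => f s x)).
Proof.
apply/funext => x; rewrite [RHS]cint_mkcond; apply: eq_cint => s.
by rewrite /f'; case: ifP.
Qed.

Lemma joint_inW : inW (fun x => cintegral m D (fun s => f s x)).
Proof. by have [h _] := joint_integral_whole fg' ifin'; rewrite -fE; eexists; exact: h. Qed.

Lemma joint_Nw w : weight S w ->
  (Nw w (fun x => cintegral m D (fun s => f s x)) <= \int[m]_(s in D) Nw w (f s))%E.
Proof.
by move=> ww; have [_ h] := joint_integral_whole fg' ifin'; rewrite -fE -Nf'//; exact: h.
Qed.

Lemma joint_flow r y :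
  flow S r y (fun x => cintegral m D (fun s => f s x)) =
  fun x => cintegral m D (fun s => flow S r y (f s) x).
Proof.
rewrite -fE (joint_flow_whole fg' ifin'); apply/funext => x.
rewrite [RHS]cint_mkcond; apply: eq_cint => s; rewrite /f'; case: ifP => // _.
by have [_ ->] := isF_flow r y (isF0 S); rewrite /finv (eq_cint _ (g := fun=> 0)) ?cint0 ?mulr0// => a; rewrite mulr0 mul0r.
Qed.

End onset.
End wiener_integral.

Section disc_prod.
Context {R : realType} (I : countType) (i0 : I) d (T : measurableType d).

Lemma measurable_disc_prod d' (T' : measurableType d') (F : I -> T -> T') :
  (forall i, measurable_fun setT (F i)) ->
  measurable_fun setT (fun z : disc i0 * T => F z.1 z.2).
Proof.
move=> mF _ Y mY; rewrite setTI.
pose B n : set (disc i0 * T) := if @unpickle I n is Some i then [set i] `*` (F i @^-1` Y) else set0.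
rewrite (_ : _ @^-1` _ = \bigcup_n B n).
  apply: bigcupT_measurable => n; rewrite /B; case: unpickle => // i.
  by apply: measurableX => //; rewrite -[X in measurable X]setTI; exact: mF.
apply/seteqP; split => -[i t] /=.
  by move=> Yt; exists (pickle i) => //; rewrite /B pickleK.
by move=> [n _]; rewrite /B; case: unpickle => // j [/= -> ].
Qed.

Lemma cmeas_disc_prod (F : I -> T -> R[i]) : (forall i, cmeas (F i)) ->
  cmeas (fun z : disc i0 * T => F z.1 z.2).
Proof.
move=> mF; split.
- by apply: (measurable_disc_prod (F := fun i t => Re (F i t))) => i; case: (mF i).
- by apply: (measurable_disc_prod (F := fun i t => Im (F i t))) => i; case: (mF i).
Qed.

Lemma cmeas_prod_disc (F : I -> T -> R[i]) : (forall i, cmeas (F i)) ->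
  cmeas (fun z : T * disc i0 => F z.2 z.1).
Proof.
by move=> /cmeas_disc_prod mF; exact: (cmeas_comp mF (@measurable_swap _ _ T (disc i0))).
Qed.

End disc_prod.

Section ccvg.
Context {R : realType}.

Lemma cvgn_lb (u : nat -> R) (l K : R) :
  u @ \oo --> l -> (forall n, K <= u n) -> K <= l.
Proof.
move=> ul uK; rewrite -(cvg_lim (@Rhausdorff R) ul); apply: limr_ge.
  by apply/cvg_ex; exists l.
by apply: nearW => n.
Qed.

Definition ccvg (u : nat -> R[i]) (l : R[i]) := cabs (u n - l) @[n --> \oo] --> (0 : R).

Lemma ccvg_uniq (u : nat -> R[i]) l l' : ccvg u l -> ccvg u l' -> l = l'.
Proof.
move=> ul ul'; apply/eqP; rewrite -subr_eq0; apply/eqP/cabs_eq0/eqP.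
rewrite eq_le cabs_ge0 andbT.
have h : (cabs (u n - l) + cabs (u n - l')) @[n --> \oo] --> (0 + 0 : R) by exact: cvgD.
rewrite -[leRHS]addr0; apply: cvgn_lb h _ => n.
rewrite (_ : l - l' = (u n - l') - (u n - l)); last by ring.
by rewrite [leRHS]addrC; exact: cabsB.
Qed.

(** Turns a sequence into a series, so that limits in the algebra are sums for
    the counting measure. *)
Definition increments (u : nat -> R[i]) (k : nat) : R[i] :=
  if k is k'.+1 then u k - u k' else u 0%N.

Lemma ccvg_increments (u : nat -> R[i]) : cintegrable (@countm R nat 0%N) setT (increments u) ->
  ccvg u (cintegral (@countm R nat 0%N) setT (increments u)).
Proof.
move=> vi; set cm := countm _; set v := increments u.
pose vn n k := if (k <= n)%N then v k else 0.
have vni n : cintegrable cm setT (vn n).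
  apply: le_Cint (vi) _; first exact: cmeas_disc.
  by move=> k; rewrite /vn; case: ifP => // _; rewrite cabs0 cabs_ge0.
have vnE n : cintegral cm setT (vn n) = u n.
  have vnC : vn n = crestrict (i0 := 0%N) `I_n.+1 v.
    apply/funext => k; rewrite /vn /crestrict.
    by congr (if _ then _ else _); apply/idP/idP; rewrite inE /= ltnS.
  rewrite vnC -csumE; last by apply/(csummableP 0%N); rewrite -vnC.
  have E : \sum_(k < n.+1) v k = u n.
    clear vnC; elim: n => [|n IH]; first by rewrite big_ord_recl big_ord0 addr0.
    by rewrite big_ord_recr /= IH addrC subrK.
  by rewrite (csum_fin 0%N)// -fsbig_ord; exact: E.
have h : (\int[cm]_k (cabs (v k - vn n k)%R)%:E @[n --> \oo] --> 0)%E.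
  apply: (dominated_abs0 (g := v)) => //.
  - move=> k; apply: cvg_near_cst; exists k => // n /= kn.
    by rewrite /vn kn subrr cabs0.
  - move=> n k; rewrite /vn; case: ifP => _; rewrite ?subr0// subrr cabs0 cabs_ge0//.
apply/cvgrPdist_lt => e e0.
have /fine_cvgP[_ /cvgrPdist_lt/(_ e e0)] := h.
apply: filterS => n; rewrite !sub0r !normrN => hn.
rewrite ger0_norm ?cabs_ge0//; apply: le_lt_trans hn.
rewrite -(vnE n) cabs_subC -cintB//.
have vi' : cintegrable cm setT (fun k => v k - vn n k) by exact: CintB.
rewrite ger0_norm; last by rewrite fine_ge0// aI_ge0.
by rewrite -lee_fin fineK ?aI_fin// cint_abs.
Qed.

End ccvg.

Section geometric_sum.
Context {R : realType}.

Lemma esum_nat_geometric (a : nat -> \bar R) (C : R) :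
  (forall k, 0 <= a k)%E -> 0 <= C ->
  (forall k, a k <= (C * 2^-1 ^+ k)%:E)%E ->
  (\int[@countm R nat 0%N]_k a k <= (2 * C)%:E)%E.
Proof.
move=> a0 C0 aC; rewrite int_countE// -nneseries_esumT//.
apply: lime_le; first by apply: is_cvg_nneseries => *; exact: a0.
apply: nearW => n.
apply: (@le_trans _ _ (\sum_(0 <= k < n) (C * 2^-1 ^+ k)%:E)%E).
  by apply: lee_sum => k _; exact: aC.
rewrite sumEFin lee_fin.
have -> : \sum_(0 <= k < n) C * 2^-1 ^+ k = 2 * C - 2 * C * 2^-1 ^+ n :> R.
  elim: n => [|n IH]; first by rewrite big_nil expr0; lra.
  by rewrite big_nat_recr//= IH exprS; lra.
by rewrite gerBl !mulr_ge0// exprn_ge0.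
Qed.

End geometric_sum.

Section wiener_complete.
Context {R : realType} {d : nat} (S : fsetting R d).
Local Notation V := 'rV[R]_d.
Local Notation Nw := (Nw S).
Local Notation N := (Nw (fun=> 1)).
Local Notation inW := (inW S).
Local Notation fhat := (@fhat R d S).

(** ** Sums of families in the algebra *)

Section sum.
Variables (I : countType) (i0 : I) (A : set I) (f : I -> V -> R[i]).
Hypothesis fW : forall i, A i -> inW (f i).
Hypothesis fs : (\esum_(i in A) N (f i) < +oo)%E.

Lemma csummable_inW x : csummable A (fun i => f i x).
Proof.
apply: (csummable_le _ fs) => i Ai; exact: sup_le_N.
Qed.

Let jfg : joint (S := S) (T := disc i0) A f (fun z => fhat (f z.1) z.2 * (if z.1 \in A then 1 else 0)).
Proof.
split; last first.
  move=> i Ai; rewrite /= mem_set//.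
  under eq_fun do rewrite mulr1.
  by apply: isF_fhat; exact: fW.
apply: (@cmeas_disc_prod _ _ i0 _ _ (fun i a => fhat (f i) a * (if i \in A then 1 else 0))) => i.
case: ifPn => [|_].
  rewrite inE => /fW/isF_fhat[/Cint_meas mf _].
  by under eq_fun do rewrite mulr1.
by under eq_fun do rewrite mulr0; exact: cmeas_cst.
Qed.

Let fE : (fun x => csum A (fun i => f i x)) =
  (fun x => cintegral (@countm R I i0) (A : set (disc i0)) (fun i => f i x)).
Proof.
apply/funext => x; rewrite (csumE i0); last exact: csummable_inW.
exact/esym/(@cint_mkcond _ _ _ (countm i0) A (fun i => f i x)).
Qed.

Let fs' : (\int[@countm R I i0]_(i in (A : set (disc i0))) N (f i) < +oo)%E.
Proof.
by rewrite integral_mkcond -esum_int_count// => i; exact: N_ge0.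
Qed.

(** A family indexed by [I] is a measurable family over the counting measure:
    this is an instance of the integral. *)
Lemma inW_csum : inW (fun x => csum A (fun i => f i x)).
Proof. by rewrite fE; exact: (joint_inW _ jfg fs'). Qed.

Lemma Nw_csum w : weight S w ->
  (Nw w (fun x => csum A (fun i => f i x)) <= \esum_(i in A) Nw w (f i))%E.
Proof.
move=> ww; rewrite fE; apply: le_trans (joint_Nw _ jfg fs' ww) _ => //.
by rewrite integral_mkcond -esum_int_count// => i; exact: Nw_ge0.
Qed.

Lemma flow_csum r y : flow S r y (fun x => csum A (fun i => f i x)) =
  fun x => csum A (fun i => flow S r y (f i) x).
Proof.
rewrite fE (joint_flow _ jfg fs')//; apply/funext => x.
rewrite (csumE i0); first exact: (@cint_mkcond _ _ _ (countm i0) A (fun i => flow S r y (f i) x)).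
apply: (csummable_le _ fs) => i Ai; rewrite -(Nw_flow r y (weight1 S) (fW Ai)).
exact: sup_le_N.
Qed.

End sum.

(** ** Completeness *)

(** The limit is the sum of the increments; applied to the sequence shifted by
    [k], the same bound gives the rate of convergence. *)
Lemma inW_limit (u : nat -> V -> R[i]) (C : R) : 0 <= C ->
  (forall k, inW (u k)) ->
  (forall k, N (fun x => u k.+1 x - u k x)%R <= (C * 2^-1 ^+ k)%:E)%E ->
  exists l, [/\ inW l, forall x, ccvg (fun k => u k x) (l x) &
    forall k, (N (fun x => l x - u k x)%R <= (4 * C * 2^-1 ^+ k)%:E)%E].
Proof.
move=> C0 uW uC.
have gen (v : nat -> V -> R[i]) (K : R) : 0 <= K -> (forall k, inW (v k)) ->
    (forall k, N (fun x => increments (fun j => v j x) k) <= (K * 2^-1 ^+ k)%:E)%E ->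
    exists l, [/\ inW l, forall x, ccvg (fun k => v k x) (l x) & (N l <= (2 * K)%:E)%E].
  move=> K0 vW vK.
  pose f (k : nat) x := increments (fun j => v j x) k.
  have fW k : [set: nat] k -> inW (f k).
    by move=> _; case: k => [|k]; rewrite /f/=; [exact: vW|exact: inWB].
  have fs : (\esum_(k in [set: nat]) N (f k) <= (2 * K)%:E)%E.
    rewrite -(int_countE 0%N); last by move=> k; exact: N_ge0.
    by apply: esum_nat_geometric => // k; exact: N_ge0.
  have fs' := le_lt_trans fs (ltry _).
  exists (fun x => csum setT (fun k => f k x)); split.
  - exact: (inW_csum 0%N).
  - move=> x; have sx := csummable_inW fs' x.
    rewrite (csumE 0%N)// (_ : crestrict _ _ = increments (fun k => v k x)).
      apply: ccvg_increments; move/(csummableP 0%N): sx.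
      by rewrite (_ : crestrict _ _ = increments (fun k => v k x))//; apply/funext => k; rewrite /crestrict in_setT.
    by apply/funext => k; rewrite /crestrict in_setT.
  - by apply: le_trans fs; apply: (Nw_csum 0%N) => //; exact: weight1.
have Nu0 : (N (u 0%N) <= (fine (N (u 0%N)))%:E)%E by rewrite fineK// N_fin.
have f0 : 0 <= fine (N (u 0%N)) by rewrite fine_ge0// N_ge0.
have [||l [lW ul _]] := gen u (fine (N (u 0%N)) + 2 * C) _ uW.
- by rewrite addr_ge0// mulr_ge0.
- case=> [|k] /=; first by rewrite expr0 mulr1 (le_trans Nu0)// lee_fin lerDl mulr_ge0.
  apply: le_trans (uC k) _; rewrite lee_fin exprS.
  have h : 0 <= 2^-1 ^+ k :> R by rewrite exprn_ge0.
  nra.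
exists l; split => // n.
have [|||l' [l'W ul' Nl']] := gen (fun k x => u (n + k)%N x - u n x) (2 * C * 2^-1 ^+ n).
- by rewrite !mulr_ge0// exprn_ge0.
- by move=> k; exact: inWB.
- case=> [|k] /=.
    rewrite (_ : (fun x => u (n + 0)%N x - u n x) = fun=> 0); last by apply/funext => x; rewrite addn0 subrr.
    by rewrite Nw0 ?lee_fin ?mulr_ge0 ?exprn_ge0//; exact: weight1.
  rewrite (_ : (fun x => u (n + k.+1)%N x - u n x - (u (n + k)%N x - u n x)) =
    fun x => u (n + k).+1 x - u (n + k)%N x); last first.
    by apply/funext => x; rewrite addnS; ring.
  apply: le_trans (uC _) _; rewrite lee_fin exprD exprS.
  by rewrite le_eqVlt; apply/orP; left; apply/eqP; field.
rewrite (_ : (fun x => l x - u n x) = l').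
  by apply: le_trans Nl' _; rewrite lee_fin !mulrA; rewrite (_ : 2 * 2 = 4 :> R)//; ring.
apply/funext => x; apply: ccvg_uniq (ul' x).
have := ul x; rewrite /ccvg => /(cvg_comp _ _ (cvg_addnl n)) h.
apply: cvg_trans h; apply: near_eq_cvg; apply: nearW => k /=.
by congr cabs; rewrite addnC; ring.
Qed.

End wiener_complete.

Section wiener_product.
Context {R : realType} {d : nat} (S : fsetting R d).
Local Notation G := (fs_G S).
Local Notation mu := (fs_mu S).
Local Notation vec := (@fs_vec _ _ S).
Local Notation V := 'rV[R]_d.
Local Notation Nw := (Nw S).
Local Notation N := (Nw (fun=> 1)).
Local Notation inW := (inW S).
Local Notation aI f := (\int[mu]_x (cabs (f x))%:E)%E.

(** ** Products *)

Section product.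
Variables (f f' : V -> R[i]) (g g' : G -> R[i]).
Hypotheses (fg : isF f g) (fg' : isF f' g').

Let sub (b a : G) := fs_add (fs_opp b) a.
Let F (z : G * G) := g z.1 * g' (sub z.1 z.2).

Let msub : measurable_fun setT (fun z : G * G => sub z.1 z.2).
Proof.
have m : measurable_fun setT (fun z : G * G => (fs_opp z.1, z.2)).
  apply: measurable_fun_pair; last exact: measurable_snd.
  exact: (measurableT_comp (@fs_mN _ _ S) measurable_fst).
exact: (measurableT_comp (@fs_mD _ _ S) m).
Qed.

Let msub1 b : measurable_fun setT (sub b).
Proof. exact: measurableT_comp msub (measurable_pair1 b). Qed.

Let mF : cmeas F.
Proof.
apply: cmeasM; first exact: (cmeas_comp (Cint_meas fg.1) measurable_fst).
exact: (cmeas_comp (Cint_meas fg'.1) msub).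
Qed.

Let invariant (h : G -> \bar R) b : measurable_fun setT h -> (forall a, 0 <= h a)%E ->
  (\int[mu]_a h (sub b a) = \int[mu]_a h a)%E.
Proof. by move=> mh h0; exact: (ge0_int_push (msub1 b) (@fs_muD _ _ S (fs_opp b)) mh h0). Qed.

Let iFb : (\int[mu]_b \int[mu]_a (cabs (F (b, a)))%:E = aI g * aI g')%E.
Proof.
under eq_integral => b _.
  under eq_integral do rewrite /F /= cabsM EFinM.
  rewrite ge0_integralZl//; last 3 first.
  - exact: (measurable_ecabs (cmeas_comp (Cint_meas fg'.1) (msub1 b))).
  - by move=> a _; rewrite lee_fin cabs_ge0.
  - by rewrite lee_fin cabs_ge0.
  rewrite (invariant b (h := fun a => (cabs (g' a))%:E)); last 2 first.
  - exact: measurable_ecabs (Cint_meas fg'.1).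
  - by move=> a; rewrite lee_fin cabs_ge0.
  over.
rewrite ge0_integralZr//.
- exact: measurable_ecabs (Cint_meas fg.1).
- by move=> b _; rewrite lee_fin cabs_ge0.
- exact: aI_ge0.
Qed.

Let iF : (\int[mu]_b \int[mu]_a (cabs (F (b, a)))%:E < +oo)%E.
Proof.
rewrite iFb; have fin1 := aI_fin fg.1; have fin2 := aI_fin fg'.1.
by rewrite ltey_eq fin_numM.
Qed.

Let mFs : cmeas (fun z : G * G => F (z.2, z.1)).
Proof. exact: (cmeas_comp mF (@measurable_swap _ _ G G)). Qed.
Let iFs : (\int[mu]_a \int[mu]_b (cabs (F (b, a)))%:E < +oo)%E.
Proof. by rewrite -(ctonelli mu mu mF). Qed.

Definition convolution (a : G) : R[i] :=
  ((fs_cst S)%:C)%C * cintegral mu setT (fun b => g b * g' (fs_add (fs_opp b) a)).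

(** The convolution theorem, by Fubini and the invariance of the measure. *)
Lemma isF_mul : isF (fun x => f x * f' x) convolution.
Proof.
have [_ h2 _] := cfubini mF iF.
split; first exact: CintZ.
move=> x; rewrite fg.2 fg'.2 /finv -mulrA; congr (_ * _).
under [RHS]eq_cint do rewrite /convolution -mulrA.
rewrite cintZ; last exact: Cint_fchar.
rewrite mulrCA; congr (_ * _).
rewrite (cint_slice_mul mFs iFs (@cmeas_fchar _ _ S x)); last first.
  by move=> a; rewrite cabs_fchar.
have mgx : cmeas (fun z : G * G => F z * fchar x z.2).
  by apply: cmeasM => //; exact: (cmeas_comp (@cmeas_fchar _ _ S x) measurable_snd).
have gx : (\int[mu]_b \int[mu]_a (cabs (F (b, a) * fchar x a))%:E < +oo)%E.
  apply: le_lt_trans iF; rewrite le_eqVlt; apply/orP; left; apply/eqP.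
  by apply: eq_integral => s _; apply: eq_integral => a _; rewrite cabsM cabs_fchar mulr1.
have [_ _ <-] := cfubini mgx gx.
have hE b : cintegral mu setT (fun a => F (b, a) * fchar x a) =
    g b * fchar x b * cintegral mu setT (fun a => g' a * fchar x a).
  have [hi' <-] := cint_push (msub1 b) (@fs_muD _ _ S (fs_opp b)) (Cint_fchar x fg'.1).
  rewrite -cintZ//; apply: eq_cint => a; rewrite /F /=.
  have -> : fchar x a = fchar x b * fchar x (sub b a).
    by rewrite -fchar_add /fchar !fs_vecD fs_vecN addrA subrr add0r.
  ring.
under [RHS]eq_cint do rewrite hE mulrC.
rewrite cintZ; last exact: (Cint_fchar x fg.1).
by rewrite mulrC.
Qed.

(** A weight that is subadditive up to the factor [c] can be moved onto one of
    the two factors, as in the Leibniz rule. *)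
Lemma wint_convolution w c : weight S w -> 0 <= c ->
  (forall u v, w (u + v) <= c * (w u + w v)) ->
  (wint w convolution <= c%:E * (wint w g * aI g' + aI g * wint w g'))%E.
Proof.
move=> ww c0 wD.
have [mg mg'] := (Cint_meas fg.1, Cint_meas fg'.1).
have [_ h2 _] := cfubini mF iF.
pose H (z : G * G) := (w (vec z.2) * cabs (F z))%:E.
have mH : measurable_fun setT H.
  apply/measurable_EFinP; apply: measurable_funM; last exact: measurable_cabs.
  exact: (measurableT_comp ww.2 measurable_snd).
have H0 z : (0 <= H z)%E by rewrite lee_fin mulr_ge0 ?cabs_ge0//; case: ww.
have mHs : measurable_fun setT (fun z : G * G => H (z.2, z.1)).
  exact: (measurableT_comp mH (@measurable_swap _ _ G G)).
apply: (@le_trans _ _ (\int[mu]_a \int[mu]_b H (b, a))%E).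
  apply: ae_ge0_le_integral => //.
  - by move=> a _; rewrite lee_fin mulr_ge0 ?cabs_ge0//; case: ww.
  - by apply: measurable_wint => //; apply: cmeasM; [exact: cmeas_cst|exact: Cint_meas h2].
  - by move=> a _; exact: integral_ge0.
  - by apply: (measurable_int2 mu mHs) => z.
  apply: filterS (ae_Cint_slice mFs iFs) => a ha _.
  rewrite /H; under [leRHS]eq_integral do rewrite /= EFinM.
  rewrite ge0_integralZl//; last 3 first.
  - exact: measurable_ecabs (Cint_meas ha).
  - by move=> s _; rewrite lee_fin cabs_ge0.
  - by rewrite lee_fin; case: ww.
  rewrite EFinM lee_wpmul2l//; first by rewrite lee_fin; case: ww.
  apply: le_trans (cint_abs ha); rewrite lee_fin /convolution cabsM cabs_real.
  have /andP[k0 k1] := fs_cst01 S.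
  by rewrite gtr0_norm// ler_piMl ?cabs_ge0.
rewrite -(@fubini_tonelli _ _ _ _ _ mu mu _ mH H0).
have b0 b : (0 <= c * cabs (g b))%R by rewrite mulr_ge0 ?cabs_ge0.
have w0 v : 0 <= w v by case: ww.
apply: (@le_trans _ _ (\int[mu]_b ((c * cabs (g b))%:E * ((w (vec b))%:E * aI g' + wint w g')))%E).
  apply: ge0_le_integral => //.
  - by move=> b _; exact: integral_ge0.
  - exact: measurable_int2.
  - apply: emeasurable_funM; first by apply/measurable_EFinP; apply: measurable_funM => //; exact: measurable_cabs.
    apply: emeasurable_funD => //; apply: emeasurable_funM => //.
    by apply/measurable_EFinP; case: ww.
  move=> b _.
  apply: (@le_trans _ _ (\int[mu]_a ((c * cabs (g b))%:E * ((w (vec b))%:E * (cabs (g' (sub b a)))%:E + (w (vec (sub b a)) * cabs (g' (sub b a)))%:E))))%E.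
    apply: ge0_le_integral => //.
    - exact: (measurableT_comp mH (measurable_pair1 b)).
    - apply: measurable_funeM; apply: emeasurable_funD.
        apply: measurable_funeM; exact: (measurable_ecabs (cmeas_comp mg' (msub1 b))).
      exact: (measurableT_comp (measurable_wint ww mg') (msub1 b)).
    - move=> a _; rewrite /H /F /= cabsM.
      rewrite -[leRHS]/((c * cabs (g b) * (w (vec b) * cabs (g' (sub b a)) + w (vec (sub b a)) * cabs (g' (sub b a))))%:E) lee_fin.
      have h : w (vec a) <= c * (w (vec b) + w (vec (sub b a))).
        have -> : vec a = vec b + vec (sub b a) by rewrite fs_vecD fs_vecN addrA subrr add0r.
        exact: wD.
      have p : 0 <= cabs (g b) * cabs (g' (sub b a)) by rewrite mulr_ge0 ?cabs_ge0.
      apply: le_trans (ler_wpM2r p h) _.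
      by rewrite le_eqVlt; apply/orP; left; apply/eqP; ring.
  rewrite ge0_integralZl//; last 3 first.
  - apply: emeasurable_funD.
      apply: measurable_funeM; exact: (measurable_ecabs (cmeas_comp mg' (msub1 b))).
    exact: (measurableT_comp (measurable_wint ww mg') (msub1 b)).
  - by move=> a _; rewrite adde_ge0// ?mule_ge0 ?lee_fin ?mulr_ge0 ?cabs_ge0.
  - by rewrite lee_fin.
  rewrite lee_wpmul2l// ?lee_fin// ge0_integralD//; last 4 first.
  - by move=> a _; rewrite mule_ge0 ?lee_fin ?cabs_ge0.
  - by apply: measurable_funeM; exact: (measurable_ecabs (cmeas_comp mg' (msub1 b))).
  - by move=> a _; rewrite lee_fin mulr_ge0 ?cabs_ge0.
  - exact: (measurableT_comp (measurable_wint ww mg') (msub1 b)).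
  rewrite ge0_integralZl//; last 3 first.
  - exact: (measurable_ecabs (cmeas_comp mg' (msub1 b))).
  - by move=> a _; rewrite lee_fin cabs_ge0.
  - by rewrite lee_fin.
  rewrite (invariant b (measurable_ecabs mg')); last by move=> a; rewrite lee_fin cabs_ge0.
  rewrite (invariant b (measurable_wint ww mg'))// => a.
  by rewrite lee_fin mulr_ge0 ?cabs_ge0.
have W0 := wint_ge0 g' ww.
under eq_integral => b _.
  rewrite EFinM -muleA ge0_muleDr; last 2 first.
  - by rewrite mule_ge0 ?lee_fin// aI_ge0.
  - exact: W0.
  rewrite muleA (muleC (cabs (g b))%:E) -EFinM.
  over.
rewrite ge0_integralZl//; last 2 first.
- apply: emeasurable_funD.
    apply: emeasurable_funM => //; exact: measurable_wint.
  by apply: emeasurable_funM => //; exact: measurable_ecabs.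
- move=> b _; rewrite adde_ge0// mule_ge0 ?lee_fin ?mulr_ge0 ?cabs_ge0//.
  exact: aI_ge0.
rewrite lee_wpmul2l ?lee_fin// ge0_integralD//; last 4 first.
- by move=> b _; rewrite mule_ge0 ?lee_fin ?mulr_ge0 ?cabs_ge0// aI_ge0.
- by apply: emeasurable_funM => //; exact: measurable_wint.
- by move=> b _; rewrite mule_ge0 ?lee_fin ?cabs_ge0.
- by apply: emeasurable_funM => //; exact: measurable_ecabs.
rewrite ge0_integralZr//; last 3 first.
- exact: measurable_wint.
- by move=> b _; rewrite lee_fin mulr_ge0 ?cabs_ge0.
- exact: aI_ge0.
rewrite ge0_integralZr//.
- exact: measurable_ecabs.
- by move=> b _; rewrite lee_fin cabs_ge0.
Qed.

End product.

Lemma inW_mul (f f' : V -> R[i]) : inW f -> inW f' -> inW (fun x => f x * f' x).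
Proof.
by move=> [g fg] [g' fg']; exists (convolution g g'); exact: isF_mul.
Qed.

Lemma Nw_mul w c (f f' : V -> R[i]) : weight S w -> 0 <= c ->
  (forall u v, w (u + v) <= c * (w u + w v)) -> inW f -> inW f' ->
  (Nw w (fun x => f x * f' x)%R <= c%:E * (Nw w f * N f' + N f * Nw w f'))%E.
Proof.
move=> ww c0 wD [g fg] [g' fg'].
rewrite (NwE ww fg) (NwE ww fg') (NE fg) (NE fg') (NwE ww (isF_mul fg fg')).
exact: (wint_convolution fg fg' ww c0 wD).
Qed.

Lemma N_mul (f f' : V -> R[i]) : inW f -> inW f' ->
  (N (fun x => f x * f' x)%R <= N f * N f')%E.
Proof.
move=> fW fW'; apply: le_trans (Nw_mul (c := 2^-1) (weight1 S) _ _ fW fW') _ => //.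
  by move=> _ _; lra.
move: (N_fin fW) (N_fin fW'); case: (N f) => // a _; case: (N f') => // b _.
by rewrite -[leLHS]/((2^-1 * (a * b + a * b))%:E) -EFinM lee_fin; lra.
Qed.

End wiener_product.

(** * Continuous curves in the Wiener algebra *)

Section joint_integrable.
Context {R : realType} {d : nat} (S : fsetting R d).
Local Notation G := (fs_G S).
Local Notation V := 'rV[R]_d.
Local Notation N := (Nw S (fun=> 1)).
Context dT (T : measurableType dT) (m : {sigma_finite_measure set T -> \bar R}).

Lemma cintegrable_mkcond (D : set T) (f : T -> R[i]) : measurable D ->
  cintegrable m D f <-> cintegrable m setT (fun s => if s \in D then f s else 0).
Proof.
move=> mD.
have e1 : (fun t => (Re (f t))%:E) \_ D = (fun t => (Re (if t \in D then f t else 0))%:E).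
  by apply/funext => t; rewrite /patch; case: ifP.
have e2 : (fun t => (Im (f t))%:E) \_ D = (fun t => (Im (if t \in D then f t else 0))%:E).
  by apply/funext => t; rewrite /patch; case: ifP.
split=> -[h1 h2]; split.
- by rewrite -e1; exact/(integrable_mkcond _ mD).
- by rewrite -e2; exact/(integrable_mkcond _ mD).
- by apply/(integrable_mkcond _ mD); rewrite e1.
- by apply/(integrable_mkcond _ mD); rewrite e2.
Qed.

Lemma joint_Cint (D : set T) (f : T -> V -> R[i]) (g : T * G -> R[i]) x :
  measurable D -> joint D f g -> (\int[m]_(s in D) N (f s) < +oo)%E ->
  cintegrable m D (fun s => f s x).
Proof.
move=> mD fg fi; have mN := joint_Nw_meas mD fg (weight1 S).
case: fg => mg fg; apply/(cintegrable_mkcond _ mD).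
have mh : cmeas (fun s => ((fs_cst S)%:C)%C * cintegral (fs_mu S) setT (fun a => g (s, a) * fchar x a)).
  apply: cmeasM; first exact: cmeas_cst.
  apply: (cmeas_cint2 (fs_mu S) (F := fun z : T * G => g z * fchar x z.2)).
  by apply: cmeasM => //; exact: (cmeas_comp (@cmeas_fchar _ _ S x) measurable_snd).
have mf : cmeas (fun s => if s \in D then f s x else 0).
  rewrite (_ : (fun s => _) = fun s => ((\1_D s)%:C)%C *
    (((fs_cst S)%:C)%C * cintegral (fs_mu S) setT (fun a => g (s, a) * fchar x a))).
    by apply: cmeasM => //; apply: cmeas_real; exact: measurable_indic.
  apply/funext => s; rewrite indicE; case: ifPn => [|_]; last by rewrite mul0r.
  by rewrite inE => /fg[_ ->]; rewrite mul1r.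
apply/CintP; split => //; apply: le_lt_trans fi.
rewrite [leRHS]integral_mkcond; apply: ge0_le_integral => //.
- by move=> s _; rewrite lee_fin cabs_ge0.
- exact: measurable_ecabs.
- by apply/(measurable_restrictT _ _).1.
- move=> s _; rewrite /patch; case: ifP => _; last by rewrite cabs0.
  exact: sup_le_N.
Qed.

End joint_integrable.

(** Compactness of the segment: local bounds become a global one. *)
Lemma segment_bounded {R : realType} (T : R) (F : R -> \bar R) :
  (forall s, 0 <= s <= T -> exists K : R, exists2 r, 0 < r & forall s', 0 <= s' <= T ->
     `|s' - s| < r -> (F s' <= K%:E)%E) ->
  exists2 K, 0 <= K & forall s, 0 <= s <= T -> (F s <= K%:E)%E.
Proof.
move=> bF; pose P (n : nat) (s : R) := 0 <= s <= T -> (F s <= n%:R%:E)%E.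
have : \forall n \near \oo, `[0, T] `<=` P n.
  have /compact_near_coveringP := @segment_compact R 0 T.
  apply => s; rewrite /= in_itv/= => sT; have [K [r r0 h]] := bF s sT.
  have H1 : \forall x \near s, `|x - s| < r.
    by apply: filterS (nbhsx_ballx s _ r0) => x; rewrite /ball/= distrC.
  have H2 : \forall n \near \oo, K <= n%:R by exact: nbhs_infty_ger.
  exists ([set x | `|x - s| < r], [set n : nat | K <= n%:R]); first by split.
  move=> [x n] /= [xs nr] xT; apply: le_trans (h x xT xs) _.
  by rewrite lee_fin.
by case=> n _ /(_ n (leqnn n)) h; exists n%:R => // s sT; apply: h.
Qed.

Section curves.
Context {R : realType} {d : nat} (S : fsetting R d).
Local Notation G := (fs_G S).
Local Notation V := 'rV[R]_d.
Local Notation Nw := (Nw S).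
Local Notation N := (Nw (fun=> 1)).
Local Notation inW := (inW S).
Local Notation fhat := (@fhat R d S).
Local Notation mR := (measurableTypeR R).
Implicit Types (f : R -> V -> R[i]) (T t s : R).

(** Continuity on [0, T] up to the end points; no value of [f] outside of the
    interval enters. *)
Definition contW T f := forall s, 0 <= s <= T -> inW (f s) /\
  forall e, 0 < e -> exists2 r, 0 < r & forall s', 0 <= s' <= T ->
    `|s' - s| < r -> (N (fun x => f s' x - f s x)%R <= e%:E)%E.

Lemma contW_inW T f s : contW T f -> 0 <= s <= T -> inW (f s).
Proof. by move=> h /h[]. Qed.

Lemma contW_unif T f e : contW T f -> 0 < e -> exists n : nat,
  forall s s', 0 <= s <= T -> 0 <= s' <= T -> `|s' - s| < n.+1%:R^-1 ->
    (N (fun x => f s' x - f s x)%R <= e%:E)%E.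
Proof.
move=> cf e0.
pose P (n : nat) (s : R) := forall s', 0 <= s <= T -> 0 <= s' <= T ->
   `|s' - s| < n.+1%:R^-1 -> (N (fun x => f s' x - f s x)%R <= e%:E)%E.
have : \forall n \near \oo, `[0, T] `<=` P n.
  have /compact_near_coveringP := @segment_compact R 0 T.
  apply => s; rewrite /= in_itv/= => s0T.
  have [_ /(_ (e / 2))] := cf s s0T; rewrite divr_gt0// => /(_ isT)[r r0 h].
  have H1 : \forall x \near s, `|x - s| < r / 2.
    have r2 : 0 < r / 2 by rewrite divr_gt0.
    by apply: filterS (nbhsx_ballx s _ r2) => x; rewrite /ball/= distrC.
  have H2 : \forall n \near \oo, n.+1%:R^-1 < r / 2.
    have /cvgr0_norm_lt h0 := @cvg_harmonic R.
    have {h0} : \forall n \near \oo, `|harmonic n| < r / 2 by apply: h0; rewrite divr_gt0.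
    by apply: filterS => n; rewrite ger0_norm// invr_ge0.
  exists ([set x | `|x - s| < r / 2], [set n : nat | n.+1%:R^-1 < r / 2]); first by split.
  move=> [x n] /= [xs nr] s' x0 s'0 s'x.
  apply: le_trans (Nw_tri _ (f s) _ (weight1 S)) _.
  rewrite [e]splitr EFinD; apply: leeD.
    apply: h => //; rewrite (_ : s' - s = (s' - x) + (x - s)); last by ring.
    apply: le_lt_trans (ler_normD _ _) _; rewrite [r]splitr ltrD//.
    exact: lt_trans s'x nr.
  rewrite Nw_subC; last exact: weight1.
  by apply: h => //; apply: lt_trans xs _; rewrite ltr_pdivrMr// ltr_pMr// ltr1n.
case=> n _ /(_ n (leqnn n)) h; exists n => s s' s0 s'0; apply: h => //.
Qed.

Lemma contW_bounded T f : contW T f -> exists2 K, 0 <= K &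
  forall s, 0 <= s <= T -> (N (f s) <= K%:E)%E.
Proof.
move=> cf; apply: segment_bounded => s sT.
have [fW /(_ 1 ltr01)[r r0 h]] := cf s sT.
exists (1 + fine (N (f s))), r => // s' s'T ss.
rewrite (_ : f s' = fun y => (f s' y - f s y) + f s y); last first.
  by apply/funext => y; rewrite subrK.
apply: le_trans (NwD _ _ (weight1 S)) _.
by rewrite EFinD leeD// ?fineK ?N_fin//; exact: h.
Qed.

Lemma measurable_truncn (c : R) :
  measurable_fun setT (fun s : mR => (Num.truncn (s * c) : disc 0%N)).
Proof.
move=> _ Y _; rewrite setTI.
have mge n : measurable [set s : mR | (n < Num.truncn (s * c))%N].
  rewrite (_ : [set _ | _] = (fun s : mR => s * c) @^-1` `[n.+1%:R, +oo[).
    rewrite -[X in measurable X]setTI.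
    have m : measurable_fun setT (fun s : mR => s * c) by exact: mulrr_measurable.
    by apply: m.
  by apply/seteqP; split => s /=; rewrite truncn_gt_nat in_itv/= andbT.
have meq n : measurable [set s : mR | Num.truncn (s * c) = n].
  case: n => [|n].
    rewrite (_ : [set _ | _] = ~` [set s : mR | (0 < Num.truncn (s * c))%N]).
      exact: measurableC.
    by apply/seteqP; split => s /=; [move=> ->|case: Num.truncn].
  rewrite (_ : [set _ | _] = [set s : mR | (n < Num.truncn (s * c))%N] `\`
      [set s : mR | (n.+1 < Num.truncn (s * c))%N]); first exact: measurableD.
  apply/seteqP; split => s /=; first by move=> ->; rewrite ltnS leqnn ltnn; split.
  by move=> [h1 /negP]; rewrite -leqNgt => h2; apply/eqP; rewrite eqn_leq h2 h1.
rewrite (_ : _ @^-1` Y = \bigcup_(n in Y) [set s : mR | Num.truncn (s * c) = n]).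
  exact: bigcup_measurable.
by apply/seteqP; split => s /=; [move=> Ys; exists (Num.truncn (s * c))|move=> [q Yq /= ->]].
Qed.

(** A continuous curve is a limit of step curves at a geometric rate. The
    transforms of the step curves are jointly measurable, and so is the series
    of their increments. *)
Lemma contW_joint T f : contW T f ->
  exists g, joint (T := mR) (S := S) `[0, T] f g.
Proof.
move=> cf.
have /choice[n hn] : forall k : nat, exists n : nat,
  forall s s', 0 <= s <= T -> 0 <= s' <= T -> `|s' - s| < n.+1%:R^-1 ->
    (N (fun x => f s' x - f s x)%R <= (2^-1 ^+ k)%:E)%E.
  by move=> k; apply: contW_unif => //; rewrite exprn_gt0.
pose c k : R := (n k).+1%:R.
have c0 k : 0 < c k by rewrite ltr0n.
(* [s] rounded down to the grid of mesh [(c k)^-1] *)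
pose step k s := (Num.truncn (s * c k))%:R / c k.
have stepP k s : 0 <= s <= T -> 0 <= step k s <= T /\ `|step k s - s| < (c k)^-1.
  move=> /andP[s0 sT].
  have /truncn_itv/andP[h1 h2] : 0 <= s * c k by rewrite mulr_ge0// ltW.
  have h3 : step k s <= s by rewrite ler_pdivrMr.
  have h4 : s < step k s + (c k)^-1.
    by rewrite /step -{2}[(c k)^-1]mul1r -mulrDl ltr_pdivlMr// natr1.
  split.
    by apply/andP; split; [rewrite divr_ge0 ?ler0n ?ltW|exact: le_trans h3 sT].
  rewrite ler0_norm ?subr_le0// opprB ltrBlDl//.
pose fk k s := f (step k s).
have fkW k s : 0 <= s <= T -> inW (fk k s).
  by move=> /(stepP k)[/cf[]].
have fkN k s : 0 <= s <= T -> (N (fun x => fk k s x - f s x)%R <= (2^-1 ^+ k)%:E)%E.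
  by move=> s0; have [s1 s2] := stepP k s s0; apply: hn.
pose gk k (z : mR * G) := fhat (fk k z.1) z.2 * (if z.1 \in `[0, T] then 1 else 0).
have mgk k : cmeas (gk k).
  have mq (q : nat) : cmeas (fun a => if 0 <= q%:R / c k <= T then fhat (f (q%:R / c k)) a else 0).
    by have [h|h] := boolP (0 <= q%:R / c k <= T); [exact: (Cint_meas (isF_fhat (contW_inW cf h)).1)|exact: cmeas_cst].
  have m1 := cmeas_disc_prod 0%N mq.
  have mp : measurable_fun setT (fun z : mR * G => (Num.truncn (z.1 * c k) : disc 0%N, z.2)).
    apply: measurable_fun_pair; last exact: measurable_snd.
    exact: (measurableT_comp (measurable_truncn (c k)) measurable_fst).
  rewrite (_ : gk k = fun z => (fun z : disc 0%N * G => if 0 <= (z.1 : nat)%:R / c k <= T then fhat (f ((z.1 : nat)%:R / c k)) z.2 else 0)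
     (Num.truncn (z.1 * c k) : disc 0%N, z.2) * ((\1_(`[0, T] : set mR) z.1)%:C)%C).
    apply: cmeasM; first exact: (cmeas_comp m1 mp).
    apply: cmeas_real; apply: (measurableT_comp _ measurable_fst).
    by apply: measurable_indic; exact: measurable_itv.
  apply/funext => -[s a]; rewrite /gk /= indicE mem_setE.
  case: (boolP (s \in `[0, T])) => [s0|_]; last by rewrite !mulr0.
  rewrite !mulr1; move: s0; rewrite in_itv/= => /(stepP k)[h _].
  by rewrite /fk -/(step k s) h.
pose psi (z : mR * G) (k : nat) := increments (fun k => gk k z) k.
have mpsi : cmeas (fun z : (mR * G) * disc 0%N => psi z.1 z.2).
  apply: (@cmeas_prod_disc _ _ 0%N _ _ (fun k z => psi z k)) => -[|k]; rewrite /psi /=.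
    exact: mgk.
  by apply: cmeasB.
pose g (z : mR * G) := cintegral (countm 0%N) setT (fun k => psi z k).
exists g; split; first exact: cmeas_cint2 mpsi.
move=> s; rewrite /= in_itv/= => s0.
pose phi (k : disc 0%N) x := increments (fun k => fk k s x) k.
have gkE k : (fun a => gk k (s, a)) = fhat (fk k s).
  by apply/funext => a; rewrite /gk /= in_itv/= s0 mulr1.
have phiF k : isF (phi k) (fun a => psi (s, a) k).
  have h q : isF (fk q s) (fun a => gk q (s, a)).
    by rewrite gkE; apply: isF_fhat; exact: fkW.
  rewrite /phi /psi; case: k => [|k] //=.
  rewrite (_ : (fun x => _) = fun x => fk k.+1 s x + (-1) * fk k s x).
    rewrite (_ : (fun a => _) = fun a => gk k.+1 (s, a) + (-1) * gk k (s, a)).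
      by apply: isFD => //; exact: isFZ.
    by apply/funext => a; rewrite mulN1r.
  by apply/funext => a; rewrite mulN1r.
have jp : joint (T := disc 0%N) (S := S) setT phi (fun z => psi (s, z.2) z.1).
  split; last by move=> k _.
  apply: (@cmeas_disc_prod _ _ 0%N _ _ (fun k a => psi (s, a) k)) => k.
  by case: (phiF k) => /Cint_meas.
pose C := fine (N (phi 0%N)) + 4.
have f0 : 0 <= fine (N (phi 0%N)) by rewrite fine_ge0// N_ge0.
have phi0W : inW (phi 0%N) by exact: fkW.
have phiN k : (N (phi k) <= (C * 2^-1 ^+ k)%:E)%E.
  case: k => [|k].
    by rewrite expr0 mulr1 -(fineK (N_fin phi0W)) lee_fin lerDl.
  apply: (@le_trans _ _ (N (fun x => fk k.+1 s x - f s x)%R + N (fun x => f s x - fk k s x)%R)%E).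
    exact: Nw_tri (weight1 S).
  rewrite [X in (_ + X)%E]Nw_subC; last exact: weight1.
  apply: le_trans (leeD (fkN k.+1 s s0) (fkN k s s0)) _.
  rewrite -EFinD lee_fin /C exprS.
  have h : 0 <= 2^-1 ^+ k :> R by rewrite exprn_ge0.
  nra.
have phis : (\int[countm 0%N]_k N (phi k) < +oo)%E.
  apply: le_lt_trans (ltry (2 * C)); apply: esum_nat_geometric => //.
    by move=> k; exact: N_ge0.
  by rewrite addr_ge0.
have [H _] := joint_integral_whole jp phis.
rewrite (_ : f s = fun x => cintegral (countm 0%N) setT (fun k => phi k x)); first exact: H.
apply/funext => x; apply/esym.
have ci : cintegrable (countm 0%N) setT (increments (fun k => fk k s x)).
  have := joint_Cint x measurableT jp phis; exact.
apply: ccvg_uniq (ccvg_increments ci) _.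
apply: (@squeeze_cvgr _ _ _ _ (fun=> 0) (fun k => 2^-1 ^+ k)).
- apply: nearW => k; rewrite cabs_ge0 /= -lee_fin.
  by apply: le_trans (fkN k s s0); apply: (sup_le_N S (fun x => fk k s x - f s x)).
- exact: cvg_cst.
- by apply: cvg_expr; rewrite ger0_norm; lra.
Qed.

End curves.

(** ** Operations on continuous curves *)

Section vector_norms.
Context {R : realType} {d : nat}.
Local Notation V := 'rV[R]_d.
Implicit Types (u v : V).

Definition l1norm (v : V) : R := \sum_i `|v 0 i|.

Lemma l1norm_ge0 v : 0 <= l1norm v. Proof. exact: sumr_ge0. Qed.
Lemma l1normD u v : l1norm (u + v) <= l1norm u + l1norm v.
Proof. by rewrite /l1norm -big_split; apply: ler_sum => i _; rewrite mxE ler_normD. Qed.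
Lemma l1normN v : l1norm (- v) = l1norm v.
Proof. by apply: eq_bigr => i _; rewrite mxE normrN. Qed.
Lemma sqnorm_ge0 v : 0 <= sqnorm v.
Proof. by apply: sumr_ge0 => i _; rewrite -expr2 sqr_ge0. Qed.
Lemma sqnormN v : sqnorm (- v) = sqnorm v.
Proof. by rewrite /sqnorm dotNl dotNr opprK. Qed.
Lemma sqnormD u v : sqnorm (u + v) <= 2 * (sqnorm u + sqnorm v).
Proof.
rewrite /sqnorm /dot -big_split mulr_sumr; apply: ler_sum => i _; rewrite mxE /=.
have := sqr_ge0 (u 0 i - v 0 i); rewrite expr2; nra.
Qed.

Lemma abs_dot_le (K : R) (y v : V) : (forall i, `|y 0 i| <= K) -> `|dot y v| <= K * l1norm v.
Proof.
move=> yK; rewrite /dot /l1norm mulr_sumr (le_trans (ler_norm_sum _ _ _))//.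
by apply: ler_sum => i _; rewrite normrM ler_wpM2r.
Qed.

Lemma mul_frac_le (K e : R) : 0 <= K -> 0 < e -> K * (e / (K + 1)) <= e.
Proof.
move=> K0 e0; have K1 : 0 < K + 1 by rewrite ltr_wpDl.
by rewrite mulrA ler_pdivrMr// mulrDr mulr1 mulrC lerDl ltW.
Qed.

End vector_norms.

Section curves_closure.
Context {R : realType} {d : nat} (S : fsetting R d).
Local Notation mu := (fs_mu S).
Local Notation vec := (@fs_vec _ _ S).
Local Notation V := 'rV[R]_d.
Local Notation Nw := (Nw S).
Local Notation N := (Nw (fun=> 1)).
Local Notation inW := (inW S).
Local Notation contW := (contW S).
Local Notation flow := (@flow R d S).
Implicit Types (f : R -> V -> R[i]) (T t s : R).

Lemma Nw_ext w (f f' : V -> R[i]) : f =1 f' -> Nw w f = Nw w f'.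
Proof. by move=> /funext ->. Qed.

Lemma contW_cst T (f : V -> R[i]) : inW f -> contW T (fun=> f).
Proof.
move=> fW s _; split => // e e0; exists 1 => // s' _ _.
rewrite (@Nw_ext _ _ (fun=> 0)); last by move=> x; rewrite subrr.
by rewrite Nw0 ?lee_fin ?ltW//; exact: weight1.
Qed.

Lemma contW_eq T f f' : (forall s, 0 <= s <= T -> f s =1 f' s) ->
  contW T f -> contW T f'.
Proof.
move=> ff cf s s0; have [h1 h2] := cf s s0; split.
  by rewrite (_ : f' s = f s)//; apply/funext => x; rewrite ff.
move=> e /h2[r r0 h]; exists r => // s' s'0 /(h _ s'0); apply: le_trans.
by rewrite le_eqVlt; apply/orP; left; apply/eqP/Nw_ext => x; rewrite !ff.
Qed.

Lemma contW_le T T' f : T' <= T -> contW T f -> contW T' f.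
Proof.
move=> TT cf s /andP[s0 sT].
have [h1 h2] := cf s (introT andP (conj s0 (le_trans sT TT))).
split=> // e /h2[r r0 h]; exists r => // s' /andP[s'0 s'T]; apply: h.
by rewrite s'0 (le_trans s'T).
Qed.

Lemma contW_shift T a f : 0 <= a <= T -> contW T f -> contW (T - a) (fun s => f (s + a)).
Proof.
move=> /andP[a0 aT] cf.
have h s : 0 <= s <= T - a -> 0 <= s + a <= T.
  by move=> /andP[s0 sT]; rewrite addr_ge0//= -lerBrDr.
move=> s s0; have [h1 h2] := cf _ (h s s0); split => // e /h2[r r0 h3].
exists r => // s' s'0 ss; apply: h3; first exact: h.
by rewrite (_ : _ - _ = s' - s)//; ring.
Qed.

(** All the continuity proofs follow this pattern: an upper bound [u] of the
    increments of [f] tends to 0. *)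
Lemma contW_dom T f (u : R -> R -> \bar R) :
  (forall s, 0 <= s <= T -> inW (f s)) ->
  (forall s s', 0 <= s <= T -> 0 <= s' <= T ->
     (N (fun x => f s' x - f s x)%R <= u s s')%E) ->
  (forall s e, 0 <= s <= T -> 0 < e -> exists2 r, 0 < r & forall s', 0 <= s' <= T ->
     `|s' - s| < r -> (u s s' <= e%:E)%E) -> contW T f.
Proof.
move=> fW fu uc s s0; split; first exact: fW.
move=> e e0; have [r r0 h] := uc s e s0 e0; exists r => // s' s'0 ss.
by apply: le_trans (fu _ _ s0 s'0) _; exact: h.
Qed.

Lemma contWD T f f' : contW T f -> contW T f' -> contW T (fun s x => f s x + f' s x).
Proof.
move=> cf cf'; apply: (contW_dom (u := fun s s' =>
   (N (fun x => f s' x - f s x)%R + N (fun x => f' s' x - f' s x)%R)%E)).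
- by move=> s s0; apply: inWD; [exact: contW_inW s0|exact: contW_inW s0].
- move=> s s' s0 s'0; apply: le_trans (NwD _ _ (weight1 S)).
  by rewrite le_eqVlt; apply/orP; left; apply/eqP/Nw_ext => x; ring.
- move=> s e s0 e0; have e2 : 0 < e / 2 by rewrite divr_gt0.
  have [r r0 h] := (cf s s0).2 _ e2; have [r' r'0 h'] := (cf' s s0).2 _ e2.
  exists (Num.min r r'); first by rewrite lt_min r0 r'0.
  move=> s' s'0; rewrite lt_min => /andP[s1 s2].
  by rewrite [e]splitr EFinD; apply: leeD; [exact: h|exact: h'].
Qed.

Lemma contWM T f f' : contW T f -> contW T f' -> contW T (fun s x => f s x * f' s x).
Proof.
move=> cf cf'.
have [K K0 hK] := contW_bounded cf; have [K' K'0 hK'] := contW_bounded cf'.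
apply: (contW_dom (u := fun s s' =>
   (N (fun x => f s' x - f s x)%R * K'%:E + K%:E * N (fun x => f' s' x - f' s x)%R)%E)).
- by move=> s s0; apply: inW_mul; [exact: contW_inW s0|exact: contW_inW s0].
- move=> s s' s0 s'0.
  have [fs fs'] := (contW_inW cf s0, contW_inW cf s'0).
  have [gs gs'] := (contW_inW cf' s0, contW_inW cf' s'0).
  rewrite (@Nw_ext _ _ (fun x => (f s' x - f s x) * f' s' x + f s x * (f' s' x - f' s x))); last by move=> x; ring.
  apply: le_trans (NwD _ _ (weight1 S)) _; apply: leeD.
    apply: le_trans (N_mul _ _) _ => //; first exact: inWB.
    by rewrite lee_wpmul2l ?N_ge0// hK'.
  apply: le_trans (N_mul _ _) _ => //; first exact: inWB.
  by rewrite lee_wpmul2r ?N_ge0// hK.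
- move=> s e s0 e0; have e2 : 0 < e / 2 by rewrite divr_gt0.
  have e3 : 0 < e / 2 / (K' + 1) by rewrite divr_gt0// ltr_wpDl.
  have e4 : 0 < e / 2 / (K + 1) by rewrite divr_gt0// ltr_wpDl.
  have [r r0 h] := (cf s s0).2 _ e3; have [r' r'0 h'] := (cf' s s0).2 _ e4.
  exists (Num.min r r'); first by rewrite lt_min r0 r'0.
  move=> s' s'0; rewrite lt_min => /andP[s1 s2].
  rewrite [e]splitr EFinD; apply: leeD.
    apply: (@le_trans _ _ ((e / 2 / (K' + 1))%:E * K'%:E)%E).
      by rewrite lee_wpmul2r ?lee_fin//; exact: h.
    by rewrite -EFinM lee_fin mulrC; exact: mul_frac_le.
  apply: (@le_trans _ _ (K%:E * (e / 2 / (K + 1))%:E)%E).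
    by rewrite lee_wpmul2l ?lee_fin//; exact: h'.
  by rewrite -EFinM lee_fin; exact: mul_frac_le.
Qed.

Lemma contWZ T z f : contW T f -> contW T (fun s x => z * f s x).
Proof.
move=> cf; apply: (contW_dom (u := fun s s' => ((cabs z)%:E * N (fun x => f s' x - f s x)%R)%E)).
- by move=> s s0; apply: inWZ; exact: contW_inW s0.
- move=> s s' s0 s'0; have [fs fs'] := (contW_inW cf s0, contW_inW cf s'0).
  rewrite -NwZ; [|exact: weight1|exact: inWB].
  by rewrite le_eqVlt; apply/orP; left; apply/eqP/Nw_ext => x; ring.
- move=> s e s0 e0; have z0 := cabs_ge0 z.
  have e3 : 0 < e / (cabs z + 1) by rewrite divr_gt0// ltr_wpDl.
  have [r r0 h] := (cf s s0).2 _ e3; exists r => // s' s'0 ss.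
  apply: (@le_trans _ _ ((cabs z)%:E * (e / (cabs z + 1))%:E)%E).
    by rewrite lee_wpmul2l ?lee_fin//; exact: h.
  by rewrite -EFinM lee_fin; exact: mul_frac_le.
Qed.

Lemma contWB T f f' : contW T f -> contW T f' -> contW T (fun s x => f s x - f' s x).
Proof.
move=> cf cf'; apply: contW_eq (contWD cf (contWZ (-1) cf')) => s _ x.
by rewrite mulN1r.
Qed.

Lemma contW_conj T f : contW T f -> contW T (fun s x => conjc (f s x)).
Proof.
move=> cf; apply: (contW_dom (u := fun s s' => N (fun x => f s' x - f s x)%R)).
- by move=> s s0; apply: inW_conj; exact: contW_inW s0.
- move=> s s' s0 s'0; rewrite -[leRHS](Nw_conj _ (weight1 S))//.
  by rewrite le_eqVlt; apply/orP; left; apply/eqP/Nw_ext => x; rewrite conjcB.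
- by move=> s e s0 e0; have [_] := cf s s0; exact.
Qed.

Lemma contW_expi T f a b : contW T f -> contW T (fun s x => expi (a * s + b) * f s x).
Proof.
move=> cf; have [K K0 hK] := contW_bounded cf.
apply: (contW_dom (u := fun s s' =>
   (N (fun x => f s' x - f s x)%R + (`|a| * `|s' - s| * K)%:E)%E)).
- by move=> s s0; apply: inWZ; exact: contW_inW s0.
- move=> s s' s0 s'0; have [fs fs'] := (contW_inW cf s0, contW_inW cf s'0).
  rewrite (@Nw_ext _ _ (fun x => expi (a * s' + b) * (f s' x - f s x) +
    (expi (a * s' + b) - expi (a * s + b)) * f s x)); last by move=> x; ring.
  apply: le_trans (NwD _ _ (weight1 S)) _; apply: leeD.
    by rewrite NwZ ?cabs_expi ?mul1e//; do ?exact: weight1; exact: inWB.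
  rewrite NwZ//.
  rewrite EFinM; apply: lee_pmul; rewrite ?lee_fin ?cabs_ge0 ?N_ge0//; last exact: hK.
  apply: le_trans (cabs_expiB _ _) _; rewrite -normrM.
  by rewrite (_ : a * s' + b - _ = a * (s' - s))//; ring.
- move=> s e s0 e0; have e2 : 0 < e / 2 by rewrite divr_gt0.
  have aK : 0 <= `|a| * K by rewrite mulr_ge0.
  have e3 : 0 < e / 2 / (`|a| * K + 1) by rewrite divr_gt0// ltr_wpDl.
  have [r r0 h] := (cf s s0).2 _ e2.
  exists (Num.min r (e / 2 / (`|a| * K + 1))); first by rewrite lt_min r0.
  move=> s' s'0; rewrite lt_min => /andP[s1 /ltW s2].
  rewrite [e]splitr EFinD; apply: leeD; first exact: h.
  rewrite lee_fin mulrAC (le_trans (ler_wpM2l aK s2))//.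
  exact: mul_frac_le.
Qed.

Lemma contW_alt_prod T n (f : 'I_n.+1 -> R -> V -> R[i]) :
  (forall k, contW T (f k)) ->
  contW T (fun s x => alt_prod (fun k => f k s x)).
Proof.
move=> cf.
pose F (k : 'I_n.+1) s x := if odd k then conjc (f k s x) else f k s x.
have cF k : contW T (F k).
  by rewrite /F; case: (odd k) => //; exact: contW_conj.
have -> : (fun s x => alt_prod (fun k => f k s x)) = (fun s x => \prod_(k < n.+1) F k s x) by [].
move: F cF; clear; elim: n => [|n IH] F cF.
  by apply: contW_eq (cF ord0) => s _ x; rewrite big_ord_recl big_ord0 mulr1.
have := contWM (cF ord0) (IH (fun k => F (lift ord0 k)) (fun k => cF _)).
by apply: contW_eq => s _ x; rewrite [RHS]big_ord_recl.
Qed.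

(** ** Strong continuity of the flows *)

Lemma weight_l1norm : weight S l1norm.
Proof.
split; first exact: l1norm_ge0.
by apply: measurable_sum => i; apply: measurableT_comp => //; exact: fs_mvec.
Qed.
Lemma weight_sqnorm : weight S sqnorm.
Proof. by split; [exact: sqnorm_ge0|exact: measurable_sqnorm]. Qed.

Lemma flow_sub_isF r y (f : V -> R[i]) g : isF f g ->
  isF (fun x => flow r y f x - f x) (fun a => (expi (phase_at r y (vec a)) - 1) * g a).
Proof.
move=> fg; rewrite (_ : (fun x => _) = fun x => flow r y f x + (-1) * f x); last first.
  by apply/funext => x; rewrite mulN1r.
rewrite (_ : (fun a => _) = fun a => expi (phase_at r y (vec a)) * g a + (-1) * g a).
  by apply: isFD; [exact: isF_flow|exact: isFZ].
by apply/funext => a; ring.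
Qed.

(** The inequality [|expi t - 1| <= |t|] for the phase [r |xi|^2 + y . xi]: a
    flow over a short time costs two derivatives, a short translation costs one.
    *)
Lemma flow_sub_le r (y : V) K (f : V -> R[i]) : inW f -> (forall i, `|y 0 i| <= K) -> 0 <= K ->
  (N (fun x => flow r y f x - f x)%R <= `|r|%:E * Nw sqnorm f + K%:E * Nw l1norm f)%E.
Proof.
move=> [g fg] yK K0; rewrite (NE (flow_sub_isF r y fg)).
rewrite (NwE weight_sqnorm fg) (NwE weight_l1norm fg).
have mg := Cint_meas fg.1.
rewrite -!ge0_integralZl//; do ?[by rewrite lee_fin]; last 4 first.
- exact: measurable_wint weight_l1norm mg.
- by move=> a _; rewrite lee_fin mulr_ge0 ?cabs_ge0 ?l1norm_ge0.
- exact: measurable_wint weight_sqnorm mg.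
- by move=> a _; rewrite lee_fin mulr_ge0 ?cabs_ge0 ?sqnorm_ge0.
rewrite -ge0_integralD//; last 4 first.
- by move=> a _; rewrite mule_ge0 ?lee_fin ?mulr_ge0 ?cabs_ge0 ?sqnorm_ge0.
- by apply: measurable_funeM; exact: measurable_wint weight_sqnorm mg.
- by move=> a _; rewrite mule_ge0 ?lee_fin ?mulr_ge0 ?cabs_ge0 ?l1norm_ge0.
- by apply: measurable_funeM; exact: measurable_wint weight_l1norm mg.
apply: ge0_le_integral => //.
- by move=> a _; rewrite lee_fin cabs_ge0.
- apply: measurable_ecabs; apply: cmeasM => //; apply: cmeasB; last exact: cmeas_cst.
  by apply: cmeas_expi; exact: measurable_phase_at.
- apply: emeasurable_funD; apply: measurable_funeM.
    exact: measurable_wint weight_sqnorm mg.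
  exact: measurable_wint weight_l1norm mg.
move=> a _; rewrite -!EFinM -EFinD lee_fin cabsM !mulrA -mulrDl ler_wpM2r ?cabs_ge0//.
rewrite (le_trans (cabs_expiB1 _))// /phase_at (le_trans (ler_normD _ _))//.
by rewrite normrM (ger0_norm (sqnorm_ge0 _)) lerD2l; exact: abs_dot_le.
Qed.

(** The transform of [f] is merely integrable, so that the bound of
    [flow_sub_le] is replaced by dominated convergence for the minimum of 2 and
    the phase. *)
Lemma flow_cont r y (f : V -> R[i]) e : inW f -> 0 < e ->
  exists2 h, 0 < h & forall t, `|t| < h ->
    (N (fun x => flow (t * r) (t *: y) f x - f x)%R <= e%:E)%E.
Proof.
move=> [g fg] e0; have mg := Cint_meas fg.1.
pose th a := phase_at r y (vec a).
have mth : measurable_fun setT th by exact: measurable_phase_at.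
pose b n a : R := Num.min 2 (n.+1%:R^-1 * `|th a|).
have b0 n a : 0 <= b n a by rewrite /b le_min mulr_ge0//= ler0n.
have mb n : measurable_fun setT (b n).
  apply: measurable_minr; first exact: measurable_cst.
  by apply: measurable_funM; [exact: measurable_cst|exact: measurableT_comp].
have H : (\int[mu]_a (cabs (((b n a)%:C)%C * g a))%:E @[n --> \oo] --> 0)%E.
  apply: (dominated_abs0 (g := fun a => (2%:C)%C * g a)).
  - by move=> n; apply: cmeasM => //; exact: cmeas_real.
  - move=> a; under eq_fun do rewrite cabsM cabs_real.
    rewrite -(mul0r (cabs (g a))); apply: cvgMl.
    apply: (@squeeze_cvgr _ _ _ _ (fun=> 0) (fun n => n.+1%:R^-1 * `|th a|)).
    + by apply: nearW => n; rewrite normr_ge0 ger0_norm//= /b ge_min lexx orbT.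
    + exact: cvg_cst.
    + by rewrite -(mul0r (`|th a|)); apply: cvgMl; exact: cvg_harmonic.
  - by apply: CintZ; case: fg.
  - move=> n a; rewrite !cabsM !cabs_real ler_wpM2r ?cabs_ge0// ger0_norm// ger0_norm//.
    by rewrite /b ge_min lexx.
have /fine_cvgP[fn /cvgrPdist_lt/(_ e e0)] := H.
case=> n _ /(_ n (leqnn n)); rewrite sub0r normrN => hn.
exists n.+1%:R^-1; first by rewrite invr_gt0.
move=> t tn; rewrite (NE (flow_sub_isF _ _ fg)).
have ci : cintegrable mu setT (fun a => ((b n a)%:C)%C * g a).
  apply: le_Cint (CintZ (2%:C)%C fg.1) _.
    by apply: cmeasM => //; exact: cmeas_real.
  move=> a; rewrite !cabsM !cabs_real ler_wpM2r ?cabs_ge0// ger0_norm// ger0_norm//.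
  by rewrite /b ge_min lexx.
apply: (@le_trans _ _ (\int[mu]_a (cabs (((b n a)%:C)%C * g a))%:E)%E).
  apply: le_aI.
  - apply: cmeasM => //; apply: cmeasB; last exact: cmeas_cst.
    by apply: cmeas_expi; exact: measurable_phase_at.
  - by apply: cmeasM => //; exact: cmeas_real.
  move=> a; rewrite !cabsM ler_wpM2r ?cabs_ge0// cabs_real ger0_norm// /b le_min.
  apply/andP; split.
    by rewrite (le_trans (cabsB _ _))// cabs_expi cabs1.
  have -> : phase_at (t * r) (t *: y) (vec a) = t * th a.
    by rewrite /th /phase_at dotZl; ring.
  by rewrite (le_trans (cabs_expiB1 _))// normrM ler_wpM2r// ltW.
rewrite -(fineK (aI_fin ci)) lee_fin ltW//; apply: le_lt_trans hn.
exact: ler_norm.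
Qed.

Lemma contW_flow T f r0 r1 y0 y1 : contW T f ->
  contW T (fun s => flow (r0 + s * r1) (y0 + s *: y1) (f s)).
Proof.
move=> cf; apply: (contW_dom (u := fun s s' =>
   (N (fun x => f s' x - f s x)%R + N (fun x => flow ((s' - s) * r1) ((s' - s) *: y1) (f s) x - f s x)%R)%E)).
- by move=> s s0; apply: inW_flow; exact: contW_inW s0.
- move=> s s' s0 s'0; have [fs fs'] := (contW_inW cf s0, contW_inW cf s'0).
  apply: le_trans (Nw_tri _ (flow (r0 + s' * r1) (y0 + s' *: y1) (f s)) _ (weight1 S)) _.
  apply: leeD.
    by rewrite -flowB// Nw_flow//; do ?exact: weight1; do ?exact: inWB.
  have -> : flow (r0 + s' * r1) (y0 + s' *: y1) (f s) =
      flow (r0 + s * r1) (y0 + s *: y1) (flow ((s' - s) * r1) ((s' - s) *: y1) (f s)).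
    have e1 : r0 + s' * r1 = (r0 + s * r1) + (s' - s) * r1 by ring.
    have e2 : y0 + s' *: y1 = (y0 + s *: y1) + (s' - s) *: y1.
      by rewrite -addrA -scalerDl [s + _]addrC subrK.
    by rewrite e1 e2 -flow_flow.
  by rewrite -flowB ?Nw_flow//; do ?exact: weight1; do ?exact: inW_flow; apply: inWB => //; exact: inW_flow.
- move=> s e s0 e0; have e2 : 0 < e / 2 by rewrite divr_gt0.
  have [r r0' h] := (cf s s0).2 _ e2.
  have [r' r'0 h'] := flow_cont r1 y1 (contW_inW cf s0) e2.
  exists (Num.min r r'); first by rewrite lt_min r0'.
  move=> s' s'0; rewrite lt_min => /andP[s1 s2].
  by rewrite [e]splitr EFinD; apply: leeD; [exact: h|exact: h'].
Qed.

End curves_closure.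

(** * Time integrals of continuous curves *)

Section time.
Context {R : realType}.
Local Notation leb := (@lebesgue_measure R).
Local Notation mR := (measurableTypeR R).

Lemma lebesgue_shift (h : R) (A : set mR) : measurable A ->
  leb ((fun s : mR => s + h : mR) @^-1` A) = leb A.
Proof.
move=> mA; have mh : measurable_fun setT (fun s : mR => s + h : mR).
  by apply: measurable_funD.
rewrite -[LHS]/(pushforward leb (fun s : mR => s + h : mR) A).
apply/esym/lebesgue_measure_unique => //= _ [[a b]] _ <-.
rewrite /pushforward (_ : _ @^-1` _ = `]a - h, b - h]%classic); last first.
  by apply/seteqP; split => s /=; rewrite !in_itv/= ltrBlDr lerBrDr.
rewrite !lebesgue_measure_itv/= !lte_fin ltrD2r; case: ifP => // _.
by rewrite -!EFinB; congr (_%:E); ring.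
Qed.

Lemma cint_lebesgue_shift (h : R) (f : R -> R[i]) : cintegrable leb setT f ->
  cintegrable leb setT (fun s => f (s + h)) /\
  cintegral leb setT (fun s => f (s + h)) = cintegral leb setT f.
Proof.
apply: (cint_push (p := fun s : mR => s + h : mR)); first exact: measurable_funD.
exact: lebesgue_shift.
Qed.

Lemma time_integralE (t : R) (f : R -> R[i]) : time_integral t f =
  cintegral leb setT (fun s => if s \in `[0, t]%classic then f s else 0).
Proof. exact: cint_mkcond. Qed.

Lemma time_integral_split (a b : R) (f : R -> R[i]) : 0 <= a -> 0 <= b ->
  cintegrable leb `[0, a + b] f ->
  time_integral (a + b) f = time_integral a f + time_integral b (fun s => f (s + a)).
Proof.
move=> a0 b0 /(cintegrable_mkcond leb _ (measurable_itv _)) fi.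
rewrite !time_integralE.
have ind (c e : R) : measurable_fun setT (\1_(`[c, e] : set mR) : mR -> R).
  by apply: measurable_indic; exact: measurable_itv.
have restr (c e : R) : `[c, e] `<=` `[0, a + b] ->
    cintegrable leb setT (fun s => if s \in `[c, e]%classic then f s else 0).
  move=> sub; rewrite (_ : (fun s => _) = fun s =>
    (if s \in `[0, a + b]%classic then f s else 0) * ((\1_(`[c, e] : set mR) s)%:C)%C).
    apply: CintM => //; first by apply: cmeas_real.
    by move=> s; rewrite indicE cabs_real; case: (_ \in _); rewrite ?normr0 ?normr1.
  apply/funext => s; rewrite indicE; case: ifPn => [|_]; last by rewrite mulr0.
  by rewrite inE => /sub/mem_set ->; rewrite mulr1.
have i1 := restr 0 a ltac:(by move=> s /=; rewrite !in_itv/= => /andP[-> /le_trans->//]; rewrite lerDl).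
have i2 := restr a (a + b) ltac:(by move=> s /=; rewrite !in_itv/= => /andP[/(le_trans a0) -> ->]).
have [_ e2] := cint_lebesgue_shift a i2.
rewrite (_ : (fun s => if s \in `[0, b]%classic then _ else 0) =
  fun s => if s + a \in `[a, a + b]%classic then f (s + a) else 0); last first.
  by apply/funext => s; rewrite !mem_setE !in_itv/= lerDr (addrC s) lerD2l.
rewrite e2 -cintD//.
apply: (ae_cint_eq fi (Cint_meas (CintD i1 i2)) _).2.
have : leb.-negligible [set a].
  by apply/negligibleP; [exact: measurable_set1|exact: lebesgue_measure_set1].
apply: negligibleS => s /= ns; apply: contrapT => sa; apply: ns.
rewrite !mem_setE !in_itv/=.
have [s1|s1|s1] := ltgtP s a; last by case: sa.
  by rewrite andFb addr0 andbT (_ : s <= a + b) ?andbT// (le_trans (ltW s1))// lerDl.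
by rewrite andbF add0r andTb (le_trans a0 (ltW s1)).
Qed.

(** In an exponentially weighted norm each time integration gains a factor
    [1 / L]; this is what closes the Gronwall and Picard arguments. *)
Lemma integral_exp_le (L M t : R) : 0 < L -> 0 <= M -> 0 <= t ->
  (\int[leb]_(s in `[0%R, t]) (M * expR (L * s))%:E <= (M * expR (L * t) / L)%:E)%E.
Proof.
move=> L0 M0; rewrite le_eqVlt => /predU1P[<-|t0].
  by rewrite set_itv1 integral_set1 lee_fin divr_ge0 ?mulr_ge0 ?expR_ge0// ltW.
have dF (s : R) : is_derive s 1 (fun s => M / L * expR (L * s)) (M * expR (L * s)).
  have h : is_derive s 1 (fun s : R => L * s) L.
    have h0 := @is_deriveZ _ _ _ (@id R) L s 1 1 (is_derive_id s 1).
    have e : L *: (1 : R) = L by rewrite /GRing.scale/= mulr1.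
    exact: (is_derive_eq h0 e).
  have h2 : is_derive s 1 (fun s : R => expR (L * s)) (L * expR (L * s)).
    have h0 := @is_derive1_comp _ (@expR R) (fun s : R => L * s) s _ _ (is_derive_expR _) h.
    by rewrite mulrC; exact: h0.
  have h3 := @is_deriveZ _ _ _ (fun s : R => expR (L * s)) (M / L) s 1 _ h2.
  have e : (M / L) *: (L * expR (L * s)) = M * expR (L * s).
    by rewrite /GRing.scale/= mulrA divfK// gt_eqF.
  exact: (is_derive_eq h3 e).
have cF : continuous (fun s : R => M / L * expR (L * s)).
  by move=> s; apply: differentiable_continuous; apply/derivable1_diffP; case: (dF s).
have cf : continuous (fun s : R => M * expR (L * s)).
  move=> s; apply: cvgMr; apply: (@continuous_comp _ _ _ (fun s : R => L * s) expR).
    by apply: cvgMr; exact: cvg_id.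
  exact: continuous_expR.
rewrite (@continuous_FTC2 _ _ (fun s => M / L * expR (L * s)))//.
- rewrite -EFinB lee_fin mulr0 expR0 mulr1 (_ : M * _ / L = M / L * expR (L * t)); last by ring.
  by rewrite lerBlDr lerDl divr_ge0// ltW.
- by apply: continuous_subspaceT.
- split.
  + by move=> x _; case: (dF x).
  + by apply: cvg_at_right_filter; exact: cF.
  + by apply: cvg_at_left_filter; exact: cF.
- by move=> x _; rewrite derive1E; case: (dF x).
Qed.

End time.

Section curves_time.
Context {R : realType} {d : nat} (S : fsetting R d).
Local Notation V := 'rV[R]_d.
Local Notation Nw := (Nw S).
Local Notation N := (Nw (fun=> 1)).
Local Notation inW := (inW S).
Local Notation contW := (contW S).
Local Notation flow := (@flow R d S).
Local Notation leb := (@lebesgue_measure R).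
Local Notation mR := (measurableTypeR R).
Implicit Types (f : R -> V -> R[i]) (T t s : R).

Lemma measurable_NwT T f w : contW T f -> weight S w ->
  measurable_fun (`[0, T] : set mR) (fun s => Nw w (f s)).
Proof.
by move=> /contW_joint[g fg] ww; apply: joint_Nw_meas fg ww; exact: measurable_itv.
Qed.

Lemma int_cst_itv t (B : R) : 0 <= t ->
  (\int[leb]_(s in `[0%R, t]) B%:E = (t * B)%:E)%E.
Proof.
move=> t0; rewrite integral_cst//= lebesgue_measure_itv/= lte_fin.
move: t0; rewrite le_eqVlt => /predU1P[<-|->].
  by rewrite ltxx mule0 mul0r.
by rewrite oppr0 adde0 -EFinM mulrC.
Qed.

Lemma le_int_itv t (u v : R -> \bar R) : measurable_fun (`[0, t] : set mR) u ->
  measurable_fun (`[0, t] : set mR) v ->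
  (forall s, 0 <= s <= t -> (0 <= u s)%E /\ (u s <= v s)%E) ->
  (\int[leb]_(s in `[0%R, t]) u s <= \int[leb]_(s in `[0%R, t]) v s)%E.
Proof.
move=> mu mv uv; apply: ge0_le_integral => //.
- by move=> s; rewrite /= in_itv/= => /uv[].
- by move=> s; rewrite /= in_itv/= => /uv[].
Qed.

Section fixed.
Variables (t : R) (f : R -> V -> R[i]).
Hypotheses (t0 : 0 <= t) (cf : contW t f).

Let jf : exists2 g, joint (T := mR) (S := S) `[0, t] f g &
  (\int[leb]_(s in `[0%R, t]) N (f s) < +oo)%E.
Proof.
have [g fg] := contW_joint cf; exists g => //.
have [K K0 NK] := contW_bounded cf.
apply: (@le_lt_trans _ _ (\int[leb]_(s in `[0%R, t]) K%:E)%E).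
  apply: le_int_itv => //; first exact: measurable_NwT (weight1 S).
  by move=> s s0; split; [exact: N_ge0|exact: NK].
by rewrite int_cst_itv// ltry.
Qed.

Lemma Cint_time x : cintegrable leb `[0, t] (fun s => f s x).
Proof.
have [g fg fi] := jf.
by apply: (joint_Cint x _ fg fi); exact: measurable_itv.
Qed.

Lemma inW_time : inW (fun x => time_integral t (fun s => f s x)).
Proof.
have [g fg fi] := jf.
by apply: (joint_inW _ fg fi); exact: measurable_itv.
Qed.

Lemma Nw_time w : weight S w ->
  (Nw w (fun x => time_integral t (fun s => f s x)) <=
   \int[leb]_(s in `[0%R, t]) Nw w (f s))%E.
Proof.
move=> ww; have [g fg fi] := jf.
by apply: (joint_Nw _ fg fi ww); exact: measurable_itv.
Qed.

Lemma flow_time r y : flow r y (fun x => time_integral t (fun s => f s x)) =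
  fun x => time_integral t (fun s => flow r y (f s) x).
Proof.
have [g fg fi] := jf.
by apply: (joint_flow _ fg fi); exact: measurable_itv.
Qed.

Lemma N_time_cst (B : R) : (forall s, 0 <= s <= t -> (N (f s) <= B%:E)%E) ->
  (N (fun x => time_integral t (fun s => f s x)) <= (t * B)%:E)%E.
Proof.
move=> fB; apply: le_trans (Nw_time (weight1 S)) _; rewrite -int_cst_itv//.
apply: le_int_itv => //; first exact: measurable_NwT (weight1 S).
by move=> s s0; split; [exact: N_ge0|exact: fB].
Qed.

Lemma N_time_exp (L M : R) : 0 < L -> 0 <= M ->
  (forall s, 0 <= s <= t -> (N (f s) <= (M * expR (L * s))%:E)%E) ->
  (N (fun x => time_integral t (fun s => f s x)) <= (M * expR (L * t) / L)%:E)%E.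
Proof.
move=> L0 M0 fB; apply: le_trans (Nw_time (weight1 S)) _.
apply: le_trans (integral_exp_le L0 M0 t0).
apply: le_int_itv => //; first exact: measurable_NwT (weight1 S).
  apply/measurable_EFinP; apply: measurable_funM => //.
  apply: measurableT_comp; first exact: measurable_expR.
  by apply: measurable_funM.
by move=> s s0; split; [exact: N_ge0|exact: fB].
Qed.

End fixed.

Lemma timeD t f f' x : 0 <= t -> contW t f -> contW t f' ->
  time_integral t (fun s => f s x + f' s x) =
  time_integral t (fun s => f s x) + time_integral t (fun s => f' s x).
Proof.
move=> t0 cf cf'; have := Cint_time t0 cf' x; have := Cint_time t0 cf x.
move=> /(cintegrable_mkcond leb _ (measurable_itv _)) fi.
move=> /(cintegrable_mkcond leb _ (measurable_itv _)) fi'.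
rewrite !time_integralE -cintD//; apply: eq_cint => s.
by case: ifP => // _; rewrite addr0.
Qed.

Lemma timeZ t z f x : 0 <= t -> contW t f ->
  time_integral t (fun s => z * f s x) = z * time_integral t (fun s => f s x).
Proof.
move=> t0 cf; have := Cint_time t0 cf x.
move=> /(cintegrable_mkcond leb _ (measurable_itv _)) fi.
rewrite !time_integralE -cintZ//; apply: eq_cint => s.
by case: ifP => // _; rewrite mulr0.
Qed.

Lemma timeB t f f' x : 0 <= t -> contW t f -> contW t f' ->
  time_integral t (fun s => f s x - f' s x) =
  time_integral t (fun s => f s x) - time_integral t (fun s => f' s x).
Proof.
move=> t0 cf cf'; have cN := contWZ (-1) cf'.
rewrite -mulN1r -(@timeZ _ _ f')// -(@timeD t f (fun s x => -1 * f' s x))//.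
by congr time_integral; apply/funext => s; rewrite mulN1r.
Qed.

Lemma time_eq t (f f' : R -> R[i]) : (forall s, 0 <= s <= t -> f s = f' s) ->
  time_integral t f = time_integral t f'.
Proof.
move=> ff; rewrite !time_integralE; apply: eq_cint => s.
by case: ifPn => //; rewrite mem_setE in_itv/= => /ff.
Qed.

Lemma time_split a b f x : 0 <= a -> 0 <= b -> contW (a + b) f ->
  time_integral (a + b) (fun s => f s x) =
  time_integral a (fun s => f s x) + time_integral b (fun s => f (s + a) x).
Proof.
move=> a0 b0 cf; apply: (time_integral_split (f := fun s => f s x)) => //.
by apply: Cint_time => //; exact: addr_ge0.
Qed.

Lemma contW_time T f : contW T f ->
  contW T (fun t x => time_integral t (fun s => f s x)).
Proof.
move=> cf; have [K K0 NK] := contW_bounded cf.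
have diff s s' : 0 <= s -> s <= s' -> s' <= T ->
    (N (fun x => time_integral s' (fun r => f r x) - time_integral s (fun r => f r x))%R
      <= ((s' - s) * K)%:E)%E.
  move=> s0 ss sT; have s'E : s' = s + (s' - s) by ring.
  have cs : contW (s' - s) (fun r => f (r + s)).
    apply: contW_le (contW_shift (a := s) (T := T) _ cf); first by rewrite lerD2r.
    by rewrite s0 (le_trans ss).
  rewrite (@Nw_ext _ _ _ _ _ (fun x => time_integral (s' - s) (fun r => f (r + s) x))).
    apply: N_time_cst => //; first by rewrite subr_ge0.
    move=> r /andP[r0 r1]; apply: NK; rewrite addr_ge0//=.
    by apply: le_trans sT; rewrite -lerBrDr.
  move=> x; rewrite {1}s'E time_split//; last 2 first.
  - by rewrite subr_ge0.
  - by rewrite -s'E; apply: contW_le cf.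
  by rewrite addrC addKr.
apply: (@contW_dom _ _ _ _ _ (fun s s' => (`|s' - s| * K)%:E)).
- by move=> s /andP[s0 sT]; apply: inW_time => //; exact: contW_le cf.
- move=> s s' /andP[s0 sT] /andP[s'0 s'T].
  have [ss|/ltW ss] := leP s s'; first by rewrite ger0_norm ?subr_ge0// diff.
  by rewrite Nw_subC ?ler0_norm ?subr_le0// ?opprB ?diff//; exact: weight1.
- move=> s e _ e0; exists (e / (K + 1)); first by rewrite divr_gt0// ltr_wpDl.
  move=> s' _ h; rewrite lee_fin; apply: le_trans (mul_frac_le K0 e0).
  by rewrite mulrC ler_wpM2l// ltW.
Qed.

(** Twice the integral is the integral of [f s + f (s + h)] plus two end pieces
    of length [h]. When a factor changes sign over [h], the sum is small: this
    replaces integration by parts in time. *)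
Lemma N_time_half_period T t h A B f : contW T f -> 0 <= t <= T -> 0 < h ->
  0 <= A -> 0 <= B ->
  (forall s, 0 <= s -> s + h <= t -> (N (fun x => f s x + f (s + h) x)%R <= A%:E)%E) ->
  (forall s, 0 <= s <= t -> (N (f s) <= B%:E)%E) ->
  (N (fun x => time_integral t (fun s => f s x)) <= (t * A + h * B)%:E)%E.
Proof.
move=> cf /andP[t0 tT] h0 A0 B0 fA fB; have ct := contW_le tT cf.
have [ht|ht] := leP t h.
  apply: le_trans (N_time_cst t0 ct fB) _; rewrite lee_fin.
  by apply: ler_wpDl; [exact: mulr_ge0|exact: ler_wpM2r].
have r0 : 0 <= t - h by rewrite subr_ge0 ltW.
have tE : t = h + (t - h) by ring.
have tE' : t = (t - h) + h by ring.
have csh : contW (t - h) (fun s => f (s + h)).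
  by apply: contW_shift => //; rewrite (ltW h0) (ltW ht).
have csr : contW h (fun s => f (s + (t - h))).
  rewrite {1}(_ : h = t - (t - h)); last by ring.
  by apply: contW_shift => //; rewrite r0 lerBlDr lerDl ltW.
have c1 : contW (t - h) f by apply: contW_le ct; rewrite lerBlDr lerDl ltW.
have c2 : contW h f by apply: contW_le ct; exact: ltW.
pose I := fun x => time_integral t (fun s => f s x).
pose I1 := fun x => time_integral (t - h) (fun s => f s x + f (s + h) x).
pose I2 := fun x => time_integral h (fun s => f s x).
pose I3 := fun x => time_integral h (fun s => f (s + (t - h)) x).
(* split [I] after a first piece of length [h], and before a last one *)
have IE : I =1 fun x => (2^-1%:C)%C * (I1 x + (I2 x + I3 x)).
  move=> x; rewrite /I1 (@timeD _ f (fun s => f (s + h)))//.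
  have e1 : I x = I2 x + time_integral (t - h) (fun s => f (s + h) x).
    by rewrite /I /I2 {1}tE time_split ?(ltW h0)//; rewrite -tE.
  have e2 : I x = time_integral (t - h) (fun s => f s x) + I3 x.
    by rewrite /I /I3 {1}tE' time_split ?(ltW h0)//; rewrite -tE'.
  rewrite (_ : _ + _ + _ = I x + I x); last by rewrite {1}e2 e1 /I2 /I3; ring.
  by apply: complexP; rewrite !(ReM, ImM, ReD, ImD)/=; lra.
have c3 := contWD c1 csh.
have W1 : inW I1 by exact: (inW_time r0 c3).
have W2 : inW I2 by apply: inW_time => //; exact: ltW.
have W3 : inW I3 by apply: inW_time => //; exact: ltW.
rewrite -/I (Nw_ext _ _ IE) NwZ; [|exact: weight1|by apply: inWD => //; exact: inWD].
rewrite cabs_real ger0_norm ?invr_ge0//.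
have b1 : (N I1 <= ((t - h) * A)%:E)%E.
  apply: (N_time_cst r0 c3).
  by move=> s /andP[s0 s1]; apply: fA => //; rewrite -lerBrDr.
have b2 : (N I2 <= (h * B)%:E)%E.
  apply: N_time_cst => //; first exact: ltW.
  by move=> s /andP[s0 s1]; apply: fB; rewrite s0 (le_trans s1 (ltW ht)).
have b3 : (N I3 <= (h * B)%:E)%E.
  apply: N_time_cst => //; first exact: ltW.
  move=> s /andP[s0 s1]; apply: fB; rewrite addr_ge0//=.
  by rewrite [leRHS]tE lerD2r.
have b23 := le_trans (NwD I2 I3 (weight1 S)) (leeD b2 b3).
have b := le_trans (NwD I1 _ (weight1 S)) (leeD b1 b23).
apply: le_trans (lee_wpmul2l _ b) _; first by rewrite lee_fin invr_ge0.
rewrite -!EFinD -EFinM lee_fin; nra.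
Qed.

End curves_time.

(** * Derivatives control frequency weights *)

Section difference_quotient.
Context {R : realType}.

Lemma sin_quotient_cvg (s : nat -> R) : (forall n, s n != 0) ->
  s @ \oo --> (0 : R) -> sin (s n) / s n @[n --> \oo] --> (1 : R).
Proof.
move=> s0 cs.
have [h1 h2] := @is_derive_sin R 0.
have h3 : h^-1 *: ((sin \o shift 0) (h *: 1) - sin 0) @[h --> 0^'] --> (1 : R).
  by rewrite -[X in _ --> X](@cos0 R) -h2; exact: h1.
have cs' : s @ \oo --> (0 : R)^'.
  move=> A A0; have : \forall n \near \oo, s n != 0 -> A (s n) by exact: (cs _ A0).
  by apply: filterS => n; apply; exact: s0.
have := cvg_comp _ _ cs' h3.
apply: cvg_trans; apply: near_eq_cvg; apply: nearW => n /=.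
by rewrite sin0 subr0 /GRing.scale/= mulr1 addr0 mulrC.
Qed.

Lemma expi_quotient_cvg (th : R) :
  n.+1%:R * cabs (expi (n.+1%:R^-1 * th) - 1) @[n --> \oo] --> `|th|.
Proof.
have [->|th0] := eqVneq th 0.
  rewrite normr0 (_ : (fun n => _) = fun=> 0); first exact: cvg_cst.
  by apply/funext => n; rewrite mulr0 expi0 subrr cabs0 mulr0.
pose s (n : nat) : R := n.+1%:R^-1 * th / 2.
have s0 n : s n != 0 by rewrite /s !mulf_neq0 ?invr_eq0 ?pnatr_eq0.
have cs : s n @[n --> \oo] --> (0 : R).
  rewrite -(mul0r (th / 2)); apply: cvg_trans (cvgMl (@cvg_harmonic R)).
  by apply: near_eq_cvg; apply: nearW => n; rewrite /s /harmonic/= mulrA.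
have h : `|th| * `|sin (s n) / s n| @[n --> \oo] --> `|th| * `|1 : R|.
  by apply: cvgMr; apply: cvg_norm; exact: sin_quotient_cvg.
rewrite normr1 mulr1 in h; apply: cvg_trans h.
apply: near_eq_cvg; apply: nearW => n; rewrite cabs_expiB1E -normrM -/(s n).
rewrite -[n.+1%:R]ger0_norm ?ler0n// -normrM; congr `|_|.
rewrite {2}/s; field.
by rewrite th0/= nat1r pnatr_eq0.
Qed.

End difference_quotient.

Section derivative_weights.
Context {R : realType} {d : nat} (S : fsetting R d).
Local Notation G := (fs_G S).
Local Notation mu := (fs_mu S).
Local Notation vec := (@fs_vec _ _ S).
Local Notation V := 'rV[R]_d.
Local Notation Nw := (Nw S).
Local Notation N := (Nw (fun=> 1)).
Local Notation inW := (inW S).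
Local Notation flow := (@flow R d S).
Local Notation leb := (@lebesgue_measure R).
Implicit Types (w : V -> R).

Lemma weightM_coord w i : weight S w -> weight S (fun v => w v * `|v 0 i|).
Proof.
move=> [w0 mw]; split; first by move=> v; rewrite mulr_ge0.
apply: measurable_funM => //; apply: measurableT_comp => //; exact: fs_mvec.
Qed.

Lemma Nw_sum (ws : 'I_d -> V -> R) f : (forall i, weight S (ws i)) -> inW f ->
  (Nw (fun v => (\sum_i ws i v)%R) f <= \sum_i Nw (ws i) f)%E.
Proof.
move=> ww [g fg].
have ww' : weight S (fun v => \sum_i ws i v).
  split; first by move=> v; apply: sumr_ge0 => i _; case: (ww i).
  by apply: measurable_sum => i; case: (ww i).
rewrite (NwE ww' fg) (eq_bigr _ (fun i _ => NwE (ww i) fg)) /wint.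
rewrite -ge0_integral_sum//; last 2 first.
- by move=> i; apply: measurable_wint => //; exact: Cint_meas fg.1.
- by move=> i a _; rewrite lee_fin mulr_ge0 ?cabs_ge0//; case: (ww i).
rewrite le_eqVlt; apply/orP; left; apply/eqP; apply: eq_integral => a _.
by rewrite mulr_suml sumEFin.
Qed.

Section line.
Variables (f : V -> R[i]) (i : 'I_d).
Hypotheses (fW : inW f) (df : cderivable i f) (dW : inW (partial i f)).
Local Notation e := (delta_mx 0 i : V).

Let cD : contW S 1 (fun s x => partial i f (x + s *: e)).
Proof.
apply: (contW_eq (f := fun s => flow (0 + s * 0) (0 + s *: e) (partial i f))).
  by move=> s _ x; rewrite mulr0 !add0r flow_translate.
by apply: contW_flow; exact: contW_cst.
Qed.

Let cont_line x (p : R[i] -> R) : (forall z z' : R[i], `|p z - p z'| <= cabs (z - z')) ->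
  continuous (fun s : R => p (partial i f (x + s *: e))).
Proof.
have E (a b : R) : x + a *: e + (b - a) *: e = x + b *: e.
  by rewrite -addrA -scalerDl (addrC a) subrK.
move=> hp s; apply/cvgrPdist_le => eps eps0.
have [h h0 H] := flow_cont (S := S) 0 e dW eps0.
apply: filterS (nbhsx_ballx s _ h0) => s'; rewrite /ball/= distrC => s's.
have {}H := H _ s's.
apply: le_trans (hp _ _) _; rewrite cabs_subC -lee_fin.
apply: le_trans H; apply: le_trans (sup_le_N S _ (x + s *: e)).
rewrite mulr0 flow_translate//.
by rewrite E.
Qed.

Let line_derive (p : R[i] -> R) x h :
  (forall z z' : R[i], `|p z - p z'| <= cabs (z - z')) ->
  (forall y, derivable (fun y => p (f y) : R^o) y e) ->
  (forall y, 'D_e (fun y => p (f y) : R^o) y = p (partial i f y)) ->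
  0 < h -> Rintegral leb `[0, h] (fun s => p (partial i f (x + s *: e))) =
    p (f (x + h *: e)) - p (f x).
Proof.
move=> hp dp Dp h0.
pose F (s : R) : R := p (f (x + s *: e)).
have dF (s : R) : is_derive s 1 F (p (partial i f (x + s *: e))).
  have E : (fun k : R => k^-1 *: ((F \o shift s) (k *: 1) - F s)) =
      (fun k : R => k^-1 *: (((fun y => p (f y) : R^o) \o shift (x + s *: e)) (k *: e) - p (f (x + s *: e)))).
    apply/funext => k /=; congr (_ *: (p (f _) - _)).
    have -> : k *: (1 : R) = k by rewrite /GRing.scale/= mulr1.
    by rewrite scalerDl addrCA.
  split; first by rewrite /derivable E; exact: dp.
  by rewrite /derive E; exact: Dp.
have cF : continuous F.
  by move=> s; apply: differentiable_continuous; apply/derivable1_diffP; case: (dF s).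
rewrite /Rintegral (@continuous_FTC2 _ _ F)//.
- by rewrite /= /F scale0r addr0.
- by apply: continuous_subspaceT; exact: cont_line.
- split.
  + by move=> s _; case: (dF s).
  + by apply: cvg_at_right_filter; exact: cF.
  + by apply: cvg_at_left_filter; exact: cF.
- by move=> s _; rewrite derive1E; case: (dF s).
Qed.

(** The fundamental theorem of calculus along a line, where the derivative is
    continuous because it lies in the algebra. *)
Lemma increment_partial h x : 0 < h ->
  f (x + h *: e) - f x = time_integral h (fun s => partial i f (x + s *: e)).
Proof.
move=> h0; apply: complexP; rewrite ?(ReD, ImD, ReN, ImN) /time_integral /cintegral [RHS]/=.
- apply/esym/line_derive => //.
  + by move=> z z'; rewrite -ReN -ReD le_Re_cabs.
  + by move=> y; case: (df y).
- apply/esym/line_derive => //.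
  + by move=> z z'; rewrite -ImN -ImD le_Im_cabs.
  + by move=> y; case: (df y).
Qed.

Let quotient_le w n : weight S w ->
  (\int[mu]_a ((w (vec a) * (n.+1%:R * cabs (expi (n.+1%:R^-1 * vec a 0 i) - 1))) *
     cabs (fhat f a))%:E <= Nw w (partial i f))%E.
Proof.
move=> ww; have h0 : 0 < n.+1%:R^-1 :> R by rewrite invr_gt0.
set h := n.+1%:R^-1 : R.
have [fi _] := isF_fhat fW.
have F1 := flow_sub_isF 0 (h *: e) (isF_fhat fW).
have E1 : (fun x => flow 0 (h *: e) f x - f x) =
    fun x => time_integral h (fun s => partial i f (x + s *: e)).
  by apply/funext => x; rewrite flow_translate// -increment_partial.
rewrite E1 in F1.
have h1 : h <= 1 by rewrite invf_le1 ?ler1n.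
have ch := contW_le h1 cD.
have H := Nw_time (ltW h0) ch ww.
rewrite (NwE ww F1) in H.
have HH : (\int[leb]_(s in `[0%R, h]) Nw w (fun x => partial i f (x + s *: e)%R) =
    h%:E * Nw w (partial i f))%E.
  under eq_integral do rewrite Nw_translate//.
  rewrite integral_cst//= lebesgue_measure_itv/= lte_fin h0 oppr0 adde0 muleC//.
rewrite HH in H.
have -> : (\int[mu]_a ((w (vec a) * (n.+1%:R * cabs (expi (h * vec a 0 i) - 1))) *
     cabs (fhat f a))%:E = n.+1%:R%:E * wint w (fun a => ((expi (phase_at 0 (h *: e) (vec a)) - 1) * fhat f a)%R))%E.
  rewrite /wint -ge0_integralZl//; last 2 first.
  - by apply: measurable_wint => //; exact: Cint_meas F1.1.
  - by move=> a _; rewrite lee_fin mulr_ge0 ?cabs_ge0//; case: ww.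
  apply: eq_integral => a _; rewrite -EFinM cabsM /phase_at mul0r add0r dotZl dot_delta.
  by congr (_%:E); ring.
apply: le_trans (lee_wpmul2l _ H) _; first by rewrite lee_fin.
by rewrite muleA -EFinM mulfV ?mul1e.
Qed.

(** The increment [f (x + h e_i) - f x] is the integral of the partial
    derivative over a segment of length [h], hence at most [h] times as large in
    norm, while its transform is that of [f] times [expi (h xi_i) - 1]. For
    [h = 1 / (n + 1)] Fatou's lemma gives the weight [|xi_i|]. *)
Lemma Nw_partial w : weight S w ->
  (Nw (fun v => w v * `|v 0%R i|)%R f <= Nw w (partial i f))%E.
Proof.
move=> ww; have fF := isF_fhat fW; have mf := Cint_meas fF.1.
rewrite (NwE (weightM_coord i ww) fF) /wint.
pose q (n : nat) (a : G) : \bar R := ((w (vec a) * (n.+1%:R * cabs (expi (n.+1%:R^-1 * vec a 0 i) - 1))) *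
     cabs (fhat f a))%:E.
have q0 n a : (0 <= q n a)%E.
  by rewrite lee_fin !mulr_ge0 ?cabs_ge0//; case: ww.
have mq n : measurable_fun setT (q n).
  apply/measurable_EFinP; apply: measurable_funM; last exact: measurable_cabs.
  apply: measurable_funM; first by case: ww.
  apply: measurable_funM => //; apply: measurable_cabs; apply: cmeasB; last exact: cmeas_cst.
  by apply: cmeas_expi; apply: measurable_funM => //; exact: fs_mvec.
have qc a : limn_einf (q^~ a) = (w (vec a) * `|vec a 0 i| * cabs (fhat f a))%:E.
  have h : q n a @[n --> \oo] --> (w (vec a) * `|vec a 0 i| * cabs (fhat f a))%:E.
    apply: cvg_EFin; first exact: nearW.
    rewrite /q /comp /=.
    by apply: cvgMl; apply: cvgMr; exact: expi_quotient_cvg.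
  by have [] := cvg_limn_einf_sup h.
under eq_integral do rewrite -qc.
apply: le_trans (fatou mu measurableT mq (fun n a _ => q0 n a)) _.
have hle n : (\int[mu]_a q n a <= Nw w (partial i f))%E by exact: quotient_le.
rewrite limn_einf_lim; apply: lime_le; first exact: is_cvg_einfs.
apply: nearW => n; apply: le_trans (hle n).
by apply: ereal_inf_lbound; exists n => /=.
Qed.

End line.

Lemma Nw_l1norm_partial (f : V -> R[i]) : inW f ->
  (forall i, cderivable i f /\ inW (partial i f)) ->
  (Nw l1norm f <= \sum_i N (partial i f))%E.
Proof.
move=> fW df.
have -> : @l1norm R d = fun v => \sum_i 1 * `|v 0 i|.
  by apply/funext => v; apply: eq_bigr => i _; rewrite mul1r.
apply: le_trans (Nw_sum (ws := fun i v => 1 * `|v 0 i|) _ fW) _.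
  by move=> i; apply: weightM_coord; exact: weight1.
apply: lee_sum => i _; have [d1 W1] := df i.
exact: (@Nw_partial f i fW d1 W1 (fun=> 1) (weight1 S)).
Qed.

Lemma Nw_sqnorm_partial (f : V -> R[i]) : inW f ->
  (forall i, cderivable i f /\ inW (partial i f)) ->
  (forall i, cderivable i (partial i f) /\ inW (partial i (partial i f))) ->
  (Nw (@sqnorm R d) f <= \sum_i N (partial i (partial i f)))%E.
Proof.
move=> fW df ddf.
have -> : @sqnorm R d = fun v => \sum_i (1 * `|v 0 i|) * `|v 0 i|.
  apply/funext => v; apply: eq_bigr => i _.
  by rewrite mul1r -normrM ger0_norm// -expr2 sqr_ge0.
have wi i : weight S (fun v => 1 * `|v 0 i|) by apply: weightM_coord; exact: weight1.
apply: le_trans (Nw_sum (ws := fun i v => (1 * `|v 0 i|) * `|v 0 i|) _ fW) _.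
  by move=> i; exact: weightM_coord.
apply: lee_sum => i _; have [d1 W1] := df i; have [d2 W2] := ddf i.
apply: le_trans (Nw_partial fW d1 W1 (wi i)) _.
exact: (@Nw_partial (partial i f) i W1 d2 W2 (fun=> 1) (weight1 S)).
Qed.

End derivative_weights.

(** * Sums over tuples *)

Section sums.
Context {R : realType}.

Lemma csum_reindex (I K : choiceType) (P : set I) (Q : set K) (e : I -> K)
    (f : K -> R[i]) : set_bij P Q e -> csum Q f = csum P (f \o e).
Proof.
move=> eb; congr (_ +i* _)%C; congr (fine _ - fine _);
  exact: (reindex_esum P Q e).
Qed.

Lemma csummable_reindex (I K : choiceType) (P : set I) (Q : set K) (e : I -> K)
    (f : K -> R[i]) : set_bij P Q e -> csummable Q f = csummable P (f \o e).
Proof. by move=> eb; rewrite /csummable (reindex_esum P Q e _ eb). Qed.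

Lemma rsumN (I : choiceType) (A : set I) (f : I -> R) :
  rsum A (fun i => - f i) = - rsum A f.
Proof. by rewrite /rsum opprB; under [in X in _ - X]eq_esum do rewrite opprK. Qed.

Lemma csum_conj (I : choiceType) (A : set I) (f : I -> R[i]) :
  csum A (fun i => conjc (f i)) = conjc (csum A f).
Proof.
rewrite /csum /= -rsumN; congr (_ +i* _)%C; congr (rsum A _);
  by apply/funext => i; case: (f i).
Qed.

Lemma csummable_conj (I : choiceType) (A : set I) (f : I -> R[i]) :
  csummable A f -> csummable A (fun i => conjc (f i)).
Proof.
move=> fs; rewrite /csummable (eq_esum (b := fun i => (cabs (f i))%:E))// => i _.
by rewrite cabs_conj.
Qed.

Lemma csum_nonneg (I : choiceType) (A : set I) (h : I -> R) : (forall i, 0 <= h i) ->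
  csum A (fun i => ((h i)%:C)%C) = ((fine (\esum_(i in A) (h i)%:E)%E)%:C)%C.
Proof.
move=> h0; rewrite /csum /rsum /=.
rewrite [X in _ - fine X]esum1 ?subr0; last first.
  by move=> i _; rewrite (max_r _)// oppr_le0.
rewrite [X in (_ +i* X)%C](_ : _ = 0); last first.
  by rewrite !esum1 ?subrr// => i _; rewrite ?oppr0 maxxx.
by congr (fine _ +i* _)%C; apply: eq_esum => i _; rewrite max_l.
Qed.

Section fubini.
Context (I K : countType) (i0 : I) (k0 : K).

Let parts (f : I * K -> R[i]) : f = fun x =>
  ((((Num.max (Re (f x)) 0)%:C)%C + (-1) * ((Num.max (- Re (f x)) 0)%:C)%C) +
   (0 +i* 1)%C * (((Num.max (Im (f x)) 0)%:C)%C + (-1) * ((Num.max (- Im (f x)) 0)%:C)%C)).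
Proof.
have max0 (t : R) : t = Num.max t 0 + -1 * Num.max (- t) 0.
  rewrite mulN1r; have [t0|t0] := leP t 0.
    by rewrite max_l ?oppr_ge0// opprK add0r.
  by rewrite max_r ?subr0// oppr_le0 ltW.
apply/funext => x; apply: complexP; rewrite !(ReD, ImD, ReM, ImM)/=.
  by rewrite [LHS]max0; ring.
by rewrite [LHS]max0; ring.
Qed.

(** Fubini's theorem for absolutely summable families, by reduction to the four
    nonnegative parts, for which it is a statement on [\esum]. *)
Lemma csum_csum (A : set I) (B : I -> set K) (f : I * K -> R[i]) :
  csummable (A `*`` B) f ->
  csummable A (fun i => csum (B i) (fun k => f (i, k))) /\
  csum (A `*`` B) f = csum A (fun i => csum (B i) (fun k => f (i, k))).
Proof.
pose P (f : I * K -> R[i]) := [/\ csummable (A `*`` B) f,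
  forall i, A i -> csummable (B i) (fun k => f (i, k)),
  csummable A (fun i => csum (B i) (fun k => f (i, k))) &
  csum (A `*`` B) f = csum A (fun i => csum (B i) (fun k => f (i, k)))].
have PD g h : P g -> P h -> P (fun x => g x + h x).
  move=> [g1 g2 g3 g4] [h1 h2 h3 h4].
  have E i : A i -> csum (B i) (fun k => g (i, k) + h (i, k)) =
      csum (B i) (fun k => g (i, k)) + csum (B i) (fun k => h (i, k)).
    by move=> Ai; rewrite (csumD k0)//; [exact: g2|exact: h2].
  split.
  - exact: (csummableD (i0, k0)).
  - by move=> i Ai; apply: (csummableD k0); [exact: g2|exact: h2].
  - by rewrite /csummable; under eq_esum => i Ai do rewrite (E _ Ai); exact: (csummableD i0).
  - by rewrite (csumD (i0, k0))// g4 h4 -(csumD i0)//; apply/esym; exact: csum_eq.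
have PZ z g : P g -> P (fun x => z * g x).
  move=> [g1 g2 g3 g4].
  have E i : A i -> csum (B i) (fun k => z * g (i, k)) = z * csum (B i) (fun k => g (i, k)).
    by move=> Ai; rewrite (csumZ k0)//; exact: g2.
  split.
  - exact: (csummableZ (i0, k0)).
  - by move=> i Ai; apply: (csummableZ k0); exact: g2.
  - by rewrite /csummable; under eq_esum => i Ai do rewrite (E _ Ai); exact: (csummableZ i0).
  - by rewrite (csumZ (i0, k0))// g4 -(csumZ i0)//; apply/esym; exact: csum_eq.
have Ppos (h : I * K -> R) : (forall x, 0 <= h x) ->
    (\esum_(x in A `*`` B) (h x)%:E < +oo)%E -> P (fun x => ((h x)%:C)%C).
  move=> h0 hs.
  have absE x : cabs ((h x)%:C)%C = h x by rewrite cabs_real ger0_norm.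
  have ee := @esum_esum R I K A B (fun i k => (h (i, k))%:E) (fun i j _ _ => h0 _).
  have eE : (\esum_(k in A `*`` B) (h (k.1, k.2))%:E = \esum_(x in A `*`` B) (h x)%:E)%E.
    by apply: eq_esum => -[].
  rewrite eE in ee; rewrite -ee in hs.
  have fin i : A i -> (\esum_(k in B i) (h (i, k))%:E < +oo)%E.
    move=> Ai; apply: le_lt_trans hs.
    rewrite -[leLHS](@esum_set1 _ _ i (fun i => \esum_(k in B i) (h (i, k))%:E)%E).
      rewrite (esum_mkcond [set i]) (esum_mkcond A); apply: le_esum => i' _.
      case: ifPn => [|_]; first by rewrite inE => ->; rewrite mem_set.
      by case: ifP => // _; apply: esum_ge0 => k _; rewrite lee_fin.
    by apply: esum_ge0 => k _; rewrite lee_fin.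
  have fE i : A i -> csum (B i) (fun k => ((h (i, k))%:C)%C) =
      ((fine (\esum_(k in B i) (h (i, k))%:E)%E)%:C)%C.
    by move=> Ai; rewrite csum_nonneg.
  have F0 i : 0 <= fine (\esum_(k in B i) (h (i, k))%:E)%E.
    by apply: fine_ge0; apply: esum_ge0 => k _; rewrite lee_fin.
  have FE i : A i -> (fine (\esum_(k in B i) (h (i, k))%:E))%:E =
     (\esum_(k in B i) (h (i, k))%:E)%E.
    move=> Ai; rewrite fineK// ge0_fin_numE ?fin//.
    by apply: esum_ge0 => k _; rewrite lee_fin.
  split.
  - by rewrite /csummable; under eq_esum do rewrite absE; rewrite -ee.
  - by move=> i Ai; rewrite /csummable; under eq_esum do rewrite absE; exact: fin.
  - rewrite /csummable; under eq_esum => i Ai do rewrite fE// cabs_real ger0_norm// FE//.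
    exact: hs.
  - rewrite csum_nonneg// (csum_eq fE) csum_nonneg//; congr ((fine _)%:C)%C.
    by rewrite -ee; apply: eq_esum => i Ai; rewrite FE.
move=> fs; suff [] : P f by [].
have le0 (p : R[i] -> R) : (forall z, p z <= cabs z) ->
    P (fun x => ((Num.max (p (f x)) 0)%:C)%C).
  move=> ph; apply: Ppos; first by move=> x; rewrite le_max lexx orbT.
  apply: le_lt_trans fs; apply: le_esum => x _; rewrite lee_fin ge_max ph.
  exact: cabs_ge0.
have h1 : P (fun x => ((Num.max (Re (f x)) 0)%:C)%C).
  by apply: (le0 (fun z => Re z)) => z; exact: le_trans (ler_norm _) (le_Re_cabs z).
have h2 : P (fun x => ((Num.max (- Re (f x)) 0)%:C)%C).
  by apply: (le0 (fun z => - Re z)) => z; rewrite (le_trans (ler_norm _))// normrN le_Re_cabs.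
have h3 : P (fun x => ((Num.max (Im (f x)) 0)%:C)%C).
  by apply: (le0 (fun z => Im z)) => z; exact: le_trans (ler_norm _) (le_Im_cabs z).
have h4 : P (fun x => ((Num.max (- Im (f x)) 0)%:C)%C).
  by apply: (le0 (fun z => - Im z)) => z; rewrite (le_trans (ler_norm _))// normrN le_Im_cabs.
have h := PD _ _ (PD _ _ h1 (PZ (-1) _ h2)) (PZ (0 +i* 1)%C _ (PD _ _ h3 (PZ (-1) _ h4))).
by rewrite (parts f); exact: h.
Qed.

End fubini.

Section partition.
Context (I K : choiceType) (A : set I) (B : I -> set K).
Hypothesis tB : forall i j k, A i -> A j -> B i k -> B j k -> i = j.

Lemma bigcup_bij : set_bij (A `*`` B) (\bigcup_(i in A) B i) (@snd I K).
Proof.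
split.
- by move=> [i k] [/= Ai Bk]; exists i.
- move=> [i k] [j k']; rewrite !inE/= => -[/= Ai Bk] [/= Aj Bk'] kk; subst k'.
  by rewrite (tB Ai Aj Bk Bk').
- by move=> k [i Ai Bk]; exists (i, k).
Qed.

Lemma esum_partition (f : K -> \bar R) : (forall k, 0 <= f k)%E ->
  (\esum_(k in \bigcup_(i in A) B i) f k = \esum_(i in A) \esum_(k in B i) f k)%E.
Proof.
move=> f0; rewrite (reindex_esum _ _ _ _ bigcup_bij).
by rewrite (esum_esum (a := fun _ k => f k)).
Qed.

End partition.

Lemma csum_partition (I K : countType) (i0 : I) (k0 : K) (A : set I) (B : I -> set K)
    (f : K -> R[i]) :
  (forall i j k, A i -> A j -> B i k -> B j k -> i = j) ->
  csummable (\bigcup_(i in A) B i) f ->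
  csummable A (fun i => csum (B i) f) /\
  csum (\bigcup_(i in A) B i) f = csum A (fun i => csum (B i) f).
Proof.
move=> /bigcup_bij eb fs.
rewrite (csum_reindex _ eb); apply: (csum_csum i0 k0 (f := f \o snd)).
by rewrite -(csummable_reindex _ eb).
Qed.

Definition tuples_in m (I : eqType) (J : set I) : set (m.-tuple I) :=
  [set l | forall p, J (tnth l p)].

Lemma tuples_cons m (I : choiceType) (J : set I) :
  set_bij (J `*`` (fun=> tuples_in (m := m) J)) (tuples_in (m := m.+1) J)
    (fun x : I * m.-tuple I => [tuple of x.1 :: x.2]).
Proof.
split.
- move=> [j l] [/= Jj Jl] p; case: (unliftP ord0 p) => [q ->|->].
    by rewrite tnthS.
  by rewrite tnth0.
- move=> [j l] [j' l'] _ _ /= /(congr1 val)/= [-> ll].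
  by congr pair; apply/val_inj.
- move=> l Jl; exists (thead l, [tuple of behead l]); last by rewrite -tuple_eta.
  split; first by rewrite /thead; exact: Jl.
  by move=> p; rewrite tnth_behead; exact: Jl.
Qed.

Lemma esumZ_le (K : choiceType) (A : set K) (c : R) (g : K -> \bar R) : 0 <= c ->
  (forall k, 0 <= g k)%E ->
  (\esum_(k in A) (c%:E * g k) <= c%:E * \esum_(k in A) g k)%E.
Proof.
move=> c0 g0; apply: ge_ereal_sup => _ [X [fX XA] <-].
rewrite -ge0_mule_fsumr//.
rewrite lee_wpmul2l ?lee_fin//; apply: ereal_sup_ubound.
by exists X.
Qed.

Lemma esum_tuple_prod m (I : choiceType) (J : set I) (z : 'I_m -> I -> R) (Z : 'I_m -> R) :
  (forall k j, 0 <= z k j) ->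
  (forall k, \esum_(j in J) (z k j)%:E <= (Z k)%:E)%E ->
  (\esum_(l in tuples_in J) (\prod_k z k (tnth l k))%:E <= (\prod_k Z k)%:E)%E.
Proof.
elim: m z Z => [|m IH] z Z z0 zZ.
  rewrite big_ord0 (_ : tuples_in J = [set [tuple]]).
    by rewrite esum_set1 big_ord0// lee_fin.
  by apply/seteqP; split => l _; [exact: tuple0|case].
rewrite (reindex_esum _ _ _ _ (tuples_cons m J)).
rewrite -(@esum_esum _ _ _ J (fun=> tuples_in J)
  (fun j l => (\prod_k z k (tnth [tuple of j :: l] k))%:E)); last first.
  by move=> j l _ _; rewrite lee_fin prodr_ge0.
have E j (l : m.-tuple I) : (\prod_k z k (tnth [tuple of j :: l] k))%:E =
    ((z ord0 j)%:E * (\prod_k z (lift ord0 k) (tnth l k))%:E)%E.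
  by rewrite big_ord_recl tnth0 EFinM; congr (_ * (_)%:E)%E; apply: eq_bigr => k _; rewrite tnthS.
have Z0 k : 0 <= Z k.
  by rewrite -lee_fin; apply: le_trans (zZ k); apply: esum_ge0 => j _; rewrite lee_fin.
have IH' := IH (fun k => z (lift ord0 k)) (fun k => Z (lift ord0 k)) (fun k => z0 _) (fun k => zZ _).
rewrite big_ord_recl EFinM.
apply: (@le_trans _ _ (\esum_(j in J) ((\prod_k Z (lift ord0 k))%:E * (z ord0 j)%:E))%E).
  apply: le_esum => j _; under eq_esum do rewrite E.
  have h0 (l : m.-tuple I) : (0 <= (\prod_k z (lift ord0 k) (tnth l k))%:E)%E.
    by rewrite lee_fin prodr_ge0.
  apply: le_trans (esumZ_le (tuples_in J) (z0 ord0 j) h0) _.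
  by rewrite muleC; apply: lee_wpmul2r; rewrite ?lee_fin.
have P0 : 0 <= \prod_k Z (lift ord0 k) by exact: prodr_ge0.
have z0' j : (0 <= (z ord0 j)%:E)%E by rewrite lee_fin.
apply: le_trans (esumZ_le J P0 z0') _.
by rewrite muleC; apply: lee_wpmul2r; rewrite ?lee_fin ?prodr_ge0.
Qed.

Lemma csum_tuple_prod m (I : countType) (i0 : I) (J : set I) (z : 'I_m -> I -> R[i]) :
  (forall k, csummable J (z k)) ->
  csummable (tuples_in J) (fun l => \prod_k z k (tnth l k)) /\
  csum (tuples_in J) (fun l => \prod_k z k (tnth l k)) = \prod_k csum J (z k).
Proof.
elim: m z => [|m IH] z zs.
  have -> : tuples_in (m := 0) J = [set [tuple]].
    by apply/seteqP; split => l _; [exact: tuple0|case].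
  split.
    by rewrite /csummable esum_set1 ?lee_fin ?cabs_ge0// ltry.
  by rewrite (csum_fin [tuple of nseq 0 i0])// fsbig_set1 !big_ord0.
have zP k : exists2 Z, 0 <= Z & (\esum_(j in J) (cabs (z k j))%:E = Z%:E)%E.
  have h0 : (0 <= \esum_(j in J) (cabs (z k j))%:E)%E.
    by apply: esum_ge0 => j _; rewrite lee_fin cabs_ge0.
  exists (fine (\esum_(j in J) (cabs (z k j))%:E)%E); first exact: fine_ge0.
  by rewrite fineK// ge0_fin_numE//; exact: zs.
have /choice[Z hZ] : forall k, exists Z, (\esum_(j in J) (cabs (z k j))%:E <= Z%:E)%E.
  by move=> k; have [Zk _ e] := zP k; exists Zk; rewrite e.
have s : csummable (tuples_in J) (fun l : m.+1.-tuple I => \prod_k z k (tnth l k)).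
  rewrite /csummable; under eq_esum do rewrite cabs_prod.
  by apply: le_lt_trans (esum_tuple_prod (z := fun k j => cabs (z k j)) _ hZ) (ltry _) => k j; exact: cabs_ge0.
split => //; have eb := tuples_cons m J.
rewrite (csum_reindex _ eb).
rewrite (csummable_reindex _ eb) in s.
have [_ ->] := csum_csum i0 [tuple of nseq m i0] s.
have [s' IH'] := IH (fun k => z (lift ord0 k)) (fun k => zs _).
rewrite big_ord_recl mulrC -(csumZ i0)//; apply: csum_eq => j Jj.
rewrite mulrC -IH' -(csumZ [tuple of nseq m i0])//; apply: csum_eq => l _ /=.
by rewrite big_ord_recl tnth0; congr (_ * _); apply: eq_bigr => k _; rewrite tnthS.
Qed.

(** A product of sums is a sum over tuples; this turns the nonlinearity into an
    interaction of waves. *)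
Lemma csum_alt_prod m (I : countType) (i0 : I) (J : set I) (z : 'I_m -> I -> R[i]) :
  (forall k, csummable J (z k)) ->
  csummable (tuples_in J) (fun l => alt_prod (fun k => z k (tnth l k))) /\
  csum (tuples_in J) (fun l => alt_prod (fun k => z k (tnth l k))) =
  alt_prod (fun k => csum J (z k)).
Proof.
move=> zs.
pose z' (k : 'I_m) j := if odd k then conjc (z k j) else z k j.
have zs' k : csummable J (z' k).
  by rewrite /z'; case: (odd k); [exact: csummable_conj|exact: zs].
have [s e] := csum_tuple_prod i0 zs'.
split => //; rewrite [LHS]e; apply: eq_bigr => k _.
by rewrite /z'; case: (odd k) => //; rewrite csum_conj.
Qed.

End sums.

(** ** Unordered sums of norms *)

Section esum_lemmas.
Context {R : realType}.

(** Only the finite subfamilies matter for an unordered sum, and the integral is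
    additive on them. *)
Lemma esum_int_le d (T : measurableType d) (m : {measure set T -> \bar R})
    (I : choiceType) (A : set I) (D : set T) (f : I -> T -> \bar R) (g : T -> \bar R) :
  measurable D -> (forall l, A l -> measurable_fun D (f l)) ->
  (forall l s, 0 <= f l s)%E -> measurable_fun D g ->
  (forall s, D s -> \esum_(l in A) f l s <= g s)%E ->
  (\esum_(l in A) \int[m]_(s in D) f l s <= \int[m]_(s in D) g s)%E.
Proof.
move=> mD mf f0 mg fg; apply: ge_ereal_sup => _ [X [fX XA] <-].
have E : (\sum_(i \in X) \int[m]_(s in D) f i s =
    \int[m]_(s in D) \sum_(i \in X) (if i \in A then f i s else 0))%E.
  rewrite ge0_integral_fsum//.
  - apply: eq_fsbigr => i; rewrite inE => /XA Ai.
    by apply: eq_integral => s _; rewrite mem_set.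
  - move=> i; have [Ai|Ai] := pselect (A i).
      by under eq_fun do rewrite mem_set//; exact: mf.
    by under eq_fun do rewrite memNset//; exact: measurable_cst.
  - by move=> i s _; case: ifP.
rewrite E; apply: ge0_le_integral => //.
- by move=> s _; rewrite fsbig_finite//=; apply: sume_ge0 => i _; case: ifP.
- under eq_fun do rewrite fsbig_finite//=.
  apply: emeasurable_sum => i; have [Ai|Ai] := pselect (A i).
    by under eq_fun do rewrite mem_set//; exact: mf.
  by under eq_fun do rewrite memNset//; exact: measurable_cst.
- move=> s Ds; apply: le_trans (fg s Ds).
  apply: ereal_sup_ubound; exists X => //.
  by apply: eq_fsbigr => i; rewrite inE => /XA Ai; rewrite mem_set.
Qed.

Lemma esumU_le (I : choiceType) (A B : set I) (f : I -> \bar R) :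
  (forall i, 0 <= f i)%E ->
  (\esum_(i in A `|` B) f i <= \esum_(i in A) f i + \esum_(i in B) f i)%E.
Proof.
move=> f0; rewrite (esumID A) => [|i _]; last exact: f0.
rewrite setUK; apply: leeD => //.
rewrite (esum_mkcond (_ `&` _)) (esum_mkcond B); apply: le_esum => i _.
case: ifPn => [|_]; last by case: ifP.
by rewrite inE/= => -[[//|Bi] _]; rewrite mem_set.
Qed.

Lemma le_esumS (I : choiceType) (A B : set I) (f : I -> \bar R) : A `<=` B ->
  (forall i, 0 <= f i)%E -> (\esum_(i in A) f i <= \esum_(i in B) f i)%E.
Proof.
move=> AB f0; rewrite (esum_mkcond A) (esum_mkcond B); apply: le_esum => i _.
case: ifPn => [|_]; first by rewrite inE => /AB Bi; rewrite mem_set.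
by case: ifP.
Qed.

Lemma le_term_esum (I : choiceType) (A : set I) (f : I -> \bar R) i : A i ->
  (forall i, 0 <= f i)%E -> (f i <= \esum_(i in A) f i)%E.
Proof.
move=> Ai f0; rewrite -(@esum_set1 _ _ i f)//; apply: le_esumS => // j ->; exact: Ai.
Qed.

Lemma esum_tail (I : choiceType) (A : set I) (b : I -> \bar R) (e : R) :
  (forall i, 0 <= b i)%E -> (\esum_(i in A) b i < +oo)%E -> 0 < e ->
  exists X, [/\ finite_set X, X `<=` A & (\esum_(i in A `\` X) b i <= e%:E)%E].
Proof.
move=> b0 bfin e0.
have bf : \esum_(i in A) b i \is a fin_num.
  by rewrite ge0_fin_numE//; exact: esum_ge0.
have [_ [X [fX XA] <-] h] := ub_ereal_sup_adherent e0 bf.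
exists X; split => //.
have := @esumID R I X A b (fun i _ => b0 i).
rewrite setIidr// -/(A `\` X) (@esum_fset _ _ X)// => E.
move: bf bfin h; rewrite -/(esum A b) E.
set s1 := (\sum_(i \in X) b i)%E; set s2 := esum _ b.
move=> bf _ h; have [f1 f2] : s1 \is a fin_num /\ s2 \is a fin_num.
  by move: bf; rewrite fin_numD => /andP[].
move: h; rewrite lteBlDr// lteD2lE// => /ltW; exact.
Qed.

End esum_lemmas.

(** ** Products of several functions *)

Section leibniz.
Context {R : realType}.

(** The sum that a derivation produces on a product: one factor [x] at a time is
    replaced by [y]. *)
Definition leibniz n (x y : 'I_n -> R) : R := \sum_k y k * \prod_(i | i != k) x i.

Lemma leibniz_recr n (x y : 'I_n.+1 -> R) :
  leibniz x y = leibniz (fun k => x (widen_ord (leqnSn n) k)) (fun k => y (widen_ord (leqnSn n) k)) * x ord_max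
    + (\prod_k x (widen_ord (leqnSn n) k)) * y ord_max.
Proof.
rewrite /leibniz big_ord_recr/= mulr_suml; congr (_ + _).
  apply: eq_bigr => k _; rewrite -mulrA; congr (_ * _).
  rewrite big_mkcond big_ord_recr/= -big_mkcond/=; congr (_ * _).
  by rewrite ifT//; apply/eqP => /(congr1 val)/= h; have := ltn_ord k; rewrite -h ltnn.
rewrite mulrC; congr (_ * _).
rewrite big_mkcond big_ord_recr/= eqxx mulr1; apply: eq_bigr => k _.
by rewrite ifT//; apply/eqP => /(congr1 val)/= h; have := ltn_ord k; rewrite h ltnn.
Qed.

Lemma leibniz_ge0 n (x y : 'I_n -> R) : (forall k, 0 <= x k) -> (forall k, 0 <= y k) ->
  0 <= leibniz x y.
Proof. by move=> x0 y0; apply: sumr_ge0 => k _; rewrite mulr_ge0 ?prodr_ge0. Qed.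

Lemma alt_prod_cst sigma (z : R[i]) :
  alt_prod (fun=> z : R[i]) (n := sigma.*2.+1) = ((cabs z ^+ sigma.*2)%:C)%C * z.
Proof.
elim: sigma => [|s IH]; first by rewrite /alt_prod big_ord1/= expr0 mul1r.
rewrite /alt_prod 2!big_ord_recr/= -/(alt_prod (fun=> z) (n := s.*2.+1)) IH.
rewrite odd_double/= [RHS]mulrC !exprS.
have -> : ((cabs z * (cabs z * cabs z ^+ s.*2))%:C)%C =
  (z * conjc z) * ((cabs z ^+ s.*2)%:C)%C :> R[i].
  rewrite !rmorphM/= mulrA; congr (_ * _); rewrite -rmorphM/= -expr2.
  case: (z) => a b; rewrite cabsE sqr_sqrtr ?addr_ge0 ?sqr_ge0//.
  by apply: complexP; rewrite ?(ReM,ImM)/=; ring.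
by ring.
Qed.

End leibniz.

Section products.
Context {R : realType} {d : nat} (S : fsetting R d).
Local Notation V := 'rV[R]_d.
Local Notation Nw := (Nw S).
Local Notation N := (Nw (fun=> 1)).
Local Notation inW := (inW S).

Lemma inW_le (w : V -> R) (f : V -> R[i]) (x : R) : (Nw w f <= x%:E)%E -> inW f.
Proof. by move=> h; apply: (lty_inW (w := w)); exact: le_lt_trans h (ltry _). Qed.

Lemma N_le_ge0 (w : V -> R) (f : V -> R[i]) (x : R) : weight S w -> (Nw w f <= x%:E)%E -> 0 <= x.
Proof. by move=> ww h; rewrite -lee_fin; apply: le_trans h; exact: Nw_ge0. Qed.

Lemma N_prod n (g : 'I_n.+1 -> V -> R[i]) (x : 'I_n.+1 -> R) :
  (forall k, (N (g k) <= (x k)%:E)%E) ->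
  (N (fun v => (\prod_k g k v)%R) <= (\prod_k x k)%:E)%E.
Proof.
elim: n g x => [|n IH] g x gx.
  by rewrite big_ord1 (@Nw_ext _ _ _ _ _ (g ord0))// => v; rewrite big_ord1.
pose g' k := g (widen_ord (leqnSn n.+1) k); pose x' k := x (widen_ord (leqnSn n.+1) k).
have h := IH g' x' (fun k => gx _).
rewrite big_ord_recr/= -/x' (@Nw_ext _ _ _ _ _ (fun v => (\prod_k g' k v) * g ord_max v)); last first.
  by move=> v; rewrite big_ord_recr.
apply: le_trans (N_mul (inW_le h) (inW_le (gx _))) _.
by rewrite EFinM; apply: lee_pmul => //; exact: N_ge0.
Qed.

Lemma Nw_prod (w : V -> R) c n (g : 'I_n.+1 -> V -> R[i]) (x y : 'I_n.+1 -> R) :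
  weight S w -> 1 <= c -> (forall u v, w (u + v) <= c * (w u + w v)) ->
  (forall k, (N (g k) <= (x k)%:E)%E) -> (forall k, (Nw w (g k) <= (y k)%:E)%E) ->
  (Nw w (fun v => (\prod_k g k v)%R) <= (c ^+ n * leibniz x y)%:E)%E.
Proof.
move=> ww c1 wD; have c0 : 0 <= c by exact: le_trans ler01 c1.
elim: n g x y => [|n IH] g x y gx gy.
  rewrite expr0 mul1r /leibniz big_ord1 big1 ?mulr1.
    by rewrite (@Nw_ext _ _ _ _ _ (g ord0))// => v; rewrite big_ord1.
  by move=> k; rewrite (ord1 k) eqxx.
pose g' k := g (widen_ord (leqnSn n.+1) k); pose x' k := x (widen_ord (leqnSn n.+1) k).
pose y' k := y (widen_ord (leqnSn n.+1) k).
have hx := N_prod (g := g') (x := x') (fun k => gx _).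
have hy := IH g' x' y' (fun k => gx _) (fun k => gy _).
have x0 k : 0 <= x k by apply: N_le_ge0 (gx k); exact: weight1.
have y0 k : 0 <= y k by apply: N_le_ge0 (gy k).
rewrite (@Nw_ext _ _ _ _ _ (fun v => (\prod_k g' k v) * g ord_max v)); last first.
  by move=> v; rewrite big_ord_recr.
apply: le_trans (Nw_mul ww c0 wD (inW_le hx) (inW_le (gx _))) _.
rewrite leibniz_recr -/x' -/y' exprS -mulrA EFinM; apply: lee_wpmul2l; first by rewrite lee_fin.
apply: (@le_trans _ _ (((c ^+ n * leibniz x' y')%:E * (x ord_max)%:E) + (\prod_k x' k)%:E * (y ord_max)%:E)%E).
  by apply: leeD; apply: lee_pmul => //; do ?exact: N_ge0; exact: Nw_ge0.
rewrite -!EFinM -EFinD lee_fin mulrDr -mulrA lerD2l.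
rewrite -/(x' _) ler_peMl ?exprn_ege1// mulr_ge0// prodr_ge0// => k _; exact: x0.
Qed.

(** Telescoping: the factors are changed one at a time. *)
Lemma N_prod_sub n (f g : 'I_n.+1 -> V -> R[i]) (x y : 'I_n.+1 -> R) :
  (forall k, (N (f k) <= (x k)%:E)%E) -> (forall k, (N (g k) <= (x k)%:E)%E) ->
  (forall k, (N (fun v => f k v - g k v)%R <= (y k)%:E)%E) ->
  (N (fun v => \prod_k f k v - \prod_k g k v)%R <= (leibniz x y)%:E)%E.
Proof.
elim: n f g x y => [|n IH] f g x y fx gx fgy.
  rewrite /leibniz big_ord1 big1 ?mulr1.
    by rewrite (@Nw_ext _ _ _ _ _ (fun v => f ord0 v - g ord0 v))// => v; rewrite !big_ord1.
  by move=> k; rewrite (ord1 k) eqxx.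
pose wd k := widen_ord (leqnSn n.+1) k.
have h := IH (fun k => f (wd k)) (fun k => g (wd k)) (fun k => x (wd k)) (fun k => y (wd k))
  (fun k => fx _) (fun k => gx _) (fun k => fgy _).
have hg := N_prod (g := fun k => g (wd k)) (x := fun k => x (wd k)) (fun k => gx _).
rewrite (@Nw_ext _ _ _ _ _ (fun v => (\prod_k f (wd k) v - \prod_k g (wd k) v) * f ord_max v
   + (\prod_k g (wd k) v) * (f ord_max v - g ord_max v))); last first.
  by move=> v; rewrite !big_ord_recr /wd/=; ring.
apply: le_trans (NwD _ _ (weight1 S)) _; rewrite leibniz_recr EFinD; apply: leeD.
  apply: le_trans (N_mul (inW_le h) (inW_le (fx _))) _.
  by rewrite EFinM; apply: lee_pmul => //; exact: N_ge0.
apply: le_trans (N_mul (inW_le hg) (inW_le (fgy _))) _.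
by rewrite EFinM; apply: lee_pmul => //; exact: N_ge0.
Qed.

Section alternating.
Variables (n : nat).
Implicit Types (f g : 'I_n.+1 -> V -> R[i]) (x y : 'I_n.+1 -> R).

Let cj f (k : 'I_n.+1) := fun v => if odd k then conjc (f k v) else f k v.
Let Ncj w f k : weight S w -> (forall v, w (- v) = w v) -> Nw w (cj f k) = Nw w (f k).
Proof. by move=> ww wN; rewrite /cj; case: (odd k) => //; exact: Nw_conj. Qed.

Lemma N_alt_prod f x : (forall k, (N (f k) <= (x k)%:E)%E) ->
  (N (fun v => alt_prod (fun k => f k v)) <= (\prod_k x k)%:E)%E.
Proof.
by move=> fx; apply: (N_prod (g := cj f)) => k; rewrite Ncj//; exact: weight1.
Qed.

Lemma Nw_alt_prod w c f x y : weight S w -> (forall v, w (- v) = w v) -> 1 <= c ->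
  (forall u v, w (u + v) <= c * (w u + w v)) ->
  (forall k, (N (f k) <= (x k)%:E)%E) -> (forall k, (Nw w (f k) <= (y k)%:E)%E) ->
  (Nw w (fun v => alt_prod (fun k => f k v)) <= (c ^+ n * leibniz x y)%:E)%E.
Proof.
move=> ww wN c1 wD fx fy; apply: (Nw_prod (g := cj f)) => // k; rewrite Ncj//.
Qed.

Lemma N_alt_prod_sub f g x y :
  (forall k, (N (f k) <= (x k)%:E)%E) -> (forall k, (N (g k) <= (x k)%:E)%E) ->
  (forall k, (N (fun v => f k v - g k v)%R <= (y k)%:E)%E) ->
  (N (fun v => alt_prod (fun k => f k v) - alt_prod (fun k => g k v))%R
     <= (leibniz x y)%:E)%E.
Proof.
move=> fx gx fgy; have w1 := weight1 S.
apply: (N_prod_sub (f := cj f) (g := cj g)) => k; rewrite ?Ncj//.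
rewrite (@Nw_ext _ _ _ _ _ (cj (fun k v => f k v - g k v) k)) ?Ncj//.
by move=> v; rewrite /cj; case: (odd k) => //; rewrite conjcB.
Qed.

End alternating.

Lemma nonlinearityE sigma (f : V -> R[i]) :
  nonlinearity sigma f = fun v => alt_prod (fun _ : 'I_sigma.*2.+1 => f v).
Proof. by apply/funext => v; rewrite alt_prod_cst. Qed.

End products.

Section sums_of_curves.
Context {R : realType} {d : nat} (S : fsetting R d).
Local Notation V := 'rV[R]_d.
Local Notation Nw := (Nw S).
Local Notation N := (Nw (fun=> 1)).
Local Notation inW := (inW S).
Local Notation contW := (contW S).
Local Notation leb := (@lebesgue_measure R).
Local Notation mR := (measurableTypeR R).
Context (I : countType) (i0 : I) (A : set I).

Lemma time_csum t (f : I -> R -> V -> R[i]) (K : R) x : 0 <= t ->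
  (forall l, A l -> contW t (f l)) ->
  (forall s, 0 <= s <= t -> (\esum_(l in A) N (f l s) <= K%:E)%E) ->
  csummable A (fun l => time_integral t (fun s => f l s x)) /\
  time_integral t (fun s => csum A (fun l => f l s x)) =
  csum A (fun l => time_integral t (fun s => f l s x)).
Proof.
move=> t0 cf fK; pose cm := @countm R I i0.
have K0 : 0 <= K.
  rewrite -lee_fin; apply: le_trans (fK 0 _); last by rewrite lexx.
  by apply: esum_ge0 => l _; exact: N_ge0.
pose F (z : mR * disc i0) : R[i] :=
  if z.2 \in A then (if z.1 \in `[0, t]%classic then f z.2 z.1 x else 0) else 0.
have mF : cmeas F.
  apply: (@cmeas_prod_disc _ _ i0 _ _ (fun l s => F (s, l))) => l; rewrite /F/=.
  case: (boolP (l \in A)) => [|_]; last exact: cmeas_cst.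
  rewrite inE => /cf cl; have := Cint_time t0 cl x.
  by move/(cintegrable_mkcond leb _ (measurable_itv _)) => /Cint_meas.
have sb s : 0 <= s <= t -> (\esum_(l in A) (cabs (f l s x))%:E <= K%:E)%E.
  move=> s0; apply: le_trans (fK s s0); apply: le_esum => l _; exact: sup_le_N.
have s1 s : 0 <= s <= t -> csummable A (fun l => f l s x).
  by move=> /sb h; exact: le_lt_trans h (ltry _).
have iF : (\int[leb]_s \int[cm]_l (cabs (F (s, l)))%:E < +oo)%E.
  apply: (@le_lt_trans _ _ (\int[leb]_(s in `[0%R, t]) K%:E)%E); last first.
    by rewrite int_cst_itv// ltry.
  rewrite [leRHS]integral_mkcond; apply: ge0_le_integral => //.
  - by move=> s _; apply: integral_ge0 => l _; rewrite lee_fin cabs_ge0.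
  - apply: (measurable_int2 cm (f := fun z => (cabs (F z))%:E)).
      exact: measurable_ecabs.
    by move=> z; rewrite lee_fin cabs_ge0.
  - by apply/(measurable_restrictT _ _).1 => //; exact: measurable_itv.
  - move=> s _; rewrite /patch; case: ifPn => [|st].
      rewrite mem_setE in_itv/= => s0; apply: le_trans (sb s s0).
      rewrite (esum_int_count i0); last by move=> l; rewrite lee_fin cabs_ge0.
      rewrite le_eqVlt; apply/orP; left; apply/eqP; apply: eq_integral => l _.
      rewrite /patch /F/=; case: ifP; rewrite ?cabs0// => _.
      by rewrite mem_setE in_itv/= s0.
    rewrite integral0_eq// => l _; rewrite /F/= (negbTE st).
    by case: ifP; rewrite cabs0.
have [h1 h2 h3] := cfubini mF iF.
have E2 : (fun l : disc i0 => cintegral leb setT (fun s => F (s, l))) =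
    crestrict A (fun l => time_integral t (fun s => f l s x)).
  apply/funext => l; rewrite /crestrict /F/=; case: ifP => _; last by rewrite cint0.
  by rewrite time_integralE.
have cs : csummable A (fun l => time_integral t (fun s => f l s x)).
  by apply/(csummableP i0); rewrite -E2.
split => //; rewrite (csumE i0 cs) -E2 -[RHS]h3 time_integralE.
apply: eq_cint => s; case: ifPn => st; last first.
  by rewrite (_ : (fun l => _) = fun=> 0) ?cint0//; apply/funext => l; rewrite /F/= (negbTE st); case: ifP.
rewrite (csumE i0); last by apply: s1; move: st; rewrite mem_setE in_itv.
by apply: eq_cint => l; rewrite /crestrict /F/= st.
Qed.

(** Uniform convergence: up to [e] the curve is a finite sum. *)
Lemma contW_csum T (f : I -> R -> V -> R[i]) (b : I -> \bar R) :
  (forall l, A l -> contW T (f l)) ->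
  (forall l, 0 <= b l)%E ->
  (forall l s, A l -> 0 <= s <= T -> (N (f l s) <= b l)%E) ->
  (\esum_(l in A) b l < +oo)%E ->
  contW T (fun s x => csum A (fun l => f l s x)).
Proof.
move=> cf b0 fb bs.
have fW l s : A l -> 0 <= s <= T -> inW (f l s) by move=> Al; exact/contW_inW/cf.
have fs s : 0 <= s <= T -> (\esum_(l in A) N (f l s) < +oo)%E.
  by move=> sT; apply: le_lt_trans bs; apply: le_esum => l Al; exact: fb.
apply: (@contW_dom _ _ _ _ _ (fun s s' => \esum_(l in A) N (fun x => f l s' x - f l s x)%R)%E).
- by move=> s sT; apply: inW_csum; [exact: i0|move=> l Al; exact: fW|exact: fs].
- move=> s s' sT s'T.
  rewrite (@Nw_ext _ _ _ _ _ (fun x => csum A (fun l => f l s' x - f l s x))).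
    apply: Nw_csum; [exact: i0|by move=> l Al; apply: inWB; exact: fW| |exact: weight1].
    apply: le_lt_trans (lte_add_pinfty (fs s' s'T) (fs s sT)).
    rewrite -esumD; [|by move=> *; exact: N_ge0..].
    by apply: le_esum => l _; apply: NwB; exact: weight1.
  have sx r x : 0 <= r <= T -> csummable A (fun l => f l r x).
    move=> rT; apply: le_lt_trans (fs r rT); apply: le_esum => l _.
    exact: sup_le_N.
  by move=> x; rewrite (csumB i0)//; exact: sx.
- move=> s e sT e0.
  have e4 : 0 < e / 4 by rewrite divr_gt0.
  have [X [fX XA tail]] := esum_tail b0 bs e4.
  have Xc : forall eta, 0 < eta -> exists2 r, 0 < r & forall s', 0 <= s' <= T -> `|s' - s| < r ->
     (\esum_(l in X) N (fun x => f l s' x - f l s x)%R <= eta%:E)%E.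
    elim/finite_set_ind : X / fX XA {tail} => [|i X fX iX IH] XA eta eta0.
      by exists 1 => // s' _ _; rewrite esum_set0 lee_fin ltW.
    have eta2 : 0 < eta / 2 by rewrite divr_gt0.
    have [r1 r10 h1] := IH (fun j Xj => XA j (or_intror Xj)) _ eta2.
    have [_ /(_ _ eta2)[r2 r20 h2]] := cf i (XA i (or_introl erefl)) s sT.
    exists (Num.min r1 r2); first by rewrite lt_min r10.
    move=> s' s'T; rewrite lt_min => /andP[l1 l2].
    apply: le_trans (esumU_le _ _ _) _; first by move=> l; exact: N_ge0.
    rewrite esum_set1 ?N_ge0// [eta]splitr EFinD; apply: leeD; first exact: h2.
    exact: h1.
  have e2 : 0 < e / 2 by rewrite divr_gt0.
  have [r r0 h] := Xc _ e2; exists r => // s' s'T s's.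
  rewrite (esumID X) => [|l _]; last exact: N_ge0.
  rewrite [e]splitr EFinD; apply: leeD; first by rewrite setIidr//; exact: h.
  apply: (@le_trans _ _ (\esum_(l in A `\` X) b l + \esum_(l in A `\` X) b l)%E).
    rewrite -esumD; [|by move=> *; exact: b0..].
    apply: le_esum => l [Al _]; apply: le_trans (NwB _ _ (weight1 S)) _.
    by apply: leeD; exact: fb.
  apply: le_trans (leeD tail tail) _; rewrite -EFinD lee_fin.
  by rewrite (_ : e / 4 + e / 4 = e / 2)//; field.
Qed.

End sums_of_curves.

(** ** Weighted sums over tuples and the Gronwall argument *)

Section tuple_bounds.
Context {R : realType}.

Lemma prod_le_exp n (P : pred 'I_n) (c : 'I_n -> R) (E : R) : 1 <= E ->
  (forall i, P i -> 0 <= c i <= E) -> \prod_(i | P i) c i <= E ^+ n.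
Proof.
move=> E1 cE; have E0 : 0 <= E by exact: le_trans ler01 E1.
rewrite big_mkcond -[n in leRHS]card_ord -prodr_const; apply: ler_prod => i _.
by case: ifP => [/cE//|_]; rewrite ler01.
Qed.

(** The weight [p] and the derivation [y] fall either on the same factor, which
    gives [PY], or on two different ones, which gives [PX * Y]; the remaining
    factors are summed with [E]. *)
Lemma esum_weighted_leibniz n (I : choiceType) (J : set I) (p x y : I -> R) (E PX Y PY : R) :
  1 <= E -> (forall j, 0 <= p j) -> (forall j, 0 <= x j) -> (forall j, 0 <= y j) ->
  (\esum_(j in J) (x j)%:E <= E%:E)%E ->
  (\esum_(j in J) (p j * x j)%:E <= PX%:E)%E ->
  (\esum_(j in J) (y j)%:E <= Y%:E)%E ->
  (\esum_(j in J) (p j * y j)%:E <= PY%:E)%E ->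
  (\esum_(l in tuples_in (m := n) J) ((\sum_q p (tnth l q)) *
      leibniz (fun k => x (tnth l k)) (fun k => y (tnth l k)))%:E
   <= (n%:R ^+ 2 * (PY + PX * Y) * E ^+ n)%:E)%E.
Proof.
move=> E1 p0 x0 y0 xE pxE yE pyE; have E0 : 0 <= E by exact: le_trans ler01 E1.
have ge0 (z : I -> R) (Z : R) : (forall j, 0 <= z j) -> (\esum_(j in J) (z j)%:E <= Z%:E)%E -> 0 <= Z.
  by move=> z0 h; rewrite -lee_fin; apply: le_trans h; apply: esum_ge0 => j _; rewrite lee_fin.
have PX0 := ge0 _ _ (fun j => mulr_ge0 (p0 j) (x0 j)) pxE.
have PY0 := ge0 _ _ (fun j => mulr_ge0 (p0 j) (y0 j)) pyE.
have Y0 := ge0 _ _ y0 yE.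
(* the factor [i] when [p] falls on the factor [q] and the derivation on [k] *)
pose z (q k i : 'I_n) j := (if i == q then p j else 1) * (if i == k then y j else x j).
have z0 q k i j : 0 <= z q k i j by rewrite /z; case: ifP => _; case: ifP => _; rewrite mulr_ge0.
have EE (l : n.-tuple I) : ((\sum_q p (tnth l q)) * leibniz (fun k => x (tnth l k)) (fun k => y (tnth l k)))%:E =
    (\sum_q \sum_k (\prod_i z q k i (tnth l i))%:E)%E.
  rewrite mulr_suml -sumEFin; apply: eq_bigr => q _.
  rewrite /leibniz mulr_sumr -sumEFin; apply: eq_bigr => k _; congr (_%:E).
  rewrite /z big_split/= -big_mkcond/= big_pred1_eq; congr (_ * _).
  rewrite [RHS](bigD1 k)//= eqxx; congr (_ * _).
  by apply: eq_bigr => i /negbTE ->.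
under eq_esum do rewrite EE.
rewrite esum_sum; last first.
  by move=> l q _ _; apply: sume_ge0 => k _; rewrite lee_fin prodr_ge0.
pose B := (PY + PX * Y) * E ^+ n.
apply: (@le_trans _ _ (\sum_(q < n) \sum_(k < n) B%:E)%E); last first.
  under eq_bigr do rewrite sumEFin.
  rewrite sumEFin lee_fin sumr_const card_ord sumr_const card_ord.
  have -> : B *+ n *+ n = n%:R ^+ 2 * (PY + PX * Y) * E ^+ n.
    by rewrite -(mulr_natr (B *+ n)) -(mulr_natr B) /B; ring.
  exact: lexx.
apply: lee_sum => q _.
rewrite esum_sum; last by move=> l k _ _; rewrite lee_fin prodr_ge0.
apply: lee_sum => k _.
pose Z (i : 'I_n) := if i == q then (if i == k then PY else PX) else if i == k then Y else E.
have zZ i : (\esum_(j in J) (z q k i j)%:E <= (Z i)%:E)%E.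
  rewrite /z /Z; case: ifP => _; case: ifP => _ //; under eq_esum do rewrite mul1r; done.
apply: le_trans (esum_tuple_prod (z0 q k) zZ) _; rewrite lee_fin /B.
have Z0 i : 0 <= Z i by rewrite /Z; do 2 case: ifP => _.
rewrite (bigD1 q)//= {1}/Z eqxx; have [qk|qk] := eqVneq q k.
  have h : \prod_(i | i != q) Z i <= E ^+ n.
    apply: prod_le_exp => // i /negbTE iq; rewrite Z0/= /Z iq.
    by rewrite -qk iq.
  apply: ler_pM => //; first exact: prodr_ge0.
  by rewrite lerDl mulr_ge0.
rewrite (bigD1 k) 1?eq_sym//= {1}/Z eq_sym (negbTE qk) eqxx mulrA.
have h : \prod_(i | (i != q) && (i != k)) Z i <= E ^+ n.
  apply: prod_le_exp => // i /andP[/negbTE iq /negbTE ik]; rewrite Z0/= /Z iq.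
  by rewrite ik.
apply: ler_pM => //; [exact: mulr_ge0|exact: prodr_ge0|].
by rewrite lerDr.
Qed.

(** Gronwall's argument for a quantity [X] with a bound [M0] known in advance:
    one step improves the bound [M] to [D + M / 2], and iteration leaves
    [2 * D]. *)
Lemma absorb (P : R -> Prop) (X : R -> \bar R) (D M0 L : R) : 0 <= M0 ->
  (forall M, 0 <= M -> (forall t, P t -> (X t <= (M * expR (L * t))%:E)%E) ->
    forall t, P t -> (X t <= ((D + M / 2) * expR (L * t))%:E)%E) -> 0 <= D ->
  (forall t, P t -> (X t <= (M0 * expR (L * t))%:E)%E) ->
  forall t, P t -> (X t <= (2 * D * expR (L * t))%:E)%E.
Proof.
move=> M00 step D0 h0.
have h n : forall t, P t -> (X t <= ((2 * D + M0 * 2^-1 ^+ n) * expR (L * t))%:E)%E.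
  elim: n => [|n IH] t Pt.
    apply: le_trans (h0 t Pt) _; rewrite lee_fin expr0 mulr1.
    by rewrite ler_wpM2r ?expR_ge0// lerDr mulr_ge0.
  have M1 : 0 <= 2 * D + M0 * 2^-1 ^+ n by rewrite addr_ge0 ?mulr_ge0 ?exprn_ge0.
  have := step _ M1 IH t Pt.
  rewrite (_ : D + _ / 2 = 2 * D + M0 * 2^-1 ^+ n.+1)//.
  by rewrite exprS; field.
move=> t Pt.
have cv : (((2 * D + M0 * 2^-1 ^+ n) * expR (L * t))%:E @[n --> \oo] --> (2 * D * expR (L * t))%:E)%E.
  apply: cvg_EFin; first exact: nearW.
  rewrite /comp/=; apply: cvgMl.
  have e : 2 * D = 2 * D + M0 * 0 by rewrite mulr0 addr0.
  rewrite {2}e; apply: cvgD; first exact: cvg_cst.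
  by apply: cvgMr; apply: cvg_expr; rewrite ger0_norm; lra.
by apply: cvge_lb cv _ => n; exact: h.
Qed.

End tuple_bounds.

(** * The profile system *)

Section esum_scaling.
Context {R : realType}.

Lemma esumZ_ge (K : choiceType) (A : set K) (c : R) (g : K -> \bar R) : 0 <= c ->
  (forall k, 0 <= g k)%E ->
  (c%:E * (\esum_(k in A) g k) <= \esum_(k in A) (c%:E * g k))%E.
Proof.
rewrite le_eqVlt => /predU1P[<-|c0] g0.
  by rewrite mul0e; apply: esum_ge0 => k _; rewrite mul0e.
have ci : 0 <= c^-1 by rewrite invr_ge0 ltW.
have h0 k : (0 <= c%:E * g k)%E by rewrite mule_ge0// lee_fin ltW.
have := esumZ_le A ci h0.
under eq_esum do rewrite muleA -EFinM mulVf ?gt_eqF// mul1e.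
move=> h; have := lee_wpmul2l (ltW (c0 : (0%:E < c%:E)%E)) h.
by rewrite muleA -EFinM mulfV ?gt_eqF// mul1e.
Qed.

Lemma cabs_minus_i (l : R) : cabs (0 -i* l)%C = `|l|.
Proof. by rewrite cabsE/= expr0n/= add0r sqrrN sqrtr_sqr. Qed.

Lemma time_integral0 (f : R -> R[i]) : time_integral 0 f = 0.
Proof. by apply: complexP => /=; rewrite set_itv1 Rintegral_set1. Qed.

End esum_scaling.

Section truncation.
Context {R : realType} {d : nat} (S : fsetting R d).
Local Notation V := 'rV[R]_d.
Local Notation Nw := (Nw S).

Lemma weight_min (q : V -> R) r : weight S q -> 0 <= r -> weight S (fun v => Num.min (q v) r).
Proof.
move=> [q0 mq] r0; split; first by move=> v; rewrite le_min q0.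
by apply: measurable_minr => //; exact: measurable_cst.
Qed.

(** Truncated weights are bounded, which makes all the sums over the profiles
    finite beforehand; this subadditivity shows that the truncation preserves
    the Leibniz rule. *)
Lemma subadd_min (q : V -> R) r c : 0 <= r -> 1 <= c -> (forall v, 0 <= q v) ->
  (forall u v, q (u + v) <= c * (q u + q v)) ->
  forall u v, Num.min (q (u + v)) r <= c * (Num.min (q u) r + Num.min (q v) r).
Proof.
move=> r0 c1 q0 qD u v; have := qD u v; have := q0 u; have := q0 v.
rewrite ge_min; case: (leP (q u) r) => h1; case: (leP (q v) r) => h2 h3 h4 h5;
  apply/orP; [left|right|right|right]; nra.
Qed.

Lemma Nw_min_cvg (q : V -> R) (f : V -> R[i]) : weight S q -> inW S f ->
  Nw (fun v => Num.min (q v) n.+1%:R) f @[n --> \oo] --> Nw q f.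
Proof.
move=> wq [g fg]; have mg := Cint_meas fg.1.
have wn n : weight S (fun v => Num.min (q v) n.+1%:R) by exact: weight_min.
rewrite (NwE wq fg) /wint; under eq_fun do rewrite (NwE (wn _) fg) /wint.
have H := @cvg_monotone_convergence _ _ R (fs_mu S) setT measurableT
  (fun n a => (Num.min (q (fs_vec a)) n.+1%:R * cabs (g a))%:E).
have L a : limn (fun n => (Num.min (q (fs_vec a)) n.+1%:R * cabs (g a))%:E) =
   (q (fs_vec a) * cabs (g a))%:E.
  apply/cvg_lim => //.
  have : \forall n \near \oo, q (fs_vec a) <= n%:R by exact: nbhs_infty_ger.
  move=> h; apply: cvg_near_cst; apply: filterS h => n h; rewrite min_l// (le_trans h)//.
  by rewrite ler_nat.
rewrite -(eq_integral _ _ (fun a _ => L a)).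
apply: H.
- by move=> n; exact: (measurable_wint (wn n) mg).
- by move=> n a _; rewrite lee_fin mulr_ge0 ?cabs_ge0//; case: (wn n).
- move=> a _ n n' nn; rewrite lee_fin ler_wpM2r ?cabs_ge0// le_min ge_min lexx/=.
  by rewrite ge_min ler_nat ltnS nn orbT.
Qed.

End truncation.

Section profile.
Context {R : realType} {d : nat} (S : fsetting R d).
Local Notation V := 'rV[R]_d.
Local Notation Nw := (Nw S).
Local Notation N := (Nw (fun=> 1)).
Local Notation inW := (inW S).
Local Notation contW := (contW S).
Local Notation flow := (@flow R d S).
Local Notation leb := (@lebesgue_measure R).
Local Notation mR := (measurableTypeR R).
Variables (sigma : nat) (lambda T : R) (J : set int) (kappa : int -> V).
Variables (alpha : int -> V -> R[i]) (a : R -> int -> V -> R[i]) (E : R).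
Local Notation m := sigma.*2.+1.
Local Notation res := (resonant (sigma := sigma) J kappa).
Local Notation Jm := (tuples_in (m := m) J).
Hypothesis T0 : 0 <= T.
Hypothesis kI : forall j k, J j -> J k -> kappa j = kappa k -> j = k.
Hypothesis ca : forall j, J j -> contW T (fun s => a s j).
Hypothesis E1 : 1 <= E.
Hypothesis aE : forall s, 0 <= s <= T -> (\esum_(j in J) N (a s j) <= E%:E)%E.
Hypothesis prof : forall t j x, 0 <= t <= T -> J j ->
  a t j (x + t *: kappa j) = alpha j x + (0 -i* lambda)%C * time_integral t (fun s =>
    csum (res j) (fun l => alt_prod (fun p => a s (tnth l p) (x + s *: kappa j)))).

Let E0 : 0 <= E. Proof. exact: le_trans ler01 E1. Qed.
Let w1 := weight1 S.
Let l0 : m.-tuple int := [tuple of nseq m 0].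

Definition combined (l : m.-tuple int) : V := alt_vec (fun p => kappa (tnth l p)).

(** The product of the amplitudes of [l], seen along the characteristic of the
    combined wave vector. *)
Definition interaction (l : m.-tuple int) s x : R[i] :=
  alt_prod (fun p => a s (tnth l p) (x + s *: combined l)).

Lemma alphaE j : J j -> alpha j = a 0 j.
Proof.
move=> Jj; apply/funext => x; have := prof (t := 0) x _ Jj.
by rewrite lexx T0 scale0r addr0 time_integral0 mulr0 addr0 => /(_ isT).
Qed.

Let aW s j : J j -> 0 <= s <= T -> inW (a s j).
Proof. by move=> Jj sT; exact: (contW_inW (ca Jj)). Qed.

Lemma contW_translate b (f : R -> V -> R[i]) (y : V) : contW b f ->
  contW b (fun s x => f s (x + s *: y)).
Proof.
move=> cf; apply: (contW_eq (f := fun s => flow (0 + s * 0) (0 + s *: y) (f s))).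
  by move=> s s0 x; rewrite mulr0 !add0r flow_translate//; exact: contW_inW cf s0.
exact: contW_flow.
Qed.

Lemma contW_interaction l : Jm l -> contW T (interaction l).
Proof.
move=> Jl; apply: (contW_alt_prod (f := fun p s x => a s (tnth l p) (x + s *: combined l))) => p.
by apply: (contW_translate (f := fun s => a s (tnth l p))); apply: ca; exact: Jl.
Qed.

Let xx s j := fine (N (a s j)).
Let xxE s j : J j -> 0 <= s <= T -> N (a s j) = (xx s j)%:E.
Proof. by move=> Jj sT; rewrite /xx fineK// N_fin//; exact: aW. Qed.
Let xx0 s j : 0 <= xx s j. Proof. by rewrite /xx fine_ge0// N_ge0. Qed.

Lemma N_interaction l s : Jm l -> 0 <= s <= T ->
  (N (interaction l s) <= (\prod_p xx s (tnth l p))%:E)%E.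
Proof.
move=> Jl sT; apply: (N_alt_prod (f := fun p x => a s (tnth l p) (x + s *: combined l))) => p.
by rewrite (Nw_translate _ _ w1) xxE//; exact: Jl.
Qed.

Lemma esum_N_interaction s : 0 <= s <= T ->
  (\esum_(l in Jm) N (interaction l s) <= (E ^+ m)%:E)%E.
Proof.
move=> sT; apply: (@le_trans _ _ (\esum_(l in Jm) (\prod_(p < m) xx s (tnth l p))%:E)%E).
  by apply: le_esum => l Jl; exact: N_interaction.
have := @esum_tuple_prod R m _ J (fun _ => xx s) (fun=> E).
rewrite prodr_const card_ord; apply => // _.
by apply: le_trans (aE sT); apply: le_esum => j Jj; rewrite xxE.
Qed.

Lemma resonant_sub j : res j `<=` Jm.
Proof. by move=> l []. Qed.
Lemma resonant_combined j l : res j l -> combined l = kappa j.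
Proof. by case. Qed.
(** A resonant tuple determines the wave vector that it generates, hence the
    index: the sets [res j] are disjoint. *)
Lemma resonant_disjoint i j l : J i -> J j -> res i l -> res j l -> i = j.
Proof. by move=> Ji Jj [_ e1 _] [_ e2 _]; apply: kI => //; rewrite -e1 -e2. Qed.

Lemma time_csum_interaction (A : set (m.-tuple int)) t x : A `<=` Jm -> 0 <= t <= T ->
  csummable A (fun l => time_integral t (fun s => interaction l s x)) /\
  time_integral t (fun s => csum A (fun l => interaction l s x)) =
  csum A (fun l => time_integral t (fun s => interaction l s x)).
Proof.
move=> AJ /andP[t0 tT]; apply: (time_csum (S := S) l0 (K := E ^+ m)) => //.
  by move=> l /AJ Jl; apply: contW_le tT _; exact: contW_interaction.
move=> s /andP[s0 st]; apply: le_trans (esum_N_interaction _).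
  by apply: le_esumS => // l; exact: N_ge0.
by rewrite s0 (le_trans st).
Qed.

Lemma profileE t j : 0 <= t <= T -> J j ->
  (fun x => a t j (x + t *: kappa j)) = fun x => alpha j x +
    (0 -i* lambda)%C * csum (res j) (fun l => time_integral t (fun s => interaction l s x)).
Proof.
move=> tT Jj; apply/funext => x; rewrite prof//; congr (_ + _ * _).
have [_ <-] := time_csum_interaction x (resonant_sub (j := j)) tT.
congr time_integral; apply/funext => s; apply: csum_eq => l rl.
by rewrite /interaction (resonant_combined rl).
Qed.

Let time_interaction_sum A t : A `<=` Jm -> 0 <= t <= T ->
  (\esum_(l in A) N (fun x => time_integral t (fun s => interaction l s x)) < +oo)%E.
Proof.
move=> AJ /andP[t0 tT].
have ct l : A l -> contW t (interaction l).
  by move=> /AJ Jl; apply: contW_le tT _; exact: contW_interaction.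
apply: (@le_lt_trans _ _ (\esum_(l in A) \int[leb]_(s in `[0%R, t]) N (interaction l s))%E).
  by apply: le_esum => l Al; apply: Nw_time => //; exact: ct.
apply: le_lt_trans (ltry (t * E ^+ m)); rewrite -int_cst_itv//.
apply: esum_int_le => //.
- by move=> l Al; apply: (measurable_NwT _ w1); exact: ct.
- by move=> l s; exact: N_ge0.
- move=> s; rewrite /= in_itv/= => /andP[s0 st]; apply: le_trans (esum_N_interaction _).
    by apply: le_esumS => // l; exact: N_ge0.
  by rewrite s0 (le_trans st).
Qed.

Section weighted.
Variables (p : int -> R) (q : V -> R) (c : R).
Hypothesis p0 : forall j, 0 <= p j.
Hypothesis pres : forall j l, J j -> res j l -> p j <= \sum_k p (tnth l k).
Hypothesis wq : weight S q.
Hypothesis qN : forall v, q (- v) = q v.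
Hypothesis c1 : 1 <= c.
Hypothesis qD : forall u v, q (u + v) <= c * (q u + q v).

Let c0 : 0 <= c. Proof. exact: le_trans ler01 c1. Qed.

(** The profile equation with norms taken under the sum and the integral: it
    grows with [t], so that its value at [T] bounds all times at once. *)
Definition majorant t j : \bar R := ((p j)%:E * (Nw q (alpha j) + `|lambda|%:E *
  \esum_(l in res j) \int[leb]_(s in `[0%R, t]) Nw q (interaction l s)))%E.

Lemma majorant_ge0 t j : (0 <= majorant t j)%E.
Proof.
rewrite /majorant mule_ge0 ?lee_fin// adde_ge0 ?Nw_ge0// mule_ge0 ?lee_fin//.
by apply: esum_ge0 => l _; apply: integral_ge0 => s _; exact: Nw_ge0.
Qed.

Lemma le_majorant s t j : 0 <= s -> s <= t -> t <= T -> J j ->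
  ((p j)%:E * Nw q (a s j) <= majorant t j)%E.
Proof.
move=> s0 st tT Jj; have sT : 0 <= s <= T by rewrite s0 (le_trans st).
rewrite /majorant lee_wpmul2l ?lee_fin//.
rewrite -(Nw_translate (s *: kappa j) (a s j) wq) profileE//.
apply: le_trans (NwD _ _ wq) _; apply: leeD => //.
have cs : contW s _ := contW_le (le_trans st tT) _.
have sumW : inW (fun x => csum (res j) (fun l => time_integral s (fun r => interaction l r x))).
  apply: (inW_csum l0).
    move=> l /resonant_sub Jl; apply: inW_time => //.
    by apply: cs; exact: contW_interaction.
  by apply: time_interaction_sum => //; exact: resonant_sub.
rewrite (NwZ _ wq sumW) cabs_minus_i lee_wpmul2l ?lee_fin//.
apply: le_trans (Nw_csum l0 _ _ wq) _.
- move=> l /resonant_sub Jl; apply: inW_time => //.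
  by apply: cs; exact: contW_interaction.
- by apply: time_interaction_sum => //; exact: resonant_sub.
apply: le_esum => l /resonant_sub Jl; have cl := contW_interaction Jl.
apply: le_trans (Nw_time s0 _ wq) _; first exact: cs.
apply: ge0_subset_integral => //.
- by apply: measurable_NwT => //; exact: contW_le cl.
- by move=> r _; exact: Nw_ge0.
- by move=> r /=; rewrite !in_itv/= => /andP[-> /le_trans]; exact.
Qed.

Lemma esum_weighted_interaction s (PX Y PY : R) : 0 <= s <= T ->
  (\esum_(j in J) ((p j)%:E * N (a s j)) <= PX%:E)%E ->
  (\esum_(j in J) Nw q (a s j) <= Y%:E)%E ->
  (\esum_(j in J) ((p j)%:E * Nw q (a s j)) <= PY%:E)%E ->
  (\esum_(l in Jm) ((\sum_k p (tnth l k))%:E * Nw q (interaction l s))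
    <= (c ^+ sigma.*2 * (m%:R ^+ 2 * (PY + PX * Y) * E ^+ m))%:E)%E.
Proof.
move=> sT hPX hY hPY; pose y j := fine (Nw q (a s j)).
have yE j : J j -> Nw q (a s j) = (y j)%:E.
  move=> Jj; rewrite /y fineK// ge0_fin_numE ?Nw_ge0//.
  apply: le_lt_trans (ltry Y); apply: le_trans hY.
  by apply: (le_term_esum (f := fun j => Nw q (a s j))) => // i; exact: Nw_ge0.
have y0 j : 0 <= y j by rewrite /y fine_ge0// Nw_ge0.
pose L (l : m.-tuple int) := (\sum_k p (tnth l k)) * leibniz (fun k => xx s (tnth l k)) (fun k => y (tnth l k)).
have L0 l : 0 <= L l by apply: mulr_ge0; [exact: sumr_ge0|exact: leibniz_ge0].
apply: (@le_trans _ _ (\esum_(l in Jm) ((c ^+ sigma.*2)%:E * (L l)%:E))%E).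
  apply: le_esum => l Jl.
  have h : (Nw q (interaction l s) <= (c ^+ sigma.*2 * leibniz (fun k => xx s (tnth l k)) (fun k => y (tnth l k)))%:E)%E.
    apply: (Nw_alt_prod (f := fun k x => a s (tnth l k) (x + s *: combined l))) => // k.
      by rewrite (Nw_translate _ _ w1) xxE//; exact: Jl.
    by rewrite (Nw_translate _ _ wq) yE//; exact: Jl.
  apply: le_trans (lee_wpmul2l _ h) _; first by rewrite lee_fin sumr_ge0.
  by rewrite -!EFinM lee_fin /L mulrCA.
apply: le_trans (esumZ_le _ _ _) _; [exact: exprn_ge0|by move=> l; rewrite lee_fin|].
rewrite EFinM lee_wpmul2l ?lee_fin ?exprn_ge0//.
apply: esum_weighted_leibniz => //.
- by apply: le_trans (aE sT); apply: le_esum => j Jj; rewrite xxE.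
- by apply: le_trans hPX; apply: le_esum => j Jj; rewrite EFinM xxE.
- by apply: le_trans hY; apply: le_esum => j Jj; rewrite yE.
- by apply: le_trans hPY; apply: le_esum => j Jj; rewrite EFinM yE.
Qed.

(** The double sum over [j] and [res j] is a sum over tuples in which each tuple
    occurs at most once, and the weight of [j] is at most the sum of the weights
    of the entries of the tuple. *)
Lemma esum_majorant t (X0 : R) (Phi : R -> R) : 0 <= t <= T ->
  (\esum_(j in J) ((p j)%:E * Nw q (alpha j)) <= X0%:E)%E ->
  measurable_fun setT (Phi : mR -> R) ->
  (forall s, 0 <= s <= t -> exists PX Y PY : R, [/\
    (\esum_(j in J) ((p j)%:E * N (a s j)) <= PX%:E)%E,
    (\esum_(j in J) Nw q (a s j) <= Y%:E)%E,
    (\esum_(j in J) ((p j)%:E * Nw q (a s j)) <= PY%:E)%E &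
    c ^+ sigma.*2 * (m%:R ^+ 2 * (PY + PX * Y) * E ^+ m) <= Phi s]) ->
  (\esum_(j in J) majorant t j <= X0%:E + `|lambda|%:E * \int[leb]_(s in `[0%R, t]) (Phi s)%:E)%E.
Proof.
move=> /andP[t0 tT] hX0 mPhi hs.
pose G l s := ((\sum_k p (tnth l k))%:E * Nw q (interaction l s))%E.
have G0 l s : (0 <= G l s)%E.
  by rewrite /G mule_ge0 ?Nw_ge0// lee_fin sumr_ge0.
have iN0 l : (0 <= \int[leb]_(s in `[0%R, t]) Nw q (interaction l s))%E.
  by apply: integral_ge0 => s _; exact: Nw_ge0.
have iG0 l : (0 <= \int[leb]_(s in `[0%R, t]) G l s)%E.
  by apply: integral_ge0 => s _; exact: G0.
have ct l : Jm l -> contW t (interaction l).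
  by move=> Jl; apply: contW_le tT _; exact: contW_interaction.
have mN l : Jm l -> measurable_fun (`[0, t] : set mR) (fun s => Nw q (interaction l s)).
  by move=> /ct cl; exact: measurable_NwT.
apply: (@le_trans _ _ (\esum_(j in J) ((p j)%:E * Nw q (alpha j) +
   `|lambda|%:E * \esum_(l in res j) \int[leb]_(s in `[0%R, t]) G l s))%E).
  apply: le_esum => j Jj; rewrite /majorant.
  have e0 : (0 <= \esum_(l in res j) \int[leb]_(s in `[0%R, t]) Nw q (interaction l s))%E.
    by apply: esum_ge0.
  rewrite ge0_muleDr ?Nw_ge0//; last by rewrite mule_ge0// lee_fin.
  apply: leeD => //; rewrite muleCA lee_wpmul2l ?lee_fin//.
  apply: le_trans (esumZ_ge _ (p0 j) iN0) _.
  apply: le_esum => l rl; have Jl := resonant_sub rl.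
  rewrite -ge0_integralZl//; [|exact: mN|by move=> s _; exact: Nw_ge0|by rewrite lee_fin].
  apply: ge0_le_integral => //.
  - by move=> s _; rewrite mule_ge0 ?Nw_ge0 ?lee_fin.
  - by apply: measurable_funeM; exact: mN.
  - by apply: measurable_funeM; exact: mN.
  - by move=> s _; rewrite /G lee_wpmul2r ?Nw_ge0// lee_fin; exact: pres.
rewrite esumD; last 2 first.
- by move=> j _; rewrite mule_ge0 ?lee_fin// Nw_ge0.
- by move=> j _; rewrite mule_ge0 ?lee_fin//; exact: esum_ge0.
apply: leeD => //.
apply: le_trans (esumZ_le _ _ _) _ => //; first by move=> j; exact: esum_ge0.
rewrite lee_wpmul2l ?lee_fin//.
rewrite -esum_partition//; last exact: resonant_disjoint.
apply: (@le_trans _ _ (\esum_(l in Jm) \int[leb]_(s in `[0%R, t]) G l s)%E).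
  by apply: le_esumS => // l [j _ /resonant_sub].
apply: esum_int_le => //.
- by move=> l Jl; apply: measurable_funeM; exact: mN.
- by apply/measurable_EFinP; exact: measurable_funTS.
- move=> s; rewrite /= in_itv/= => st.
  have [PX [Y [PY [h1 h2 h3 h4]]]] := hs s st.
  apply: le_trans (esum_weighted_interaction _ h1 h2 h3) _; last by rewrite lee_fin.
  by case/andP: st => -> /le_trans ->.
Qed.

End weighted.

(** When [p] and the derivation measured by [q] fall on two different factors of
    an interaction, a product [PX * Y] of sums appears; [cross] bounds it
    affinely in the sum [X] that is to be estimated, which keeps the Gronwall
    argument linear. *)
Definition cross (p : int -> R) (q : V -> R) (D : R) := forall s X, 0 <= s <= T -> 0 <= X ->
  (\esum_(j in J) ((p j)%:E * Nw q (a s j)) <= X%:E)%E ->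
  exists PX Y, [/\ (\esum_(j in J) ((p j)%:E * N (a s j)) <= PX%:E)%E,
    (\esum_(j in J) Nw q (a s j) <= Y%:E)%E & PX * Y <= E * X + D].

Let min_sum_le n (u : R) (b : 'I_n -> R) r : 0 <= r -> (forall k, 0 <= b k) ->
  u <= \sum_k b k -> Num.min u r <= \sum_k Num.min (b k) r.
Proof.
move=> r0 b0 ub; have [h|/existsNP[k /negP]] := pselect (forall k, b k <= r).
  by rewrite ge_min (le_trans ub)//; apply: ler_sum => k _; rewrite min_l.
rewrite -ltNge => bk; rewrite ge_min; apply/orP; right.
rewrite (bigD1 k)//= min_r ?(ltW bk)// lerDl sumr_ge0// => i _.
by rewrite le_min b0.
Qed.

Section propagation.
Variables (p : int -> R) (q : V -> R) (c X0 D : R).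
Hypothesis p0 : forall j, 0 <= p j.
Hypothesis pres : forall j l, J j -> res j l -> p j <= \sum_k p (tnth l k).
Hypothesis wq : weight S q.
Hypothesis qN : forall v, q (- v) = q v.
Hypothesis c1 : 1 <= c.
Hypothesis qD : forall u v, q (u + v) <= c * (q u + q v).
Hypothesis D0 : 0 <= D.
Hypothesis hX0 : (\esum_(j in J) ((p j)%:E * Nw q (alpha j)) <= X0%:E)%E.
Hypothesis crossr : forall r, 1 <= r ->
  cross (fun j => Num.min (p j) r) (fun v => Num.min (q v) r) D.

Let c0 : 0 <= c. Proof. exact: le_trans ler01 c1. Qed.
Let K := `|lambda| * (c ^+ sigma.*2 * (m%:R ^+ 2 * E ^+ m)).
Let K0 : 0 <= K.
Proof. by rewrite /K !mulr_ge0 ?exprn_ge0. Qed.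
(* At this rate the sum contributes at most one half of itself to its own bound. *)
Let L := 2 * (K * (1 + E)) + 1.
Let L1 : 1 <= L. Proof. by rewrite /L lerDr mulr_ge0// mulr_ge0// addr_ge0. Qed.
Let X00 : 0 <= X0.
Proof.
rewrite -lee_fin; apply: le_trans hX0; apply: esum_ge0 => j _.
by rewrite mule_ge0 ?lee_fin// Nw_ge0.
Qed.

(** The truncation provides the finite bound [r * r * E] from which [absorb]
    starts, and the bound that comes out does not depend on [r]. *)
Lemma truncated_bound r t : 1 <= r -> 0 <= t <= T ->
  (\esum_(j in J) ((Num.min (p j) r)%:E * Nw (fun v => Num.min (q v) r) (a t j))
   <= (2 * (X0 + K * D) * expR (L * T))%:E)%E.
Proof.
move=> r1 tT; have r0 : 0 <= r by exact: le_trans ler01 r1.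
pose pr j := Num.min (p j) r; pose qr v := Num.min (q v) r.
have pr0 j : 0 <= pr j by rewrite le_min p0.
have wqr : weight S qr by exact: weight_min.
have qrN v : qr (- v) = qr v by rewrite /qr qN.
have qrD : forall u v, qr (u + v) <= c * (qr u + qr v).
  by apply: subadd_min => //; case: wq.
have prres j l : J j -> res j l -> pr j <= \sum_k pr (tnth l k).
  by move=> Jj rl; apply: min_sum_le => // ; exact: pres.
pose X s := (\esum_(j in J) ((pr j)%:E * Nw qr (a s j)))%E.
have apriori s : 0 <= s <= T -> (X s <= (r * r * E)%:E)%E.
  move=> sT; apply: (@le_trans _ _ (\esum_(j in J) ((r * r)%:E * N (a s j)))%E).
    apply: le_esum => j Jj.
    have [h|] := @le_Nw_N _ _ S qr r (a s j) wqr r0 (fun v => ltac:(by rewrite /qr ge_min lexx orbT)).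
      rewrite EFinM -muleA; apply: lee_pmul => //; rewrite ?lee_fin ?Nw_ge0//.
      by rewrite ge_min lexx orbT.
    by case; exact: aW.
  apply: le_trans (esumZ_le _ _ _) _; [by rewrite mulr_ge0|by move=> j; exact: N_ge0|].
  by rewrite (EFinM (r * r)) lee_wpmul2l ?lee_fin ?mulr_ge0//; exact: aE.
have exp1 s : 0 <= s -> 1 <= expR (L * s).
  move=> s0; apply: le_trans (expR_ge1Dx _); rewrite lerDl mulr_ge0//.
  exact: le_trans ler01 L1.
have := @absorb R (fun s => 0 <= s <= T) X (X0 + K * D) (r * r * E) L.
have h1 : 0 <= r * r * E by rewrite !mulr_ge0.
have h2 : 0 <= X0 + K * D by rewrite addr_ge0// mulr_ge0.
move=> /(_ h1); set step := (X in (X -> _ -> _ -> _) -> _).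
suff hs : step.
  move=> /(_ hs h2) H; apply: le_trans (H _ t tT) _.
    move=> s sT; apply: le_trans (apriori s sT) _; rewrite lee_fin.
    by rewrite ler_peMr// exp1//; case/andP: sT.
  rewrite lee_fin ler_wpM2l ?mulr_ge0// ler_expR ler_wpM2l//.
    exact: le_trans ler01 L1.
  by case/andP: tT.
rewrite /step => M M0 hM s sT {h1 h2 step}.
pose Phi (r : R) := (c ^+ sigma.*2 * (m%:R ^+ 2 * E ^+ m) * ((1 + E) * M + D)) * expR (L * r).
have hmaj : (\esum_(j in J) majorant pr qr s j <=
    X0%:E + `|lambda|%:E * \int[leb]_(r in `[0%R, s]) (Phi r)%:E)%E.
  apply: (esum_majorant (c := c)) => //.
  - apply: le_trans hX0; apply: le_esum => j _; apply: lee_pmul => //.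
    + by rewrite lee_fin.
    + exact: Nw_ge0.
    + by rewrite lee_fin ge_min lexx.
    + by apply: le_Nw => // v; rewrite ge_min lexx.
  - apply: measurable_funM => //; apply: measurableT_comp; first exact: measurable_expR.
    exact: measurable_funM.
  - move=> s' /andP[s'0 s's]; have s'T : 0 <= s' <= T.
      by rewrite s'0 (le_trans s's)//; case/andP: sT.
    have hX := hM s' s'T; have M'0 : 0 <= M * expR (L * s') by rewrite mulr_ge0// expR_ge0.
    have [PX [Y [h1 h2 h3]]] := crossr r1 s'T M'0 hX.
    exists PX, Y, (M * expR (L * s')); split => //.
    have e1 := exp1 _ s'0.
    have key : M * expR (L * s') + PX * Y <= ((1 + E) * M + D) * expR (L * s').
      have : D <= D * expR (L * s') by rewrite ler_peMr.
      by move: h3; rewrite !mulrDl mul1r; lra.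
    rewrite /Phi (_ : _ * _ * _ * _ = c ^+ sigma.*2 *
        (m%:R ^+ 2 * (((1 + E) * M + D) * expR (L * s')) * E ^+ m)); last by ring.
    by rewrite ler_wpM2l ?exprn_ge0// ler_wpM2r ?exprn_ge0// ler_wpM2l ?exprn_ge0.
apply: (@le_trans _ _ (\esum_(j in J) majorant pr qr s j)%E).
  apply: le_esum => j Jj; apply: (le_majorant (q := qr)) => //; by case/andP: sT.
apply: le_trans hmaj _.
have L0 : 0 < L by exact: lt_le_trans ltr01 L1.
have s0 : 0 <= s by case/andP: sT.
have P0 : 0 <= c ^+ sigma.*2 * (m%:R ^+ 2 * E ^+ m) * ((1 + E) * M + D).
  by rewrite !mulr_ge0 ?exprn_ge0// addr_ge0// mulr_ge0// addr_ge0.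
have hi := integral_exp_le L0 P0 s0.
apply: le_trans (leeD (lexx _) (lee_wpmul2l _ hi)) _; first by rewrite lee_fin.
rewrite -EFinM -EFinD lee_fin.
have e1 := exp1 _ s0.
have -> : `|lambda| * (c ^+ sigma.*2 * (m%:R ^+ 2 * E ^+ m) * ((1 + E) * M + D) * expR (L * s) / L) =
    (K * (1 + E) / L * M + K * D / L) * expR (L * s) by rewrite /K; field; rewrite gt_eqF.
have k1 : K * (1 + E) / L <= 2^-1.
  rewrite ler_pdivrMr// /L; have : 0 <= K * (1 + E) by rewrite mulr_ge0// addr_ge0.
  lra.
have k2 : K * D / L <= K * D by rewrite ler_pdivrMr// ler_peMr// mulr_ge0.
have k3 : X0 <= X0 * expR (L * s) by rewrite ler_peMr.
apply: le_trans (lerD k3 (lexx _)) _; rewrite -mulrDl ler_wpM2r ?expR_ge0//.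
rewrite -addrA lerD2l addrC lerD// mulrC ler_wpM2l//.
Qed.

(** Fatou's lemma as the level of truncation tends to infinity. *)
Lemma propagated t : 0 <= t <= T ->
  (\esum_(j in J) ((p j)%:E * Nw q (a t j)) <= (2 * (X0 + K * D) * expR (L * T))%:E)%E.
Proof.
move=> tT; set C := (X in (_ <= X)%E).
have nn0 j : (0 <= (p j)%:E * Nw q (a t j))%E by rewrite mule_ge0 ?lee_fin// Nw_ge0.
rewrite (esum_int_count (0 : int))//.
pose f (n : nat) (j : disc (0 : int)) : \bar R :=
  if j \in J then ((Num.min (p j) n.+1%:R)%:E * Nw (fun v => Num.min (q v) n.+1%:R) (a t j))%E else 0%E.
have wn n : weight S (fun v => Num.min (q v) n.+1%:R) by exact: weight_min.
have g0 n j : (0 <= (Num.min (p j) n.+1%:R)%:E * Nw (fun v => Num.min (q v) n.+1%:R) (a t j))%E.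
  by apply: mule_ge0; [rewrite lee_fin le_min p0 ler0n|exact: Nw_ge0].
have f0 n j : (0 <= f n j)%E by rewrite /f; case: ifP.
have lim j : limn_einf (f^~ j) = ((fun j => (p j)%:E * Nw q (a t j)) \_ (J : set (disc (0 : int))))%E j.
  suff h : f n j @[n --> \oo] --> ((fun j => (p j)%:E * Nw q (a t j)) \_ (J : set (disc (0 : int))))%E j.
    by have [] := cvg_limn_einf_sup h.
  rewrite /f /patch; case: (boolP (j \in J)) => [|_]; last exact: cvg_cst.
  rewrite inE => Jj.
  have h1 : ((p j)%:E * Nw (fun v => Num.min (q v) n.+1%:R) (a t j) @[n --> \oo] --> (p j)%:E * Nw q (a t j))%E.
    by apply: cvgeZl => //; apply: Nw_min_cvg => //; exact: aW.
  apply: cvg_trans h1; apply: near_eq_cvg.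
  have : \forall n \near \oo, p j <= n%:R by exact: nbhs_infty_ger.
  apply: filterS => n pn; rewrite min_l// (le_trans pn)// ler_nat//.
under eq_integral do rewrite -lim.
apply: le_trans (fatou _ measurableT _ _) _ => //.
rewrite limn_einf_lim; apply: lime_le; first exact: is_cvg_einfs.
apply: nearW => n.
have hle : (\int[@countm R int (0 : int)%R]_j f n j <= C)%E.
  have := truncated_bound (r := n.+1%:R) ltac:(by rewrite ler1n) tT.
  by rewrite (esum_int_count (0 : int)).
by apply: le_trans hle; apply: ereal_inf_lbound; exists n => /=.
Qed.

Hypothesis cross0 : cross p q D.

(** The majorant at time [T], with the bounds of [propagated] inserted under the
    time integral. *)
Lemma weighted_majorant : exists b : int -> R, [/\ forall j, 0 <= b j,
  exists B : R, (\esum_(j in J) (b j)%:E <= B%:E)%E &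
  forall s j, 0 <= s <= T -> J j -> ((p j)%:E * Nw q (a s j) <= (b j)%:E)%E].
Proof.
set C := 2 * (X0 + K * D) * expR (L * T).
have C0 : 0 <= C by rewrite !mulr_ge0 ?expR_ge0// addr_ge0// mulr_ge0.
pose P := c ^+ sigma.*2 * (m%:R ^+ 2 * (C + (E * C + D)) * E ^+ m).
have hB : (\esum_(j in J) majorant p q T j <= (X0 + `|lambda| * (T * P))%:E)%E.
  rewrite EFinD EFinM -int_cst_itv//; apply: (esum_majorant (c := c)) => //.
  - by rewrite T0 lexx.
  - move=> s sT; have hC := propagated sT.
    have [PX [Y [h1 h2 h3]]] := cross0 sT C0 hC.
    exists PX, Y, C; split => //; rewrite /P ler_wpM2l ?exprn_ge0// ler_wpM2r ?exprn_ge0//.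
    by rewrite ler_wpM2l ?exprn_ge0// lerD2l.
have m0 j := @majorant_ge0 p q p0 wq T j.
have mE j : J j -> (fine (majorant p q T j))%:E = majorant p q T j.
  move=> Jj; rewrite fineK// ge0_fin_numE//; apply: le_lt_trans (ltry _).
  exact: le_trans (le_term_esum Jj m0) hB.
exists (fun j => fine (majorant p q T j)); split.
- by move=> j; exact: fine_ge0.
- exists (X0 + `|lambda| * (T * P)); apply: le_trans hB; apply: le_esum => j Jj.
  by rewrite mE.
- by move=> s j /andP[s0 sT] Jj; rewrite mE//; exact: le_majorant.
Qed.

End propagation.

Let sum_1N s : 0 <= s <= T -> (\esum_(j in J) (1%:E * N (a s j)) <= E%:E)%E.
Proof. by move=> sT; under eq_esum do rewrite mul1e; exact: aE. Qed.

Let cross_p1 q : cross (fun=> 1) q 0.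
Proof.
move=> s X sT X0 hX; exists E, X; split; first exact: sum_1N.
  by under eq_esum do rewrite -[Nw q _]mul1e.
by rewrite addr0.
Qed.

Let cross_q1 p : cross p (fun=> 1) 0.
Proof.
by move=> s X sT X0 hX; exists X, E; split => //; [exact: aE|rewrite mulrC addr0].
Qed.

Let min1 (r : R) : 1 <= r -> Num.min 1 r = 1.
Proof. by move=> r1; rewrite min_l. Qed.

Let cross_p1r q r : 1 <= r -> cross (fun=> Num.min 1 r) q 0.
Proof. by move=> r1; rewrite min1//; exact: cross_p1. Qed.

Let cross_q1r p r : 1 <= r -> cross p (fun=> Num.min 1 r) 0.
Proof. by move=> r1; rewrite min1//; exact: cross_q1. Qed.

Section regular.
Variables (P : int -> R) (X0 : R).
Hypothesis P0 : forall j, 0 <= P j.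
Hypothesis Pres : forall j l, J j -> res j l -> P j <= \sum_k P (tnth l k).
Hypothesis init1 : (\esum_(j in J) ((P j)%:E * N (alpha j)) <= X0%:E)%E.
Hypothesis init2 : (\esum_(j in J) Nw l1norm (alpha j) <= X0%:E)%E.
Hypothesis init3 : (\esum_(j in J) ((P j)%:E * Nw l1norm (alpha j)) <= X0%:E)%E.
Hypothesis init4 : (\esum_(j in J) Nw (@sqnorm R d) (alpha j) <= X0%:E)%E.

Let one0 (j : int) : 0 <= 1 :> R. Proof. exact: ler01. Qed.
Let one_res j (l : m.-tuple int) : J j -> res j l -> 1 <= \sum_(k < m) 1 :> R.
Proof. by move=> _ _; rewrite sumr_const card_ord ler1n. Qed.
Let one_sub (u v : V) : 1 <= 1 * (1 + 1) :> R. Proof. lra. Qed.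
Let l1_sub (u v : V) : l1norm (u + v) <= 1 * (l1norm u + l1norm v).
Proof. by rewrite mul1r l1normD. Qed.
Let wl1 := weight_l1norm S.
Let wsq := weight_sqnorm S.

(** The weights are propagated one after the other: 1, [P], [l1norm], [sqnorm],
    and last the product of [P] and [l1norm], whose cross terms are bounded by
    the second and the third. The quotient of the sum [b] by the maximum of 1
    and [P] is the family [x], to which one factor [P] can be restored. *)
Lemma profile_majorant : exists b x : int -> R, [/\
  forall j, 0 <= x j <= b j, forall j, P j * x j <= b j,
  exists2 B, 1 <= B & (\esum_(j in J) (b j)%:E <= B%:E)%E,
  forall s j, 0 <= s <= T -> J j -> (N (a s j) <= (x j)%:E)%E /\
    (Nw l1norm (a s j) <= (x j)%:E)%E &
  forall s j, 0 <= s <= T -> J j -> (Nw (@sqnorm R d) (a s j) <= (b j)%:E)%E].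
Proof.
have initN : (\esum_(j in J) (1%:E * N (alpha j)) <= E%:E)%E.
  under eq_esum => j Jj do rewrite alphaE//; apply: sum_1N; exact/andP.
have [b1 [b10 [B1 hB1] hb1]] := @weighted_majorant (fun=> 1) (fun=> 1) 1 E 0 one0 one_res w1
  (fun=> erefl) (lexx _) one_sub (lexx _) initN
  (fun r r1 => @cross_p1r _ r r1) (@cross_p1 _).
have [bP [bP0 [BP hBP] hbP]] := @weighted_majorant P (fun=> 1) 1 X0 0 P0 Pres w1
  (fun=> erefl) (lexx _) one_sub (lexx _) init1
  (fun r r1 => @cross_q1r _ r r1) (@cross_q1 _).
have init2' : (\esum_(j in J) (1%:E * Nw l1norm (alpha j)) <= X0%:E)%E.
  by under eq_esum do rewrite mul1e.
have [bL [bL0 [BL hBL] hbL]] := @weighted_majorant (fun=> 1) l1norm 1 X0 0 one0 one_res wl1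
  (@l1normN _ _) (lexx _) l1_sub (lexx _) init2'
  (fun r r1 => @cross_p1r _ r r1) (@cross_p1 _).
have init4' : (\esum_(j in J) (1%:E * Nw (@sqnorm R d) (alpha j)) <= X0%:E)%E.
  by under eq_esum do rewrite mul1e.
have [bQ [bQ0 [BQ hBQ] hbQ]] := @weighted_majorant (fun=> 1) (@sqnorm R d) 2 X0 0 one0 one_res wsq
  (@sqnormN _ _) (ler1n R 2) (@sqnormD _ _) (lexx _) init4'
  (fun r r1 => @cross_p1r _ r r1) (@cross_p1 _).
have sumP s : 0 <= s <= T -> (\esum_(j in J) ((P j)%:E * N (a s j)) <= BP%:E)%E.
  by move=> sT; apply: le_trans hBP; apply: le_esum => j Jj; exact: hbP.
have sumL s : 0 <= s <= T -> (\esum_(j in J) Nw l1norm (a s j) <= BL%:E)%E.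
  by move=> sT; apply: le_trans hBL; apply: le_esum => j Jj; rewrite -[leLHS]mul1e; exact: hbL.
have BP0 : 0 <= BP.
  by rewrite -lee_fin; apply: le_trans hBP; apply: esum_ge0 => j _; rewrite lee_fin.
have BL0 : 0 <= BL.
  by rewrite -lee_fin; apply: le_trans hBL; apply: esum_ge0 => j _; rewrite lee_fin.
have ge_minl (u v : R) : Num.min u v <= u by rewrite ge_min lexx.
have crossPL p q : (forall j, p j <= P j) -> weight S q -> (forall v, q v <= l1norm v) ->
    cross p q (BP * BL).
  move=> pP wq ql s X sT X00 _; exists BP, BL; split.
  - apply: le_trans (sumP s sT); apply: le_esum => j _.
    by apply: lee_wpmul2r; rewrite ?lee_fin ?N_ge0.
  - by apply: le_trans (sumL s sT); apply: le_esum => j _; exact: le_Nw.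
  - by rewrite lerDr mulr_ge0.
have [bM [bM0 [BM hBM] hbM]] := @weighted_majorant P l1norm 1 X0 (BP * BL) P0 Pres wl1
  (@l1normN _ _) (lexx _) l1_sub (mulr_ge0 BP0 BL0) init3
  (fun r r1 => crossPL _ _ (fun j => ge_minl (P j) r)
     (weight_min wl1 (le_trans ler01 r1)) (fun v => ge_minl (l1norm v) r))
  (crossPL _ _ (fun j => lexx _) wl1 (fun v => lexx _)).
pose b j := b1 j + bP j + bL j + bM j + bQ j.
pose M j := Num.max 1 (P j).
have M1 j : 1 <= M j by rewrite le_max lexx.
have M0 j : 0 < M j by exact: lt_le_trans ltr01 (M1 j).
have b0 j : 0 <= b j by rewrite /b !addr_ge0.
have bound q s j (u v : int -> R) : weight S q -> (Nw q (a s j) <= (u j)%:E)%E ->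
    ((P j)%:E * Nw q (a s j) <= (v j)%:E)%E -> u j <= b j -> v j <= b j ->
    (Nw q (a s j) <= (b j / M j)%:E)%E.
  move=> wq hu hv ub vb.
  have fn : Nw q (a s j) \is a fin_num.
    by rewrite ge0_fin_numE ?Nw_ge0//; exact: le_lt_trans hu (ltry _).
  move: hu hv; rewrite -(fineK fn) -EFinM !lee_fin => hu hv.
  rewrite ler_pdivlMr// mulrC /M maxEle; case: ifP => _.
    exact: le_trans hv vb.
  by rewrite mul1r (le_trans hu ub).
exists b, (fun j => b j / M j); split.
- by move=> j; rewrite divr_ge0 ?(ltW (M0 j))//= ler_pdivrMr// ler_peMr.
- move=> j; rewrite mulrA ler_pdivrMr// mulrC ler_wpM2l//.
  by rewrite le_max lexx orbT.
- exists (1 + `|B1 + BP + BL + BM + BQ|); first by rewrite lerDl.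
  apply: (@le_trans _ _ (B1%:E + BP%:E + BL%:E + BM%:E + BQ%:E)%E); last first.
    by rewrite -!EFinD lee_fin (le_trans (ler_norm _))// lerDr.
  rewrite /b; under eq_esum do rewrite !EFinD.
  have p0 (u : int -> R) : (forall j, 0 <= u j) -> forall j, J j -> (0 <= (u j)%:E)%E.
    by move=> h j _; rewrite lee_fin.
  do 4 (rewrite esumD; [|by move=> j Jj; rewrite -?EFinD lee_fin ?addr_ge0..]).
  by rewrite !leeD.
- move=> s j sT Jj; split.
  + apply: (bound _ _ _ b1 bP) => //; [|exact: hbP| |].
    * by rewrite -[leLHS]mul1e; exact: hb1.
    * by rewrite /b -!addrA lerDl !addr_ge0.
    * by rewrite /b (addrC (b1 j)) -!addrA lerDl !addr_ge0.
  + apply: (bound _ _ _ bL bM) => //; [|exact: hbM| |].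
    * by rewrite -[leLHS]mul1e; exact: hbL.
    * by rewrite /b; move: (b10 j) (bP0 j) (bM0 j) (bQ0 j) (bL0 j); lra.
    * by rewrite /b; move: (b10 j) (bP0 j) (bM0 j) (bQ0 j) (bL0 j); lra.
- move=> s j sT Jj; apply: (@le_trans _ _ (bQ j)%:E).
    by rewrite -[leLHS]mul1e; exact: hbQ.
  by rewrite lee_fin /b; move: (b10 j) (bP0 j) (bM0 j) (bQ0 j) (bL0 j); lra.
Qed.

End regular.

End profile.

(** * The approximate solution almost solves the equation *)

Section leibniz_linear.
Context {R : realType}.

Lemma leibnizD n (x y y' : 'I_n -> R) :
  leibniz x (fun k => y k + y' k) = leibniz x y + leibniz x y'.
Proof. by rewrite /leibniz -big_split; apply: eq_bigr => k _; rewrite mulrDl. Qed.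

Lemma leibnizZ n (x y : 'I_n -> R) z : leibniz x (fun k => z * y k) = z * leibniz x y.
Proof. by rewrite /leibniz mulr_sumr; apply: eq_bigr => k _; rewrite mulrA. Qed.

Lemma alt_prod_expi n (z : 'I_n -> R[i]) (th : 'I_n -> R) :
  alt_prod (fun k => z k * expi (th k)) =
  alt_prod z * expi (\sum_(k < n) (-1) ^+ k * th k).
Proof.
rewrite /alt_prod expi_sum -big_split; apply: eq_bigr => k _ /=.
rewrite -(signr_odd _ k); case: (odd k); rewrite ?expr0 ?mul1r//.
by rewrite expr1 mulN1r expiN conjcM.
Qed.

End leibniz_linear.

Lemma dot_suml {R : realType} {d : nat} n (F : 'I_n -> 'rV[R]_d) v :
  dot (\sum_k F k) v = \sum_k dot (F k) v.
Proof.
by rewrite (big_morph (fun u => dot u v) (fun u u' => dotDl u u' v) (dot0l v)).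
Qed.

Section residual.
Context {R : realType} {d : nat} (S : fsetting R d).
Local Notation G := (fs_G S).
Local Notation vec := (@fs_vec _ _ S).
Local Notation V := 'rV[R]_d.
Local Notation Nw := (Nw S).
Local Notation N := (Nw (fun=> 1)).
Local Notation inW := (inW S).
Local Notation contW := (contW S).
Local Notation flow := (@flow R d S).
Variables (sigma : nat) (lambda T : R) (J : set int) (kappa : int -> V).
Variables (alpha : int -> V -> R[i]) (a : R -> int -> V -> R[i]) (E : R).
Local Notation m := sigma.*2.+1.
Local Notation res := (resonant (sigma := sigma) J kappa).
Local Notation Jm := (tuples_in (m := m) J).
Local Notation comb := (combined (sigma := sigma) kappa).
Local Notation inter := (interaction (sigma := sigma) kappa a).
Hypothesis T0 : 0 <= T.
Hypothesis kI : forall j k, J j -> J k -> kappa j = kappa k -> j = k.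
Hypothesis ca : forall j, J j -> contW T (fun s => a s j).
Hypothesis E1 : 1 <= E.
Hypothesis aE : forall s, 0 <= s <= T -> (\esum_(j in J) N (a s j) <= E%:E)%E.
Hypothesis prof : forall t j x, 0 <= t <= T -> J j ->
  a t j (x + t *: kappa j) = alpha j x + (0 -i* lambda)%C * time_integral t (fun s =>
    csum (res j) (fun l => alt_prod (fun p => a s (tnth l p) (x + s *: kappa j)))).
Variables (P b x : int -> R) (B : R).
Hypothesis P0 : forall j, 0 <= P j.
Hypothesis Pkappa : (forall j i, J j -> `|kappa j 0 i| <= P j) \/
  (forall t j, 0 <= t <= T -> J j -> Nw l1norm (a t j) = 0%E).
Hypothesis xb : forall j, 0 <= x j <= b j.
Hypothesis Pxb : forall j, P j * x j <= b j.
Hypothesis B1 : 1 <= B.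
Hypothesis bB : (\esum_(j in J) (b j)%:E <= B%:E)%E.
Hypothesis ax : forall s j, 0 <= s <= T -> J j ->
  (N (a s j) <= (x j)%:E)%E /\ (Nw l1norm (a s j) <= (x j)%:E)%E.
Hypothesis asq : forall s j, 0 <= s <= T -> J j -> (Nw (@sqnorm R d) (a s j) <= (b j)%:E)%E.

Let w1 := weight1 S.
Let l0 : m.-tuple int := [tuple of nseq m 0].
Let x0 j : 0 <= x j. Proof. by have /andP[] := xb j. Qed.
Let b0 j : 0 <= b j. Proof. by have /andP[? ?] := xb j; exact: le_trans (x0 j) _. Qed.
Let B0 : 0 <= B. Proof. exact: le_trans ler01 B1. Qed.
Let ci l : Jm l -> contW T (inter l).
Proof. exact: contW_interaction. Qed.
Let Px l := \prod_(k < m) x (tnth l k).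
Let Px0 l : 0 <= Px l. Proof. exact: prodr_ge0. Qed.
Let xB : (\esum_(j in J) (x j)%:E <= B%:E)%E.
Proof.
by apply: le_trans bB; apply: le_esum => j _; rewrite lee_fin; have /andP[] := xb j.
Qed.
Let PxB : (\esum_(j in J) (P j * x j)%:E <= B%:E)%E.
Proof. by apply: le_trans bB; apply: le_esum => j _; rewrite lee_fin. Qed.

Let N_interaction_x l s : Jm l -> 0 <= s <= T -> (N (inter l s) <= (Px l)%:E)%E.
Proof.
move=> Jl sT; apply: (N_alt_prod (f := fun p v => a s (tnth l p) (v + s *: comb l))) => p.
by rewrite (Nw_translate _ _ w1); have [] := ax sT (Jl p).
Qed.

Let sum_Px : (\esum_(l in Jm) (Px l)%:E <= (B ^+ m)%:E)%E.
Proof.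
have := @esum_tuple_prod R m _ J (fun _ => x) (fun=> B).
by rewrite prodr_const card_ord; apply.
Qed.

Let Nsq_interaction l s : Jm l -> 0 <= s <= T ->
  (Nw (@sqnorm R d) (inter l s) <=
    (2 ^+ sigma.*2 * leibniz (fun k => x (tnth l k)) (fun k => b (tnth l k)))%:E)%E.
Proof.
move=> Jl sT; have wsq := weight_sqnorm S.
apply: (Nw_alt_prod (f := fun p v => a s (tnth l p) (v + s *: comb l))) => //.
- exact: sqnormN.
- exact: ler1n.
- exact: sqnormD.
- by move=> p; rewrite (Nw_translate _ _ w1); have [] := ax sT (Jl p).
- by move=> p; rewrite (Nw_translate _ _ wsq); exact: asq.
Qed.

Let AW t j : J j -> 0 <= t <= T -> inW (a t j).
Proof. by move=> Jj tT; exact: (contW_inW (ca Jj)). Qed.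

Definition speed j := fine (`|lambda|%:E * \esum_(l in res j) (Px l)%:E)%E.

Let sum_res_Px j : (\esum_(l in res j) (Px l)%:E <= (B ^+ m)%:E)%E.
Proof.
apply: le_trans sum_Px; apply: le_esumS; first exact: resonant_sub.
by move=> l; rewrite lee_fin.
Qed.

Let speedE j : (speed j)%:E = (`|lambda|%:E * \esum_(l in res j) (Px l)%:E)%E.
Proof.
have h0 : (0 <= \esum_(l in res j) (Px l)%:E)%E.
  by apply: esum_ge0 => l _; rewrite lee_fin.
rewrite /speed fineK// ge0_fin_numE ?mule_ge0 ?lee_fin//.
apply: le_lt_trans (ltry (`|lambda| * B ^+ m)).
by rewrite EFinM lee_wpmul2l ?lee_fin//; exact: sum_res_Px.
Qed.

Let speed0 j : 0 <= speed j.
Proof.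
rewrite -lee_fin speedE mule_ge0 ?lee_fin//.
by apply: esum_ge0 => l _; rewrite lee_fin.
Qed.

Let sum_speed : (\esum_(j in J) (speed j)%:E <= (`|lambda| * B ^+ m)%:E)%E.
Proof.
under eq_esum do rewrite speedE.
apply: le_trans (esumZ_le _ _ _) _ => //.
  by move=> j; apply: esum_ge0 => l _; rewrite lee_fin.
rewrite EFinM lee_wpmul2l ?lee_fin//.
have tB i j l : J i -> J j -> res i l -> res j l -> i = j by exact: resonant_disjoint.
rewrite -(@esum_partition R _ _ J (fun j => res j) tB (fun l => (Px l)%:E)); last first.
  by move=> l; rewrite lee_fin.
apply: le_trans sum_Px; apply: le_esumS; last by move=> l; rewrite lee_fin.
by move=> l [j _ /resonant_sub].
Qed.

(** Along the characteristic of [j] the profile equation is an integral equation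
    in time; the terms in [alpha] cancel in the difference. *)
Lemma amplitude_lipschitz s h j : 0 <= s -> 0 <= h -> s + h <= T -> J j ->
  (N (fun v => a (s + h) j (v + (s + h) *: kappa j) - a s j (v + s *: kappa j))%R
    <= (h * speed j)%:E)%E.
Proof.
move=> s0 h0 shT Jj.
have sT : 0 <= s <= T by rewrite s0 (le_trans _ shT)// lerDl.
have shT' : 0 <= s + h <= T by rewrite shT addr_ge0.
pose I l v := time_integral h (fun r => inter l (r + s) v).
have cis l : Jm l -> contW h (fun r => inter l (r + s)).
  move=> Jl; apply: (contW_le (T := T - s)); first by rewrite lerBrDl.
  exact: contW_shift (ci Jl).
have e1 := profileE ca aE prof shT' Jj.
have e2 := profileE ca aE prof sT Jj.
have E' : (fun v => a (s + h) j (v + (s + h) *: kappa j) - a s j (v + s *: kappa j)) =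
    fun v => (0 -i* lambda)%C * csum (res j) (fun l => I l v).
  apply/funext => v.
  rewrite (congr1 (fun g => g v) e1) (congr1 (fun g => g v) e2).
  have [sh1 _] := @time_csum_interaction R d S sigma T J kappa a E ca aE (res j) (s + h) v (@resonant_sub R d sigma J kappa j) shT'.
  have [sh2 _] := @time_csum_interaction R d S sigma T J kappa a E ca aE (res j) s v (@resonant_sub R d sigma J kappa j) sT.
  rewrite opprD addrACA subrr add0r.
  rewrite -mulrBr; congr (_ * _).
  rewrite -(csumB l0 sh1 sh2).
  apply: csum_eq => l /resonant_sub Jl; rewrite (@time_split R d S s h (inter l))//.
    by rewrite addrC addKr.
  exact: contW_le (ci Jl).
have IN l : res j l -> (N (I l) <= (h * Px l)%:E)%E.
  move=> /resonant_sub Jl; apply: N_time_cst => //; first exact: cis.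
  move=> r /andP[r0 rh]; apply: N_interaction_x => //.
  by rewrite addr_ge0//= (le_trans _ shT)// addrC lerD2l.
have IW l : res j l -> inW (I l) by move=> rl; exact: inW_le (IN l rl).
have sumI : (\esum_(l in res j) N (I l) <= h%:E * \esum_(l in res j) (Px l)%:E)%E.
  apply: (@le_trans _ _ (\esum_(l in res j) (h%:E * (Px l)%:E))%E).
    by apply: le_esum => l rl; rewrite -EFinM; exact: IN.
  by apply: esumZ_le => // l; rewrite lee_fin.
have Ifin : (\esum_(l in res j) N (I l) < +oo)%E.
  apply: le_lt_trans sumI _; apply: (@le_lt_trans _ _ (h%:E * (B ^+ m)%:E)%E); last by rewrite -EFinM ltry.
  by rewrite lee_wpmul2l ?lee_fin//; exact: sum_res_Px.
rewrite E' NwZ//; last by apply: (inW_csum l0).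
rewrite cabs_minus_i EFinM speedE muleCA lee_wpmul2l ?lee_fin//.
by apply: le_trans sumI; apply: (Nw_csum l0).
Qed.

Let Psum (l : m.-tuple int) := \sum_k P (tnth l k).
Let Psum0 l : 0 <= Psum l. Proof. exact: sumr_ge0. Qed.

Let drift l k i : (forall j i, J j -> `|kappa j 0 i| <= P j) -> Jm l ->
  `|(comb l - kappa (tnth l k)) 0 i| <= 2 * Psum l.
Proof.
move=> kP Jl; rewrite !mxE (le_trans (ler_normB _ _))// mulr_natl mulr2n; apply: lerD.
  rewrite /combined /alt_vec summxE (le_trans (ler_norm_sum _ _ _))//.
  by apply: ler_sum => q _; rewrite !mxE normrM normrX normrN1 expr1n mul1r kP.
by rewrite (le_trans (kP _ i (Jl k)))// /Psum (bigD1 k)//= lerDl sumr_ge0.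
Qed.

(** The first term comes from the time derivative of the factors along their own
    characteristics, the second one from the drift between these and the
    characteristic of the product. *)
Definition interaction_speed (l : m.-tuple int) :=
  leibniz (fun k => x (tnth l k)) (fun k => speed (tnth l k)) +
  2 * Psum l * leibniz (fun k => x (tnth l k)) (fun k => x (tnth l k)).

(** Each factor is evaluated along the characteristic of the product instead of
    its own: the drift between the two costs one derivative of the amplitude and
    one factor of the size of the wave vectors. *)
Lemma interaction_lipschitz l s h : Jm l -> 0 <= s -> 0 <= h -> s + h <= T ->
  (N (fun v => inter l (s + h) v - inter l s v)%R
    <= (h * interaction_speed l)%:E)%E.
Proof.
move=> Jl s0 h0 shT.
have sT : 0 <= s <= T by rewrite s0 (le_trans _ shT)// lerDl.
have shT' : 0 <= s + h <= T by rewrite shT addr_ge0.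
have -> : h * interaction_speed l = leibniz (fun k => x (tnth l k))
    (fun k => h * (speed (tnth l k) + 2 * Psum l * x (tnth l k))).
  by rewrite leibnizZ leibnizD leibnizZ.
apply: (N_alt_prod_sub (f := fun p v => a (s + h) (tnth l p) (v + (s + h) *: comb l))
  (g := fun p v => a s (tnth l p) (v + s *: comb l))) => k.
- by rewrite (Nw_translate _ _ w1); have [] := ax shT' (Jl k).
- by rewrite (Nw_translate _ _ w1); have [] := ax sT (Jl k).
set j := tnth l k; have Jj : J j by exact: Jl.
pose eta := comb l - kappa j.
have etaE : eta = comb l - kappa j by [].
have ke : comb l = kappa j + eta by rewrite /eta addrC subrK.
clearbody eta.
apply: le_trans (Nw_tri _ (fun v => a s j (v + s *: kappa j + (s + h) *: eta)) _ w1) _.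
rewrite mulrDr EFinD; apply: leeD.
  pose D v := a (s + h) j (v + (s + h) *: kappa j) - a s j (v + s *: kappa j).
  rewrite (@Nw_ext _ _ _ _ _ (fun v => D (v + (s + h) *: eta))); last first.
    move=> v; rewrite /D ke; congr (a _ _ _ - a _ _ _); first by rewrite scalerDr addrA addrAC.
    by rewrite addrAC.
  by rewrite (Nw_translate _ _ w1); exact: amplitude_lipschitz.
pose f v := a s j (v + s *: comb l).
have fW : inW f by apply: inW_translate; exact: AW.
have Nf : Nw l1norm f = Nw l1norm (a s j) by apply: Nw_translate; exact: weight_l1norm.
rewrite (@Nw_ext _ _ _ _ _ (fun v => flow 0 (h *: eta) f v - f v)); last first.
  move=> v; rewrite flow_translate// /f; congr (a _ _ _ - _).
  rewrite ke scalerDr scalerDl -!addrA; congr (_ + _).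
  by rewrite [RHS]addrC addrA.
have [kP|z] := Pkappa.
  apply: le_trans (flow_sub_le (K := h * (2 * Psum l)) _ fW _ _) _.
  - by move=> i; rewrite mxE normrM ger0_norm// ler_wpM2l// etaE; exact: drift.
  - by rewrite !mulr_ge0.
  rewrite (_ : h * (2 * Psum l * x j) = h * (2 * Psum l) * x j); last by ring.
  rewrite normr0 mul0e add0e [leRHS]EFinM Nf lee_wpmul2l ?lee_fin ?mulr_ge0//.
  by have [] := ax sT Jj.
have ge i : `|(h *: eta) 0 i| <= l1norm (h *: eta).
  by rewrite /l1norm (bigD1 i)//= lerDl sumr_ge0.
apply: le_trans (flow_sub_le _ fW ge _) _; first exact: l1norm_ge0.
by rewrite normr0 mul0e add0e Nf z// mule0 lee_fin !mulr_ge0.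
Qed.

(** One quantity that dominates the constants of all the error terms of a tuple,
    so that a single sum over the tuples is needed. *)
Definition tuple_size (l : m.-tuple int) := interaction_speed l +
  2 ^+ sigma.*2 * leibniz (fun k => x (tnth l k)) (fun k => b (tnth l k)) + Px l.

Lemma tuple_size_ge0 l : 0 <= tuple_size l.
Proof.
rewrite /tuple_size /interaction_speed !addr_ge0//.
- exact: leibniz_ge0.
- by rewrite !mulr_ge0// leibniz_ge0.
- by rewrite mulr_ge0 ?exprn_ge0// leibniz_ge0.
Qed.

Let leibniz_sum (y : int -> R) Y : (forall j, 0 <= y j) ->
  (\esum_(j in J) (y j)%:E <= Y%:E)%E ->
  (\esum_(l in Jm) (leibniz (fun k => x (tnth l k)) (fun k => y (tnth l k)))%:E
    <= (m%:R ^+ 2 * (Y + B * Y) * B ^+ m)%:E)%E.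
Proof.
move=> y0 yY; have := @esum_weighted_leibniz R m _ J (fun=> 1) x y B B Y Y B1
  (fun=> ler01) x0 y0 xB.
have e1 (z : int -> R) Z : (\esum_(j in J) (z j)%:E <= Z%:E)%E -> (\esum_(j in J) (1 * z j)%:E <= Z%:E)%E.
  by under eq_esum do rewrite -[z _]mul1r.
move=> /(_ (e1 _ _ xB) yY (e1 _ _ yY)); apply: le_trans; apply: le_esum => l _.
by rewrite lee_fin ler_peMl ?leibniz_ge0// sumr_const card_ord ler1n.
Qed.

Definition total_size : R :=
  m%:R ^+ 2 * (`|lambda| * B ^+ m + B * (`|lambda| * B ^+ m)) * B ^+ m +
  2 * (m%:R ^+ 2 * (B + B * B) * B ^+ m) +
  2 ^+ sigma.*2 * (m%:R ^+ 2 * (B + B * B) * B ^+ m) + B ^+ m.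

Lemma esum_tuple_size : (\esum_(l in Jm) (tuple_size l)%:E <= total_size%:E)%E.
Proof.
have L0 (y : int -> R) l : (forall j, 0 <= y j) ->
    0 <= leibniz (fun k : 'I_m => x (tnth l k)) (fun k => y (tnth l k)) by move=> y0; exact: leibniz_ge0.
have E2 l : (tuple_size l)%:E = ((leibniz (fun k => x (tnth l k)) (fun k => speed (tnth l k)))%:E +
   2%:E * (Psum l * leibniz (fun k => x (tnth l k)) (fun k => x (tnth l k)))%:E +
   (2 ^+ sigma.*2)%:E * (leibniz (fun k => x (tnth l k)) (fun k => b (tnth l k)))%:E + (Px l)%:E)%E.
  by rewrite -!EFinM -!EFinD /tuple_size /interaction_speed mulrA.
under eq_esum do rewrite E2.
have t1 l : (0 <= (leibniz (fun k : 'I_m => x (tnth l k)) (fun k => speed (tnth l k)))%:E)%E.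
  by rewrite lee_fin L0.
have t2' l : (0 <= (Psum l * leibniz (fun k : 'I_m => x (tnth l k)) (fun k => x (tnth l k)))%:E)%E.
  by rewrite lee_fin mulr_ge0// L0.
have t2 l : (0 <= 2%:E * (Psum l * leibniz (fun k : 'I_m => x (tnth l k)) (fun k => x (tnth l k)))%:E)%E.
  by rewrite mule_ge0// lee_fin.
have t3' l : (0 <= (leibniz (fun k : 'I_m => x (tnth l k)) (fun k => b (tnth l k)))%:E)%E.
  by rewrite lee_fin L0.
have t3 l : (0 <= (2 ^+ sigma.*2)%:E * (leibniz (fun k : 'I_m => x (tnth l k)) (fun k => b (tnth l k)))%:E)%E.
  by rewrite mule_ge0// lee_fin exprn_ge0.
have t4 l : (0 <= (Px l)%:E)%E by rewrite lee_fin.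
rewrite esumD => [|l _|l _//]; last by rewrite !adde_ge0.
rewrite esumD => [|l _|l _//]; last by rewrite !adde_ge0.
rewrite esumD => [|l _//|l _//].
rewrite /total_size [leRHS]EFinD; apply: leeD; last exact: sum_Px.
rewrite [leRHS]EFinD; apply: leeD; first (rewrite [leRHS]EFinD; apply: leeD).
- exact: leibniz_sum.
- apply: le_trans (esumZ_le _ _ t2') _ => //; rewrite EFinM lee_wpmul2l ?lee_fin//.
  exact: esum_weighted_leibniz.
- apply: le_trans (esumZ_le _ _ t3') _; first exact: exprn_ge0.
  rewrite EFinM lee_wpmul2l ?lee_fin ?exprn_ge0//; exact: leibniz_sum.
Qed.

(** ** The oscillating waves at a fixed semiclassical parameter *)

Section waves.
Variable eps : R.
Hypothesis eps01 : 0 < eps <= 1.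
Hypothesis freqJ : forall j, J j -> exists g : G, vec g = eps^-1 *: kappa j.
Hypothesis freqJm : forall l, Jm l -> exists g : G, vec g = eps^-1 *: comb l.

Let eps0 : 0 < eps. Proof. by case/andP: eps01. Qed.

Definition carrier (y : V) (v : V) : R[i] := expi (dot (eps^-1 *: y) v).

Let inW_carrier y f : (exists g : G, vec g = eps^-1 *: y) -> inW f ->
  inW (fun v => carrier y v * f v).
Proof. by move=> [g gy] fW; rewrite /carrier -gy; exact: inW_modulate. Qed.

Let N_carrier y f : (exists g : G, vec g = eps^-1 *: y) -> inW f ->
  N (fun v => carrier y v * f v) = N f.
Proof. by move=> [g gy] fW; rewrite /carrier -gy; exact: N_modulate. Qed.

Let contW_carrier y t (f : R -> V -> R[i]) : (exists g : G, vec g = eps^-1 *: y) ->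
  contW t f -> contW t (fun s v => carrier y v * f s v).
Proof.
move=> hy cf s st; have [fW h] := cf s st; split; first exact: inW_carrier.
move=> e /h[r r0 {}h]; exists r => // s' s't /(h s' s't) hs.
rewrite (@Nw_ext _ _ _ _ _ (fun v => carrier y v * (f s' v - f s v))) ?N_carrier//.
  by apply: inWB => //; case: (cf s' s't).
by move=> v; rewrite mulrBr.
Qed.

(** In the interaction picture a wave of time frequency [w] on the carrier [y]
    keeps oscillating at the rate of the defect of resonance [sqnorm y - w], and
    its amplitude is seen along the characteristic. *)
Lemma flow_wave t y w f : inW f -> (exists g : G, vec g = eps^-1 *: y) ->
  flow (eps * t / 2) 0 (fun v => f v * expi (dot (eps^-1 *: y) v - t / (2 * eps) * w)) =
  fun v => expi (t / (2 * eps) * (sqnorm y - w)) *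
    (carrier y v * flow (eps * t / 2) 0 (fun z => f (z + t *: y)) v).
Proof.
move=> fW [g gy].
have -> : (fun v => f v * expi (dot (eps^-1 *: y) v - t / (2 * eps) * w)) =
    fun v => expi (- (t / (2 * eps) * w)) * (expi (dot (vec g) v) * f v).
  by apply/funext => v; rewrite gy expiD mulrC (mulrC (expi (dot _ _))) mulrA.
rewrite flowZ; last exact: inW_modulate.
rewrite flow_modulate//; apply/funext => v; rewrite gy mulrA -expiD.
have -> : - (t / (2 * eps) * w) + phase_at (eps * t / 2) 0 (eps^-1 *: y) =
    t / (2 * eps) * (sqnorm y - w).
  by rewrite /phase_at dot0l addr0 /sqnorm dotZl dotZr; field; rewrite gt_eqF.
congr (_ * (_ * _)).
have -> : 0 + (2 * (eps * t / 2)) *: (eps^-1 *: y) = 0 + t *: y.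
  by rewrite scalerA; congr (0 + _ *: _); field; rewrite gt_eqF.
rewrite -[X in flow X _](addr0 (eps * t / 2)) -(flow_flow _ _ _ _ fW).
by rewrite flow_translate.
Qed.

Let amp t j v := a t j (v + t *: kappa j).
Let amp_cont j : J j -> contW T (fun t => amp t j).
Proof. by move=> Jj; apply: (contW_translate (f := fun t => a t j)); exact: ca. Qed.
Let ampW t j : J j -> 0 <= t <= T -> inW (amp t j).
Proof. by move=> Jj tT; apply: inW_translate; exact: AW. Qed.

(** In the interaction picture the [j]-th wave of the approximate solution has
    no rapid phase in time left. *)
Definition wave t j v := carrier (kappa j) v * flow (eps * t / 2) 0 (amp t j) v.
Definition filtered t v := csum J (fun j => wave t j v).

Let wave_cont j : J j -> contW T (fun t => wave t j).
Proof.
move=> Jj; apply: contW_carrier; first exact: freqJ.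
apply: (contW_eq (f := fun t => flow (0 + t * (eps / 2)) (0 + t *: 0) (amp t j))).
  by move=> t _ v; rewrite scaler0 !add0r mulrCA mulrA.
by apply: contW_flow; exact: amp_cont.
Qed.

Let N_wave t j : J j -> 0 <= t <= T -> (N (wave t j) <= (x j)%:E)%E.
Proof.
move=> Jj tT; rewrite N_carrier; [|exact: freqJ|by apply: inW_flow; exact: ampW].
rewrite (Nw_flow _ _ w1); last exact: ampW.
by rewrite (Nw_translate _ _ w1); have [] := ax tT Jj.
Qed.

Let x_fin : (\esum_(j in J) (x j)%:E < +oo)%E.
Proof. exact: le_lt_trans xB (ltry _). Qed.

Lemma contW_filtered : contW T filtered.
Proof.
apply: (contW_csum (0 : int) (f := fun j t => wave t j) (b := fun j => (x j)%:E)) => //.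
by move=> j s Jj sT; exact: N_wave.
Qed.

Let esum_wave t : 0 <= t <= T -> (\esum_(j in J) N (wave t j) < +oo)%E.
Proof. by move=> tT; apply: le_lt_trans x_fin; apply: le_esum => j Jj; exact: N_wave. Qed.

Lemma N_filtered t : 0 <= t <= T -> (N (filtered t) <= B%:E)%E.
Proof.
move=> tT; apply: le_trans (Nw_csum (0 : int) _ _ w1) _.
- by move=> j Jj; exact: contW_inW (wave_cont Jj) tT.
- exact: esum_wave.
- by apply: le_trans xB; apply: le_esum => j Jj; exact: N_wave.
Qed.

Let term t j v := a t j v * expi (phase (kappa j) t v / eps).

Let termE t j v : term t j v =
  a t j v * expi (dot (eps^-1 *: kappa j) v - t / (2 * eps) * sqnorm (kappa j)).
Proof.
rewrite /term /phase dotZl; congr (_ * expi _).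
by field; rewrite gt_eqF.
Qed.

Let term_carrier t j : J j -> term t j = fun v =>
  expi (- (t / (2 * eps) * sqnorm (kappa j))) * (carrier (kappa j) v * a t j v).
Proof.
by move=> Jj; apply/funext => v; rewrite termE expiD mulrC (mulrC (expi _)) mulrA.
Qed.

Let termW t j : J j -> 0 <= t <= T -> inW (term t j).
Proof.
move=> Jj tT; rewrite term_carrier//; apply: inWZ; apply: inW_carrier; first exact: freqJ.
exact: AW.
Qed.

Let N_term t j : J j -> 0 <= t <= T -> (N (term t j) <= (x j)%:E)%E.
Proof.
move=> Jj tT; rewrite term_carrier// NwZ//; last first.
  by apply: inW_carrier; [exact: freqJ|exact: AW].
rewrite cabs_expi mul1e N_carrier; [|exact: freqJ|exact: AW].
by have [] := ax tT Jj.
Qed.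

Let esum_term t : 0 <= t <= T -> (\esum_(j in J) N (term t j) < +oo)%E.
Proof. by move=> tT; apply: le_lt_trans x_fin; apply: le_esum => j Jj; exact: N_term. Qed.

Lemma inW_u_app t : 0 <= t <= T -> inW (u_app J kappa a eps t).
Proof.
move=> tT; apply: (inW_csum (0 : int)); last exact: esum_term.
by move=> j Jj; exact: termW.
Qed.

Lemma flow_u_app t : 0 <= t <= T -> flow (eps * t / 2) 0 (u_app J kappa a eps t) = filtered t.
Proof.
move=> tT; rewrite (flow_csum (0 : int) (f := fun j => term t j)); last 2 first.
- by move=> j Jj; exact: termW.
- exact: esum_term.
apply/funext => v; apply: csum_eq => j Jj.
have -> : term t j = fun v => a t j v * expi (dot (eps^-1 *: kappa j) v - t / (2 * eps) * sqnorm (kappa j)).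
  by apply/funext => z; rewrite termE.
rewrite flow_wave; [|exact: AW|exact: freqJ].
by rewrite subrr mulr0 expi0 mul1r.
Qed.

Let defect l := sqnorm (comb l) - alt_sqnorm (fun p => kappa (tnth l p)).
Let osc s l v := expi (s / (2 * eps) * defect l) * flow (eps * s / 2) 0 (inter l s) v.
Let product s l v := carrier (comb l) v * osc s l v.

Let osc_cont l : Jm l -> contW T (fun s => osc s l).
Proof.
move=> Jl; apply: (contW_eq (f := fun s v => expi (((2 * eps)^-1 * defect l) * s + 0) *
   flow (0 + s * (eps / 2)) (0 + s *: 0) (inter l s) v)).
  move=> s _ v; rewrite scaler0 !add0r addr0 /osc; congr (expi _ * flow _ _ _ _); by ring.
by apply: contW_expi; apply: contW_flow; exact: ci.
Qed.

Let product_cont l : Jm l -> contW T (fun s => product s l).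
Proof. by move=> Jl; apply: contW_carrier; [exact: freqJm|exact: osc_cont]. Qed.

Let N_osc s l : Jm l -> 0 <= s <= T -> (N (osc s l) <= (Px l)%:E)%E.
Proof.
move=> Jl sT; have iW := contW_inW (ci Jl) sT.
rewrite NwZ//; last exact: inW_flow.
by rewrite cabs_expi mul1e (Nw_flow _ _ w1)//; exact: N_interaction_x.
Qed.

Let N_product s l : Jm l -> 0 <= s <= T -> (N (product s l) <= (Px l)%:E)%E.
Proof.
move=> Jl sT; rewrite N_carrier; [exact: N_osc|exact: freqJm|].
exact: contW_inW (osc_cont Jl) sT.
Qed.

(** The power of the sum of waves is expanded into one wave for each tuple, with
    the combined wave vector as its carrier. *)
Lemma flow_nonlinearity s : 0 <= s <= T ->
  flow (eps * s / 2) 0 (nonlinearity sigma (u_app J kappa a eps s)) =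
  fun v => csum Jm (fun l => product s l v).
Proof.
move=> sT; rewrite nonlinearityE.
pose B_ l v := alt_prod (fun p : 'I_m => a s (tnth l p) v).
pose theta l v := dot (eps^-1 *: comb l) v - s / (2 * eps) * alt_sqnorm (fun p => kappa (tnth l p)).
have BW l : Jm l -> inW (B_ l).
  move=> Jl; have aN p : (N (a s (tnth l p)) <= (x (tnth l p))%:E)%E.
    by have [] := ax sT (Jl p).
  exact: inW_le (N_alt_prod (f := fun p => a s (tnth l p)) aN).
have BN l : Jm l -> (N (B_ l) <= (Px l)%:E)%E.
  move=> Jl; apply: (N_alt_prod (f := fun p => a s (tnth l p))) => p.
  by have [] := ax sT (Jl p).
have eqT v : alt_prod (fun _ : 'I_m => u_app J kappa a eps s v) =
    csum Jm (fun l => B_ l v * expi (theta l v)).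
  have zs (k : 'I_m) : csummable J (fun j => term s j v).
    apply: le_lt_trans (esum_term sT); apply: le_esum => j _; exact: sup_le_N.
  have [_ <-] := csum_alt_prod (0 : int) zs.
  apply: csum_eq => l Jl.
  rewrite (_ : (fun k => _) = fun k : 'I_m => a s (tnth l k) v * expi (phase (kappa (tnth l k)) s v / eps))//.
  rewrite alt_prod_expi; congr (_ * expi _); rewrite /theta /combined /alt_vec /alt_sqnorm.
  rewrite dotZl dot_suml !mulr_sumr -sumrB; apply: eq_bigr => k _.
  by rewrite dotZl /phase; field; rewrite gt_eqF.
rewrite (funext eqT).
pose wv l v := B_ l v * expi (theta l v).
have wvE l : wv l = fun v => expi (- (s / (2 * eps) * alt_sqnorm (fun p => kappa (tnth l p)))) *
    (carrier (comb l) v * B_ l v).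
  by apply/funext => v; rewrite /wv /theta expiD mulrC (mulrC (expi _)) mulrA.
have wvW l : Jm l -> inW (wv l).
  by move=> Jl; rewrite wvE; apply: inWZ; apply: inW_carrier; [exact: freqJm|exact: BW].
rewrite (flow_csum l0 (f := wv)) => [|//|]; last first.
  apply: le_lt_trans (le_lt_trans sum_Px (ltry _)); apply: le_esum => l Jl.
  rewrite wvE NwZ//; last by apply: inW_carrier; [exact: freqJm|exact: BW].
  rewrite cabs_expi mul1e N_carrier; [exact: BN|exact: freqJm|exact: BW].
apply/funext => v; apply: csum_eq => l Jl.
rewrite /wv /theta flow_wave; [|exact: BW|exact: freqJm].
by rewrite /product /osc mulrCA.
Qed.

Section estimate.
Variable c : R.
Hypothesis c0 : 0 < c.
Hypothesis gap : forall l, nonresonant J kappa l -> c <= `|defect l|.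

Local Notation NR := (nonresonant (sigma := sigma) J kappa).
Local Notation RU := (\bigcup_(j in J) res j).
Local Notation mil := (0 -i* lambda)%C.

Let size_le l : interaction_speed l + 2 ^+ sigma.*2 *
  leibniz (fun k => x (tnth l k)) (fun k => b (tnth l k)) <= tuple_size l.
Proof. by rewrite lerDl. Qed.
Let sq_le l : 2 ^+ sigma.*2 *
  leibniz (fun k => x (tnth l k)) (fun k => b (tnth l k)) <= tuple_size l.
Proof.
apply: le_trans (size_le l); rewrite lerDr /interaction_speed addr_ge0//.
  exact: leibniz_ge0.
by rewrite !mulr_ge0// leibniz_ge0.
Qed.
Let Px_le l : Px l <= tuple_size l.
Proof.
rewrite lerDr /interaction_speed !addr_ge0//.
- exact: leibniz_ge0.
- by rewrite !mulr_ge0// leibniz_ge0.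
- by rewrite mulr_ge0 ?exprn_ge0// leibniz_ge0.
Qed.

Let flow_sub_sq r f (K : R) : inW f -> (Nw (@sqnorm R d) f <= K%:E)%E ->
  (N (fun v => flow r 0 f v - f v)%R <= (`|r| * K)%:E)%E.
Proof.
move=> fW fK; apply: le_trans (flow_sub_le (K := 0) r fW _ (lexx 0)) _.
  by move=> i; rewrite mxE normr0.
by rewrite mul0e adde0 EFinM lee_wpmul2l// lee_fin.
Qed.

Let half_period l s : defect l != 0 -> let h := 2 * pi * eps / `|defect l| in
  expi ((s + h) / (2 * eps) * defect l) = - expi (s / (2 * eps) * defect l).
Proof.
move=> d0 h; have e0 : eps != 0 by rewrite gt_eqF.
have ad0 : `|defect l| != 0 by rewrite normr_eq0.
have -> : (s + h) / (2 * eps) * defect l = s / (2 * eps) * defect l + pi * (defect l / `|defect l|).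
  by rewrite /h; field; rewrite ad0 e0.
rewrite expiD; have [dn|dp|/eqP] := ltgtP (defect l) 0; last by rewrite (negbTE d0).
  by rewrite ltr0_norm// invrN mulrN mulfV// mulrN1 expiN expi_pi rmorphN rmorph1 mulrN1.
by rewrite gtr0_norm// mulfV// mulr1 expi_pi mulrN1.
Qed.

(** The defect of a non-resonant tuple is at least [c], so that the phase of its
    product changes sign after a time of at most [2 pi eps / c], while its
    amplitude varies at the rate [tuple_size]: consecutive half periods cancel
    up to [O(eps)]. *)
Let N_nonresonant t l : NR l -> 0 <= t <= T ->
  (N (fun v => time_integral t (fun s => product s l v)) <=
    (eps * (2 * pi / c * (T + 1) * tuple_size l))%:E)%E.
Proof.
move=> nl /andP[t0 tT]; have Jl : Jm l by case: nl.
have cl := gap nl; have ad0 : 0 < `|defect l| by exact: lt_le_trans cl.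
have d0 : defect l != 0 by rewrite -normr_gt0.
(* half a period of the phase *)
pose h := 2 * pi * eps / `|defect l|.
have h0 : 0 < h by rewrite divr_gt0// !mulr_gt0// pi_gt0.
have hc : h <= eps * (2 * pi / c).
  rewrite /h (_ : eps * _ = 2 * pi * eps / c); last by ring.
  by rewrite ler_pM2l ?lef_pV2// !mulr_gt0// pi_gt0.
have oc := osc_cont Jl; have oct := contW_le tT oc.
rewrite (@Nw_ext _ _ _ _ _ (fun v => carrier (comb l) v * time_integral t (fun s => osc s l v))); last first.
  by move=> v; rewrite -(@timeZ R d S t _ (fun s => osc s l)).
rewrite N_carrier; [|exact: freqJm|exact: inW_time].
pose G2 := 2 ^+ sigma.*2 * leibniz (fun k => x (tnth l k)) (fun k => b (tnth l k)).
have G20 : 0 <= G2 by rewrite mulr_ge0 ?exprn_ge0// leibniz_ge0.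
have is0 : 0 <= interaction_speed l.
  by rewrite /interaction_speed addr_ge0 ?leibniz_ge0// !mulr_ge0// leibniz_ge0.
have tT' : 0 <= t <= T by rewrite t0 tT.
have H := N_time_half_period (h := h) (A := h * (interaction_speed l + G2)) (B := Px l) oc tT' h0.
apply: le_trans (H _ _ _ _) _ => //.
- by rewrite mulr_ge0 ?(ltW h0)// addr_ge0.
- move=> s s0 sht.
  have sT : 0 <= s <= T by rewrite s0 (le_trans _ tT)// (le_trans _ sht)// lerDl ltW.
  have shT : 0 <= s + h <= T by rewrite addr_ge0 ?(ltW h0)//= (le_trans sht).
  have iW1 := contW_inW (ci Jl) sT; have iW2 := contW_inW (ci Jl) shT.
  pose f2 := flow (eps * h / 2) 0 (inter l (s + h)).
  have f2W : inW f2 by exact: inW_flow.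
  rewrite (@Nw_ext _ _ _ _ _ (fun v => expi (s / (2 * eps) * defect l) *
     flow (eps * s / 2) 0 (fun v => inter l s v - f2 v) v)); last first.
    move=> v; rewrite flowB// /f2 flow_flow// addr0 /osc half_period// mulNr -mulrBr.
    by have -> : eps * (s + h) / 2 = eps * s / 2 + eps * h / 2 by ring.
  rewrite NwZ//; last by apply: inW_flow; exact: inWB.
  rewrite cabs_expi mul1e (Nw_flow _ _ w1); last exact: inWB.
  apply: le_trans (Nw_tri _ (inter l (s + h)) _ w1) _.
  rewrite mulrDr EFinD; apply: leeD.
    rewrite (Nw_subC _ _ w1); apply: interaction_lipschitz => //; first exact: ltW.
    by case/andP: shT.
  rewrite (Nw_subC _ _ w1).
  apply: le_trans (flow_sub_sq _ iW2 (Nsq_interaction Jl shT)) _; rewrite lee_fin -/G2.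
  rewrite ler_wpM2r// ger0_norm; last by rewrite divr_ge0// mulr_ge0// ltW.
  by case/andP: eps01 => _ e1; rewrite ler_pdivrMr// mulrC ler_pM2l//; lra.
- move=> s /andP[s0 st]; apply: N_osc => //; by rewrite s0 (le_trans st).
- rewrite lee_fin (_ : t * _ + h * Px l = h * (t * (interaction_speed l + G2) + Px l)); last by ring.
  rewrite -mulrA mulrA; apply: ler_pM => //; first exact: ltW.
    by rewrite addr_ge0 ?mulr_ge0// addr_ge0.
  rewrite mulrDl mul1r; apply: lerD; last exact: Px_le.
  by apply: ler_pM => //; exact: addr_ge0.
Qed.

(** The phase of a resonant product is stationary: the only error is the flow
    over the time [eps s / 2], which costs two derivatives. *)
Let N_resonant t j l : J j -> res j l -> 0 <= t <= T ->
  (N (fun v => carrier (comb l) v * time_integral t (fun s => inter l s v) -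
     time_integral t (fun s => product s l v))%R <= (eps * (T ^+ 2 / 2 * tuple_size l))%:E)%E.
Proof.
move=> Jj rl /andP[t0 tT]; have Jl := resonant_sub rl.
have ct := contW_le tT (ci Jl).
have d0 : defect l = 0.
  case: rl => _ e1 e2; rewrite /defect /combined e1 /=; apply/eqP; rewrite subr_eq0; apply/eqP.
  by rewrite -e2.
have oct := contW_le tT (osc_cont Jl).
pose D s v := inter l s v - osc s l v.
have cD : contW t D by exact: contWB.
rewrite (@Nw_ext _ _ _ _ _ (fun v => carrier (comb l) v * time_integral t (fun s => D s v))); last first.
  move=> v; rewrite /D (@timeB R d S t (inter l) (fun s => osc s l))// mulrBr; congr (_ - _).
  by rewrite -(@timeZ R d S t _ (fun s => osc s l)).
rewrite N_carrier; [|exact: freqJm|exact: inW_time].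
apply: (@le_trans _ _ (t * (eps * (T / 2 * tuple_size l)))%:E).
  apply: N_time_cst => // s /andP[s0 st].
  have sT : 0 <= s <= T by rewrite s0 (le_trans st).
  have iW := contW_inW (ci Jl) sT.
  rewrite (Nw_subC _ _ w1) (@Nw_ext _ _ _ _ _ (fun v => flow (eps * s / 2) 0 (inter l s) v - inter l s v)); last first.
    by move=> v; rewrite /osc d0 mulr0 expi0 mul1r.
  apply: le_trans (flow_sub_sq _ iW (Nsq_interaction Jl sT)) _; rewrite lee_fin.
  rewrite ger0_norm; last by rewrite divr_ge0// mulr_ge0// ltW.
  set K2 := 2 ^+ _ * leibniz _ _.
  have -> : eps * s / 2 * K2 = eps * (s / 2 * K2) by ring.
  rewrite ler_wpM2l ?(ltW eps0)//; apply: ler_pM => //.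
  - by rewrite divr_ge0.
  - by rewrite mulr_ge0 ?exprn_ge0// leibniz_ge0.
  - by rewrite ler_wpM2r// (le_trans st).
  - exact: sq_le.
rewrite lee_fin mulrCA ler_wpM2l ?(ltW eps0)// mulrA ler_wpM2r ?tuple_size_ge0//.
by rewrite mulrA expr2 ler_wpM2r// ler_wpM2r.
Qed.

Lemma Jm_split : Jm = RU `|` NR /\ RU `&` NR = set0.
Proof.
split; apply/seteqP; split=> l //=.
- move=> Jl; have [h|h] := pselect (RU l); first by left.
  by right; split.
- by case=> [[j _ /resonant_sub//]|[]].
- by case=> [h [_]].
Qed.

Definition duhamel t v := time_integral t (fun s =>
  flow (eps * s / 2) 0 (nonlinearity sigma (u_app J kappa a eps s)) v).

Let duhamelE t v : 0 <= t <= T ->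
  csummable Jm (fun l => time_integral t (fun s => product s l v)) /\
  duhamel t v = csum Jm (fun l => time_integral t (fun s => product s l v)).
Proof.
move=> /andP[t0 tT]; have [h1 h2] := @time_csum R d S _ l0 Jm t (fun l s => product s l) (B ^+ m) v t0
  (fun l Jl => contW_le tT (product_cont Jl)) ltac:(move=> s /andP[s0 st];
     apply: le_trans sum_Px; apply: le_esum => l Jl; apply: N_product => //; by rewrite s0 (le_trans st)).
split => //; rewrite -h2; apply: time_eq => s /andP[s0 st].
by rewrite flow_nonlinearity// s0 (le_trans st).
Qed.

Let ampB t j v : 0 <= t <= T -> J j ->
  amp t j v = alpha j v + mil * csum (res j) (fun l => time_integral t (fun s => inter l s v)).
Proof. by move=> tT Jj; exact: (congr1 (fun g => g v) (profileE ca aE prof tT Jj)). Qed.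

Let amp0 j v : J j -> wave 0 j v = carrier (kappa j) v * alpha j v.
Proof.
move=> Jj; rewrite /wave mulr0 mul0r flow0; last by apply: ampW => //; rewrite lexx.
by rewrite /amp scale0r addr0 (alphaE T0 prof Jj).
Qed.

Let resonant_part t v : 0 <= t <= T ->
  [/\ csummable RU (fun l => carrier (comb l) v * time_integral t (fun s => inter l s v)),
    csummable J (fun j => carrier (kappa j) v * (amp t j v - alpha j v)) &
    csum J (fun j => carrier (kappa j) v * (amp t j v - alpha j v)) =
    mil * csum RU (fun l => carrier (comb l) v * time_integral t (fun s => inter l s v))].
Proof.
move=> tT; have RJ : RU `<=` Jm by move=> l [j _ /resonant_sub].
have [s1 _] := @time_csum_interaction R d S sigma T J kappa a E ca aE Jm t v (fun l h => h) tT.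
pose g l := carrier (comb l) v * time_integral t (fun s => inter l s v).
have sg : csummable RU g.
  apply: le_lt_trans s1; apply: (@le_trans _ _ (\esum_(l in RU) (cabs (time_integral t (fun s => inter l s v)))%:E)%E).
    by apply: le_esum => l _; rewrite /g cabsM cabs_expi mul1r.
  by apply: le_esumS => // l; rewrite lee_fin cabs_ge0.
have tB i j l : J i -> J j -> res i l -> res j l -> i = j by exact: resonant_disjoint.
have [h1 h2] := csum_partition (0 : int) l0 tB sg.
have eJ j : J j -> carrier (kappa j) v * (amp t j v - alpha j v) = mil * csum (res j) g.
  move=> Jj; rewrite ampB// addrC addKr mulrCA; congr (_ * _).
  have [s2 _] := @time_csum_interaction R d S sigma T J kappa a E ca aE (res j) t v (@resonant_sub R d sigma J kappa j) tT.
  by rewrite -(csumZ l0)//; apply: csum_eq => l rl; rewrite /g (resonant_combined rl).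
split => //.
  apply: le_lt_trans (csummableZ (0 : int) mil h1).
  by apply: le_esum => j Jj; rewrite eJ.
by rewrite -/g h2 -(csumZ (0 : int))//; exact: csum_eq.
Qed.

Definition residual_constant := T / 2 * B + `|lambda| * (T ^+ 2 / 2 * total_size) +
  `|lambda| * (2 * pi / c * (T + 1) * total_size).

(** By the profile equation the resonant interactions account for the change of
    the amplitudes. Three sums of order [eps] remain: the flow acting on the
    amplitudes, the flow acting on the resonant interactions, and the
    non-resonant interactions. *)
Lemma residual_bound t : 0 <= t <= T ->
  (N (fun v => filtered t v - filtered 0 v - mil * duhamel t v)%R <=
    (residual_constant * eps)%:E)%E.
Proof.
move=> tT; have O0 : 0 <= (0 : R) <= T by rewrite lexx.
pose g1 j v := carrier (kappa j) v * (flow (eps * t / 2) 0 (amp t j) v - amp t j v).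
pose g2 l v := carrier (comb l) v * time_integral t (fun s => inter l s v) -
  time_integral t (fun s => product s l v).
pose g3 l v := time_integral t (fun s => product s l v).
have [JmE RN0] := Jm_split.
have RJ : RU `<=` Jm by rewrite JmE; exact: subsetUl.
have NJ : NR `<=` Jm by rewrite JmE; exact: subsetUr.
have g1W j : J j -> inW (g1 j).
  move=> Jj; apply: inW_carrier; first exact: freqJ.
  by apply: inWB; [apply: inW_flow|]; exact: ampW.
have g1N j : J j -> (N (g1 j) <= (eps * (T / 2) * b j)%:E)%E.
  move=> Jj; rewrite N_carrier; [|exact: freqJ|by apply: inWB; [apply: inW_flow|]; exact: ampW].
  have hq : (Nw (@sqnorm R d) (amp t j) <= (b j)%:E)%E.
    by rewrite (Nw_translate _ _ (weight_sqnorm S)); exact: asq.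
  apply: le_trans (flow_sub_sq _ (ampW Jj tT) hq) _; rewrite lee_fin ler_wpM2r//.
  case/andP: tT => t0 t1; rewrite ger0_norm; last by rewrite divr_ge0// mulr_ge0// ltW.
  by rewrite -mulrA ler_wpM2l ?(ltW eps0)// ler_wpM2r.
have g1s : (\esum_(j in J) N (g1 j) <= (eps * (T / 2) * B)%:E)%E.
  have k0 : 0 <= eps * (T / 2) by rewrite mulr_ge0 ?(ltW eps0)// divr_ge0.
  apply: (@le_trans _ _ (\esum_(j in J) ((eps * (T / 2))%:E * (b j)%:E))%E).
    by apply: le_esum => j Jj; rewrite -EFinM; exact: g1N.
  apply: le_trans (esumZ_le _ k0 _) _; first by move=> j; rewrite lee_fin.
  by rewrite [leRHS]EFinM lee_wpmul2l ?lee_fin.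
have scale A (u : m.-tuple int -> V -> R[i]) k : A `<=` Jm -> 0 <= k ->
    (forall l, A l -> (N (u l) <= (eps * (k * tuple_size l))%:E)%E) ->
    (\esum_(l in A) N (u l) <= (eps * (k * total_size))%:E)%E.
  move=> AJ k0 hu; have ek0 : 0 <= eps * k by rewrite mulr_ge0// ltW.
  apply: (@le_trans _ _ (\esum_(l in A) ((eps * k)%:E * (tuple_size l)%:E))%E).
    by apply: le_esum => l Al; rewrite -EFinM -mulrA; exact: hu.
  have ts0 l : (0 <= (tuple_size l)%:E)%E by rewrite lee_fin tuple_size_ge0.
  apply: le_trans (esumZ_le _ ek0 ts0) _.
  rewrite mulrA [leRHS]EFinM lee_wpmul2l ?lee_fin//.
  by apply: le_trans esum_tuple_size; exact: le_esumS.
have g2N l : RU l -> (N (g2 l) <= (eps * (T ^+ 2 / 2 * tuple_size l))%:E)%E.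
  by move=> [j Jj rl]; exact: (N_resonant Jj rl tT).
have g3N l : NR l -> (N (g3 l) <= (eps * (2 * pi / c * (T + 1) * tuple_size l))%:E)%E.
  by move=> nl; exact: N_nonresonant.
have g2s := scale _ _ _ RJ _ g2N.
have g3s := scale _ _ _ NJ _ g3N.
have {}g2s := g2s ltac:(by rewrite divr_ge0// exprn_ge0).
have {}g3s := g3s ltac:(by rewrite mulr_ge0 ?addr_ge0// divr_ge0 ?(ltW c0)// mulr_ge0// pi_ge0).
have g2W l : RU l -> inW (g2 l) by move=> rl; exact: inW_le (g2N l rl).
have g3W l : NR l -> inW (g3 l) by move=> nl; exact: inW_le (g3N l nl).
have EE : (fun v => filtered t v - filtered 0 v - mil * duhamel t v) =1
    fun v => csum J (fun j => g1 j v) + (mil * csum RU (fun l => g2 l v) +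
      - (mil * csum NR (fun l => g3 l v))).
  move=> v; have sw r : 0 <= r <= T -> csummable J (fun j => wave r j v).
    by move=> rT; apply: le_lt_trans (esum_wave rT); apply: le_esum => j _; exact: sup_le_N.
  have [sD ->] := duhamelE v tT; have [sR sA eR] := resonant_part v tT.
  have sg1 : csummable J (fun j => g1 j v).
    by apply: le_lt_trans (le_lt_trans g1s (ltry _)); apply: le_esum => j _; exact: sup_le_N.
  have sD1 := csummableS RJ sD.
  rewrite /filtered -(csumB (0 : int) (sw t tT) (sw 0 O0)).
  rewrite [in X in _ - mil * X]JmE (csumU l0 RN0); last by rewrite -JmE.
  rewrite (csumB l0 sR sD1) mulrBr -eR.
  rewrite [X in X - _ = _](_ : _ = csum J (fun j => g1 j v) + csum J (fun j => carrier (kappa j) v * (amp t j v - alpha j v))).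
    by rewrite mulrDr; ring.
  rewrite -(csumD (0 : int) sg1 sA); apply: csum_eq => j Jj.
  by rewrite amp0// /wave /g1; ring.
rewrite (Nw_ext _ _ EE).
apply: le_trans (NwD _ _ w1) _.
apply: le_trans (leeD (lexx _) (NwD _ _ w1)) _.
rewrite NwN// NwZ//; last by apply: (inW_csum l0) => //; exact: le_lt_trans g2s (ltry _).
rewrite NwZ//; last by apply: (inW_csum l0) => //; exact: le_lt_trans g3s (ltry _).
rewrite cabs_minus_i.
have h1 := le_trans (Nw_csum (0 : int) g1W (le_lt_trans g1s (ltry _)) w1) g1s.
have h2 := le_trans (Nw_csum l0 g2W (le_lt_trans g2s (ltry _)) w1) g2s.
have h3 := le_trans (Nw_csum l0 g3W (le_lt_trans g3s (ltry _)) w1) g3s.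
have lam0 : (0 <= `|lambda|%:E)%E by rewrite lee_fin.
apply: le_trans (leeD h1 (leeD (lee_wpmul2l lam0 h2) (lee_wpmul2l lam0 h3))) _.
rewrite -!EFinM -!EFinD lee_fin le_eqVlt; apply/orP; left; apply/eqP.
by rewrite /residual_constant; ring.
Qed.

End estimate.

End waves.

End residual.

(** * Stability of Duhamel's formula *)

Section picard.
Context {R : realType} {d : nat} (S : fsetting R d).
Local Notation V := 'rV[R]_d.
Local Notation Nw := (Nw S).
Local Notation N := (Nw (fun=> 1)).
Local Notation inW := (inW S).
Local Notation contW := (contW S).
Local Notation flow := (@flow R d S).
Variables (sigma : nat) (lambda eps T : R).
Local Notation m := sigma.*2.+1.
Local Notation mil := (0 -i* lambda)%C.
Hypothesis T0 : 0 <= T.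
Let w1 := weight1 S.

Local Notation back s f := (flow (eps * s / 2) 0 f).
Local Notation fwd s f := (flow (- (eps * s / 2)) 0 f).

Let backK s f : inW f -> fwd s (back s f) = f.
Proof. by move=> fW; rewrite flow_flow// addNr addr0 flow0. Qed.

Lemma contW_back f : contW T f -> contW T (fun s => back s (f s)).
Proof.
move=> cf; apply: (contW_eq (f := fun s => flow (0 + s * (eps / 2)) (0 + s *: 0) (f s))).
  by move=> s _ v; rewrite scaler0 !add0r mulrCA mulrA.
exact: contW_flow.
Qed.

Lemma contW_fwd f : contW T f -> contW T (fun s => fwd s (f s)).
Proof.
move=> cf; apply: (contW_eq (f := fun s => flow (0 + s * (- (eps / 2))) (0 + s *: 0) (f s))).
  by move=> s _ v; rewrite scaler0 !add0r mulrN mulrCA mulrA.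
exact: contW_flow.
Qed.

Lemma contW_nonlinearity f : contW T f -> contW T (fun s => nonlinearity sigma (f s)).
Proof.
move=> cf; apply: (contW_eq (f := fun s v => alt_prod (fun _ : 'I_m => f s v))).
  by move=> s _ v; rewrite nonlinearityE.
by apply: (contW_alt_prod (f := fun=> f)).
Qed.

Lemma inW_nonlinearity f : inW f -> inW (nonlinearity sigma f).
Proof.
move=> fW; rewrite nonlinearityE; have fN := fineK (N_fin fW).
apply: inW_le (N_alt_prod (f := fun=> f) (x := fun=> fine (N f)) _) => k.
by rewrite fN.
Qed.

Let leibniz_cst (K D : R) : 1 <= K -> 0 <= D ->
  leibniz (fun _ : 'I_m => K) (fun=> D) <= m%:R * K ^+ m * D.
Proof.
move=> K1 D0; have K0 : 0 <= K by exact: le_trans ler01 K1.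
have -> : m%:R * K ^+ m * D = \sum_(k < m) D * K ^+ m.
  by rewrite sumr_const card_ord -[RHS]mulr_natl; ring.
apply: ler_sum => k _; rewrite ler_wpM2l//.
by apply: prod_le_exp => // i _; rewrite K0 lexx.
Qed.

Definition lip (K : R) := m%:R * K ^+ m.

Lemma N_nonlinearity_sub K D f g : 1 <= K -> (N f <= K%:E)%E -> (N g <= K%:E)%E ->
  (N (fun v => f v - g v)%R <= D%:E)%E ->
  (N (fun v => nonlinearity sigma f v - nonlinearity sigma g v)%R <= (lip K * D)%:E)%E.
Proof.
move=> K1 fK gK fgD; rewrite !nonlinearityE.
apply: le_trans (N_alt_prod_sub (f := fun _ : 'I_m => f) (g := fun=> g)
  (fun=> fK) (fun=> gK) (fun=> fgD)) _.
by rewrite lee_fin leibniz_cst//; exact: N_le_ge0 w1 fgD.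
Qed.

(** The nonlinear term in the interaction picture. Both flows are isometric, so
    that its Lipschitz constants do not depend on [eps]. *)
Definition force s f := back s (nonlinearity sigma (fwd s f)).

Lemma contW_force w : contW T w -> contW T (fun s => force s (w s)).
Proof. by move=> cw; apply: contW_back; apply: contW_nonlinearity; exact: contW_fwd. Qed.

Lemma N_force_sub s K D f g : 1 <= K -> (N f <= K%:E)%E -> (N g <= K%:E)%E ->
  (N (fun v => f v - g v)%R <= D%:E)%E ->
  (N (fun v => force s f v - force s g v)%R <= (lip K * D)%:E)%E.
Proof.
move=> K1 fK gK fgD; have fW := inW_le fK; have gW := inW_le gK.
have nf : inW (nonlinearity sigma (fwd s f)) by apply: inW_nonlinearity; exact: inW_flow.
have ng : inW (nonlinearity sigma (fwd s g)) by apply: inW_nonlinearity; exact: inW_flow.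
rewrite (@Nw_ext _ _ _ _ _ (back s (fun v => nonlinearity sigma (fwd s f) v - nonlinearity sigma (fwd s g) v))).
  rewrite (Nw_flow _ _ w1); last exact: inWB.
  apply: (@N_nonlinearity_sub K D (fwd s f) (fwd s g) K1).
    by rewrite (Nw_flow _ _ w1).
    by rewrite (Nw_flow _ _ w1).
  rewrite (@Nw_ext _ _ _ _ _ (fwd s (fun v => f v - g v))).
    by rewrite (Nw_flow _ _ w1)//; exact: inWB.
  by move=> v; rewrite flowB.
by move=> v; rewrite flowB.
Qed.

Variable u0 : V -> R[i].
Hypothesis u0W : inW u0.

Definition duhamel_map (w : R -> V -> R[i]) t v :=
  u0 v + mil * time_integral t (fun s => force s (w s) v).

Lemma duhamel_map_eq w w' t : (forall s, 0 <= s <= t -> w s = w' s) ->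
  duhamel_map w t = duhamel_map w' t.
Proof.
move=> e; apply/funext => v.
have h : time_integral t (fun s => force s (w s) v) = time_integral t (fun s => force s (w' s) v).
  by apply: time_eq => s /e ->.
exact: (congr1 (fun z => u0 v + mil * z) h).
Qed.

Lemma contW_duhamel_map w : contW T w -> contW T (duhamel_map w).
Proof.
move=> cw; apply: contWD; first exact: contW_cst.
by apply: contWZ; apply: contW_time; exact: contW_force.
Qed.

(** Chosen so that [`|lambda| * lip K / rate K] is at most one half. *)
Definition rate (K : R) := 2 * (`|lambda| * lip K) + 1.

Lemma lip_ge0 K : 1 <= K -> 0 <= lip K.
Proof. by move=> K1; rewrite mulr_ge0// exprn_ge0// (le_trans ler01 K1). Qed.

Lemma rate_ge1 K : 1 <= K -> 1 <= rate K.
Proof. by move=> K1; rewrite lerDr mulr_ge0// mulr_ge0// lip_ge0. Qed.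

(** In the norm weighted by [expR (- rate K * t)], the Duhamel map contracts
    distances in the ball of radius [K] by one half. *)
Lemma duhamel_contraction K M w w' : 1 <= K -> 0 <= M -> contW T w -> contW T w' ->
  (forall s, 0 <= s <= T -> (N (w s) <= K%:E)%E) ->
  (forall s, 0 <= s <= T -> (N (w' s) <= K%:E)%E) ->
  (forall s, 0 <= s <= T -> (N (fun v => w s v - w' s v)%R <= (M * expR (rate K * s))%:E)%E) ->
  forall t, 0 <= t <= T ->
    (N (fun v => duhamel_map w t v - duhamel_map w' t v)%R <=
      (M / 2 * expR (rate K * t))%:E)%E.
Proof.
move=> K1 M0 cw cw' wK w'K ww' t /andP[t0 tT].
have L0 : 0 < rate K by exact: lt_le_trans ltr01 (rate_ge1 K1).
have c1 := contW_le tT (contW_force cw); have c2 := contW_le tT (contW_force cw').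
have c3 : contW t (fun s v => force s (w s) v - force s (w' s) v) by exact: (contWB c1 c2).
rewrite (@Nw_ext _ _ _ _ _ (fun v => mil *
  time_integral t (fun s => force s (w s) v - force s (w' s) v))); last first.
  move=> v; rewrite (@timeB R d S t (fun s => force s (w s)) (fun s => force s (w' s)))//.
  by rewrite /duhamel_map opprD addrACA subrr add0r mulrBr.
rewrite NwZ//; last exact: inW_time.
rewrite cabs_minus_i.
have l0 := lip_ge0 K1.
have H := N_time_exp t0 c3 L0 (mulr_ge0 l0 M0).
apply: le_trans (lee_wpmul2l _ (H _)) _; first by rewrite lee_fin.
  move=> s /andP[s0 st]; have sT : 0 <= s <= T by rewrite s0 (le_trans st).
  by rewrite -mulrA; apply: N_force_sub; [|exact: wK|exact: w'K|exact: ww'].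
rewrite -EFinM lee_fin.
rewrite [leLHS](_ : _ = (`|lambda| * lip K / rate K) * (M * expR (rate K * t))); last by ring.
rewrite [leRHS](_ : _ = 2^-1 * (M * expR (rate K * t))); last by ring.
rewrite ler_wpM2r ?mulr_ge0 ?expR_ge0//.
have q0 : 0 <= `|lambda| * lip K by exact: mulr_ge0.
by rewrite ler_pdivrMr// /rate; lra.
Qed.

Lemma contW_uniform_limit (u : nat -> R -> V -> R[i]) w C :
  (forall k, contW T (u k)) -> (forall t, 0 <= t <= T -> inW (w t)) ->
  (forall k t, 0 <= t <= T -> (N (fun v => w t v - u k t v)%R <= (C * 2^-1 ^+ k)%:E)%E) ->
  contW T w.
Proof.
move=> cu wW wu t tT; split; first exact: wW.
move=> e e0; have e3 : 0 < e / 3 by rewrite divr_gt0.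
have [k hk] : exists k : nat, C * 2^-1 ^+ k <= e / 3.
  have cv : C * 2^-1 ^+ n @[n --> \oo] --> (0 : R).
    rewrite -(mulr0 C); apply: cvgMr; apply: cvg_expr.
    by rewrite ger0_norm; lra.
  have /cvgr0Pnorm_lt/(_ _ e3)[n _ /(_ n (leqnn n)) h] := cv.
  by exists n; rewrite (le_trans (ler_norm _))// ltW.
have [_ /(_ _ e3)[r r0 h]] := cu k t tT.
exists r => // t' t'T t't.
apply: le_trans (Nw_tri _ (u k t') _ w1) _.
have h1 := le_trans (wu k t' t'T) (_ : (_ <= (e / 3)%:E)%E).
have h2 := le_trans (wu k t tT) (_ : (_ <= (e / 3)%:E)%E).
rewrite (_ : e%:E = ((e / 3)%:E + ((e / 3)%:E + (e / 3)%:E))%E); last by rewrite -!EFinD; congr (_%:E); field.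
apply: leeD; first by apply: h1; rewrite lee_fin.
apply: le_trans (Nw_tri _ (u k t) _ w1) _; apply: leeD; first exact: h.
by rewrite (Nw_subC _ _ w1); apply: h2; rewrite lee_fin.
Qed.

Lemma N_geometric0 (f : V -> R[i]) C : (forall k, (N f <= (C * 2^-1 ^+ k)%:E)%E) -> f =1 fun=> 0.
Proof.
move=> fC v; apply: cabs_eq0; apply/eqP; rewrite eq_le cabs_ge0 andbT.
have cv : C * 2^-1 ^+ n @[n --> \oo] --> (0 : R).
  rewrite -[X in _ --> X](mulr0 C); apply: cvgMr; apply: cvg_expr.
  by rewrite ger0_norm; lra.
apply: cvgn_lb cv _ => n; rewrite -lee_fin; apply: le_trans (fC n); exact: sup_le_N.
Qed.

(** Both curves are bounded; for a common radius the contraction makes their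
    distance vanish, whatever the size of the data. *)
Lemma duhamel_unique w w' : contW T w -> contW T w' ->
  (forall t, 0 <= t <= T -> w t =1 duhamel_map w t) ->
  (forall t, 0 <= t <= T -> w' t =1 duhamel_map w' t) ->
  forall t, 0 <= t <= T -> w t =1 w' t.
Proof.
move=> cw cw' ww w'w'.
have [K1 K10 wK1] := contW_bounded cw; have [K2 K20 wK2] := contW_bounded cw'.
pose K := 1 + K1 + K2.
have hK : 1 <= K by rewrite /K -addrA lerDl addr_ge0.
have wK s : 0 <= s <= T -> (N (w s) <= K%:E)%E.
  by move=> sT; apply: le_trans (wK1 s sT) _; rewrite lee_fin /K; lra.
have w'K s : 0 <= s <= T -> (N (w' s) <= K%:E)%E.
  by move=> sT; apply: le_trans (wK2 s sT) _; rewrite lee_fin /K; lra.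
have K0 : 0 <= K by exact: le_trans ler01 hK.
pose X t := N (fun v => w t v - w' t v).
have r0 := le_trans ler01 (rate_ge1 hK).
have X0 s : 0 <= s <= T -> (X s <= (2 * K * expR (rate K * s))%:E)%E.
  move=> sT; apply: le_trans (NwB _ _ w1) _; apply: le_trans (leeD (wK s sT) (w'K s sT)) _.
  rewrite -EFinD lee_fin; have : 1 <= expR (rate K * s).
    by apply: le_trans (expR_ge1Dx _); rewrite lerDl mulr_ge0//; case/andP: sT.
  by move=> ?; rewrite (_ : K + K = 2 * K); [rewrite ler_peMr// mulr_ge0|ring].
move=> t tT v; apply/eqP; rewrite -subr_eq0; apply/eqP.
apply: (@N_geometric0 (fun v => w t v - w' t v) 0) => k.
rewrite mul0r.
have A := @absorb R (fun s => 0 <= s <= T) X 0 (2 * K) (rate K) (mulr_ge0 (ler0n R 2) K0).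
suff step : forall M, 0 <= M -> (forall t, 0 <= t <= T -> (X t <= (M * expR (rate K * t))%:E)%E) ->
    forall t, 0 <= t <= T -> (X t <= ((0 + M / 2) * expR (rate K * t))%:E)%E.
  by have := A step (lexx 0) X0 t tT; rewrite mulr0 mul0r.
move=> M M0 hM s sT; rewrite add0r.
rewrite /X (@Nw_ext _ _ _ _ _ (fun v => duhamel_map w s v - duhamel_map w' s v)).
  exact: (duhamel_contraction hK M0 cw cw' wK w'K hM sT).
by move=> z; rewrite ww// w'w'.
Qed.

(** Picard iteration started at the approximate solution [w0]. In the weighted
    norm the iterates move by a total of twice the residual, and the smallness
    condition keeps them at distance 1 of [w0], that is in the ball where the
    Duhamel map is a contraction. Existence on the whole of [0, T] and closeness
    to [w0] come together. *)
Lemma duhamel_exists w0 K rho : contW T w0 -> 1 <= K ->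
  (forall t, 0 <= t <= T -> (N (w0 t) <= (K - 1)%:E)%E) -> 0 <= rho ->
  (forall t, 0 <= t <= T -> (N (fun v => w0 t v - duhamel_map w0 t v)%R <= rho%:E)%E) ->
  4 * (rho * expR (rate K * T)) <= 1 ->
  exists w, [/\ contW T w, forall t, 0 <= t <= T -> w t =1 duhamel_map w t &
    forall t, 0 <= t <= T ->
      (N (fun v => w t v - w0 t v)%R <= (4 * (rho * expR (rate K * T)))%:E)%E].
Proof.
move=> cw0 K1 w0K rho0 res small; set C := rho * expR (rate K * T) in small *.
have r0 := le_trans ler01 (rate_ge1 K1).
have C0 : 0 <= C by rewrite mulr_ge0// expR_ge0.
have eT s : 0 <= s <= T -> rho * expR (rate K * s) <= C.
  by move=> /andP[_ sT]; rewrite ler_wpM2l// ler_expR ler_wpM2l.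
have e1 s : 0 <= s <= T -> 1 <= expR (rate K * s).
  move=> /andP[s0 _]; apply: le_trans (expR_ge1Dx _); by rewrite lerDl mulr_ge0.
have ball (f g : V -> R[i]) : (N g <= (K - 1)%:E)%E -> (N (fun v => f v - g v)%R <= 1%:E)%E -> (N f <= K%:E)%E.
  move=> gK fg; rewrite (@Nw_ext _ _ _ _ _ (fun v => (f v - g v) + g v)); last by move=> v; rewrite subrK.
  apply: le_trans (NwD _ _ w1) _; apply: le_trans (leeD fg gK) _.
  by rewrite -EFinD lee_fin addrC subrK.
pose u k := iter k duhamel_map w0.
have claim k : [/\ contW T (u k),
    forall t, 0 <= t <= T -> (N (fun v => u k t v - w0 t v)%R <= ((2 - 2 * 2^-1 ^+ k) * (rho * expR (rate K * t)))%:E)%E &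
    forall t, 0 <= t <= T -> (N (fun v => u k.+1 t v - u k t v)%R <= (rho * 2^-1 ^+ k * expR (rate K * t))%:E)%E].
  elim: k => [|k [IH1 IH2 IH3]].
    split => //.
    - move=> t _; rewrite (@Nw_ext _ _ _ _ _ (fun=> 0)); last by move=> v; rewrite subrr.
      by rewrite Nw0// expr0 mulr1 subrr mul0r.
    - move=> t tT; rewrite (Nw_subC _ _ w1) expr0 mulr1; apply: le_trans (res t tT) _.
      by rewrite lee_fin ler_peMr// e1.
  have cu : contW T (u k.+1) by exact: contW_duhamel_map.
  have pk : 0 <= 2^-1 ^+ k :> R by rewrite exprn_ge0.
  have pk1 : 2^-1 ^+ k <= 1 :> R by rewrite exprn_ile1//; lra.
  have h2 t : 0 <= t <= T -> (N (fun v => u k.+1 t v - w0 t v)%R <= ((2 - 2 * 2^-1 ^+ k.+1) * (rho * expR (rate K * t)))%:E)%E.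
    move=> tT; apply: le_trans (Nw_tri _ (u k t) _ w1) _.
    apply: le_trans (leeD (IH3 t tT) (IH2 t tT)) _.
    rewrite -EFinD lee_fin le_eqVlt; apply/orP; left; apply/eqP.
    by rewrite exprS; field.
  have bound j t : 0 <= t <= T -> 0 <= 2^-1 ^+ j :> R ->
     (N (fun v => u j t v - w0 t v)%R <= ((2 - 2 * 2^-1 ^+ j) * (rho * expR (rate K * t)))%:E)%E ->
     (N (u j t) <= K%:E)%E.
    move=> tT pj h; apply: ball (w0K t tT) _; apply: le_trans h _; rewrite lee_fin.
    have h1 := eT t tT; have h3 : 0 <= rho * expR (rate K * t) by rewrite mulr_ge0// expR_ge0.
    nra.
  split => // t tT.
  have H := @duhamel_contraction K (rho * 2^-1 ^+ k) (u k.+1) (u k) K1 (mulr_ge0 rho0 pk) cu IH1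
    (fun s sT => bound k.+1 s sT (exprn_ge0 _ (ltac:(lra) : 0 <= 2^-1)) (h2 s sT))
    (fun s sT => bound k s sT pk (IH2 s sT)) IH3 t tT.
  apply: le_trans H _; rewrite lee_fin exprS le_eqVlt; apply/orP; left; apply/eqP; by field.
have /choice[w hw] : forall t, exists f, 0 <= t <= T -> [/\ inW f,
    forall k, (N (fun v => f v - u k t v)%R <= (4 * C * 2^-1 ^+ k)%:E)%E & True].
  move=> t; have [tT|tT] := pselect (0 <= t <= T); last by exists (fun=> 0).
  have [||l [h1 h2 h3]] := @inW_limit R d S (fun k => u k t) C C0.
  - by move=> k; have [h _ _] := claim k; exact: contW_inW h tT.
  - move=> k; have [_ _ h] := claim k; apply: le_trans (h t tT) _; rewrite lee_fin mulrAC.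
    by rewrite ler_wpM2r ?exprn_ge0// eT.
  - by exists l.
have wW t : 0 <= t <= T -> inW (w t) by move=> /hw[].
have wu k t : 0 <= t <= T -> (N (fun v => w t v - u k t v)%R <= (4 * C * 2^-1 ^+ k)%:E)%E.
  by move=> /hw[].
have cw : contW T w.
  by apply: (contW_uniform_limit (u := u)) wW wu => k; case: (claim k).
have ww0 t : 0 <= t <= T -> (N (fun v => w t v - w0 t v)%R <= (4 * C)%:E)%E.
  by move=> tT; have := wu 0%N t tT; rewrite expr0 mulr1.
have wK t : 0 <= t <= T -> (N (w t) <= K%:E)%E.
  move=> tT; apply: ball (w0K t tT) _; apply: le_trans (ww0 t tT) _; by rewrite lee_fin.
have uK k t : 0 <= t <= T -> (N (u k t) <= K%:E)%E.
  move=> tT; have [_ h _] := claim k; apply: ball (w0K t tT) _; apply: le_trans (h t tT) _; rewrite lee_fin.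
  have h1 := eT t tT; have h3 : 0 <= rho * expR (rate K * t) by rewrite mulr_ge0// expR_ge0.
  have pk : 0 <= 2^-1 ^+ k :> R by rewrite exprn_ge0.
  nra.
exists w; split => // t tT v; apply/eqP; rewrite -subr_eq0; apply/eqP.
apply: (@N_geometric0 (fun v => w t v - duhamel_map w t v) (4 * C * (1 + expR (rate K * T)))) => k.
have pk : 0 <= 2^-1 ^+ k :> R by rewrite exprn_ge0.
apply: le_trans (Nw_tri _ (u k.+1 t) _ w1) _.
have M0 : 0 <= 4 * C * 2^-1 ^+ k by rewrite !mulr_ge0.
have [cu _ _] := claim k.
have hM s : 0 <= s <= T -> (N (fun v => u k s v - w s v)%R <= (4 * C * 2^-1 ^+ k * expR (rate K * s))%:E)%E.
  move=> sT; rewrite (Nw_subC _ _ w1); apply: le_trans (wu k s sT) _.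
  by rewrite lee_fin ler_peMr// e1.
have H := duhamel_contraction K1 M0 cu cw (uK k) wK hM tT.
apply: le_trans (leeD (wu k.+1 t tT) H) _; rewrite -EFinD lee_fin exprS.
have ee : expR (rate K * t) <= expR (rate K * T).
  by rewrite ler_expR ler_wpM2l//; case/andP: tT.
have e0 := expR_ge0 (rate K * t).
have -> : 4 * C * (1 + expR (rate K * T)) * 2^-1 ^+ k = 4 * C * 2^-1 ^+ k + 4 * C * 2^-1 ^+ k * expR (rate K * T) by ring.
apply: lerD; first by move: M0; lra.
by apply: ler_pM => //; [rewrite divr_ge0|move: M0; lra].
Qed.

(** The flow commutes with the time integral and the two flows around the
    nonlinear term compose to the propagator over the time [t - s]. *)
Lemma duhamel_mild (u : R -> V -> R[i]) t : contW T u -> 0 <= t <= T ->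
  fwd t (duhamel_map (fun s => back s (u s)) t) = fun v =>
    flow (- (eps * t / 2)) 0 u0 v + mil * time_integral t (fun s =>
      flow (- (eps * (t - s) / 2)) 0 (nonlinearity sigma (u s)) v).
Proof.
move=> cu /andP[t0 tT].
have cb : contW T (fun s => back s (u s)) by exact: contW_back.
have cf := contW_le tT (contW_force cb).
rewrite flowD//; last by apply: inWZ; exact: inW_time.
rewrite flowZ; last exact: inW_time.
rewrite (flow_time t0 cf).
suff e v : time_integral t (fun s => fwd t (force s (back s (u s))) v) =
    time_integral t (fun s => flow (- (eps * (t - s) / 2)) 0 (nonlinearity sigma (u s)) v).
  by apply/funext => v; rewrite e.
apply: time_eq => s /andP[s0 st].
have uW : inW (u s) by apply: (contW_inW cu); rewrite s0 (le_trans st).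
rewrite /force backK// flow_flow; last exact: inW_nonlinearity.
have -> : - (eps * t / 2) + eps * s / 2 = - (eps * (t - s) / 2) by field.
by rewrite addr0.
Qed.

End picard.

(** * Justification of the approximation, on the torus and the space at once *)

Section justification.
Context {R : realType} {d : nat} (S : fsetting R d).
Local Notation G := (fs_G S).
Local Notation vec := (@fs_vec _ _ S).
Local Notation V := 'rV[R]_d.
Local Notation Nw := (Nw S).
Local Notation N := (Nw (fun=> 1)).
Local Notation inW := (inW S).
Local Notation contW := (contW S).
Local Notation flow := (@flow R d S).
Variables (sigma : nat) (lambda T : R) (J : set int) (kappa : int -> V).
Variables (alpha : int -> V -> R[i]) (a : R -> int -> V -> R[i]) (E : R).
Local Notation m := sigma.*2.+1.
Local Notation res := (resonant (sigma := sigma) J kappa).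
Local Notation Jm := (tuples_in (m := m) J).
Hypothesis T0 : 0 <= T.
Hypothesis kI : forall j k, J j -> J k -> kappa j = kappa k -> j = k.
Hypothesis ca : forall j, J j -> contW T (fun s => a s j).
Hypothesis E1 : 1 <= E.
Hypothesis aE : forall s, 0 <= s <= T -> (\esum_(j in J) N (a s j) <= E%:E)%E.
Hypothesis prof : forall t j x, 0 <= t <= T -> J j ->
  a t j (x + t *: kappa j) = alpha j x + (0 -i* lambda)%C * time_integral t (fun s =>
    csum (res j) (fun l => alt_prod (fun p => a s (tnth l p) (x + s *: kappa j)))).
Variables (P : int -> R) (X0 c : R).
Hypothesis P0 : forall j, 0 <= P j.
Hypothesis Pres : forall j l, J j -> res j l -> P j <= \sum_k P (tnth l k).
Hypothesis Pkappa : (forall j i, J j -> `|kappa j 0 i| <= P j) \/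
  (forall t j, 0 <= t <= T -> J j -> Nw l1norm (a t j) = 0%E).
Hypothesis init1 : (\esum_(j in J) ((P j)%:E * N (alpha j)) <= X0%:E)%E.
Hypothesis init2 : (\esum_(j in J) Nw l1norm (alpha j) <= X0%:E)%E.
Hypothesis init3 : (\esum_(j in J) ((P j)%:E * Nw l1norm (alpha j)) <= X0%:E)%E.
Hypothesis init4 : (\esum_(j in J) Nw (@sqnorm R d) (alpha j) <= X0%:E)%E.
Hypothesis c0 : 0 < c.
Hypothesis gap : forall l, nonresonant J kappa l ->
  c <= `|sqnorm (alt_vec (fun p : 'I_m => kappa (tnth l p))) -
         alt_sqnorm (fun p => kappa (tnth l p))|.

Let w1 := weight1 S.

Definition mild eps (u0 : V -> R[i]) (u : R -> V -> R[i]) := contW T u /\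
  forall t v, 0 <= t <= T -> u t v = flow (- (eps * t / 2)) 0 u0 v +
    (0 -i* lambda)%C * time_integral t (fun s =>
      flow (- (eps * (t - s) / 2)) 0 (nonlinearity sigma (u s)) v).

Let flow_inv r (f : V -> R[i]) : inW f -> flow r 0 (flow (- r) 0 f) = f.
Proof. by move=> fW; rewrite flow_flow// addrN addr0 flow0. Qed.
Let flow_inv' r (f : V -> R[i]) : inW f -> flow (- r) 0 (flow r 0 f) = f.
Proof. by move=> fW; rewrite flow_flow// addNr addr0 flow0. Qed.

Let mild_duhamel eps u0 u : inW u0 -> mild eps u0 u ->
  contW T (fun s => flow (eps * s / 2) 0 (u s)) /\
  forall t, 0 <= t <= T -> flow (eps * t / 2) 0 (u t) =1
    duhamel_map S sigma lambda eps u0 (fun s => flow (eps * s / 2) 0 (u s)) t.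
Proof.
move=> u0W [cu uE]; have cb := contW_back eps cu; split=> // t tT.
have e : u t = flow (- (eps * t / 2)) 0
    (duhamel_map S sigma lambda eps u0 (fun s => flow (eps * s / 2) 0 (u s)) t).
  by rewrite (duhamel_mild sigma lambda eps u0W cu tT); apply/funext => v; exact: uE.
have cd := contW_duhamel_map sigma lambda eps u0W cb.
by rewrite {1}e flow_inv//; exact: contW_inW cd tT.
Qed.

Lemma mild_unique eps u0 u v : inW u0 -> mild eps u0 u -> mild eps u0 v ->
  forall t, 0 <= t <= T -> v t =1 u t.
Proof.
move=> u0W hu hv t tT.
have [cu uE] := mild_duhamel u0W hu; have [cv vE] := mild_duhamel u0W hv.
have h := duhamel_unique cv cu vE uE tT.
have uW : inW (u t) by case: hu => cu' _; exact: contW_inW cu' tT.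
have vW : inW (v t) by case: hv => cv' _; exact: contW_inW cv' tT.
move=> z; rewrite -(flow_inv' (eps * t / 2) uW) -(flow_inv' (eps * t / 2) vW).
by rewrite (funext h).
Qed.

(** The approximate solution in the interaction picture is the starting point
    [w0] of the Picard iteration; its residual, together with the error on the
    data, is [(C0 + Cr) * eps]. The threshold on [eps] is the smallness
    condition of that iteration. *)
Theorem approximation_justified (C0 : R) : 0 <= C0 -> exists eps0 C : R, 0 < eps0 /\
  forall eps, 0 < eps <= eps0 ->
  (forall j, J j -> exists g : G, vec g = eps^-1 *: kappa j) ->
  (forall l, Jm l -> exists g : G, vec g = eps^-1 *: combined kappa l) ->
  forall u0, inW u0 ->
  (N (fun v => u0 v - u_app J kappa a eps 0 v)%R <= (C0 * eps)%:E)%E ->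
  contW T (u_app J kappa a eps) /\
  exists u, mild eps u0 u /\
    forall t, 0 <= t <= T -> (N (fun v => u t v - u_app J kappa a eps t v)%R <= (C * eps)%:E)%E.
Proof.
move=> C00.
have [b [x [xb Pxb [B B1 bB] ax asq]]] :=
  profile_majorant T0 kI ca E1 aE prof P0 Pres init1 init2 init3 init4.
have B0 : 0 <= B by exact: le_trans ler01 B1.
pose K := B + 2; have K1 : 1 <= K by rewrite /K; lra.
pose Cr := residual_constant sigma lambda T B c.
have Cr0 : 0 <= Cr.
  have t0 : 0 <= total_size sigma lambda B.
    by rewrite /total_size; do ![exact: ler0n|exact: normr_ge0|exact: B0|apply: exprn_ge0|apply: addr_ge0|apply: mulr_ge0].
  rewrite /Cr /residual_constant !addr_ge0// !mulr_ge0 ?exprn_ge0 ?divr_ge0 ?pi_ge0 ?(ltW c0)//.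
  - by rewrite invr_ge0 ltW.
  - by rewrite addr_ge0.
pose ee := expR (rate sigma lambda K * T).
have ee0 : 0 <= ee by exact: expR_ge0.
pose C := 4 * ((C0 + Cr) * ee).
have C1 : 0 <= C by rewrite !mulr_ge0// addr_ge0.
(* [K] leaves room around the approximate solution for the Picard iterates, and
   [eps <= (C + 1)^-1] makes the distance [C * eps] at most 1. *)
exists (Num.min 1 (C + 1)^-1), C; split.
  by rewrite lt_min ltr01 invr_gt0 ltr_wpDl.
move=> eps /andP[eps0]; rewrite le_min => /andP[eps1 epsC] freqJ freqJm u0 u0W hu0.
have eps01 : 0 < eps <= 1 by rewrite eps0.
pose w0 := filtered S J kappa a eps.
have cw0 : contW T w0 := contW_filtered ca xb bB ax freqJ.
have uaW t : 0 <= t <= T -> inW (u_app J kappa a eps t).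
  by move=> tT; exact: (inW_u_app ca xb bB ax eps01 freqJ tT).
have fua t : 0 <= t <= T -> flow (eps * t / 2) 0 (u_app J kappa a eps t) = w0 t.
  by move=> tT; exact: (flow_u_app ca xb bB ax eps01 freqJ tT).
have uaE t : 0 <= t <= T -> u_app J kappa a eps t = flow (- (eps * t / 2)) 0 (w0 t).
  by move=> tT; rewrite -fua// flow_inv'//; exact: uaW.
have cua : contW T (u_app J kappa a eps).
  apply: (contW_eq _ (contW_fwd eps cw0)) => s sT v.
  by rewrite uaE.
split => //.
have O0 : 0 <= (0 : R) <= T by rewrite lexx.
have w00 : w0 0 = u_app J kappa a eps 0.
  by rewrite -fua// mulr0 mul0r flow0//; exact: uaW.
pose rho := (C0 + Cr) * eps.
have rho0 : 0 <= rho by apply: mulr_ge0; [exact: addr_ge0|exact: ltW].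
have w0K t : 0 <= t <= T -> (N (w0 t) <= (K - 1)%:E)%E.
  move=> tT; apply: le_trans (N_filtered ca xb bB ax freqJ tT) _.
  by rewrite lee_fin /K; lra.
have res t : 0 <= t <= T ->
    (N (fun v => w0 t v - duhamel_map S sigma lambda eps u0 w0 t v)%R <= rho%:E)%E.
  move=> tT.
  have H := residual_bound T0 kI ca aE prof P0 Pkappa xb Pxb B1 bB ax asq eps01 freqJ freqJm c0 gap tT.
  have dE v : time_integral t (fun s => force S sigma eps s (w0 s) v) = duhamel S sigma J kappa a eps t v.
    apply: time_eq => s /andP[s0 st]; rewrite /force -uaE//.
    by rewrite s0 (le_trans st)//; case/andP: tT.
  rewrite (@Nw_ext _ _ _ _ _ (fun v => (w0 t v - w0 0 v - (0 -i* lambda)%C * duhamel S sigma J kappa a eps t v) +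
      (w0 0 v - u0 v))); last first.
    have alg (p q r s : R[i]) : p - (s + r) = (p - q - r) + (q - s) by ring.
    by move=> v; rewrite /duhamel_map dE; exact: alg.
  apply: le_trans (NwD _ _ w1) _; rewrite (Nw_subC _ _ w1) w00 in hu0 *.
  apply: le_trans (leeD _ hu0) _; first by rewrite -w00; exact: H.
  by rewrite -EFinD lee_fin /rho -/Cr; lra.
have small : 4 * (rho * ee) <= 1.
  have -> : 4 * (rho * ee) = C * eps by rewrite /C /rho; ring.
  have h : eps * (C + 1) <= 1 by rewrite -ler_pdivlMr ?mul1r// ltr_wpDl.
  lra.
have [w [cw wE ww0]] := duhamel_exists u0W cw0 K1 w0K rho0 res small.
pose u t := flow (- (eps * t / 2)) 0 (w t).
have cu : contW T u by exact: contW_fwd.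
have wW t : 0 <= t <= T -> inW (w t) by exact: contW_inW.
exists u; split; first split => // t v tT.
  have e : w t = duhamel_map S sigma lambda eps u0 (fun s => flow (eps * s / 2) 0 (u s)) t.
    rewrite (funext (wE t tT)); apply: duhamel_map_eq => s /andP[s0 st].
    by rewrite /u flow_inv//; apply: wW; rewrite s0 (le_trans st)//; case/andP: tT.
  by have := congr1 (fun g => g v) (duhamel_mild sigma lambda eps u0W cu tT); rewrite -e.
move=> t tT; rewrite (@Nw_ext _ _ _ _ _ (flow (- (eps * t / 2)) 0 (fun v => w t v - w0 t v))).
  rewrite (Nw_flow _ _ w1); last by apply: inWB; [exact: wW|exact: contW_inW cw0 tT].
  apply: le_trans (ww0 t tT) _; rewrite lee_fin le_eqVlt; apply/orP; left; apply/eqP.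
  by rewrite /C /rho -/ee; ring.
by move=> v; rewrite uaE// flowB; [|exact: wW|exact: contW_inW cw0 tT].
Qed.

End justification.

(** * The torus and the space *)

Section generation.
Context (T : Type) (d : nat) (C : set (set T)).
Hypothesis CC : forall A, C A -> C (~` A).
Hypothesis CU : forall A : nat -> set T, (forall n, C (A n)) -> C (\bigcup_n A n).

Lemma sigma_class_set0 A : C A -> C set0.
Proof.
move=> CA; rewrite -setCT; apply: CC.
rewrite (_ : setT = \bigcup_n (if n is 0%N then A else ~` A)).
  by apply: CU => -[|n] //; exact: CC.
by apply/seteqP; split => // x _; have [Ax|Ax] := pselect (A x); [exists 0%N|exists 1%N].
Qed.

Lemma sigma_class_bigcap_ord (A : 'I_d -> set T) : (0 < d)%N -> (forall i, C (A i)) ->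
  C [set x | forall i, A i x].
Proof.
move=> d0 CA; have C0 := sigma_class_set0 (CA (Ordinal d0)).
rewrite -[X in C X]setCK; apply: CC.
rewrite (_ : ~` _ = \bigcup_n (if insub n is Some i then ~` A i else set0)).
  by apply: CU => n; case: insubP => [i _ _|_]; [exact: CC|].
apply/seteqP; split=> x /=.
  by move/existsNP => [i Ai]; exists (i : nat) => //; rewrite valK.
by move=> [n _]; case: insubP => [i _ _ Ai h|//]; exact: Ai.
Qed.

Lemma sigma_class_sigma_algebra A : C A -> sigma_algebra setT C.
Proof.
move=> CA; split; [exact: sigma_class_set0 CA| |exact: CU].
by move=> B CB; rewrite setTD; exact: CC.
Qed.

End generation.

Section torus.
Context (R : realType) (d : nat).
Local Notation K := 'rV[int]_d.
Local Notation G := (disc (0 : K)).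
Local Notation vec := (@freq_vec R d Torus).

(** A point of Z^d is cut out by half-spaces at distance 1/2, and every set of
    points is a countable union of points. *)
Lemma torus_gen (d0 : (0 < d)%N) (C : set (set G)) :
  (forall A, C A -> C (~` A)) ->
  (forall A : nat -> set G, (forall n, C (A n)) -> C (\bigcup_n A n)) ->
  (forall i c, C [set a : G | c < vec a 0 i]) ->
  forall A, measurable A -> C A.
Proof.
move=> CC CU Cg A _; have C0 := sigma_class_set0 CC CU (Cg (Ordinal d0) 0).
have C1 (k : G) : C [set k].
  rewrite (_ : [set k] = [set a : G | forall i, ([set a : G | vec k 0 i - 2^-1 < vec a 0 i] `&`
      ~` [set a : G | vec k 0 i + 2^-1 < vec a 0 i]) a]).
    apply: sigma_class_bigcap_ord => // i; rewrite -[X in C X]setCK setCI; apply: (CC).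
    rewrite (_ : _ `|` _ = \bigcup_n (if n is 0%N then ~` [set a : G | vec k 0 i - 2^-1 < vec a 0 i]
        else ~` ~` [set a : G | vec k 0 i + 2^-1 < vec a 0 i])).
      by apply: (CU) => -[|n]; [exact: CC _ (Cg _ _)|exact: CC _ (CC _ (Cg _ _))].
    apply/seteqP; split => x /=; first by case=> h; [exists 0%N|exists 1%N].
    by case=> [[|n] _] h; [left|right].
  apply/seteqP; split => a /=.
    by move=> -> i /=; split; [rewrite ltrBlDr ltrDl|apply/negP; rewrite -leNgt lerDl ltW].
  move=> h; apply/rowP => i; have [] := h i; rewrite !mxE => h1 /negP; rewrite -leNgt => h2.
  have h3 : k 0 i - 1 < a 0 i by rewrite -(ltr_int R) rmorphB/=; lra.
  have h4 : a 0 i - 1 < k 0 i by rewrite -(ltr_int R) rmorphB/=; lra.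
  have alg (p q : int) : p - 1 < q -> q - 1 < p -> q = p by lia.
  exact: alg h3 h4.
rewrite (_ : A = \bigcup_n (if unpickle n is Some k then
    if (k : G) \in A then [set k] else set0 else set0)).
  by apply: CU => n; case: unpickle => // k; case: ifP.
apply/seteqP; split => [a Aa|a [n _]].
  by exists (pickle (a : K)) => //; rewrite pickleK mem_set.
by case: unpickle => // k; case: ifPn => //; rewrite inE => Ak ->.
Qed.

Definition torus_add (a b : G) : G := (a : K) + b.
Definition torus_opp (a : G) : G := - (a : K).

Lemma countm_bij (h g : G -> G) (A : set G) : cancel h g -> cancel g h ->
  @countm R _ (0 : K) (h @^-1` A) = countm (0 : K) A.
Proof.
move=> hg gh; have E (B : set G) : countm (0 : K) B = (\esum_(i in B) (1 : \bar R))%E.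
  rewrite (esum_int_count (0 : K) B (f := fun=> 1%E))// -integral_mkcond integral_cst//.
  by rewrite mul1e.
rewrite !E; apply/esym; apply: (@reindex_esum R G G _ _ h (fun=> 1%E)) => //; split.
- by [].
- by move=> x y _ _ xy; rewrite -(hg x) xy hg.
- by move=> y Ay; exists (g y); rewrite /= ?gh.
Qed.

Lemma torus_mvec i : measurable_fun setT (fun a : G => vec a 0 i).
Proof. exact: measurable_fun_disc. Qed.

Lemma measurable_fun_disc2 (f : G * G -> G) : measurable_fun setT f.
Proof.
move=> _ A _; rewrite setTI.
rewrite (_ : f @^-1` A = \bigcup_n (if unpickle n is Some k then
    if f k \in A then [set k.1 : G] `*` [set k.2 : G] else set0 else set0)).
  apply: bigcupT_measurable => n; case: unpickle => // k.
  by case: ifP => // _; exact: measurableX.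
apply/seteqP; split => [[k l] Akl|[k l] [n _]].
  by exists (pickle ((k, l) : K * K)) => //; rewrite pickleK mem_set.
by case: unpickle => // -[k' l']; case: ifPn => //; rewrite inE => Ak [/= -> ->].
Qed.

Definition torus (d0 : (0 < d)%N) : fsetting R d.
Proof.
refine (@FSetting R d _ G (countm (0 : K)) vec 1 torus_add torus_opp
  _ _ (@measurable_fun_disc2 _) (@measurable_fun_disc K 0 _ _ _) torus_mvec _ _ _ (torus_gen d0)).
- by move=> a b; apply/rowP => i; rewrite !mxE rmorphD.
- by move=> a; apply/rowP => i; rewrite !mxE rmorphN.
- move=> c A _; apply: (@countm_bij _ (torus_add (torus_opp c))) => a.
    exact: addKr.
  exact: addNKr.
- by move=> A _; apply: (@countm_bij _ torus_opp) => a; exact: opprK.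
- by rewrite ltr01 lexx.
Defined.

End torus.

Section space.
Context (R : realType).
Local Notation mR := (measurableTypeR R).

Definition tmap n (h : 'I_n -> mR -> mR) (t : n.-tuple mR) : n.-tuple mR :=
  [tuple h i (tnth t i) | i < n].

Lemma measurable_tmap n (h : 'I_n -> mR -> mR) :
  (forall i, measurable_fun setT (h i)) -> measurable_fun setT (tmap h).
Proof.
move=> mh; apply/measurable_fun_tnthP => i.
rewrite (_ : _ \o _ = h i \o (fun t : n.-tuple mR => tnth t i)).
  by apply: measurableT_comp => //; exact: measurable_tnth.
by apply/funext => t /=; rewrite tnth_mktuple.
Qed.

Lemma tmap_cons n (h : 'I_n.+1 -> mR -> mR) (p : mR * n.-tuple mR) :
  tmap h (Defs.cons_tuple p) = Defs.cons_tuple (h ord0 p.1, tmap (fun i => h (lift ord0 i)) p.2).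
Proof.
apply: eq_from_tnth => i; rewrite tnth_mktuple.
case: (unliftP ord0 i) => [j|] ->; last by rewrite !tnth0.
by rewrite !tnthS tnth_mktuple.
Qed.

(** A product of measure preserving maps preserves the product measure, which
    gives at once the invariance under translations and under the reflection. *)
Lemma lebesgue_tuple_tmap n (h : 'I_n -> mR -> mR) :
  (forall i, measurable_fun setT (h i)) ->
  (forall i A, measurable A ->
     @lebesgue_measure R (h i @^-1` A) = @lebesgue_measure R A) ->
  forall A, measurable A -> lebesgue_tuple R n (tmap h @^-1` A) = lebesgue_tuple R n A.
Proof.
elim: n h => [|n IH] h mh ph A mA.
  by congr (lebesgue_tuple R 0 _); apply/seteqP; split => t /=; rewrite (tuple0 (tmap h t)) (tuple0 t).
have mcons B : measurable B -> measurable (@Defs.cons_tuple R n @^-1` B).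
  by move=> mB; rewrite -[X in measurable X]setTI; exact: measurable_cons_tuple.
rewrite /=/lebesgue_tuple_step /pushforward /product_measure1/=.
set h' := fun i => h (lift ord0 i).
rewrite (_ : (fun x => _) = (fun x => (lebesgue_tuple R n \o
    xsection (@Defs.cons_tuple R n @^-1` A)) (h ord0 x))); last first.
  apply/funext => x /=.
  have mX : measurable (xsection (@Defs.cons_tuple R n @^-1` A) (h ord0 x)).
    by apply: measurable_xsection; exact: mcons.
  apply: etrans (IH h' (fun i => mh _) (fun i => ph _) _ mX).
  congr (lebesgue_tuple R n _); apply/seteqP; split => t; rewrite /xsection/= !inE/=.
  - by rewrite tmap_cons.
  - by rewrite tmap_cons.
apply: (ge0_int_push (mh ord0) (ph ord0)).
- by apply: measurable_fun_xsection; exact: mcons.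
- by move=> y; exact: measure_ge0.
Qed.

Context (d : nat).
Local Notation G := (d.-tuple mR).
Local Notation vec := (@freq_vec R d Defs.Space).

Lemma space_mvec i : measurable_fun setT (fun a : G => vec a 0 i).
Proof.
rewrite (_ : (fun a => _) = fun a : G => tnth a i); first exact: measurable_tnth.
by apply/funext => a; rewrite mxE.
Qed.

(** The sigma-algebra of tuples is generated by the coordinates, and that of the
    line by the half-lines. *)
Lemma space_gen (d0 : (0 < d)%N) (C : set (set G)) :
  (forall A, C A -> C (~` A)) ->
  (forall A : nat -> set G, (forall n, C (A n)) -> C (\bigcup_n A n)) ->
  (forall i c, C [set a : G | c < vec a 0 i]) ->
  forall A, measurable A -> C A.
Proof.
move=> CC CU Cg.
have sC := sigma_class_sigma_algebra CC CU (Cg (Ordinal d0) 0).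
apply: smallest_sub => // A; rewrite -bigcup_seq => -[i _ [B mB <-]].
have : (@RGenOInfty.G R).-sigma.-measurable B.
  by rewrite -RGenOInfty.measurableE.
rewrite -[C _]/(image_set_system setT (fun t : G => tnth t i) C B).
move: B {mB}; apply: smallest_sub.
  exact: sigma_algebra_image.
move=> _ [c ->]; rewrite /image_set_system /= setTI.
rewrite (_ : _ @^-1` _ = [set a : G | c < vec a 0 i])//.
by apply/seteqP; split => a /=; rewrite in_itv/= andbT mxE.
Qed.

Definition space_add (a b : G) : G := [tuple tnth a i + tnth b i | i < d].
Definition space_opp (a : G) : G := [tuple - tnth a i | i < d].

Lemma space_cst01 : 0 < (Num.sqrt (2 * pi : R)) ^- d <= 1.
Proof.
have h : 1 <= Num.sqrt (2 * pi : R).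
  by rewrite -[leLHS]sqrtr1 ler_wsqrtr//; have := pi_ge2 R; lra.
have h0 : 0 < Num.sqrt (2 * pi : R) by lra.
by rewrite invr_gt0 exprn_gt0//= invf_le1 ?exprn_gt0// exprn_ege1.
Qed.

Definition space (d0 : (0 < d)%N) : fsetting R d.
Proof.
refine (@FSetting R d _ G (lebesgue_tuple R d) vec _ space_add space_opp
  _ _ _ _ space_mvec _ _ space_cst01 (space_gen d0)).
- by move=> a b; apply/rowP => i; rewrite !mxE tnth_mktuple.
- by move=> a; apply/rowP => i; rewrite !mxE tnth_mktuple.
- apply/measurable_fun_tnthP => i.
  rewrite (_ : _ \o _ = (fun p : G * G => (tnth p.1 i : mR) + tnth p.2 i)).
    apply: measurable_funD.
      by apply: (measurableT_comp (f := fun t : G => tnth t i)) => //; exact: measurable_tnth.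
    by apply: (measurableT_comp (f := fun t : G => tnth t i)) => //; exact: measurable_tnth.
  by apply/funext => t /=; rewrite tnth_mktuple.
- by apply: (measurable_tmap (h := fun i x => - x)) => i; exact: measurable_funN.
- move=> c A mA; apply: (lebesgue_tuple_tmap (h := fun i x => (tnth c i : R) + x)) => //.
    by move=> i; exact: measurable_funD.
  move=> i B mB; under [X in X @^-1` _]eq_fun do rewrite addrC.
  exact: lebesgue_shift.
- move=> A mA; apply: (lebesgue_tuple_tmap (h := fun i x => - x)) => //.
    by move=> i; exact: measurable_funN.
  by move=> i B mB; exact: lebesgue_measureN.
Defined.

End space.

(** ** Translation to the concrete Wiener algebras *)

Lemma cvg0_itvP {R : realType} (T t : R) (F : R -> \bar R) : (forall s, 0 <= F s)%E ->
  F s @[s --> within `[0, T] (nbhs t)] --> 0%E <->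
  forall e, 0 < e -> exists2 r, 0 < r & forall s, 0 <= s <= T ->
    `|s - t| < r -> (F s <= e%:E)%E.
Proof.
move=> F0; split => [/fine_cvgP[fF /cvgr0Pnorm_le cF] e e0|h].
  have /nbhs_ballP[r /= r0 H] : nbhs t [set s | `[0, T]%classic s ->
      F s \is a fin_num /\ `|fine (F s)| <= e] by exact: filterI fF (cF e e0).
  exists r => // s sT st; have tb : ball t r s by rewrite /ball/= distrC.
  have [|fs fe] := H s tb; first by rewrite /= in_itv.
  by rewrite -(fineK fs) lee_fin (le_trans _ fe)// ler_norm.
apply/fine_cvgP; split.
  have [r r0 H] := h 1 ltr01; apply/nbhs_ballP; exists r => //= s; rewrite /ball/= distrC => st.
  rewrite in_itv/= => sT; rewrite ge0_fin_numE//.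
  by apply: le_lt_trans (H s sT st) _; rewrite ltry.
apply/cvgr0Pnorm_le => e e0; have [r r0 H] := h e e0.
apply/nbhs_ballP; exists r => //= s; rewrite /ball/= distrC => st.
rewrite in_itv/= => sT; rewrite ger0_norm ?fine_ge0//.
have Fs := H s sT st; rewrite -lee_fin fineK// ge0_fin_numE//.
by apply: le_lt_trans Fs _; rewrite ltry.
Qed.

Section setting.
Context {R : realType} {d : nat} (d0 : (0 < d)%N).
Local Notation V := 'rV[R]_d.
Implicit Types (f : V -> R[i]) (M : domain).

Definition setting M : fsetting R d :=
  match M with Torus => torus R d0 | Defs.Space => space R d0 end.

Let L1_torus (b : 'rV[int]_d -> R[i]) :
  csummable setT b <-> cintegrable (countm (0 : 'rV[int]_d)) setT b.
Proof.
rewrite (_ : b = crestrict (i0 := 0) setT b) -?csummableP; last first.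
  by apply/funext => k; rewrite /crestrict in_setT.
by rewrite {1}(_ : crestrict setT b = b)//; apply/funext => k; rewrite /crestrict in_setT.
Qed.

Let fourier_inv_torus (b : 'rV[int]_d -> R[i]) : csummable setT b ->
  @fourier_inv R d Torus b = finv (S := torus R d0) b.
Proof.
move=> sb; apply/funext => x; rewrite /fourier_inv /finv/=.
have sbx : csummable setT (fun k : 'rV[int]_d => b k * expi (dot x (freq_vec (M := Torus) k))).
  apply: le_lt_trans sb; apply: le_esum => k _.
  by rewrite cabsM cabs_expi mulr1.
rewrite (csumE (0 : 'rV[int]_d))// mul1r; apply: eq_cint => k.
by rewrite /crestrict in_setT.
Qed.

Lemma isF_torus f : @is_fourier R d Torus f = @isF R d (torus R d0) f.
Proof.
apply/seteqP; split => b [] /=.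
  move=> sb fb; split; first exact/L1_torus.
  by move=> x; rewrite fb; exact: (congr1 (fun g => g x) (fourier_inv_torus sb)).
move=> /L1_torus sb fb; split => // x.
by rewrite fb; exact/esym/(congr1 (fun g => g x) (fourier_inv_torus sb)).
Qed.

Lemma in_WE M f : in_W M f = inW (setting M) f.
Proof.
case: M; last by [].
by apply/propext; split => -[b fb]; exists b; move: fb; rewrite isF_torus.
Qed.

Lemma W_normE M f : W_norm M f = Nw (setting M) (fun=> 1) f.
Proof.
rewrite /W_norm /Nw -in_WE; case: ifP => // /asboolP fW.
case: M fW => fW; rewrite wint1//= /fourier /fhat isF_torus.
by rewrite int_countE// => k; rewrite lee_fin cabs_ge0.
Qed.

Lemma propagatorE M (eps t : R) f : in_W M f ->
  propagator M eps t f = @flow R d (setting M) (- (eps * t / 2)) 0 f.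
Proof.
have e v : phase_at (- (eps * t / 2)) 0 v = - (eps * t / 2 * sqnorm v) :> R.
  by rewrite /phase_at dot0l addr0 mulNr.
rewrite in_WE; case: M => fW; rewrite /propagator /flow.
  have [fi _] := isF_fhat fW.
  rewrite /fourier isF_torus fourier_inv_torus.
    by congr finv; apply/funext => k; rewrite e.
  apply/L1_torus; rewrite (_ : (fun k => _) = (fun k : fs_G (torus R d0) =>
    expi (phase_at (- (eps * t / 2)) 0 (fs_vec k)) * fhat f k)).
    exact: (@Cint_flow R d (torus R d0) _ _ _ fi).
  by apply/funext => k; rewrite e.
apply: (congr1 (@finv R d (space R d0))).
by apply/funext => k; rewrite e.
Qed.

Lemma cont_WE M T (u : R -> V -> R[i]) : cont_W M T u <-> contW (setting M) T u.
Proof.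
have F0 t s : (0 <= W_norm M (fun x => (u s x - u t x)%R))%E.
  by rewrite W_normE; exact/Nw_ge0/weight1.
split => h t tT; have [utW ut] := h t tT.
  split => [|e e0]; first by rewrite -in_WE.
  have [r r0 H] := (@cvg0_itvP R T t _ (F0 t)).1 ut e e0.
  by exists r => // s sT st; rewrite -W_normE; exact: H.
split; first by rewrite in_WE.
apply/(@cvg0_itvP R T t _ (F0 t)) => e e0; have [r r0 H] := ut e e0.
by exists r => // s sT st; rewrite W_normE; exact: H.
Qed.

End setting.

(** ** Amplitude spaces and initial data *)

Section torus_constants.
Context {R : realType} {d : nat} (d0 : (0 < d)%N).
Local Notation S := (torus R d0).

Let in0 (k : 'rV[int]_d) : (k \in [set 0]) = (k == 0).
Proof. by apply/idP/eqP; rewrite inE. Qed.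

Lemma isF_const (z : R[i]) :
  @isF R d S (fun=> z : R[i]) (fun k : 'rV[int]_d => if k == 0 then z else 0).
Proof.
rewrite -isF_torus.
have s0 : csummable [set 0 : 'rV[int]_d] (fun=> z).
  by rewrite /csummable esum_set1 ?lee_fin ?cabs_ge0// ltry.
have e (h : 'rV[int]_d -> R[i]) : (fun k => if k \in [set 0] then h k else 0) =
    (fun k => if k == 0 then h k else 0).
  by apply/funext => k; rewrite in0.
split=> [|x]; first by rewrite /= -(e (fun=> z)) -csummable_mkcond.
rewrite /fourier_inv (_ : (fun k => _) =
    (fun k => if k == 0 then z * expi (dot x (freq_vec (M := Torus) k)) else 0)).
  rewrite -e -csum_mkcond (csum_fin 0) ?fsbig_set1//.
  rewrite (_ : dot _ _ = 0) ?expi0 ?mulr1//.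
  by rewrite /dot big1// => i _; rewrite !mxE mulr0.
by apply/funext => k; case: eqP => // _; rewrite mul0r.
Qed.

Lemma N_const (z : R[i]) : Nw S (fun=> 1) (fun=> z) = (cabs z)%:E.
Proof.
rewrite (NE (isF_const z)) int_countE; last by move=> k; rewrite lee_fin cabs_ge0.
rewrite -(@esum_set1 _ _ (0 : 'rV[int]_d) (fun=> (cabs z)%:E)) ?lee_fin ?cabs_ge0//.
rewrite [RHS]esum_mkcond; apply: eq_esum => k _.
by rewrite in0; case: ifP => //; rewrite cabs0.
Qed.

Lemma Nw_const0 w (z : R[i]) : weight S w -> w 0 = 0 -> Nw S w (fun=> z) = 0%E.
Proof.
move=> ww w0; rewrite (NwE ww (isF_const z)) /wint integral0_eq// => k _.
case: eqP => [->|_]; last by rewrite cabs0 mulr0.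
rewrite (_ : fs_vec _ = 0) ?w0 ?mul0r//.
by apply/rowP => i; rewrite !mxE.
Qed.

End torus_constants.

Section amplitudes.
Context {R : realType} {d : nat} (d0 : (0 < d)%N) (M : domain).
Local Notation V := 'rV[R]_d.
Local Notation S := (setting (R := R) d0 M).
Local Notation N := (Nw S (fun=> 1)).

Lemma E_normE (D : set int) (a : int -> V -> R[i]) :
  (M = Torus -> forall j, D j -> forall x, a j x = a j 0) ->
  E_norm M D a = (\esum_(j in D) N (a j))%E.
Proof.
case: M => /= h; apply: eq_esum => j Dj; last by rewrite (W_normE d0).
rewrite -[in RHS](_ : (fun=> a j 0) = a j) ?N_const//.
by apply/funext => x; rewrite h.
Qed.

(** Continuity of the family for the summed norm is continuity of each member,
    and compactness of the time interval bounds the sums. *)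
Lemma cont_E_curves (D : set int) (T : R) (a : R -> int -> V -> R[i]) : cont_E M D T a ->
  (forall j, D j -> contW S T (fun s => a s j)) /\
  exists2 E : R, 1 <= E & forall s, 0 <= s <= T -> (\esum_(j in D) N (a s j) <= E%:E)%E.
Proof.
move=> ca; have w1 := weight1 S.
have aN s : 0 <= s <= T -> E_norm M D (a s) = (\esum_(j in D) N (a s j))%E.
  by move=> sT; have [[h _] _] := ca s sT; rewrite E_normE.
have afin s : 0 <= s <= T -> (\esum_(j in D) N (a s j) < +oo)%E.
  by move=> sT; rewrite -aN//; have [[_ h] _] := ca s sT.
have close s e : 0 <= s <= T -> 0 < e -> exists2 r, 0 < r & forall s', 0 <= s' <= T ->
    `|s' - s| < r -> (\esum_(j in D) N (fun x => a s' j x - a s j x)%R <= e%:E)%E.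
  move=> sT e0; have [[h _] cs] := ca s sT.
  have F0 s' : (0 <= E_norm M D (fun j x => (a s' j x - a s j x)%R))%E.
    rewrite /E_norm; case: (M) => /=; apply: esum_ge0 => j _; rewrite ?lee_fin ?cabs_ge0//.
    by rewrite (W_normE d0); exact/N_ge0.
  have [r r0 H] := (@cvg0_itvP R T s _ F0).1 cs e e0.
  exists r => // s' s'T ss; rewrite -E_normE; first exact: H.
  by move=> MT j Dj x; have [[h' _] _] := ca s' s'T; rewrite (h' MT j Dj x) (h MT j Dj x).
split=> [j Dj s sT|].
  split; first by apply: (@lty_inW _ _ _ (fun=> 1)); apply: le_lt_trans (afin s sT);
    apply: (le_term_esum (f := fun j => N (a s j))) => // i; exact: N_ge0.
  move=> e e0; have [r r0 H] := close s e sT e0.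
  exists r => // s' s'T ss; apply: le_trans (H s' s'T ss).
  by apply: (le_term_esum (f := fun j => N (fun x => (a s' j x - a s j x)%R))) => // i; exact: N_ge0.
have [|K K0 aK] := @segment_bounded R T (fun s => \esum_(j in D) N (a s j))%E.
  move=> s sT; have [r r0 H] := close s 1 sT ltr01.
  exists (1 + fine (\esum_(j in D) N (a s j)))%R, r => // s' s'T ss.
  have f0 : (0 <= \esum_(j in D) N (a s j))%E by apply: esum_ge0 => j _; exact: N_ge0.
  rewrite EFinD fineK; last by rewrite ge0_fin_numE// afin.
  apply: le_trans (leeD (H s' s'T ss) (lexx _)); rewrite -esumD; do ?by move=> j _; exact: N_ge0.
  apply: le_esum => j _; apply: le_trans (NwD _ _ w1).
  by rewrite le_eqVlt; apply/orP; left; apply/eqP; apply: Nw_ext => x; rewrite subrK.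
exists (K + 1); first by rewrite lerDr.
by move=> s sT; apply: le_trans (aK s sT) _; rewrite lee_fin lerDl.
Qed.

Lemma mildP (sigma : nat) (lambda eps T : R) (u0 : V -> R[i]) (u : R -> V -> R[i]) :
  in_W M u0 ->
  mild_solution M sigma lambda eps T u0 u <-> mild S sigma lambda T eps u0 u.
Proof.
move=> u0W; have e t x : contW S T u -> 0 <= t <= T ->
  propagator M eps t u0 x + (0 -i* lambda)%C * time_integral t (fun s =>
     propagator M eps (t - s) (nonlinearity sigma (u s)) x) =
  @flow R d S (- (eps * t / 2)) 0 u0 x + (0 -i* lambda)%C * time_integral t (fun s =>
      @flow R d S (- (eps * (t - s) / 2)) 0 (nonlinearity sigma (u s)) x).
  move=> cu tT; rewrite (propagatorE d0)//; congr (_ + _ * _).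
  apply: time_eq => s /andP[s0 st]; rewrite (propagatorE d0)// (in_WE d0).
  apply: inW_nonlinearity; apply: contW_inW cu _.
  by rewrite s0 (le_trans st)//; case/andP: tT.
split=> -[cu uE]; split; do ?exact/(cont_WE d0).
  by move/(cont_WE d0) : cu => cu t x tT; rewrite uE// e.
by move=> t x tT; rewrite uE// e.
Qed.

End amplitudes.

Section initial_data.
Context {R : realType} {d : nat} (d0 : (0 < d)%N).
Local Notation V := 'rV[R]_d.
Local Notation Sp := (space R d0).
Local Notation N := (Nw Sp (fun=> 1)).
Implicit Types (f : V -> R[i]).

Lemma mpartial_single (i : 'I_d) n f :
  mpartial (fun k => if k == i then n else 0%N) f = iter n (partial i) f.
Proof.
have h s : uniq s -> foldr (fun k => iter (if k == i then n else 0%N) (partial k)) f s =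
    if i \in s then iter n (partial i) f else f.
  elim: s => // k s IH /= /andP[ks us]; rewrite IH// inE eq_sym.
  by have [->|//] := eqVneq i k; rewrite (negbTE ks).
by rewrite /mpartial h ?enum_uniq// mem_enum.
Qed.

Lemma morder_single (i : 'I_d) n : morder (fun k => if k == i then n else 0%N) = n.
Proof.
rewrite /morder (bigD1 i)//= eqxx big1 ?addn0// => k /negbTE ->//.
Qed.

Lemma l1norm_japanese (v : V) : l1norm v <= d%:R * japanese v.
Proof.
rewrite /l1norm (le_trans (ler_sum _ (G := fun=> japanese v) _))//; last first.
  by rewrite sumr_const card_ord mulr_natl.
move=> i _; rewrite -sqrtr_sqr ler_wsqrtr// /sqnorm /dot (bigD1 i)//= -expr2.
rewrite addrCA lerDl addr_ge0// sumr_ge0// => k _.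
by rewrite -expr2 sqr_ge0.
Qed.

Lemma lty_le_fine (x : \bar R) : (0 <= x)%E -> (x < +oo)%E -> exists2 r : R, 0 <= r & (x <= r%:E)%E.
Proof.
move=> x0 xo; exists (fine x); first exact: fine_ge0.
by rewrite fineK// ge0_fin_numE.
Qed.

Lemma esum_extend0 (J0 J : set int) (alpha : int -> V -> R[i]) (F : int -> (V -> R[i]) -> \bar R)
    (G : int -> \bar R) X :
  (forall j, F j (fun=> 0) = 0%E) -> (forall j, J0 j -> 0 <= F j (alpha j))%E ->
  (forall j, J0 j -> F j (alpha j) <= G j)%E ->
  (\esum_(j in J0) G j <= X)%E ->
  (\esum_(j in J) F j (extend0 J0 alpha j) <= X)%E.
Proof.
move=> F0 Fp FG; apply: le_trans.
rewrite (esum_mkcond J) (esum_mkcond J0); apply: le_esum => j _.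
have [jJ0|jJ0] := pselect (J0 j).
  rewrite (_ : extend0 J0 alpha j = alpha j) ?(mem_set jJ0); last first.
    by apply/funext => x; rewrite /extend0 asboolT.
  case: ifP => _; first exact: FG.
  by apply: le_trans (FG _ jJ0); exact: Fp.
rewrite (_ : extend0 J0 alpha j = fun=> 0); last first.
  by apply/funext => x; rewrite /extend0 asboolF.
by rewrite F0 (memNset jJ0); case: ifP.
Qed.

(** Derivatives turn into frequency weights by [Nw_l1norm_partial] and
    [Nw_sqnorm_partial], and the l^1 size of a wave vector is at most [d] times
    its [japanese] bracket. *)
Lemma space_initial_bounds (J0 J : set int) (kappa : int -> V) (alpha : int -> V -> R[i]) :
  assumption_A1 Defs.Space J0 kappa alpha -> exists X0 : R, [/\
  (\esum_(j in J) ((l1norm (kappa j))%:E * N (extend0 J0 alpha j)) <= X0%:E)%E,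
  (\esum_(j in J) Nw Sp (@l1norm R d) (extend0 J0 alpha j) <= X0%:E)%E,
  (\esum_(j in J) ((l1norm (kappa j))%:E * Nw Sp (@l1norm R d) (extend0 J0 alpha j)) <= X0%:E)%E &
  (\esum_(j in J) Nw Sp (@sqnorm R d) (extend0 J0 alpha j) <= X0%:E)%E].
Proof.
move=> [_ /(_ erefl)[hp h2 h1]].
have WE f : W_norm Defs.Space f = N f := W_normE d0 Defs.Space f.
have wl := weight_l1norm Sp; have ws := weight_sqnorm Sp; have w1 := weight1 Sp.
have l0 j : 0 <= l1norm (kappa j) by exact: l1norm_ge0.
have jap0 j : 0 <= japanese (kappa j) by exact: sqrtr_ge0.
pose D n i j := iter n (partial i) (alpha j).
have sD n i : (n <= 2)%N -> (\esum_(j in J0) N (D n i j) < +oo)%E.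
  move=> n2; have [] := h2 (fun k => if k == i then n else 0%N).
    by rewrite morder_single.
  move=> _; rewrite /E_norm; apply: le_lt_trans; apply: le_esum => j _.
  by rewrite WE mpartial_single.
have sJ n i : (n <= 1)%N ->
    (\esum_(j in J0) ((japanese (kappa j))%:E * N (D n i j)) < +oo)%E.
  move=> n1; have [] := h1 (fun k => if k == i then n else 0%N).
    by rewrite morder_single.
  move=> _; rewrite /E_norm; apply: le_lt_trans; apply: le_esum => j J0j.
  have fW : inW Sp (D n i j).
    apply: (@lty_inW _ _ _ (fun=> 1)); apply: le_lt_trans (sD n i (leq_trans n1 _)) => //.
    by apply: (le_term_esum (f := fun j => N (D n i j))) => // k; exact: N_ge0.
  by rewrite WE mpartial_single NwZ// cabs_real ger0_norm.
have Dd n i k j : J0 j -> (n < 2)%N -> cderivable k (D n i j).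
  by move=> J0j n2; rewrite /D -mpartial_single; apply: (hp j J0j); rewrite morder_single.
have DW n i j : J0 j -> (n <= 2)%N -> inW Sp (D n i j).
  move=> J0j n2; apply: (@lty_inW _ _ _ (fun=> 1)); apply: le_lt_trans (sD n i n2).
  by apply: (le_term_esum (f := fun j => N (D n i j))) => // k; exact: N_ge0.
(* an arbitrary index, for the iterates of order 0 *)
pose i0 := Ordinal d0.
have aW j : J0 j -> inW Sp (alpha j) by move=> J0j; exact: (DW 0%N i0).
have b1 j : J0 j -> (Nw Sp (@l1norm R d) (alpha j) <= \sum_i N (D 1%N i j))%E.
  move=> J0j; apply: Nw_l1norm_partial; first exact: aW.
  by move=> i; split; [exact: (Dd 0%N i)|exact: (DW 1%N i)].
have b2 j : J0 j -> (Nw Sp (@sqnorm R d) (alpha j) <= \sum_i N (D 2%N i j))%E.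
  move=> J0j; apply: Nw_sqnorm_partial; first exact: aW.
    by move=> i; split; [exact: (Dd 0%N i)|exact: (DW 1%N i)].
  by move=> i; split; [exact: (Dd 1%N i)|exact: (DW 2%N i)].
have bnd (g : 'I_d -> int -> \bar R) : (forall i j, 0 <= g i j)%E ->
    (forall i, \esum_(j in J0) g i j < +oo)%E ->
    exists2 r : R, 0 <= r & (\esum_(j in J0) \sum_i g i j <= r%:E)%E.
  move=> g0 gf; apply: lty_le_fine.
    by apply: esum_ge0 => j _; apply: sume_ge0 => i _; exact: g0.
  rewrite esum_sum => [|j i _ _]; last exact: g0.
  by apply: lte_sum_pinfty => i _; exact: gf.
have N0 n i j : (0 <= N (D n i j))%E by exact: N_ge0.
have JN0 n i j : (0 <= (japanese (kappa j))%:E * N (D n i j))%E.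
  by rewrite mule_ge0 ?lee_fin.
have [r1 r10 H1] := bnd (fun i j => (japanese (kappa j))%:E * N (D 0%N i j))%E
  (JN0 0%N) (fun i => sJ 0%N i isT).
have [r2 r20 H2] := bnd (fun i j => N (D 1%N i j)) (N0 1%N) (fun i => sD 1%N i isT).
have [r3 r30 H3] := bnd (fun i j => (japanese (kappa j))%:E * N (D 1%N i j))%E
  (JN0 1%N) (fun i => sJ 1%N i isT).
have [r4 r40 H4] := bnd (fun i j => N (D 2%N i j)) (N0 2%N) (fun i => sD 2%N i isT).
have scale n (r : R) : (\esum_(j in J0) \sum_i ((japanese (kappa j))%:E * N (D n i j)) <= r%:E)%E ->
    (\esum_(j in J0) (d%:R%:E * \sum_i ((japanese (kappa j))%:E * N (D n i j))) <= (d%:R * r)%:E)%E.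
  move=> h; apply: le_trans (esumZ_le _ _ _) _ => //.
    by move=> j; apply: sume_ge0 => i _; exact: JN0.
  by rewrite EFinM lee_wpmul2l// lee_fin.
exists (d%:R * r1 + r2 + d%:R * r3 + r4).
have dr1 : 0 <= d%:R * r1 by rewrite mulr_ge0.
have dr3 : 0 <= d%:R * r3 by rewrite mulr_ge0.
split.
- apply: (@esum_extend0 J0 J alpha (fun j f => (l1norm (kappa j))%:E * N f)%E _ _ _ _ _
    (le_trans (scale _ _ H1) _)); last by rewrite lee_fin; lra.
  + by move=> j; rewrite Nw0// mule0.
  + by move=> j _; rewrite mule_ge0 ?lee_fin// N_ge0.
  + move=> j _; apply: (@le_trans _ _ (d%:R%:E * ((japanese (kappa j))%:E * N (alpha j)))%E).
      rewrite muleA -EFinM; apply: lee_wpmul2r; first exact: N_ge0.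
      by rewrite lee_fin l1norm_japanese.
    apply: lee_wpmul2l; first by rewrite lee_fin.
    by rewrite (bigD1 i0)//= leeDl//; apply: sume_ge0 => i _; exact: (JN0 0%N).
- apply: (@esum_extend0 J0 J alpha (fun j f => Nw Sp (@l1norm R d) f) _ _ _ _ b1
    (le_trans H2 _)); last by rewrite lee_fin; lra.
  + by move=> j; rewrite Nw0.
  + by move=> j _; exact: Nw_ge0.
- apply: (@esum_extend0 J0 J alpha (fun j f => (l1norm (kappa j))%:E * Nw Sp (@l1norm R d) f)%E _ _ _ _ _
    (le_trans (scale _ _ H3) _)); last by rewrite lee_fin; lra.
  + by move=> j; rewrite Nw0// mule0.
  + by move=> j _; rewrite mule_ge0 ?lee_fin// Nw_ge0.
  + move=> j J0j; rewrite -ge0_sume_distrr; last by move=> i _; exact: N0.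
    rewrite muleA -EFinM; apply: lee_pmul; rewrite ?lee_fin ?Nw_ge0 ?l1norm_japanese//.
    exact: b1.
- apply: (@esum_extend0 J0 J alpha (fun j f => Nw Sp (@sqnorm R d) f) _ _ _ _ b2
    (le_trans H4 _)); last by rewrite lee_fin; lra.
  + by move=> j; rewrite Nw0.
  + by move=> j _; exact: Nw_ge0.
Qed.

Lemma integer_combination n (xi : 'I_n -> V) :
  (forall p i, xi p 0 i \is a Num.int) -> forall i, alt_vec xi 0 i \is a Num.int.
Proof.
move=> h i; rewrite /alt_vec summxE rpred_sum// => k _; rewrite mxE rpredM//.
by rewrite rpredX// rpredN rpred1.
Qed.

Lemma integer_wave_vectors sigma (J0 J : set int) (kappa : int -> V) :
  wave_vectors Torus sigma J0 J kappa ->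
  forall j, J j -> forall i, kappa j 0 i \is a Num.int.
Proof.
move=> [_ _ /(_ erefl) int0 Jgen].
have h n : forall v, generated sigma (kappa @` J0) n v -> forall i, v 0 i \is a Num.int.
  elim: n => [v [j J0j <-]|n IH v [|[xi [xin -> _]]]]; [exact: int0|exact: IH|].
  by apply: integer_combination => p i; exact: IH (xin p) i.
move=> j Jj; have : (kappa @` J) (kappa j) by exists j.
by rewrite Jgen => -[n _]; exact: h.
Qed.

(** On the torus [eps^-1] is an integer, hence the quotients by [eps] of integer
    wave vectors are frequencies again. *)
Lemma frequency M eps (v : V) : admissible M eps ->
  (M = Torus -> forall i, v 0 i \is a Num.int) ->
  exists g : fs_G (setting (R := R) d0 M), fs_vec g = eps^-1 *: v.
Proof.
case: M => -[_ h] vi.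
  have [n [_ ->]] := h erefl.
  have ex i : exists m : int, n%:R * v 0 i = m%:~R.
    by apply/intrP; rewrite rpredM ?rpred_nat//; exact: vi.
  exists ((\row_i xget 0 [set m : int | n%:R * v 0 i = m%:~R]) : 'rV[int]_d).
  apply/rowP => i; rewrite !mxE.
  by have /(xgetPex (0 : int))/= <- := ex i.
exists [tuple (eps^-1 *: v) 0 i | i < d].
apply/rowP => i; transitivity (tnth [tuple (eps^-1 *: v) 0 k | k < d] i); first exact: mxE.
by rewrite tnth_mktuple.
Qed.

Lemma l1norm_resonant sigma (J : set int) (kappa : int -> V) j (l : sigma.*2.+1.-tuple int) :
  resonant J kappa j l -> l1norm (kappa j) <= \sum_k l1norm (kappa (tnth l k)).
Proof.
move=> [_ <- _]; rewrite /alt_vec.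
elim/big_ind2 : _ => [|x u y v ux vy|k _].
- by rewrite /l1norm big1// => i _; rewrite mxE normr0.
- by apply: le_trans (l1normD _ _) _; exact: lerD.
rewrite /l1norm ler_sum// => i _; rewrite mxE normrM normrX normrN normr1 expr1n mul1r//.
Qed.

End initial_data.

(** ** Essential suprema *)

Section essential_suprema.
Context {R : realType} {d : nat} (d0 : (0 < d)%N) (M : domain) (T : R).
Local Notation V := 'rV[R]_d.

Lemma ess_sup_time_le (F : R -> \bar R) (y : \bar R) :
  (forall t, 0 <= t <= T -> (F t <= y)%E) -> (ess_sup (time_measure T) F <= y)%E.
Proof.
move=> Fy; apply/ess_supP; exists (~` `[0, T]%classic : set (measurableTypeR R)); split.
- by apply: measurableC; exact: measurable_itv.
- by rewrite /time_measure/= /mrestr setICl measure0.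
- by move=> t /=; apply: contra_not; rewrite in_itv/=; exact: Fy.
Qed.

(** The product of the null set of exceptional times with the whole space is
    null. *)
Lemma Linf_norm_le_W (u : R -> V -> R[i]) : (Linf_norm T u <= Linf_W_norm M T u)%E.
Proof.
have [A [mA A0 sA]] := ess_sup_ge (time_measure T) (fun t => W_norm M (u t)).
apply/ess_supP; exists (A `*` setT); split.
- exact: measurableX.
- apply: etrans (product_measure1E _ _ mA measurableT) _.
  by rewrite A0 mul0e.
- move=> [t x] /= h; split => //; apply: sA => /= h'; apply: h.
  by apply: le_trans h'; rewrite (W_normE d0); exact: sup_le_N.
Qed.

End essential_suprema.

Theorem theorem6p5 (R : realType) (d : nat) (M : domain) (sigma : nat)
    (lambda : R) (J0 J : set int) (kappa : int -> 'rV[R]_d)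
    (alpha : int -> 'rV[R]_d -> R[i]) :
  (0 < d)%N -> (0 < sigma)%N -> lambda != 0 ->
  wave_vectors M sigma J0 J kappa ->
  assumption_A1 M J0 kappa alpha ->
  assumption_A2 sigma J kappa ->
  forall (T : R) (a : R -> int -> 'rV[R]_d -> R[i]),
  0 < T ->
  profile_solution M sigma lambda T J kappa (extend0 J0 alpha) a ->
  forall (u0 : R -> 'rV[R]_d -> R[i]) (C0 : R),
  0 <= C0 ->
  (forall eps, admissible M eps ->
    in_W M (u0 eps) /\
    (W_norm M (fun x => (u0 eps x - u_app J kappa a eps 0 x)%R)
       <= (C0 * eps)%:E)%E) ->
  exists eps0 C : R, 0 < eps0 /\
    forall eps, admissible M eps -> eps <= eps0 ->
    exists u : R -> 'rV[R]_d -> R[i],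
      [/\ mild_solution M sigma lambda eps T (u0 eps) u,
          forall v, mild_solution M sigma lambda eps T (u0 eps) v ->
            forall t x, 0 <= t <= T -> v t x = u t x,
          (Linf_W_norm M T u < +oo)%E,
          (Linf_norm T (fun t x => (u t x - u_app J kappa a eps t x)%R)
             <= Linf_W_norm M T (fun t x => (u t x - u_app J kappa a eps t x)%R))%E &
          (Linf_W_norm M T (fun t x => (u t x - u_app J kappa a eps t x)%R)
             <= (C * eps)%:E)%E].
Proof.
move=> d0 _ _ wv A1 [c c0 gap] T a T0 [caE prof] u0 C0 C00 hu0.
have [ca [E E1 aE]] := cont_E_curves d0 caE.
have kI : forall j k, J j -> J k -> kappa j = kappa k -> j = k by case: wv.
have [P [X0 [P0 Pres Pkappa [i1 i2 i3 i4]]]] : exists (P : int -> R) (X0 : R),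
  [/\ forall j, 0 <= P j,
   forall j l, J j -> resonant (sigma := sigma) J kappa j l -> P j <= \sum_k P (tnth l k),
   (forall j i, J j -> `|kappa j 0 i| <= P j) \/
     (forall t j, 0 <= t <= T -> J j -> Nw (setting d0 M) (@l1norm R d) (a t j) = 0%E) &
   [/\ (\esum_(j in J) ((P j)%:E * Nw (setting d0 M) (fun=> 1%R) (extend0 J0 alpha j)) <= X0%:E)%E,
   (\esum_(j in J) Nw (setting d0 M) (@l1norm R d) (extend0 J0 alpha j) <= X0%:E)%E,
   (\esum_(j in J) ((P j)%:E * Nw (setting d0 M) (@l1norm R d) (extend0 J0 alpha j)) <= X0%:E)%E &
   (\esum_(j in J) Nw (setting d0 M) (@sqnorm R d) (extend0 J0 alpha j) <= X0%:E)%E]].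
  case: M wv A1 caE {hu0 prof ca aE} => wv A1 caE.
    (* The amplitudes are constant on the torus: every norm that involves a
       derivative vanishes, and so may the weight P. *)
    have l10 : l1norm (0 : 'rV[R]_d) = 0 by rewrite /l1norm big1// => i _; rewrite mxE normr0.
    have sq0 : sqnorm (0 : 'rV[R]_d) = 0 by exact: dot0l.
    have e0 j : extend0 J0 alpha j = fun=> extend0 J0 alpha j 0.
      apply/funext => x; rewrite /extend0; case: ifP => // /asboolP J0j.
      by case: A1 => -[h _] _; exact: h.
    have wl := weight_l1norm (torus R d0); have ws := weight_sqnorm (torus R d0).
    exists (fun=> 0), 0; split => //.
    - by move=> j l _ _; rewrite big1.
    - right=> t j tT Jj; have [[h _] _] := caE t tT.
      rewrite (_ : a t j = fun=> a t j 0); last by apply/funext => x; exact: h.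
      exact: Nw_const0.
    split; rewrite esum1// => j _; rewrite ?mul0e// e0; exact: Nw_const0.
  have [X0 bounds] := space_initial_bounds d0 J A1.
  exists (fun j => l1norm (kappa j)), X0; split => //.
  - by move=> j; exact: l1norm_ge0.
  - by move=> j l _; exact: l1norm_resonant.
  - left=> j i _; rewrite /l1norm (bigD1 i)//= lerDl.
    by apply: sumr_ge0 => k _; exact: normr_ge0.
have [eps0 [C [eps00 H]]] := approximation_justified (ltW T0) kI ca E1 aE prof P0 Pres
  Pkappa i1 i2 i3 i4 c0 gap C00.
exists eps0, C; split => // eps ad eps_le; have [eps_gt0 _] := ad.
have eps_in : 0 < eps <= eps0 by rewrite eps_gt0.
have [u0W du0] := hu0 eps ad.
have int_kappa : M = Torus -> forall j, J j -> forall i, kappa j 0 i \is a Num.int.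
  by move=> MT; move: wv; rewrite MT => wv; exact: integer_wave_vectors wv.
have freqJ j : J j -> exists g : fs_G (setting d0 M), fs_vec g = eps^-1 *: kappa j.
  by move=> Jj; apply: frequency => // MT; exact: int_kappa.
have freqJm l : tuples_in (m := sigma.*2.+1) J l ->
    exists g : fs_G (setting d0 M), fs_vec g = eps^-1 *: combined kappa l.
  move=> Jl; apply: frequency => // MT; apply: integer_combination => p.
  by apply: int_kappa => //; exact: Jl.
rewrite (in_WE d0) in u0W; rewrite (W_normE d0) in du0.
have [cua [u [mu ua]]] := H eps eps_in freqJ freqJm (u0 eps) u0W du0.
have u0W' : in_W M (u0 eps) by rewrite (in_WE d0).
exists u; split.
- exact/(mildP d0).
- move=> v /(mildP d0 sigma lambda eps T v u0W') mv t x tT.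
  exact: (mild_unique u0W mu mv tT).
- have [K _ uK] := contW_bounded mu.1.
  apply: (@le_lt_trans _ _ K%:E); last exact: ltry.
  by apply: ess_sup_time_le => t tT; rewrite (W_normE d0); exact: uK.
- exact: Linf_norm_le_W.
- by apply: ess_sup_time_le => t tT; rewrite (W_normE d0); exact: ua.
Qed.
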